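(* Let $q_1,q_2\in\mathbb{C}^*$ be multiplicatively independent (i.e. $q_1^{n_1}q_2^{n_2}=1$ with $n_1,n_2\in\mathbb{Z}$ implies $n_1=n_2=0$), and assume that $q_1$ and $q_2$ are not both algebraic numbers of modulus one all of whose Galois conjugates have modulus one. Let $f$ be a $q_1$-hypergeometric function and let $g$ be a $q_2$-hypergeometric function. Then $f$ and $g$ are algebraically independent over $\mathbb{C}(x)$, unless one of them is rational.
   Context: Let $q\in\mathbb{C}^*$ not be a root of unity. For $n\ge0$ set $[n]!_q=\prod_{i=1}^n\frac{1-q^i}{1-q}$ and $(a;q)_n=\prod_{i=0}^{n-1}(1-aq^i)$. A $q$-hypergeometric function is a power series of the form $$\sum_{n=0}^\infty\frac{(\alpha_1;q)_n\cdots(\alpha_r;q)_n}{(\beta_1;q)_n\cdots(\beta_s;q)_n}\left((-1)^nq^{\binom{n}{2}}\right)^{s-r}\frac{x^n}{[n]!_q}\in\mathbb{C}[[x]],$$ where $r,s$ are nonnegative integers and $\alpha_1,\dots,\alpha_r,\beta_1,\dots,\beta_s\in\mathbb{C}$ with $\beta_i\notin q^{\mathbb{Z}_{\le0}}$ for all $i$. *)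

(* Defs.v *)
(* C is modelled as R[i] for an arbitrary realType R
   (every realType is a complete archimedean ordered field, i.e. the reals). *)
From HB Require Import structures.
From mathcomp Require Import all_boot all_order all_algebra.
From mathcomp Require Import reals.
From mathcomp Require Export complex.
Set Implicit Arguments. Unset Strict Implicit. Unset Printing Implicit Defensive.
Import Order.TTheory GRing.Theory Num.Theory.
Local Open Scope ring_scope.

Section Defs.
Variable (F : fieldType).

Definition fps := nat -> F.

Definition fps_mul (f g : fps) : fps :=
  fun n => \sum_(k < n.+1) f k * g (n - k)%N.

Definition fps_one : fps := fun n => if n == 0%N then 1 else 0.

Definition fps_exp (f : fps) (m : nat) : fps := iter m (fps_mul f) fps_one.

Definition fps_of_poly (p : {poly F}) : fps := fun n => p`_n.

Definition fps_add (f g : fps) : fps := fun n => f n + g n.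
Definition fps_zero : fps := fun _ => 0.

Definition fps_rational (f : fps) : Prop :=
  exists (a b : {poly F}), b != 0 /\ fps_mul (fps_of_poly b) f = fps_of_poly a.

Definition fps_eval2 (P : {poly {poly {poly F}}}) (f g : fps) : fps :=
  \big[fps_add/fps_zero]_(j < size P) \big[fps_add/fps_zero]_(i < size P`_j)
     fps_mul (fps_of_poly (P`_j)`_i) (fps_mul (fps_exp f i) (fps_exp g j)).

(* f and g are algebraically independent over C(x) (clearing denominators,
   no nonzero P in C[x][Y,Z] annihilates (f,g)) *)
Definition alg_indep2 (f g : fps) : Prop :=
  forall P : {poly {poly {poly F}}}, fps_eval2 P f g = fps_zero -> P = 0.

Definition qpoch (q a : F) (n : nat) : F := \prod_(i < n) (1 - a * q ^+ i).

Definition qfact (q : F) (n : nat) : F :=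
  \prod_(1 <= i < n.+1) ((1 - q ^+ i) / (1 - q)).

Definition qhyp_series (q : F) (alpha beta : seq F) : fps := fun n =>
  (\prod_(a <- alpha) qpoch q a n) / (\prod_(b <- beta) qpoch q b n)
  * ((-1) ^+ n * q ^+ 'C(n, 2)) ^ ((size beta)%:Z - (size alpha)%:Z)
  / qfact q n.

Definition is_qhyp (q : F) (f : fps) : Prop :=
  exists (alpha beta : seq F),
    (forall b, b \in beta -> forall k : nat, b != q ^- k) /\
    f = qhyp_series q alpha beta.

End Defs.

(* q is an algebraic number all of whose Galois conjugates (the roots of its
   minimal polynomial over Q, q itself included) have modulus one *)
Definition alg_all_conj_unimodular (R : realType) (q : R[i]) : Prop :=
  exists p : {poly rat}, irreducible_poly p /\ root (map_poly ratr p) q /\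
    forall z : R[i], root (map_poly ratr p) z -> `|z| = 1.

(* Main.v *)
Require Import Defs.
From HB Require Import structures.
From mathcomp Require Import all_boot all_order all_algebra.
From mathcomp Require Import reals complex.
From mathcomp Require Import boolp classical_sets filter.
From mathcomp Require Import zify ring lra.
Set Implicit Arguments. Unset Strict Implicit. Unset Printing Implicit Defensive.
Import Order.TTheory GRing.Theory Num.Theory.
Local Open Scope classical_set_scope.
Local Open Scope ring_scope.

(**
Suppose that P(f, g) = 0 with P <> 0.

The coefficients satisfy B(q^n) f_(n+1) = A(q^n) f_n. If |q1| = 1, one of the bases (say q1) is transcendental or has
a conjugate off the unit circle, so an isomorphism between finitely generated subfields of C moves all the data to a
situation with |q1| <> 1, and rationality descends along it; replacing q by 1/q we may take |q1| < 1. According to the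
valuations of A and B at 0, f is then meromorphic, or divergent, or entire with f_(n+1)/f_n ~ c p^n, p a power of q1.

Meromorphic f: its poles lie on finitely many q1-spirals. The shifts f(q2^j x) are algebraic over the functions g(q2^i x),
which span a finite-dimensional space, so f(q2^j x) is algebraic over later shifts, whose poles are elsewhere; hence f
has no poles far out on a spiral and is rational.

Divergent f: Taylor expansion of the relation at truncations of f and g shows that g_(N+v)/f_(N+u) has a nonzero limit,
so that the two recurrences force q1 and q2 to be multiplicatively dependent.

Entire f and |q2| <> 1: g is entire as well, each zero of f far away is close to a zero of g, and the zeros are
asymptotically geometric progressions of ratios p and p', whence p = p'^k.

Entire f and |q2| = 1: g is algebraic over the entire functions, hence satisfies a linear differential equation with
entire coefficients, and its recurrence then makes it rational or entire. If it is entire, it has size polynomial in z at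
the zeros z of f, so that at each such radius a second term of its Taylor series is comparable with the largest one, and
then A(q2^n) is small at the two indices n in question, that is, q2^n is close to a root of A. As q2 is not a root of unity
and the indices grow linearly with the rank of the zero, a window of bounded length contains few such n, and by pigeonhole
the same two terms would dominate at two distant radii, which is absurd.
*)

(** * Formal power series *)

Section PowerSeries.
Variable F : fieldType.

(** The isomorphism of subfields controls one base only: it takes the modulus of that base away from
    1, while the image of the other base may lie anywhere, in particular on the unit circle. Hence
    the cases with |q2| = 1, where the second series has no asymptotic size of its own and
    everything has to be learnt from its algebraic dependence on the first. The two series play
    different roles throughout, and [swapXY] exchanges them.

    No function theory is presupposed. A convergent series is one with geometrically bounded
    coefficients, and a meromorphic function is a series that a polynomial multiplies into a
    convergent one. Cauchy's estimate and the minimum modulus principle come from averages over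
    roots of unity, and compactness from limits along an ultrafilter on the indices. Zeros of entire
    series are located by comparison with Euler's series, which has an explicit product.

    The differential equation used for |q2| = 1 exists because the entire functions form a ring
    stable under derivation; at indices with large coefficients its top order term dominates, as it
    carries the highest power of the index. *)

Definition ps := nat -> F.
HB.instance Definition _ := gen_eqMixin ps.
HB.instance Definition _ := gen_choiceMixin ps.

Implicit Types f g h : ps.

Definition ps_add f g : ps := fun n => f n + g n.
Definition ps_opp f : ps := fun n => - f n.
Definition ps_zero : ps := fun=> 0.
Definition ps_mul f g : ps := fun n => \sum_(k < n.+1) f k * g (n - k)%N.
Definition ps_one : ps := fun n => (n == 0)%:R.

Lemma ps_addA : associative ps_add.
Proof. by move=> f g h; apply/funext => n; rewrite /ps_add addrA. Qed.
Lemma ps_addC : commutative ps_add.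
Proof. by move=> f g; apply/funext => n; rewrite /ps_add addrC. Qed.
Lemma ps_add0 : left_id ps_zero ps_add.
Proof. by move=> f; apply/funext => n; rewrite /ps_add add0r. Qed.
Lemma ps_addN : left_inverse ps_zero ps_opp ps_add.
Proof. by move=> f; apply/funext => n; rewrite /ps_add addNr. Qed.
HB.instance Definition _ := GRing.isZmodule.Build ps ps_addA ps_addC ps_add0 ps_addN.

Definition trunc (m : nat) f : {poly F} := \poly_(i < m) f i.

(** A coefficient of a product sees only finitely many coefficients of the factors; the ring axioms
    are inherited from polynomials in this way. *)
Lemma ps_mul_trunc m n f g : (n < m)%N -> ps_mul f g n = (trunc m f * trunc m g)`_n.
Proof.
move=> nm; rewrite coefM; apply: eq_bigr => i _.
have im := leq_ltn_trans (leq_ord i) nm.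
by rewrite !coef_poly im (leq_ltn_trans (leq_subr _ _) nm).
Qed.

Lemma ps_mulA : associative ps_mul.
Proof.
move=> f g h; apply/funext => n.
rewrite (@ps_mul_trunc n.+1) // (@ps_mul_trunc n.+1 n (ps_mul f g)) //.
have E u v : forall i, (i <= n)%N -> (trunc n.+1 (ps_mul u v))`_i = (trunc n.+1 u * trunc n.+1 v)`_i.
  by move=> i Hi; rewrite coef_poly ltnS Hi -ps_mul_trunc.
have E1 : (trunc n.+1 f * trunc n.+1 (ps_mul g h))`_n
   = (trunc n.+1 f * (trunc n.+1 g * trunc n.+1 h))`_n.
  by rewrite !coefM; apply: eq_bigr => i _; rewrite [(trunc _ (ps_mul _ _))`__]E // leq_subr.
have E2 : (trunc n.+1 (ps_mul f g) * trunc n.+1 h)`_n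
   = (trunc n.+1 f * trunc n.+1 g * trunc n.+1 h)`_n.
  by rewrite !coefM; apply: eq_bigr => i _; rewrite [(trunc _ (ps_mul _ _))`__]E // -ltnS.
by rewrite E1 E2 mulrA.
Qed.
Lemma ps_mulC : commutative ps_mul.
Proof. by move=> f g; apply/funext => n; rewrite !(@ps_mul_trunc n.+1) // mulrC. Qed.
Lemma ps_mul1 : left_id ps_one ps_mul.
Proof.
move=> f; apply/funext => n; rewrite /ps_mul big_ord_recl /ps_one eqxx mul1r subn0.
by rewrite big1 ?addr0 // => i _; rewrite mul0r.
Qed.
Lemma ps_mulD : left_distributive ps_mul ps_add.
Proof.
by move=> f g h; apply/funext => n; rewrite /ps_add /ps_mul -big_split; apply: eq_bigr => i _; rewrite mulrDl.
Qed.
Lemma ps_one_neq0 : ps_one != 0.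
Proof. by apply/eqP => /(congr1 (fun f : ps => f 0%N)) /eqP; rewrite /ps_one eqxx oner_eq0. Qed.
HB.instance Definition _ := GRing.Zmodule_isComNzRing.Build ps ps_mulA ps_mulC ps_mul1 ps_mulD ps_one_neq0.

Lemma psD f g n : (f + g) n = f n + g n. Proof. by []. Qed.
Lemma psN f n : (- f) n = - f n. Proof. by []. Qed.
Lemma psB f g n : (f - g) n = f n - g n. Proof. by []. Qed.
Lemma ps0 n : (0 : ps) n = 0. Proof. by []. Qed.
Lemma ps1 n : (1 : ps) n = (n == 0)%:R. Proof. by []. Qed.
Lemma psM f g n : (f * g) n = \sum_(k < n.+1) f k * g (n - k)%N. Proof. by []. Qed.
Lemma ps_sum (I : Type) (r : seq I) (P : pred I) (G : I -> ps) n :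
  (\sum_(i <- r | P i) G i) n = \sum_(i <- r | P i) G i n.
Proof. by elim/big_rec2: _ => // i y1 y2 _ <-. Qed.

Lemma psP f g : (forall n, f n = g n) -> f = g.
Proof. by move=> H; apply/funext. Qed.

Lemma ps_neq0P f : f != 0 -> exists v, f v != 0 /\ forall k, (k < v)%N -> f k = 0.
Proof.
move=> f0; have [n Hn] : exists n, f n != 0.
  apply/not_existsP => H; case/eqP: f0; apply: psP => n.
  by apply/eqP; apply/negPn/negP; apply: H.
exists (ex_minn (ex_intro (fun n => f n != 0) n Hn)).
case: ex_minnP => v Hv Hm; split=> // k kv; apply/eqP; apply: contraLR kv => fk.
by rewrite -leqNgt; apply: Hm.
Qed.

(** Lowest terms multiply without cancellation, whence the absence of zero divisors. *)
Lemma ps_mul_lead f g v w : (forall k, (k < v)%N -> f k = 0) -> (forall k, (k < w)%N -> g k = 0) ->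
  (f * g) (v + w)%N = f v * g w.
Proof.
move=> fv gw; rewrite psM.
have vlt : (v < (v + w).+1)%N by rewrite ltnS leq_addr.
rewrite (bigD1 (Ordinal vlt)) //= addKn big1 ?addr0 // => i /eqP iv.
case: (ltnP i v) => [Hi|Hi]; first by rewrite fv ?mul0r.
have Hi2 : (v < i)%N.
  rewrite ltn_neqAle Hi andbT; apply/eqP => E; apply: iv; exact/val_inj.
rewrite gw ?mulr0 // ltn_subLR; last exact: (ltn_ord i).
by rewrite ltn_add2r.
Qed.

Lemma ps_mulf_eq0 f g : f * g = 0 -> (f == 0) || (g == 0).
Proof.
move=> fg; case: (eqVneq f 0) => //= f0; case: (eqVneq g 0) => //= g0.
have [v [fv Hv]] := ps_neq0P f0; have [w [gw Hw]] := ps_neq0P g0.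
have := ps_mul_lead Hv Hw; rewrite fg ps0 => /esym/eqP.
by rewrite mulf_eq0 (negbTE fv) (negbTE gw).
Qed.

Definition ps_unit : {pred ps} := fun f => `[< exists g, g * f = 1 >].
Definition ps_inv f : ps := if pselect (exists g, g * f = 1) is left H then projT1 (cid H) else f.
Lemma ps_mulV : {in ps_unit, left_inverse 1 ps_inv *%R}.
Proof. by move=> f /asboolP H; rewrite /ps_inv; case: pselect => // H'; case: cid. Qed.
Lemma ps_unitP f g : g * f = 1 -> f \in ps_unit.
Proof. by move=> H; apply/asboolP; exists g. Qed.
Lemma ps_inv_out : {in [predC ps_unit], ps_inv =1 id}.
Proof. by move=> f /asboolP H; rewrite /ps_inv; case: pselect. Qed.
HB.instance Definition _ := GRing.ComNzRing_hasMulInverse.Build ps ps_mulV ps_unitP ps_inv_out.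
HB.instance Definition _ := GRing.ComUnitRing_isIntegral.Build ps ps_mulf_eq0.

Definition pp (p : {poly F}) : ps := fun n => p`_n.
Lemma pp_is_zmod : zmod_morphism pp.
Proof. by move=> p q; apply: psP => n; rewrite psB /pp coefB. Qed.
Lemma pp_is_monoid : monoid_morphism pp.
Proof.
split; first by apply: psP => n; rewrite /pp coef1.
by move=> p q; apply: psP => n; rewrite /pp coefM psM.
Qed.
HB.instance Definition _ := GRing.isZmodMorphism.Build {poly F} ps pp pp_is_zmod.
HB.instance Definition _ := GRing.isMonoidMorphism.Build {poly F} ps pp pp_is_monoid.
Lemma pp_inj : injective pp.
Proof. by move=> p q pq; apply/polyP => i; have := congr1 (fun f : ps => f i) pq. Qed.
Lemma pp_eq0 p : (pp p == 0) = (p == 0).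
Proof. by rewrite -(rmorph0 pp) (inj_eq pp_inj). Qed.

Definition psX : ps := pp 'X.
Lemma psXnE (d n : nat) : (psX ^+ d : ps) n = (n == d)%:R.
Proof. by rewrite -rmorphXn /= /pp coefXn. Qed.
Lemma psXnM (d : nat) f n : (psX ^+ d * f) n = if (n < d)%N then 0 else f (n - d)%N.
Proof.
rewrite psM; case: ltnP => [nd|dn].
  by rewrite big1 // => i _; rewrite psXnE; case: eqP => [E|]; rewrite ?mul0r //; have := ltn_ord i; lia.
have hlt : (d < n.+1)%N by [].
rewrite (bigD1 (Ordinal hlt)) //= psXnE eqxx mul1r big1 ?addr0 // => i /eqP ih.
by rewrite psXnE; case: eqP => [E|_]; rewrite ?mul0r //; case: ih; apply/val_inj.
Qed.
Lemma ps_shift (d : nat) f : (forall k, (k < d)%N -> f k = 0) -> f = psX ^+ d * (fun n => f (n + d)%N).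
Proof. by move=> H; apply: psP => n; rewrite psXnM; case: ltnP => [/H|/subnK ->]. Qed.
Lemma psCM (a : F) f n : (pp a%:P * f) n = a * f n.
Proof.
by rewrite psM big_ord_recl /= /pp coefC eqxx subn0 big1 ?addr0 // => i _; rewrite coefC mul0r.
Qed.

(* The series [f (a * x)]. *)
Definition sc (a : F) (f : ps) : ps := fun n => a ^+ n * f n.
Lemma sc_is_zmod a : zmod_morphism (sc a).
Proof. by move=> f g; apply: psP => n; rewrite psB /sc mulrBr. Qed.
Lemma sc_is_monoid a : monoid_morphism (sc a).
Proof.
split; first by apply: psP => -[|n]; rewrite /sc; [rewrite expr0 mul1r | exact: mulr0].
move=> f g; apply: psP => n; rewrite /sc !psM big_distrr; apply: eq_bigr => i _ /=.
by rewrite mulrACA -exprD subnKC // -ltnS.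
Qed.
HB.instance Definition _ a := GRing.isZmodMorphism.Build ps ps (sc a) (sc_is_zmod a).
HB.instance Definition _ a := GRing.isMonoidMorphism.Build ps ps (sc a) (sc_is_monoid a).
Lemma sc_comp a b f : sc a (sc b f) = sc (a * b) f.
Proof. by apply: psP => n; rewrite /sc mulrA exprMn. Qed.
Lemma sc1 f : sc 1 f = f.
Proof. by apply: psP => n; rewrite /sc expr1n mul1r. Qed.
Lemma sc_eq0 a f : a != 0 -> (sc a f == 0) = (f == 0).
Proof.
move=> a0; apply/eqP/eqP => [E|->]; last by rewrite rmorph0.
apply: psP => n; have /eqP := congr1 (fun f : ps => f n) E.
by rewrite /sc ps0 mulf_eq0 expf_eq0 (negbTE a0) andbF /= => /eqP.
Qed.
Lemma sc_pp a p : sc a (pp p) = pp (p \Po (a *: 'X)).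
Proof.
apply: psP => n; rewrite /sc /pp comp_polyE coef_sum.
case: (ltnP n (size p)) => [np|pn].
  rewrite (bigD1 (Ordinal np)) //= coefZ exprZn coefZ coefXn eqxx mulr1 mulrC big1 ?addr0 // => i ni.
  by rewrite coefZ exprZn coefZ coefXn; case: eqP => [E|_]; rewrite ?mulr0 //; case/eqP: ni; apply/val_inj.
rewrite nth_default // mulr0 big1 // => i _; rewrite coefZ exprZn coefZ coefXn.
by case: eqP => [E|_]; rewrite ?mulr0 //; have := ltn_ord i; lia.
Qed.

(* The derivation [x * d/dx]. *)
Definition dl (f : ps) : ps := fun n => n%:R * f n.
Lemma dl_is_zmod : zmod_morphism dl.
Proof. by move=> f g; apply: psP => n; rewrite psB /dl mulrBr. Qed.
HB.instance Definition _ := GRing.isZmodMorphism.Build ps ps dl dl_is_zmod.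
Lemma dlM f g : dl (f * g) = dl f * g + f * dl g.
Proof.
apply: psP => n; rewrite psD /dl !psM big_distrr -big_split; apply: eq_bigr => i _ /=.
have -> : n%:R = i%:R + (n - i)%:R :> F by rewrite -natrD subnKC // -ltnS.
by ring.
Qed.
Lemma dl_iter k f n : iter k dl f n = n%:R ^+ k * f n.
Proof. by elim: k => [|k IH] /=; rewrite ?expr0 ?mul1r // {1}/dl IH exprS mulrA. Qed.

Lemma fps_rationalP f : fps_rational f <-> exists a b, b != 0 /\ pp b * f = pp a.
Proof. by []. Qed.

Lemma fps_expE f m : fps_exp f m = (f ^+ m : ps).
Proof.
elim: m => [|m IH]; first by apply: psP => n; rewrite /= /fps_one;
  change ((if n == 0%N then 1 else 0) = (n == 0)%:R :> F); case: eqP.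
by rewrite exprS /fps_exp iterS -/(fps_exp f m) IH.
Qed.

Lemma fps_eval2E (P : {poly {poly {poly F}}}) f g :
  fps_eval2 P f g = \sum_(j < size P) \sum_(i < size P`_j) pp (P`_j)`_i * (f ^+ i * g ^+ j).
Proof.
rewrite /fps_eval2.
have -> : (fps_zero F : ps) = 0 by [].
by apply: eq_bigr => j _; apply: eq_bigr => i _; rewrite !fps_expE.
Qed.

End PowerSeries.
Arguments ps F : clear implicits.

(** * The modulus, limits and ultralimits *)

Section Norm.
Variable R : realType.
Local Notation C := R[i].
Implicit Types (x y z : C) (e : R).

Definition nm (z : C) : R := ComplexField.Normc.normc z.

Lemma nm_norm z : `|z| = (nm z)%:C%C. Proof. by case: z. Qed.
Lemma nm0 : nm 0 = 0. Proof. exact: ComplexField.Normc.normc0. Qed.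
Lemma nm1 : nm 1 = 1. Proof. exact: ComplexField.Normc.normc1. Qed.
Lemma nmM x y : nm (x * y) = nm x * nm y. Proof. exact: ComplexField.Normc.normcM. Qed.
Lemma nmD x y : nm (x + y) <= nm x + nm y.
Proof. by rewrite -lecR rmorphD /= -!nm_norm ler_normD. Qed.
Lemma nmN x : nm (- x) = nm x. Proof. exact: normcN. Qed.
Lemma nmB x y : nm (x - y) <= nm x + nm y. Proof. by rewrite -(nmN y) nmD. Qed.
Lemma nm_sym x y : nm (x - y) = nm (y - x). Proof. by rewrite -nmN opprB. Qed.
Lemma nm_ge0 x : 0 <= nm x. Proof. by rewrite -lecR -nm_norm normr_ge0. Qed.
Lemma nm_eq0 x : (nm x == 0) = (x == 0).
Proof. by apply/eqP/eqP => [/ComplexField.Normc.eq0_normc|->] //; exact: nm0. Qed.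
Lemma nm_gt0 x : (0 < nm x) = (x != 0).
Proof. by rewrite lt_neqAle nm_ge0 andbT eq_sym nm_eq0. Qed.
Lemma nmV x : nm x^-1 = (nm x)^-1. Proof. exact: ComplexField.Normc.normcV. Qed.
Lemma nmX x n : nm (x ^+ n) = nm x ^+ n.
Proof. by elim: n => [|n IH]; rewrite ?expr0 ?nm1 // !exprS nmM IH. Qed.
Lemma nm_prod I (r : seq I) P (G : I -> C) :
  nm (\prod_(i <- r | P i) G i) = \prod_(i <- r | P i) nm (G i).
Proof. by apply: (big_morph nm nmM nm1). Qed.
Lemma nm_sum I (r : seq I) P (G : I -> C) :
  nm (\sum_(i <- r | P i) G i) <= \sum_(i <- r | P i) nm (G i).
Proof.
elim/big_rec2: _ => [|i x y _ H]; first by rewrite nm0.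
by apply: le_trans (nmD _ _) _; rewrite lerD2l.
Qed.
Lemma nm_sub_ge x y : nm x - nm y <= nm (x - y).
Proof. by have := nmD (x - y) y; rewrite subrK; lra. Qed.
Lemma nm_real (a : R) : nm a%:C%C = `|a|.
Proof. by rewrite /nm /= expr0n /= addr0 sqrtr_sqr. Qed.
Lemma nm_nat n : nm (n%:R : C) = n%:R.
Proof. by rewrite -(rmorph_nat (real_complex R)) nm_real normr_nat. Qed.
Lemma Re_le_nm z : `|complex.Re z| <= nm z.
Proof. by rewrite -lecR -nm_norm normc_ge_Re. Qed.
Lemma Im_le_nm z : `|complex.Im z| <= nm z.
Proof.
case: z => a b; rewrite /nm /= -sqrtr_sqr ler_sqrt ?addr_ge0 ?sqr_ge0 //.
by rewrite lerDr sqr_ge0.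
Qed.
Lemma nm_le_ReIm z : nm z <= `|complex.Re z| + `|complex.Im z|.
Proof.
case: z => a b; have -> : (a +i* b)%C = a%:C%C + (0 +i* b)%C by simpc.
apply: le_trans (nmD _ _) _; rewrite nm_real.
by rewrite /nm /= expr0n /= add0r sqrtr_sqr !(add0r, addr0).
Qed.

Lemma expr_small (x e : R) : 0 <= x -> x < 1 -> 0 < e -> exists N, forall n, (N <= n)%N -> x ^+ n < e.
Proof.
move=> x0 x1 e0; have [->|xn0] := eqVneq x 0.
  by exists 1%N => -[|n] // _; rewrite expr0n.
have xp : 0 < x by rewrite lt_neqAle eq_sym xn0.
have bern (t : R) n : 0 <= t -> 1 + n%:R * t <= (1 + t) ^+ n.
  move=> t0; elim: n => [|n IH]; first by rewrite mul0r addr0 expr0.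
  rewrite exprS; apply: le_trans (_ : (1 + t) * (1 + n%:R * t) <= _).
    rewrite -natr1; have : 0 <= n%:R * t * t by rewrite !mulr_ge0 ?ler0n.
    by lra.
  by rewrite ler_wpM2l //; lra.
pose t := x^-1 - 1; have t0 : 0 < t by rewrite subr_gt0 invf_gt1.
exists (Num.truncn (e^-1 / t)).+1 => n Nn.
have h : e^-1 / t < n%:R by apply: lt_le_trans (truncnS_gt _) _; rewrite ler_nat.
have h1 : e^-1 < n%:R * t by rewrite -ltr_pdivrMr.
have h2 : e^-1 < x^-1 ^+ n.
  have h3 := bern t n (ltW t0); have e1 : 1 + t = x^-1 by rewrite /t; lra.
  by rewrite e1 in h3; lra.
by move: h2; rewrite exprVn ltf_pV2 // posrE exprn_gt0.
Qed.

Lemma expr_big (x M : R) : 1 < x -> exists N, forall n, (N <= n)%N -> M < x ^+ n.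
Proof.
move=> x1; have x0 : 0 < x by lra.
have xi0 : 0 <= x^-1 by rewrite invr_ge0 ltW.
have xi1 : x^-1 < 1 by rewrite invf_lt1.
have M0 : 0 < `|M| + 1 by rewrite ltr_wpDl.
have Mi : 0 < (`|M| + 1)^-1 by rewrite invr_gt0.
have [N HN] := expr_small xi0 xi1 Mi.
exists N => n /HN; rewrite exprVn ltf_pV2 ?posrE ?exprn_gt0 //.
by move=> H; apply: le_lt_trans (ler_norm _) _; apply: lt_trans H; rewrite ltrDl.
Qed.

Lemma natr_big (M : R) : exists N : nat, forall n, (N <= n)%N -> M < n%:R.
Proof.
by exists (Num.truncn M).+1 => n Nn; apply: lt_le_trans (truncnS_gt _) _; rewrite ler_nat.
Qed.

Lemma geo_sum_le (x : R) n : 0 <= x -> x < 1 -> \sum_(i < n) x ^+ i <= (1 - x)^-1.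
Proof.
move=> x0 x1; have x1' : 0 < 1 - x by lra.
have := subrX1 x n; have := exprn_ge0 n x0; set S := \sum_(i < n) _ => h0 h1.
rewrite -(ler_pM2l x1') mulfV; last by lra.
have -> : (1 - x) * S = - ((x - 1) * S) by ring.
by rewrite -h1; lra.
Qed.

(** Limits along an arbitrary filter: ordinary limits and ultralimits share one calculus. *)
Definition flim (G : set (set nat)) (u : nat -> C) (l : C) : Prop :=
  forall e, 0 < e -> G [set n | nm (u n - l) < e].

Lemma flim_unique G u l l' : ProperFilter G -> flim G u l -> flim G u l' -> l = l'.
Proof.
move=> FG ul ul'; apply/eqP; rewrite -subr_eq0 -nm_eq0; apply/eqP/le_anti/andP; split; last exact: nm_ge0.
rewrite leNgt; apply/negP => d0.
have e0 : 0 < nm (l - l') / 2 by lra.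
have [n [/= h1 h2]] := filter_ex (filterI (ul _ e0) (ul' _ e0)).
have h3 := nmD (l - u n) (u n - l'); rewrite addrA subrK in h3; rewrite nm_sym in h1; lra.
Qed.

Lemma flim_cst G l : ProperFilter G -> flim G (fun=> l) l.
Proof. by move=> FG e e0; apply: filterE => n /=; rewrite subrr nm0. Qed.

Lemma flimD G u v l m : ProperFilter G -> flim G u l -> flim G v m -> flim G (fun n => u n + v n) (l + m).
Proof.
move=> FG ul vm e e0; have e2 : 0 < e / 2 by lra.
apply: filterS (filterI (ul _ e2) (vm _ e2)) => n [/= h1 h2].
by have := nmD (u n - l) (v n - m); rewrite opprD addrACA; lra.
Qed.
Lemma flimN G u l : ProperFilter G -> flim G u l -> flim G (fun n => - u n) (- l).
Proof.
by move=> FG ul e e0; apply: filterS (ul _ e0) => n /=; rewrite -opprD nmN.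
Qed.
Lemma flim_bd G u l : ProperFilter G -> flim G u l -> G [set n | nm (u n) <= nm l + 1].
Proof.
move=> FG ul; apply: filterS (ul 1 ltr01) => n /= h.
by have := nm_sub_ge (u n) l; lra.
Qed.
Lemma flimM G u v l m : ProperFilter G -> flim G u l -> flim G v m -> flim G (fun n => u n * v n) (l * m).
Proof.
move=> FG ul vm e e0.
have M1 : 0 < nm l + 1 by have := nm_ge0 l; lra.
have M2 : 0 < nm m + 1 by have := nm_ge0 m; lra.
have e1 : 0 < e / 2 / (nm l + 1) by rewrite !divr_gt0.
have e2 : 0 < e / 2 / (nm m + 1) by rewrite !divr_gt0.
apply: filterS (filterI (flim_bd FG ul) (filterI (vm _ e1) (ul _ e2))) => n [/= h0 [h1 h2]].
have -> : u n * v n - l * m = u n * (v n - m) + (u n - l) * m by ring.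
apply: le_lt_trans (nmD _ _) _; rewrite !nmM.
have k1 : nm (u n) * nm (v n - m) <= (nm l + 1) * nm (v n - m) by rewrite ler_wpM2r ?nm_ge0.
have k2 : nm (u n - l) * nm m <= nm (u n - l) * (nm m + 1) by rewrite ler_wpM2l ?nm_ge0 //; lra.
move: h1; rewrite ltr_pdivlMr // mulrC => h1.
move: h2; rewrite ltr_pdivlMr // => h2.
by lra.
Qed.
Lemma flim_sum G (I : Type) (r : seq I) (u : I -> nat -> C) (l : I -> C) : ProperFilter G ->
  (forall i, flim G (u i) (l i)) -> flim G (fun n => \sum_(i <- r) u i n) (\sum_(i <- r) l i).
Proof.
move=> FG H; elim: r => [|i r IH].
  by under boolp.eq_fun do rewrite big_nil; rewrite big_nil; apply: flim_cst.
under boolp.eq_fun do rewrite big_cons; rewrite big_cons; exact: flimD.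
Qed.
Lemma flim_prod G (I : Type) (r : seq I) (u : I -> nat -> C) (l : I -> C) : ProperFilter G ->
  (forall i, flim G (u i) (l i)) -> flim G (fun n => \prod_(i <- r) u i n) (\prod_(i <- r) l i).
Proof.
move=> FG H; elim: r => [|i r IH].
  by under boolp.eq_fun do rewrite big_nil; rewrite big_nil; apply: flim_cst.
under boolp.eq_fun do rewrite big_cons; rewrite big_cons; exact: flimM.
Qed.
Lemma flimX G u l k : ProperFilter G -> flim G u l -> flim G (fun n => u n ^+ k) (l ^+ k).
Proof.
move=> FG H; elim: k => [|k IH]; first by apply: flim_cst.
by under boolp.eq_fun do rewrite exprS; rewrite exprS; apply: flimM.
Qed.
Lemma flimV G u l : ProperFilter G -> l != 0 -> flim G u l -> flim G (fun n => (u n)^-1) l^-1.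
Proof.
move=> FG l0 ul e e0.
have L0 : 0 < nm l by rewrite nm_gt0.
have e1 : 0 < nm l / 2 by lra.
have e2 : 0 < e * (nm l * nm l) / 2 by rewrite !mulr_gt0 // invr_gt0.
apply: filterS (filterI (ul _ e1) (ul _ e2)) => n [/= h1 h2].
have hu : nm l / 2 < nm (u n) by have := nm_sub_ge l (u n); rewrite nm_sym; lra.
have u0 : u n != 0 by rewrite -nm_gt0; lra.
have -> : (u n)^-1 - l^-1 = (l - u n) / (u n * l) by field; rewrite u0 l0.
rewrite nmM nmV nmM ltr_pdivrMr; last by rewrite mulr_gt0 //; lra.
rewrite nm_sym; apply: lt_le_trans h2 _; rewrite -mulrA ler_wpM2l ?(ltW e0) //.
by have := ler_wpM2r (ltW L0) (ltW hu); lra.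
Qed.
Lemma flim_le G u l (M : R) : ProperFilter G -> flim G u l -> G [set n | nm (u n) <= M] -> nm l <= M.
Proof.
move=> FG ul H; rewrite leNgt; apply/negP => d0.
have e0 : 0 < nm l - M by lra.
have [n [/= h1 h2]] := filter_ex (filterI (ul _ e0) H).
by have := nm_sub_ge l (u n); rewrite nm_sym; lra.
Qed.
Lemma flim_ge G u l (M : R) : ProperFilter G -> flim G u l -> G [set n | M <= nm (u n)] -> M <= nm l.
Proof.
move=> FG ul H; rewrite leNgt; apply/negP => d0.
have e0 : 0 < M - nm l by lra.
have [n [/= h1 h2]] := filter_ex (filterI (ul _ e0) H).
by have := nm_sub_ge (u n) l; lra.
Qed.
Lemma flim_near G u v l : ProperFilter G -> flim G u l -> G [set n | u n = v n] -> flim G v l.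
Proof. by move=> FG ul H e e0; apply: filterS (filterI (ul _ e0) H) => n [/= h <-]. Qed.
Lemma flim0_le G u (b : nat -> R) : ProperFilter G ->
  (forall e, 0 < e -> G [set n | b n < e]) -> G [set n | nm (u n) <= b n] -> flim G u 0.
Proof.
move=> FG Hb H e e0; apply: filterS (filterI (Hb _ e0) H) => n [/= h1 h2].
by rewrite subr0 (le_lt_trans h2).
Qed.

Definition tends := flim \oo.

Lemma ooP (P : nat -> Prop) : \oo [set n | P n] <-> exists N, forall n, (N <= n)%N -> P n.
Proof. by split=> [[N _ H]|[N H]]; exists N. Qed.
Lemma tendsP u l : tends u l <-> forall e, 0 < e -> exists N, forall n, (N <= n)%N -> nm (u n - l) < e.
Proof. by split=> H e /H => [/ooP|] //; move/ooP. Qed.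
Lemma tends_expr (x : C) : nm x < 1 -> tends (fun n => x ^+ n) 0.
Proof.
move=> x1; apply/tendsP => e e0; have [N HN] := expr_small (nm_ge0 x) x1 e0.
by exists N => n /HN; rewrite subr0 nmX.
Qed.
Lemma tends_sub u l (s : nat -> nat) : (forall n, (n <= s n)%N) -> tends u l -> tends (fun n => u (s n)) l.
Proof.
move=> Hs /tendsP H; apply/tendsP => e /H [N HN]; exists N => n Nn.
by apply: HN; apply: leq_trans Nn (Hs n).
Qed.

Section Ultra.
Variable U : set (set nat).
Hypothesis UU : UltraFilter U.

Lemma ultra_dec (P : nat -> Prop) : U [set n | P n] \/ U [set n | ~ P n].
Proof. by case: (in_ultra_setVsetC [set n | P n] UU); [left|right]. Qed.

(** The limit is the supremum of the reals that lie below [u n] for almost all [n]; the ultrafilter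
    decides each comparison. *)
Lemma ulim_real (u : nat -> R) (M : R) : U [set n | `|u n| <= M] ->
  exists l : R, forall e, 0 < e -> U [set n | `|u n - l| < e].
Proof.
have FU := @ultra_proper _ _ UU.
move=> UM; pose S := [set x : R | U [set n | x <= u n]].
have SM : S (- M) by apply: filterS UM => n /=; rewrite ler_norml => /andP[].
have ubS : ubound S M.
  move=> x Sx; have [n [/= h1 h2]] := filter_ex (filterI Sx UM).
  by apply: le_trans h1 _; move: h2; rewrite ler_norml => /andP[].
have hS : has_sup S by split; [exists (- M) | exists M].
exists (sup S) => e e0.
have [x Sx hx] := sup_adherent e0 hS.
have nS : U [set n | ~ (sup S + e <= u n)].
  case: (ultra_dec (fun n => sup S + e <= u n)) => // H.
  have : S (sup S + e) by [].
  by move/(ub_le_sup (ex_intro _ M ubS)); lra.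
apply: filterS (filterI Sx nS) => n [/= h1 /negP]; rewrite -ltNge => h2.
by rewrite ltr_norml; apply/andP; split; lra.
Qed.

Lemma ulim_ex (u : nat -> C) (M : R) : U [set n | nm (u n) <= M] -> exists l, flim U u l.
Proof.
have FU := @ultra_proper _ _ UU.
move=> UM.
have [a Ha] := @ulim_real (fun n => complex.Re (u n)) M (filterS (fun n => le_trans (Re_le_nm _)) UM).
have [b Hb] := @ulim_real (fun n => complex.Im (u n)) M (filterS (fun n => le_trans (Im_le_nm _)) UM).
exists (a +i* b)%C => e e0; have e2 : 0 < e / 2 by lra.
apply: filterS (filterI (Ha _ e2) (Hb _ e2)) => n [/= h1 h2].
by apply: le_lt_trans (nm_le_ReIm _) _; move: h1 h2; case: (u n) => x y /=; lra.
Qed.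
End Ultra.

Lemma ultra_ex : exists U : set (set nat), UltraFilter U /\ (\oo `<=` U)%classic.
Proof. exact: ultraFilterLemma. Qed.

End Norm.

(** * Convergent power series *)

Section Eval.
Variable R : realType.
Local Notation C := R[i].
Implicit Types (F G : ps C) (s : C) (r M : R).

Definition bnd F r M := forall n, nm (F n) * r ^+ n <= M.
(** Convergence past the closed disc of radius [r]. The margin between [r] and [r'] pays for the
    loss of radius in products and gives geometric tails. *)
Definition cv F r := exists r' M, r < r' /\ bnd F r' M.
Definition psum F s n := \sum_(i < n) F i * s ^+ i.

Lemma bnd_ge0 F r M : bnd F r M -> 0 <= M.
Proof. by move/(_ 0%N); rewrite expr0 mulr1; apply: le_trans; exact: nm_ge0. Qed.
Lemma bnd_le F r M r1 M1 : 0 <= r1 -> r1 <= r -> M <= M1 -> bnd F r M -> bnd F r1 M1.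
Proof.
move=> r10 rr MM H n; apply: le_trans MM; apply: le_trans (H n).
by rewrite ler_wpM2l ?nm_ge0 // lerXn2r // ?nnegrE //; apply: le_trans rr.
Qed.
Lemma cv_le F r r1 : r1 <= r -> cv F r -> cv F r1.
Proof. by move=> rr [r' [M [h1 h2]]]; exists r', M; split=> //; apply: le_lt_trans h1. Qed.

Lemma bndD F G r M M' : 0 <= r -> bnd F r M -> bnd G r M' -> bnd (F + G) r (M + M').
Proof.
move=> r0 hF hG n; have := nmD (F n) (G n); have := hF n; have := hG n.
have rn := exprn_ge0 n r0; move=> h1 h2 h3.
by have := ler_wpM2r rn h3; rewrite psD; lra.
Qed.

(** Each of the first [n.+1] powers of [x] is at least [x ^+ n]. This absorbs the number of terms of
    a convolution. *)
Lemma nat_geo (x : R) n : 0 <= x -> x < 1 -> n.+1%:R * x ^+ n <= (1 - x)^-1.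
Proof.
move=> x0 x1; apply: le_trans (geo_sum_le n.+1 x0 x1).
rewrite -[X in X%:R]card_ord -sum1_card natr_sum big_distrl /=.
by apply: ler_sum => i _; rewrite mul1r ler_wiXn2l // ?(ltW x1) // -ltnS.
Qed.

Lemma absconv_bnd F G r r' M M' n : 0 <= r -> r < r' -> bnd F r' M -> bnd G r' M' ->
  (\sum_(k < n.+1) nm (F k) * nm (G (n - k)%N)) * r ^+ n <= M * M' * (1 - r / r')^-1.
Proof.
move=> r0 rr hF hG; have r'0 : 0 < r' by lra.
have M0 := bnd_ge0 hF; have M'0 := bnd_ge0 hG.
have x0 : 0 <= r / r' by rewrite divr_ge0 // ltW.
have x1 : r / r' < 1 by rewrite ltr_pdivrMr // mul1r.
apply: le_trans (ler_wpM2l (mulr_ge0 M0 M'0) (nat_geo n x0 x1)).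
have E : r ^+ n = r' ^+ n * (r / r') ^+ n by rewrite -exprMn mulrC divfK // gt_eqF.
rewrite E mulrA -[X in _ * (X%:R * _)]card_ord mulrA ler_wpM2r ?exprn_ge0 //.
rewrite -sum1_card natr_sum !big_distrl big_distrr /=.
apply: ler_sum => k _; rewrite mulr1.
have kn : (k <= n)%N by rewrite -ltnS.
have -> : r' ^+ n = r' ^+ k * r' ^+ (n - k)%N by rewrite -exprD subnKC.
by rewrite mulrACA ler_pM // mulr_ge0 ?nm_ge0 // exprn_ge0 // ltW.
Qed.

Lemma nmM_conv F G n : nm ((F * G) n) <= \sum_(k < n.+1) nm (F k) * nm (G (n - k)%N).
Proof. by rewrite psM; apply: le_trans (nm_sum _ _ _) _; apply: ler_sum => i _; rewrite nmM. Qed.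

Lemma bndM F G r r' M M' : 0 <= r -> r < r' -> bnd F r' M -> bnd G r' M' ->
  bnd (F * G) r (M * M' * (1 - r / r')^-1).
Proof.
move=> r0 rr hF hG n; apply: le_trans (absconv_bnd n r0 rr hF hG).
by rewrite ler_wpM2r ?exprn_ge0 // nmM_conv.
Qed.

Lemma cv_common F G r : cv F r -> cv G r -> exists r' M, [/\ r < r', bnd F r' M & bnd G r' M].
Proof.
move=> [r1 [M1 [h1 b1]]] [r2 [M2 [h2 b2]]].
have [r0|r0] := ltP r 0.
  (* For negative [r] the radius 0 will do, where only the constant terms count. *)
  exists 0, (Num.max (nm (F 0%N)) (nm (G 0%N))); split=> // -[|n]; rewrite ?expr0 ?mulr1 ?le_max ?lexx ?orbT //.
    by rewrite expr0n /= mulr0 nm_ge0.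
  by rewrite expr0n /= mulr0 nm_ge0.
exists (Num.min r1 r2), (Num.max M1 M2); split; first by rewrite lt_min h1.
  by apply: bnd_le b1; rewrite ?ge_min ?le_max ?lexx // le_min; apply/andP; split; lra.
by apply: bnd_le b2; rewrite ?ge_min ?le_max ?lexx ?orbT // le_min; apply/andP; split; lra.
Qed.

Lemma cvD F G r : 0 <= r -> cv F r -> cv G r -> cv (F + G) r.
Proof.
move=> r0 hF hG; have [r' [M [h b1 b2]]] := cv_common hF hG; exists r', (M + M); split=> //.
by apply: bndD => //; lra.
Qed.
Lemma cvM F G r : 0 <= r -> cv F r -> cv G r -> cv (F * G) r.
Proof.
move=> r0 hF hG; have [r' [M [h b1 b2]]] := cv_common hF hG.
exists ((r + r') / 2), (M * M * (1 - (r + r') / 2 / r')^-1); split; first by lra.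
by apply: bndM => //; lra.
Qed.
Lemma cvN F r : cv F r -> cv (- F) r.
Proof. by move=> [r' [M [h b]]]; exists r', M; split=> // n; rewrite psN nmN. Qed.
Lemma cv_sum I (l : seq I) (P : pred I) (G : I -> ps C) r : 0 <= r ->
  (forall i, P i -> cv (G i) r) -> cv (\sum_(i <- l | P i) G i) r.
Proof.
move=> r0 H; elim/big_rec: _ => [|i x Pi Hx]; last by apply: cvD => //; exact: H.
by exists (r + 1), 0; split; [lra | move=> n; rewrite ps0 nm0 mul0r].
Qed.
Lemma bnd_poly (p : {poly C}) r : 0 <= r -> bnd (pp p) r (\sum_(i < size p) nm p`_i * r ^+ i).
Proof.
move=> r0 n; rewrite /pp; case: (ltnP n (size p)) => [np|pn].
  rewrite (bigD1 (Ordinal np)) //= lerDl sumr_ge0 // => i _.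
  by rewrite mulr_ge0 ?nm_ge0 ?exprn_ge0.
rewrite nth_default // nm0 mul0r sumr_ge0 // => i _.
by rewrite mulr_ge0 ?nm_ge0 ?exprn_ge0.
Qed.
Lemma cv_pp p r : cv (pp p) r.
Proof.
by exists (`|r| + 1), (\sum_(i < size p) nm p`_i * (`|r| + 1) ^+ i); split;
  [have := ler_norm r; lra | apply: bnd_poly; have := normr_ge0 r; lra].
Qed.
Lemma cv_1 r : cv 1 r. Proof. by rewrite -(rmorph1 (@pp C)); apply: cv_pp. Qed.
Lemma cvX F r k : 0 <= r -> cv F r -> cv (F ^+ k) r.
Proof. by move=> r0 h; elim: k => [|k IH]; rewrite ?expr0 ?exprS; [apply: cv_1 | apply: cvM]. Qed.
Lemma cv_prod I (l : seq I) (P : pred I) (G : I -> ps C) r : 0 <= r ->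
  (forall i, P i -> cv (G i) r) -> cv (\prod_(i <- l | P i) G i) r.
Proof.
move=> r0 H; elim/big_rec: _ => [|i x Pi Hx]; last by apply: cvM => //; exact: H.
exact: cv_1.
Qed.
Lemma cv_sc F a r : a != 0 -> cv F (nm a * r) -> cv (sc a F) r.
Proof.
move=> a0 [r' [M [h b]]]; have A : 0 < nm a by rewrite nm_gt0.
exists (r' / nm a), M; split; first by rewrite ltr_pdivlMr // mulrC.
move=> n; rewrite /sc nmM nmX expr_div_n; apply: le_trans (b n).
by rewrite mulrC mulrA divfK ?gt_eqF ?exprn_gt0 // mulrC.
Qed.

Lemma psum_tail F s r M m n : nm s < r -> bnd F r M -> (n <= m)%N ->
  nm (psum F s m - psum F s n) <= M * (nm s / r) ^+ n * (1 - nm s / r)^-1.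
Proof.
move=> sr b nm_; have s0 := nm_ge0 s; have r0 : 0 < r by lra.
have M0 := bnd_ge0 b.
have x0 : 0 <= nm s / r by rewrite divr_ge0 // ltW.
have x1 : nm s / r < 1 by rewrite ltr_pdivrMr // mul1r.
rewrite /psum -!(big_mkord xpredT (fun i => F i * s ^+ i)) (big_cat_nat (leq0n n) nm_) /=.
have -> : forall a c : C, a + c - a = c by move=> a c; ring.
have -> : \sum_(n <= i < m) F i * s ^+ i = \sum_(0 <= i < m - n) F (i + n)%N * s ^+ (i + n).
  by rewrite -{1}[n]add0n big_addn.
apply: le_trans (nm_sum _ _ _) _.
apply: le_trans (_ : \sum_(0 <= i < m - n) M * (nm s / r) ^+ n * (nm s / r) ^+ i <= _).
  apply: ler_sum => i _; rewrite nmM nmX -mulrA -exprD [(n + i)%N]addnC.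
  have -> : nm s ^+ (i + n) = r ^+ (i + n) * (nm s / r) ^+ (i + n).
    by rewrite -exprMn mulrC divfK // gt_eqF.
  by rewrite mulrA ler_wpM2r ?exprn_ge0.
rewrite -big_distrr /= ler_wpM2l ?mulr_ge0 ?exprn_ge0 //.
by rewrite big_mkord geo_sum_le.
Qed.

(** Bounded partial sums have an ultralimit, and the tail estimate makes it a true limit. *)
Lemma ev_ex F s : cv F (nm s) -> exists l, tends (psum F s) l.
Proof.
move=> [r [M [sr b]]]; have [U [UU UO]] := ultra_ex.
have FU := @ultra_proper _ _ UU.
have s0 := nm_ge0 s; have r0 : 0 < r by lra.
have M0 := bnd_ge0 b.
have x0 : 0 <= nm s / r by rewrite divr_ge0 // ltW.
have x1 : nm s / r < 1 by rewrite ltr_pdivrMr // mul1r.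
have [|l Hl] := @ulim_ex _ U UU (psum F s) (M * (1 - nm s / r)^-1).
  apply: filterE => n /=; have := psum_tail sr b (leq0n n).
  by rewrite /psum big_ord0 subr0 expr0 mulr1.
exists l; apply/tendsP => e e0.
have K0 : 0 < (1 - nm s / r) by lra.
have e1 : 0 < e * (1 - nm s / r) / (M + 1) by rewrite divr_gt0 ?mulr_gt0 //; lra.
have [N HN] := expr_small x0 x1 e1; exists N => n Nn.
have H : nm (psum F s n - l) <= M * (nm s / r) ^+ n * (1 - nm s / r)^-1.
  have FL : flim U (fun m => psum F s n - psum F s m) (psum F s n - l).
    by apply: flimD; [apply: flim_cst | apply: flimN].
  apply: flim_le FL _; apply: UO; apply/ooP; exists n => m nm_.
  by rewrite nm_sym; apply: psum_tail.
apply: le_lt_trans H _; rewrite ltr_pdivrMr //.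
have := HN n Nn; rewrite ltr_pdivlMr; last lra.
by have := exprn_ge0 n x0; lra.
Qed.

(** The value is 0 where the partial sums have no limit. *)
Definition ev F s : C := if pselect (exists l, tends (psum F s) l) is left H then projT1 (cid H) else 0.

Lemma ev_tends F s : cv F (nm s) -> tends (psum F s) (ev F s).
Proof. by move=> /ev_ex H; rewrite /ev; case: pselect => // H'; case: cid. Qed.

Lemma ev_eq F s l : tends (psum F s) l -> ev F s = l.
Proof.
move=> H; have E : exists l, tends (psum F s) l by exists l.
rewrite /ev; case: pselect => // E'; case: cid => l' /= H'.
exact: (flim_unique _ H' H).
Qed.

Lemma ev_tail F s r M n : nm s < r -> bnd F r M ->
  nm (ev F s - psum F s n) <= M * (nm s / r) ^+ n * (1 - nm s / r)^-1.
Proof.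
move=> sr b; have c : cv F (nm s) by exists r, M.
have FL : tends (fun m => psum F s m - psum F s n) (ev F s - psum F s n).
  by apply: flimD; [apply: ev_tends | apply: flimN; apply: flim_cst].
by apply: flim_le FL _; apply/ooP; exists n => m nm_; apply: psum_tail.
Qed.

Lemma ev_bound F s r M : nm s < r -> bnd F r M -> nm (ev F s) <= M * (1 - nm s / r)^-1.
Proof.
by move=> sr b; have := ev_tail 0 sr b; rewrite /psum big_ord0 subr0 expr0 mulr1.
Qed.

Lemma evD F G s : cv F (nm s) -> cv G (nm s) -> ev (F + G) s = ev F s + ev G s.
Proof.
move=> hF hG; apply: ev_eq.
have -> : psum (F + G) s = (fun n => psum F s n + psum G s n).
  by apply/funext => n; rewrite /psum -big_split; apply: eq_bigr => i _; rewrite psD mulrDl.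
by apply: flimD; apply: ev_tends.
Qed.

Lemma psum_horner F s n : psum F s n = (trunc n F).[s].
Proof. by rewrite horner_poly. Qed.

Lemma ev_pp p s : ev (pp p) s = p.[s].
Proof.
apply: ev_eq; apply: flim_near (flim_cst _ _) _; apply/ooP; exists (size p) => n Hn.
rewrite psum_horner; congr horner; apply/polyP => i.
rewrite coef_poly /pp; case: ltnP => // ni.
by rewrite nth_default // (leq_trans Hn).
Qed.
Lemma ev_sum I (l : seq I) (P : pred I) (G : I -> ps C) s :
  (forall i, P i -> cv (G i) (nm s)) -> ev (\sum_(i <- l | P i) G i) s = \sum_(i <- l | P i) ev (G i) s.
Proof.
move=> H; suff [] : ev (\sum_(i <- l | P i) G i) s = \sum_(i <- l | P i) ev (G i) s /\ cv (\sum_(i <- l | P i)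
  G i) (nm s) by [].
elim/big_rec2: _ => [|i x y Pi [E c]].
  rewrite -(rmorph0 (@pp C)) ev_pp horner0; split=> //; exact: cv_pp.
by rewrite evD ?E //; [split=> //; apply: cvD => //; [exact: nm_ge0|exact: H] | exact: H].
Qed.

(** The truncation of the product and the product of the truncations differ by a polynomial without
    terms below degree [n], with coefficients bounded independently of [n]; its value at [s] tends
    to 0. *)
Lemma evM F G s : cv F (nm s) -> cv G (nm s) -> ev (F * G) s = ev F s * ev G s.
Proof.
move=> hF hG; apply: ev_eq.
have s0 := nm_ge0 s.
have [r [M [sr bF bG]]] := cv_common hF hG.
pose t := (nm s + r) / 2.
have tr : t < r by rewrite /t; lra.
have st : nm s < t by rewrite /t; lra.
have t0 : 0 <= t by rewrite /t; lra.
pose K := M * M * (1 - t / r)^-1.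
have H n : nm (psum (F * G) s n - psum F s n * psum G s n) <= 2 * K * (nm s / t) ^+ n * (1 - nm s / t)^-1.
  rewrite !psum_horner -hornerM -hornerN -hornerD.
  set D := trunc _ _ - _.
  have bF' : bnd (pp (trunc n F)) r M.
    move=> m; rewrite /pp coef_poly; case: ltnP => // _; rewrite nm0 mul0r; exact: bnd_ge0 bF.
  have bG' : bnd (pp (trunc n G)) r M.
    move=> m; rewrite /pp coef_poly; case: ltnP => // _; rewrite nm0 mul0r; exact: bnd_ge0 bF.
  have bD : bnd (pp D) t (2 * K).
    move=> m; have -> : 2 * K = K + K by ring.
    rewrite /D rmorphB rmorphM /=; apply: le_trans (_ : (nm (pp (trunc n (F * G)) m) + nm ((pp (trunc n F) * pp
      (trunc n G)) m)) * t ^+ m <= _).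
      by rewrite ler_wpM2r ?exprn_ge0 // nmB.
    rewrite mulrDl lerD //; last exact: bndM tr bF' bG' m.
    rewrite /pp coef_poly; case: ltnP => _; first exact: bndM tr bF bG m.
    rewrite nm0 mul0r; apply: bnd_ge0 (bndM t0 tr bF bG).
  have := psum_tail (m := maxn n (size D)) st bD (leq_maxl _ _).
  have -> : psum (pp D) s n = 0.
    rewrite /psum big1 // => i _; rewrite /pp /D coefB coef_poly ltn_ord.
    by rewrite -(@ps_mul_trunc _ n i F G) // subrr mul0r.
  rewrite subr0 psum_horner; have -> // : trunc (maxn n (size D)) (pp D) = D.
  apply/polyP => i; rewrite coef_poly /pp; case: ltnP => // h.
  by rewrite nth_default // (leq_trans _ h) // leq_maxr.
have T0 : 0 < t by lra.
have x0 : 0 <= nm s / t by rewrite divr_ge0 // ltW.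
have x1 : nm s / t < 1 by rewrite ltr_pdivrMr // mul1r.
have L : tends (fun n => psum (F * G) s n - psum F s n * psum G s n) 0.
  apply: (@flim0_le _ \oo _ (fun n => 2 * K * (nm s / t) ^+ n * (1 - nm s / t)^-1)).
    move=> e e0; apply/ooP.
    have K0 : 0 <= K by exact: bnd_ge0 (bndM t0 tr bF bG).
    have e1 : 0 < e * (1 - nm s / t) / (2 * K + 1) by rewrite divr_gt0 ?mulr_gt0 //; lra.
    have [N HN] := expr_small x0 x1 e1; exists N => n /HN.
    rewrite ltr_pdivlMr; last lra.
    rewrite ltr_pdivrMr; last lra.
    by have := exprn_ge0 n x0; lra.
  by apply: filterE => n /=; exact: H.
have := flimD _ L (flimM _ (ev_tends hF) (ev_tends hG)).
rewrite add0r => L2; apply: (flim_near _ (L2 _ _)); apply: filterE => n /=; by rewrite subrK.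
Qed.

Lemma evX F s k : cv F (nm s) -> ev (F ^+ k) s = ev F s ^+ k.
Proof.
move=> h; elim: k => [|k IH].
  by rewrite !expr0 -(rmorph1 (@pp C)) ev_pp hornerC.
by rewrite !exprS evM ?IH //; apply: cvX => //; exact: nm_ge0.
Qed.
Lemma ev_sc F a s : ev (sc a F) s = ev F (a * s).
Proof.
have E : psum (sc a F) s = psum F (a * s).
  by apply/funext => n; apply: eq_bigr => i _; rewrite /sc exprMn; ring.
by rewrite /ev E.
Qed.
Lemma ev0 F : ev F 0 = F 0%N.
Proof.
apply: ev_eq; apply: flim_near (flim_cst _ _) _; apply/ooP; exists 1%N => -[|n] // _.
by rewrite /psum big_ord_recl expr0 mulr1 big1 ?addr0 // => i _; rewrite expr0n /= mulr0.
Qed.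

End Eval.

(** * Cauchy's estimate, division by a zero, identity theorem *)

Section Circle.
Variable R : realType.
Local Notation C := R[i].
Implicit Types (F G : ps C) (s : C) (r M : R).

(** A root of [X^(2^k) + 1] has an order that divides [2 ^ k.+1] but not [2 ^ k]. Orders that are
    powers of 2 are arbitrarily large, which is enough for the averages below. *)
Lemma prim2 k : exists w : C, (2 ^ k.+1).-primitive_root w.
Proof.
have n0 : (0 < 2 ^ k)%N by rewrite expn_gt0.
have /closed_rootP [w] : size ('X^(2 ^ k) + 1 : {poly C}) != 1.
  rewrite size_polyDl ?size_polyXn ?size_poly1 ?ltnS // eqSS; by rewrite -lt0n.
rewrite rootE !hornerE addr_eq0 => /eqP Hw; exists w.
have wn : w ^+ (2 ^ k.+1) = 1 by rewrite expnS mulnC exprM Hw expr2 mulrNN mulr1.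
have [m Hm mn] := prim_order_exists (n := 2 ^ k.+1) ltac:(by rewrite expn_gt0) wn.
have /(dvdn_pfactor _ _ (isT : prime 2)) [j jk mE] := mn.
suff E : j = k.+1 by rewrite -E -mE.
apply/eqP; rewrite eqn_leq jk /= ltnNge; apply/negP => jk'.
have : w ^+ (2 ^ k) == 1 by rewrite -(prim_order_dvd Hm) mE dvdn_exp2l.
by rewrite Hw eq_sym -subr_eq0 opprK -[1 + 1]/(2%:R) pnatr_eq0.
Qed.

Lemma prim_nm n (w : C) : n.-primitive_root w -> nm w = 1.
Proof.
move=> H; have n0 := prim_order_gt0 H.
have /eqP := congr1 (@nm R) (prim_expr_order H).
by rewrite nmX nm1 pexpr_eq1 ?nm_ge0 // => /eqP.
Qed.

Lemma prim_sum0 n (w : C) j : n.-primitive_root w -> ~~ (n %| j)%N -> \sum_(i < n) w ^+ (i * j) = 0.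
Proof.
move=> H nj; have := subrX1 (w ^+ j) n; rewrite -exprM mulnC exprM (prim_expr_order H) expr1n subrr.
move/esym/eqP; rewrite mulf_eq0 subr_eq0 -(prim_order_dvd H) (negbTE nj) /= => /eqP E.
by rewrite -[RHS]E; apply: eq_bigr => i _; rewrite mulnC exprM.
Qed.

(** Cauchy's formula with the circle replaced by [n]-th roots of unity: once [n] exceeds
    [size p + l], the average of [p] against [w ^+ (i * (n - l))] isolates the coefficient of index
    [l] exactly. *)
Lemma cauchy_poly (p : {poly C}) r B l : 0 < r -> (forall s, nm s = r -> nm p.[s] <= B) ->
  nm p`_l * r ^+ l <= B.
Proof.
move=> r0 HB.
have [w Hw] := prim2 (size p + l); set n := (2 ^ _)%N in Hw.
have np : (size p + l < n)%N.
  by apply: leq_trans (ltn_expl _ (isT : (1 < 2)%N)) _; rewrite leq_exp2l.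
have n0 : (0 < n)%N := prim_order_gt0 Hw.
have w1 := prim_nm Hw.
clearbody n.
have E : \sum_(i < n) p.[r%:C%C * w ^+ i] * w ^+ (i * (n - l)) = n%:R * (p`_l * r%:C%C ^+ l).
  transitivity (\sum_(i < n) \sum_(m < size p) p`_m * r%:C%C ^+ m * w ^+ (i * (m + (n - l)))).
    apply: eq_bigr => i _; rewrite horner_coef big_distrl; apply: eq_bigr => m _ /=.
    by rewrite exprMn -exprM mulnDr exprD; ring.
  rewrite exchange_big /=.
  have S0 (m : 'I_(size p)) : m != l :> nat ->
      \sum_(i < n) p`_m * r%:C%C ^+ m * w ^+ (i * (m + (n - l))) = 0.
    move=> ml; rewrite -big_distrr /= prim_sum0 ?mulr0 //.
    (* The exponent m + (n - l) lies strictly between 0 and 2n, so it is divisible by [n] only for m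
       = l. *)
    have mn : (m < n)%N by apply: leq_trans (ltn_ord m) _; apply: leq_trans (ltnW np); apply: leq_addr.
    have ln : (l < n)%N by apply: leq_ltn_trans np; apply: leq_addl.
    apply/negP => /dvdnP [k]; move: (nat_of_ord m) ml mn => m' /eqP ml mn E.
    case: k E => [|[|k]] E; [lia | by rewrite mul1n in E; lia |].
    have : (2 * n <= k.+2 * n)%N by rewrite leq_mul2r orbT.
    by lia.
  case: (ltnP l (size p)) => lp.
    rewrite (bigD1 (Ordinal lp)) //= [X in _ + X]big1 ?addr0; last first.
      by move=> m /eqP ml; apply: S0; apply/eqP => E; apply: ml; apply/val_inj.
    rewrite subnKC; last by apply: ltnW; apply: leq_ltn_trans np; apply: leq_addl.
    transitivity (\sum_(i < n) p`_l * r%:C%C ^+ l).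
      by apply: eq_bigr => i _; rewrite mulnC exprM (prim_expr_order Hw) expr1n mulr1.
    by rewrite sumr_const card_ord mulr_natl.
  rewrite nth_default // mul0r mulr0 big1 // => m _; apply: S0.
  by apply/eqP => E; have := ltn_ord m; rewrite E ltnNge lp.
have nR : 0 < n%:R :> R by rewrite ltr0n.
rewrite -(ler_pM2l nR); apply: le_trans (_ : nm (n%:R * (p`_l * r%:C%C ^+ l)) <= _).
  by rewrite !nmM nm_nat nmX nm_real gtr0_norm.
rewrite -E; apply: le_trans (nm_sum _ _ _) _.
apply: le_trans (_ : \sum_(i < n) B <= _); last by rewrite sumr_const card_ord mulr_natl.
apply: ler_sum => i _; rewrite nmM nmX w1 expr1n mulr1; apply: HB.
by rewrite nmM nmX w1 expr1n mulr1 nm_real gtr0_norm.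
Qed.

Lemma cauchy_ev F r B l : 0 < r -> cv F r -> (forall s, nm s = r -> nm (ev F s) <= B) ->
  nm (F l) * r ^+ l <= B.
Proof.
move=> r0 [r' [M [rr b]]] HB.
have M0 := bnd_ge0 b.
have x0 : 0 <= r / r' by rewrite divr_ge0; lra.
have x1 : r / r' < 1 by rewrite ltr_pdivrMr; lra.
apply/ler_addgt0Pr => e e0.
have e1 : 0 < e * (1 - r / r') / (M + 1) by rewrite divr_gt0 ?mulr_gt0 //; lra.
have [N HN] := expr_small x0 x1 e1.
pose n := (maxn N l.+1).
have -> : F l = (trunc n F)`_l by rewrite coef_poly leq_max ltnSn orbT.
apply: cauchy_poly => // s sr; rewrite -psum_horner.
have sr' : nm s < r' by rewrite sr.
have := ev_tail n sr' b; rewrite sr nm_sym => h.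
have := nm_sub_ge (psum F s n) (ev F s); have := HB s sr.
suff : M * (r / r') ^+ n / (1 - r / r') <= e by lra.
rewrite ler_pdivrMr; last lra.
have := HN n (leq_maxl _ _); rewrite ltr_pdivlMr; last lra.
by have := exprn_ge0 n x0; lra.
Qed.

(** The quotient by 1 - x/s has coefficients [psum F s n.+1 / s ^+ n]. As [F] vanishes at [s], these
    partial sums are tails up to sign, so the radius [r] is preserved. *)
Lemma ev_div F s r M : s != 0 -> nm s < r -> bnd F r M -> ev F s = 0 ->
  exists G M', bnd G r M' /\ F = pp (1 - s^-1 *: 'X) * G.
Proof.
move=> s0 sr b E; pose G : ps C := fun n => psum F s n.+1 / s ^+ n.
have sp : 0 < nm s by rewrite nm_gt0.
exists G, (M * (nm s / r) * (1 - nm s / r)^-1); split.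
  move=> n; rewrite /G nmM nmV nmX.
  have := ev_tail n.+1 sr b; rewrite E sub0r nmN => h.
  have r0 : 0 < r by lra.
  have x0 : 0 < nm s / r by rewrite divr_gt0.
  have -> : nm (psum F s n.+1) / nm s ^+ n * r ^+ n = nm (psum F s n.+1) / (nm s / r) ^+ n.
    by rewrite expr_div_n invf_div mulrA mulrAC.
  rewrite ler_pdivrMr ?exprn_gt0 //; apply: le_trans h _.
  by rewrite exprS le_eqVlt; apply/orP; left; apply/eqP; ring.
apply: psP => n; rewrite rmorphB rmorph1 /= mulrBl mul1r psB.
have -> : (pp (s^-1 *: 'X) * G) n = if n is n'.+1 then s^-1 * G n' else 0.
  have -> : pp (s^-1 *: 'X) = pp (s^-1)%:P * psX C ^+ 1 by rewrite -rmorphM /= mul_polyC.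
  by rewrite -mulrA psCM psXnM; case: n => [|n] /=; rewrite ?mulr0 // subn1.
case: n => [|n]; rewrite /G /psum.
  by rewrite big_ord_recl big_ord0 expr0 addr0 mulr1 subr0 divr1.
rewrite big_ord_recr /= exprS; field; by rewrite expf_neq0.
Qed.

Lemma ev_cont F r M (G : set (set nat)) (u : nat -> C) (l : C) : ProperFilter G ->
  0 < r -> bnd F r M -> nm l < r -> flim G u l -> flim G (fun n => ev F (u n)) (ev F l).
Proof.
move=> FG r0 b lr ul e e0.
have M0 := bnd_ge0 b.
pose t := (nm l + r) / 2; have tr : t < r by rewrite /t; lra.
have lt : nm l < t by rewrite /t; lra.
have t0 : 0 < t by have := nm_ge0 l; lra.
have x0 : 0 <= t / r by rewrite divr_ge0; lra.
have x1 : t / r < 1 by rewrite ltr_pdivrMr; lra.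
have tail n s : nm s <= t -> nm (ev F s - psum F s n) <= M * (t / r) ^+ n * (1 - t / r)^-1.
  move=> st; apply: le_trans (ev_tail n (le_lt_trans st tr) b) _.
  have h : nm s / r <= t / r by rewrite ler_pM2r ?invr_gt0.
  have h0 : 0 <= nm s / r by rewrite divr_ge0 ?nm_ge0 ?ltW.
  apply: ler_pM.
  - by rewrite mulr_ge0 ?exprn_ge0.
  - by rewrite invr_ge0; lra.
  - by rewrite ler_wpM2l // lerXn2r // nnegrE.
  by rewrite lef_pV2 ?posrE; lra.
have e1 : 0 < e / 3 * (1 - t / r) / (M + 1) by rewrite !divr_gt0 ?mulr_gt0 //; lra.
have [N HN] := expr_small x0 x1 e1.
have TN : M * (t / r) ^+ N * (1 - t / r)^-1 < e / 3.
  rewrite ltr_pdivrMr; last lra.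
  have := HN N (leqnn N); rewrite ltr_pdivlMr; last lra.
  by have := exprn_ge0 N x0; lra.
have P : flim G (fun n => psum F (u n) N) (psum F l N).
  by apply: flim_sum => i; apply: flimM; [apply: flim_cst | apply: flimX].
have e3 : 0 < e / 3 by lra.
have tl : 0 < t - nm l by lra.
apply: filterS (filterI (P _ e3) (ul _ tl)) => n [/= h1 h2].
have ut : nm (u n) <= t by have := nm_sub_ge (u n) l; lra.
have h3 := tail N _ ut; have h4 := tail N _ (ltW lt).
have -> : ev F (u n) - ev F l = (ev F (u n) - psum F (u n) N) + (psum F (u n) N - psum F l N) - (ev F l - psum
  F l N) by ring.
have := nmB (ev F (u n) - psum F (u n) N + (psum F (u n) N - psum F l N)) (ev F l - psum F l N).
have := nmD (ev F (u n) - psum F (u n) N) (psum F (u n) N - psum F l N).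
by lra.
Qed.

(** After division by the lowest power of [x], the values along [u] tend to the first nonzero
    coefficient. *)
Lemma ev_identity F (u : nat -> C) : cv F 0 -> tends u 0 -> (forall n, u n != 0) ->
  (exists N, forall n, (N <= n)%N -> ev F (u n) = 0) -> F = 0.
Proof.
move=> [r [M [r0 b]]] u0 un [N HN]; apply/eqP/negPn/negP => F0.
have [v [Fv Hv]] := ps_neq0P F0.
have FE := ps_shift Hv; set G := (X in _ * X) in FE.
have bG : bnd G r (M / r ^+ v).
  by move=> n; rewrite /G ler_pdivlMr ?exprn_gt0 // -mulrA -exprD; apply: b.
have L : tends (fun n => ev G (u n)) (ev G 0).
  by apply: (ev_cont (r := r) _ _ bG) => //; rewrite nm0.
have L0 : tends (fun n => ev G (u n)) 0.
  have /tendsP := u0; move/(_ r r0) => [N1 HN1].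
  apply: (flim_near _ (flim_cst _ _)); apply/ooP; exists (maxn N N1) => n; rewrite geq_max => /andP[h1 h2] /=.
  have := HN n h1; rewrite FE evM.
  - rewrite -rmorphXn /= ev_pp hornerXn => /eqP; rewrite mulf_eq0 expf_eq0 (negbTE (un n)) andbF /=.
    by move/eqP.
  - by rewrite -rmorphXn; apply: cv_pp.
  by exists r, (M / r ^+ v); split=> //; have := HN1 n h2; rewrite subr0.
have := flim_unique _ L L0; rewrite ev0 /G add0n => /(_ _)/eqP.
by rewrite (negbTE Fv).
Qed.

End Circle.

(** * The recurrence and meromorphic continuation *)

Section Regular.
Variable R : realType.
Local Notation C := R[i].
Implicit Types (f F G : ps C) (s : C) (r M : R).

Lemma seq_bounded (u : nat -> C) l : tends u l -> exists M, forall n, nm (u n) <= M.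
Proof.
move=> /tendsP /(_ 1 ltr01) [N HN].
exists (\sum_(i < N) nm (u i) + nm l + 1) => n.
have S0 : 0 <= \sum_(i < N) nm (u i) by apply: sumr_ge0 => i _; exact: nm_ge0.
case: (ltnP n N) => nN; last by have := HN n nN; have := nm_sub_ge (u n) l; lra.
rewrite (bigD1 (Ordinal nN)) //=; have := nm_ge0 l.
have : 0 <= \sum_(i < N | i != Ordinal nN) nm (u i) by apply: sumr_ge0 => i _; exact: nm_ge0.
by lra.
Qed.

Lemma seq_bounded_below (u : nat -> C) l : tends u l -> l != 0 -> (forall n, u n != 0) ->
  exists k, 0 < k /\ forall n, k <= nm (u n).
Proof.
move=> ul l0 u0; have [M HM] := seq_bounded (flimV _ l0 ul).
have M0 : 0 < M by apply: lt_le_trans (HM 0%N); rewrite nm_gt0 invr_eq0.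
exists M^-1; rewrite invr_gt0; split=> // n.
by rewrite -[nm (u n)]invrK -nmV lef_pV2 ?posrE ?nm_gt0 ?invr_eq0.
Qed.

Lemma cv_ratio F (l : C) r : 0 <= r -> (forall n, F n != 0) -> tends (fun n => F n.+1 / F n) l ->
  nm l * r < 1 -> cv F r.
Proof.
move=> r0 F0 Hl lr.
(* The increment over [r] is so small that [nm l * t] stays below 1. *)
pose t := r + (1 - nm l * r) / (2 * (nm l + 1)).
have l0 := nm_ge0 l.
have e0 : 0 < (1 - nm l * r) / (2 * (nm l + 1)) by rewrite divr_gt0 //; lra.
have rt : r < t by rewrite /t; lra.
have t0 : 0 < t by lra.
have e1 : (1 - nm l * r) / (2 * (nm l + 1)) * (2 * (nm l + 1)) = 1 - nm l * r.
  by rewrite divfK //; lra.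
have lt1 : nm l * t < 1 by rewrite /t; set e := _ / _ in e0 e1 *; nra.
have d0 : 0 < t^-1 - nm l by rewrite subr_gt0 -[t^-1]mul1r ltr_pdivlMr.
have /tendsP := Hl; move=> /(_ _ d0) [N HN].
exists t, (\sum_(i < N.+1) nm (F i) * t ^+ i); split=> // n.
have P i : 0 <= nm (F i) * t ^+ i by rewrite mulr_ge0 ?nm_ge0 // exprn_ge0 // ltW.
elim: n => [|n IH].
  by rewrite big_ord_recl /= lerDl sumr_ge0.
case: (ltnP n N) => nN.
  have nN1 : (n.+1 < N.+1)%N by [].
  by rewrite (bigD1 (Ordinal nN1)) //= lerDl sumr_ge0.
apply: le_trans IH; rewrite exprS mulrA ler_wpM2r //; first by rewrite exprn_ge0 // ltW.
rewrite -ler_pdivlMr // mulrC -ler_pdivrMr ?nm_gt0 // -nmV -nmM.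
by have := HN n nN; have := nm_sub_ge (F n.+1 / F n) l; lra.
Qed.

Lemma tends_horner (p : {poly C}) (u : nat -> C) l : tends u l -> tends (fun n => p.[u n]) p.[l].
Proof.
move=> ul; have -> : (fun n => p.[u n]) = (fun n => \sum_(i < size p) p`_i * u n ^+ i).
  by apply/funext => n; rewrite horner_coef.
rewrite horner_coef; apply: flim_sum => i.
by apply: flimM; [apply: flim_cst | apply: flimX].
Qed.

(* Normal form of a [q]-hypergeometric recurrence that never breaks off; [B.[q^-1] = 0] makes it hold at index [-1] too. *)
Definition hyp (q : C) (A B : {poly C}) f : Prop :=
  [/\ q != 0, f 0%N != 0, B.[q^-1] = 0, forall n, A.[q ^+ n] != 0 /\ B.[q ^+ n] != 0 &
      forall n, B.[q ^+ n] * f n.+1 = A.[q ^+ n] * f n].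

Lemma hyp_neq0 q A B f : hyp q A B f -> forall n, f n != 0.
Proof.
move=> [q0 f0 _ AB H]; elim=> // n IH; have [a b] := AB n.
by apply/eqP => E; move/eqP: (H n); rewrite E mulr0 eq_sym mulf_eq0 (negbTE a) (negbTE IH).
Qed.
Lemma hyp_ratio q A B f n : hyp q A B f -> f n.+1 / f n = A.[q ^+ n] / B.[q ^+ n].
Proof.
move=> Hf; have f0 := hyp_neq0 Hf n; case: Hf => _ _ _ AB H; have [_ b] := AB n.
by apply/eqP; rewrite eqr_div // mulrC -H mulrC.
Qed.

(* The coefficients of the [q]-difference equation equivalent to the recurrence, see [hyp_feq]. *)
Definition bpol (q : C) (A B : {poly C}) (i : nat) : {poly C} := (B`_i / q ^+ i)%:P - A`_i *: 'X.

Lemma ps_bpolM q A B i F m : (pp (bpol q A B i) * F) m =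
  B`_i / q ^+ i * F m - A`_i * (if m is m'.+1 then F m' else 0).
Proof.
rewrite /bpol rmorphB /= mulrBl psB psCM; congr (_ - _).
have -> : pp (A`_i *: 'X) = pp (A`_i)%:P * psX _ ^+ 1 by rewrite -rmorphM /= mul_polyC.
by rewrite -mulrA psCM psXnM; case: m => [|m] //=; rewrite subn1.
Qed.

(** Multiplying the coefficient of index m by [q ^+ (i * m)] is the dilation [sc (q ^+ i)], so the
    polynomials in q^m turn into operators. Degree 0 is where [B.[q^-1] = 0] enters. *)
Lemma hyp_feq q A B f n : hyp q A B f -> (size A <= n)%N -> (size B <= n)%N ->
  \sum_(i < n) pp (bpol q A B i) * sc (q ^+ i) f = 0.
Proof.
move=> [q0 f0 Bq _ H] sA sB; apply: psP => m; rewrite ps_sum ps0.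
under eq_bigr do rewrite ps_bpolM /sc.
rewrite sumrB; case: m => [|m].
  rewrite [X in _ - X]big1 ?subr0; last by move=> i _; rewrite mulr0.
  under eq_bigr do rewrite expr0 mul1r.
  rewrite -big_distrl /= -[X in X * _ = _]/(\sum_(i < n) B`_i / q ^+ i).
  have -> : \sum_(i < n) B`_i / q ^+ i = B.[q^-1].
    by rewrite (horner_coef_wide _ sB); apply: eq_bigr => i _; rewrite exprVn.
  by rewrite Bq mul0r.
have -> : \sum_(i < n) B`_i / q ^+ i * ((q ^+ i) ^+ m.+1 * f m.+1) = B.[q ^+ m] * f m.+1.
  rewrite (horner_coef_wide _ sB) big_distrl; apply: eq_bigr => i _ /=.
  rewrite -exprM mulnS exprD -exprM mulnC; field.
  by rewrite expf_neq0.
have -> : \sum_(i < n) A`_i * ((q ^+ i) ^+ m * f m) = A.[q ^+ m] * f m.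
  rewrite (horner_coef_wide _ sA) big_distrl; apply: eq_bigr => i _ /=.
  by rewrite -!exprM mulnC mulrA.
by rewrite H subrr.
Qed.

(* [F] continues meromorphically to a disc containing [s] in its interior, with finitely many poles, and takes the value [y] at [s]. *)
Definition reg F s y := exists Q : {poly C}, [/\ Q.[s] != 0,
  cv (pp Q * F) (nm s) & ev (pp Q * F) s = y * Q.[s]].

Lemma reg_unique F s y y' : reg F s y -> reg F s y' -> y = y'.
Proof.
move=> [Q [Q0 c E]] [Q' [Q0' c' E']].
have : ev (pp Q' * (pp Q * F)) s = ev (pp Q * (pp Q' * F)) s by rewrite mulrCA.
rewrite (evM (cv_pp _ _) c) (evM (cv_pp _ _) c') !ev_pp E E'.
move=> H; apply/(mulIf Q0)/(mulIf Q0'); have := H; move=> h.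
by transitivity (Q'.[s] * (y * Q.[s])); [ring | rewrite h; ring].
Qed.
Lemma reg_cv F s : cv F (nm s) -> reg F s (ev F s).
Proof.
by move=> c; exists 1; rewrite rmorph1 mul1r hornerE mulr1 oner_eq0; split.
Qed.
Lemma reg_ev F s y : cv F (nm s) -> reg F s y -> ev F s = y.
Proof. by move=> /reg_cv h1 h2; apply: reg_unique h1 h2. Qed.
Lemma reg_pp p s : reg (pp p) s p.[s].
Proof. by rewrite -ev_pp; apply: reg_cv; apply: cv_pp. Qed.
Lemma regD F G s y z : reg F s y -> reg G s z -> reg (F + G) s (y + z).
Proof.
move=> [Q [Q0 c E]] [Q' [Q0' c' E']]; exists (Q * Q').
have h1 : cv (pp Q' * (pp Q * F)) (nm s) by apply: cvM => //; [exact: nm_ge0 | exact: cv_pp].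
have h2 : cv (pp Q * (pp Q' * G)) (nm s) by apply: cvM => //; [exact: nm_ge0 | exact: cv_pp].
have EE : pp (Q * Q') * (F + G) = pp Q' * (pp Q * F) + pp Q * (pp Q' * G) by rewrite rmorphM /=; ring.
rewrite EE hornerM mulf_neq0 //; split=> //; first by apply: cvD => //; exact: nm_ge0.
rewrite evD // (evM (cv_pp _ _) c) (evM (cv_pp _ _) c') !ev_pp E E'.
by ring.
Qed.
Lemma regM F G s y z : reg F s y -> reg G s z -> reg (F * G) s (y * z).
Proof.
move=> [Q [Q0 c E]] [Q' [Q0' c' E']]; exists (Q * Q').
have EE : pp (Q * Q') * (F * G) = (pp Q * F) * (pp Q' * G) by rewrite rmorphM /=; ring.
rewrite EE hornerM mulf_neq0 //; split=> //; first by apply: cvM => //; exact: nm_ge0.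
by rewrite evM // E E'; ring.
Qed.
Lemma reg_sum (I : Type) (l : seq I) (F : I -> ps C) (y : I -> C) s :
  (forall i, reg (F i) s (y i)) -> reg (\sum_(i <- l) F i) s (\sum_(i <- l) y i).
Proof.
move=> H; elim: l => [|i l IH]; last by rewrite !big_cons; apply: regD.
by rewrite !big_nil -(rmorph0 (@pp C)) -[X in reg _ _ X](horner0 s); apply: reg_pp.
Qed.
Lemma reg_sc F a s y : a != 0 -> reg F (a * s) y -> reg (sc a F) s y.
Proof.
move=> a0 [Q [Q0 c E]]; exists (Q \Po (a *: 'X)).
have EE : pp (Q \Po (a *: 'X)) * sc a F = sc a (pp Q * F) by rewrite -sc_pp rmorphM.
have hE : (Q \Po (a *: 'X)).[s] = Q.[a * s] by rewrite horner_comp !hornerE.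
rewrite EE hE; split=> //; last by rewrite ev_sc.
by apply: cv_sc => //; rewrite -nmM.
Qed.
Lemma reg_mulI (p : {poly C}) F s y : p.[s] != 0 -> reg (pp p * F) s y -> reg F s (y / p.[s]).
Proof.
move=> p0 [Q [Q0 c E]]; exists (Q * p); rewrite hornerM mulf_neq0 // rmorphM -mulrA.
by split=> //; rewrite E; field.
Qed.

Lemma lin_size (a : C) : a != 0 -> size (1 - a *: 'X : {poly C}) = 2%N.
Proof.
by move=> a0; rewrite addrC size_polyDl ?size_polyN size_scale ?size_polyX ?size_poly1.
Qed.
Lemma lin_neq0 (a : C) : (1 - a *: 'X : {poly C}) != 0.
Proof.
have [->|/lin_size] := eqVneq a 0; first by rewrite scale0r subr0 oner_neq0.
by rewrite -size_poly_gt0 => ->.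
Qed.

(** Common zeros at [s] of the multiplier and of its product with [F] are divided out. The descent
    stops at a multiplier that compensates the pole exactly. *)
Lemma pole_order F s (T : {poly C}) : s != 0 -> T != 0 -> cv (pp T * F) (nm s) ->
  (forall y, ~ reg F s y) ->
  exists Q : {poly C}, [/\ Q.[s] = 0, cv (pp Q * F) (nm s) & ev (pp Q * F) s != 0].
Proof.
move=> s0 T0 cT nr.
have : exists (n : nat) (T : {poly C}), (size T <= n)%N /\ (T != 0 /\ cv (pp T * F) (nm s)).
  by exists (size T), T.
move=> [n]; elim: n => [|n IH] [T1 [sT [T10 c1]]].
  by move: T10; rewrite -size_poly_gt0 ltnNge sT.
have [E|E] := eqVneq T1.[s] 0; last first.
  case: (nr (ev (pp T1 * F) s / T1.[s])); exists T1; split=> //; by rewrite divfK.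
have [E2|E2] := eqVneq (ev (pp T1 * F) s) 0; last by exists T1.
have [Q TQ] : exists Q, T1 = Q * (1 - s^-1 *: 'X).
  have /factor_theorem [Q TQ] : root T1 s by apply/eqP.
  exists (- s *: Q); rewrite TQ -!scalerAl; rewrite scalerAr; congr (_ * _).
  rewrite scalerBr scalerA mulNr mulfV // scaleN1r opprK alg_polyC rmorphN /= addrC.
  by [].
apply: IH; exists Q; split.
  have Q0 : Q != 0 by apply: contraNneq T10 => Q0; rewrite TQ Q0 mul0r.
  have L0 := lin_neq0 s^-1.
  have si0 : s^-1 != 0 by rewrite invr_eq0.
  by move: sT; rewrite TQ size_mul // (lin_size si0) addn2 /= ltnS.
split; first by apply: contraNneq T10 => Q0; rewrite TQ Q0 mul0r.
have [r [M [sr b]]] := c1; have [G [M' [bG EG]]] := ev_div s0 sr b E2.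
have -> : pp Q * F = G; last by exists r, M'.
have L0 : pp (1 - s^-1 *: 'X : {poly C}) != 0 by rewrite pp_eq0 lin_neq0.
by apply: (mulfI L0); rewrite -EG TQ rmorphM /=; ring.
Qed.

End Regular.

(** * Rationality of hypergeometric series *)

Section HypRat.
Variable R : realType.
Local Notation C := R[i].
Implicit Types (f F G : ps C) (s : C) (r M : R) (T A B : {poly C}).

Lemma prod_hyp q A B f m k : hyp q A B f ->
  f (m + k)%N * \prod_(j < k) B.[q ^+ (m + j)] = f m * \prod_(j < k) A.[q ^+ (m + j)].
Proof.
move=> Hf; have [_ _ _ _ H] := Hf; elim: k => [|k IH]; first by rewrite !big_ord0 addn0.
rewrite !big_ord_recr /= addnS; have := H (m + k)%N.
set b := B.[q ^+ (m + k)]; set a := A.[q ^+ (m + k)] => E.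
transitivity (b * f (m + k).+1 * \prod_(i < k) B.[q ^+ (m + i)]); first by ring.
rewrite E; transitivity (a * (f (m + k)%N * \prod_(i < k) B.[q ^+ (m + i)])); first by ring.
by rewrite IH; ring.
Qed.

(* [(T * f)_(m + size T)] vanishes exactly when this polynomial vanishes at [q ^+ m], see [test_polyE]. *)
Definition test_poly q A B T : {poly C} := let D := size T in
  \sum_(i < D) T`_i *: ((\prod_(j < D - i) (A \Po (q ^+ j *: 'X))) *
                        (\prod_(D - i <= j < D) (B \Po (q ^+ j *: 'X)))).

Lemma horner_scX (p : {poly C}) a x : (p \Po (a *: 'X)).[x] = p.[a * x].
Proof. by rewrite horner_comp !hornerE. Qed.

Lemma psM_poly T f n : (size T <= n.+1)%N -> (pp T * f) n = \sum_(i < size T) T`_i * f (n - i)%N.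
Proof.
move=> sT; rewrite psM -!(big_mkord xpredT (fun i => T`_i * f (n - i)%N)) (big_cat_nat _ sT) //=.
rewrite [X in _ + X]big_nat [X in _ + X]big1 ?addr0 // => i /andP[h _].
by rewrite nth_default // mul0r.
Qed.

Lemma test_polyE q A B f T m : hyp q A B f -> let D := size T in
  (pp T * f) (m + D)%N * \prod_(j < D) B.[q ^+ (m + j)] = f m * (test_poly q A B T).[q ^+ m].
Proof.
move=> Hf D; rewrite psM_poly; last by rewrite leqW // leq_addl.
rewrite /test_poly -/D horner_sum big_distrl big_distrr; apply: eq_bigr => i _ /=.
have iD : (i <= D)%N by rewrite ltnW.
rewrite hornerZ hornerM !horner_prod.
have E1 : \prod_(j < D) B.[q ^+ (m + j)] =
  \prod_(j < D - i) B.[q ^+ (m + j)] * \prod_(D - i <= j < D) B.[q ^+ (m + j)].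
  by rewrite -!(big_mkord xpredT (fun j => B.[q ^+ (m + j)])) -big_cat_nat //= leq_subr.
rewrite E1; have -> : (m + D - i = m + (D - i))%N by rewrite addnBA.
have := prod_hyp m (D - i) Hf; set P1 := \prod_(j < D - i) _; set P2 := \prod_(j < D - i) _.
have -> : \prod_(j < D - i) (A \Po (q ^+ j *: 'X)).[q ^+ m] = P2.
  by apply: eq_bigr => j _; rewrite horner_scX -exprD addnC.
have -> : \prod_(D - i <= j < D) (B \Po (q ^+ j *: 'X)).[q ^+ m] = \prod_(D - i <= j < D) B.[q ^+ (m + j)].
  by apply: eq_bigr => j _; rewrite horner_scX -exprD addnC.
set P3 := \prod_(_ <= _ < _) _ => E.
transitivity (T`_i * (f (m + (D - i))%N * P1) * P3); first by ring.
by rewrite E; ring.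
Qed.

(** All coefficients of [T * f] from index [size T] on then vanish. *)
Lemma test_poly0_rational q A B f T : hyp q A B f -> T != 0 -> test_poly q A B T = 0 -> fps_rational f.
Proof.
move=> Hf T0 V0; apply/fps_rationalP; exists (trunc (size T) (pp T * f)), T; split=> //.
apply: psP => n; rewrite /pp coef_poly -/(pp T); case: ltnP => // h.
have [m Em] : exists m, n = (m + size T)%N by exists (n - size T)%N; rewrite subnK.
have := test_polyE T m Hf; rewrite /= V0 horner0 mulr0 -Em => /eqP.
rewrite mulf_eq0 => /orP[/eqP //|].
have [_ _ _ AB _] := Hf.
by rewrite prodf_seq_eq0 => /hasP[j _ /=]; have [_ /negbTE ->] := AB (m + j)%N.
Qed.

(** The multiplicity [e] of the root 0 governs the decay along q^m, so it is at most geometric. *)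
Lemma poly_qn_lower (V : {poly C}) (q : C) : V != 0 -> q != 0 -> nm q < 1 ->
  exists e c N, 0 < c /\ forall m, (N <= m)%N -> c * (nm q ^+ e) ^+ m <= nm V.[q ^+ m].
Proof.
move=> V0 q0 q1; have [e [V' V'0 VE]] := multiplicity_XsubC V 0.
rewrite V0 /= in V'0; rewrite subr0 in VE.
have L := tends_horner V' (tends_expr q1).
have c0 : 0 < nm V'.[0] by rewrite nm_gt0.
have c2 : 0 < nm V'.[0] / 2 by lra.
have /tendsP := L; move=> /(_ _ c2) [N HN].
exists e, (nm V'.[0] / 2), N; split=> // m Nm.
rewrite VE hornerM hornerXn nmM -exprM mulnC exprM nmX -nmX nmX ler_wpM2r ?exprn_ge0 ?nm_ge0 //.
by have := HN m Nm; rewrite nm_sym; have := nm_sub_ge V'.[0] V'.[q ^+ m]; rewrite -nmN; lra.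
Qed.

(** With a nonzero test polynomial, [T * f] would have coefficients bounded below by a geometric
    sequence, as [f] has; those of an entire series fall below every geometric sequence. *)
Lemma entire_mul_rational q A B f T (l : C) : hyp q A B f -> nm q < 1 -> T != 0 ->
  tends (fun n => f n.+1 / f n) l -> l != 0 -> (forall r, cv (pp T * f) r) -> fps_rational f.
Proof.
move=> Hf q1 T0 L l0 ent; have [q0 f00 _ AB _] := Hf.
have fn0 := hyp_neq0 Hf.
have [V0|V0] := eqVneq (test_poly q A B T) 0; first exact: test_poly0_rational Hf T0 V0.
exfalso; have [e [c [N [c0 HN]]]] := poly_qn_lower V0 q0 q1.
have [k [k0 Hk]] : exists k, 0 < k /\ forall n, k <= nm (f n.+1 / f n).
  by apply: (seq_bounded_below L l0) => n; rewrite mulf_neq0 ?invr_eq0.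
have flow n : nm (f 0%N) * k ^+ n <= nm (f n).
  elim: n => [|n IH]; first by rewrite expr0 mulr1.
  have := Hk n; rewrite nmM nmV ler_pdivlMr ?nm_gt0 // => h.
  by apply: le_trans h; rewrite exprS mulrCA ler_wpM2l // ltW.
have [MB HMB] := seq_bounded (tends_horner B (tends_expr q1)).
have MB0 : 0 <= MB by apply: le_trans (HMB 0%N); exact: nm_ge0.
pose t := k * nm q ^+ e; have t0 : 0 < t by rewrite mulr_gt0 // exprn_gt0 // nm_gt0.
(* At this radius the lower bound [K * t ^+ m] for the coefficients turns into growth like 2^m. *)
have [r [M [rt b]]] := ent (2 / t).
have r0 : 0 < r by apply: lt_trans rt; rewrite divr_gt0.
have f0p : 0 < nm (f 0%N) by rewrite nm_gt0.
set D := size T in b *.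
pose K := nm (f 0%N) * c.
have K0 : 0 < K by rewrite mulr_gt0.
have P m : (N <= m)%N -> K * 2 ^+ m <= M / r ^+ D * MB ^+ D.
  move=> Nm; have := test_polyE T m Hf; rewrite /= -/D => /(congr1 (@nm R)); rewrite !nmM => E.
  have h1 : K * t ^+ m <= nm (f m) * nm (test_poly q A B T).[q ^+ m].
    rewrite /K /t exprMn mulrACA; apply: ler_pM (flow m) (HN m Nm).
      by rewrite mulr_ge0 ?nm_ge0 // exprn_ge0 // ltW.
    by rewrite mulr_ge0 ?(ltW c0) // !exprn_ge0 // nm_ge0.
  have h2 : nm (\prod_(j < D) B.[q ^+ (m + j)]) <= MB ^+ D.
    rewrite nm_prod -[X in MB ^+ X]card_ord -prodr_const; apply: ler_prod => j _.
    by rewrite nm_ge0 HMB.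
  have h3 : nm ((pp T * f) (m + D)%N) <= M / r ^+ D / r ^+ m.
    rewrite !ler_pdivlMr ?exprn_gt0 // -mulrA -exprD; exact: b.
  have h4 : K * t ^+ m <= M / r ^+ D / r ^+ m * MB ^+ D.
    apply: le_trans h1 _; rewrite -E; apply: ler_pM; rewrite ?nm_ge0 //.
  have h5 : K * t ^+ m * r ^+ m <= M / r ^+ D * MB ^+ D.
    apply: le_trans (ler_wpM2r (exprn_ge0 m (ltW r0)) h4) _.
    by rewrite mulrAC divfK // gt_eqF // exprn_gt0.
  apply: le_trans h5.
  rewrite -mulrA ler_wpM2l ?(ltW K0) // -exprMn lerXn2r ?nnegrE //; first by rewrite mulr_ge0 // ltW.
  by rewrite mulrC -ler_pdivrMr // ltW.
have [N3 HN3] := expr_big (M / r ^+ D * MB ^+ D / K) (ltac:(lra) : 1 < 2 :> R).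
have := HN3 (maxn N N3) (leq_maxr _ _); rewrite ltr_pdivrMr // mulrC.
by have := P (maxn N N3) (leq_maxl _ _); lra.
Qed.

End HypRat.

(** * Poles of meromorphic hypergeometric series *)

Section Poles.
Variable R : realType.
Local Notation C := R[i].

Lemma tends_near (u v : nat -> C) l : tends u l -> (exists N, forall n, (N <= n)%N -> u n = v n) -> tends v l.
Proof.
move=> /tendsP ul [N HN]; apply/tendsP => e /ul [N1 HN1]; exists (maxn N N1) => n.
by rewrite geq_max => /andP[h1 h2]; rewrite -HN // HN1.
Qed.
Lemma tends_ext (u v : nat -> C) l : tends u l -> (forall n, u n = v n) -> tends v l.
Proof. by move=> ul uv; apply: tends_near ul _; exists 0%N => n _. Qed.

Implicit Types (F G : ps C) (s : C) (r M : R) (T : {poly C}).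
Variables (q : C) (A B : {poly C}) (f : ps C) (n : nat).
Hypotheses (Hf : hyp q A B f) (q1 : nm q < 1) (A0 : A`_0 != 0) (B0 : B`_0 != 0).
Hypotheses (sA : (size A <= n.+1)%N) (sB : (size B <= n.+1)%N).

Let q0 : q != 0. Proof. by case: Hf. Qed.
Let nq0 : 0 < nm q. Proof. by rewrite nm_gt0. Qed.

(** [pole_at 0] is the zero of [bpol q A B 0]; the functional equation carries singularities from x
    to x/q, outwards since |q| < 1. *)
Definition pole_at (k : nat) : C := B`_0 / A`_0 / q ^+ k.
Local Notation xs := pole_at.

Lemma xs_neq0 k : xs k != 0.
Proof. by rewrite /xs !mulf_neq0 // ?invr_eq0 ?expf_neq0. Qed.
Lemma xsE k i : q ^+ i * xs (k + i)%N = xs k.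
Proof. by rewrite /xs exprD; field; rewrite !expf_neq0 // A0. Qed.
Lemma xs_mono k j : (k <= j)%N -> nm (xs k) <= nm (xs j).
Proof.
move=> kj; rewrite -(xsE k (j - k)) subnKC // nmM nmX ler_piMl ?nm_ge0 //.
by rewrite exprn_ile1 ?nm_ge0 // ltW.
Qed.
Lemma xs_big M : exists k, M < nm (xs k).
Proof.
have i1 : 1 < (nm q)^-1 by rewrite invf_gt1.
have x0 : 0 < nm (xs 0) by rewrite nm_gt0 xs_neq0.
have [N HN] := expr_big (M / nm (xs 0)) i1; exists N.
have := HN N (leqnn N); rewrite ltr_pdivrMr // => h; apply: lt_le_trans h _.
by rewrite -(xsE 0 N) add0n nmM nmX exprVn mulKf // expf_neq0 // gt_eqF.
Qed.

Lemma hyp_ratio_tends : tends (fun m => f m.+1 / f m) (A`_0 / B`_0).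
Proof.
have E (p : {poly C}) : p`_0 = p.[0] by rewrite horner_coef0.
rewrite !E; have h p := tends_horner p (tends_expr q1).
have L : tends (fun m => A.[q ^+ m] / B.[q ^+ m]) (A.[0] / B.[0]).
  by apply: flimM; [exact: h | apply: flimV; [rewrite -E | exact: h]].
by apply: tends_ext L _ => m; rewrite (hyp_ratio m Hf).
Qed.

Lemma cv_below_pole r : 0 <= r -> r < nm (xs 0) -> cv f r.
Proof.
move=> r0 rx; apply: (cv_ratio r0 (hyp_neq0 Hf) hyp_ratio_tends).
move: rx; rewrite /xs expr0 divr1 -invf_div nmV => rx.
by rewrite mulrC -ltr_pdivlMr ?nm_gt0 ?mulf_neq0 ?invr_eq0 // mul1r.
Qed.

Lemma horner_bpol i x : (bpol q A B i).[x] = B`_i / q ^+ i - A`_i * x.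
Proof. by rewrite /bpol hornerD hornerN hornerC hornerZ hornerX. Qed.

(** The functional equation writes [bpol q A B 0] times [f] through the dilations by [q ^+ i] with i
    > 0. These need a multiplier only for a disc smaller by the factor |q|, where a dilated copy of
    the previous one serves. *)
Lemma mero_multiplier K : exists T, [/\ T != 0, forall s, root T s -> exists k, s = xs k &
  forall r, 0 <= r -> r < nm (xs K) -> cv (pp T * f) r].
Proof.
elim: K => [|K [T [T0 rT cT]]].
  exists 1; split; first exact: oner_neq0.
    by move=> s; rewrite rootE hornerE oner_eq0.
  by move=> r r0 rx; rewrite rmorph1 mul1r; apply: cv_below_pole.
pose T' i : {poly C} := T \Po (q ^+ i *: 'X).
have T'0 i : T' i != 0.
  apply/eqP => /(congr1 (@pp C)); rewrite rmorph0 /T' -sc_pp => /eqP.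
  by rewrite sc_eq0 ?expf_neq0 // pp_eq0 (negbTE T0).
exists (bpol q A B 0 * \prod_(i < n) T' i.+1); split.
- rewrite mulf_neq0 //; last by apply/prodf_neq0 => i _; apply: T'0.
  apply/eqP => /(congr1 (fun p : {poly C} => p.[0])); rewrite horner_bpol horner0 mulr0 subr0 expr0 divr1 =>
    /eqP.
  by rewrite (negbTE B0).
- move=> s; rewrite rootM => /orP[|].
    rewrite rootE horner_bpol expr0 divr1 subr_eq0 => /eqP E; exists 0%N.
    by rewrite /xs E expr0 divr1 mulrAC mulfV // mul1r.
  rewrite rootE horner_prod prodf_seq_eq0 => /hasP[i _ /=].
  rewrite horner_scX -rootE => /rT [k E]; exists (k + i.+1)%N.
  apply: (mulfI (expf_neq0 i.+1 q0)); by rewrite xsE.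
move=> r r0 rx; have := hyp_feq Hf sA sB.
rewrite big_ord_recl /= expr0 sc1 => /eqP; rewrite addr_eq0 => /eqP E.
rewrite rmorphM /= mulrAC E mulNr; apply: cvN; rewrite big_distrl.
apply: cv_sum => // i _ /=.
rewrite rmorph_prod /= (bigD1 i) //= /T' -sc_pp /bump /=.
have -> : forall a b c d : ps C, a * b * (c * d) = a * d * (c * b) by move=> *; ring.
rewrite -rmorphM; apply: cvM => //.
  apply: cvM => //; first exact: cv_pp.
  by apply: cv_prod => // j _; exact: cv_pp.
apply: cv_sc; first by rewrite expf_neq0.
apply: cT; first by rewrite mulr_ge0 ?nm_ge0.
rewrite -(xsE K 1) addn1 expr1 nmM ?add1n nmX exprS -mulrA ltr_pM2l //.
apply: le_lt_trans rx; by rewrite ler_piMl // exprn_ile1 ?nm_ge0 // ltW.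
Qed.

Lemma f_reg_off s : (forall k, s != xs k) -> exists y, reg f s y.
Proof.
move=> Hs; have [K HK] := xs_big (nm s).
have [T [T0 rT cT]] := mero_multiplier K.
have Ts : T.[s] != 0.
  by apply/negP => /rT [k E]; have := Hs k; rewrite E eqxx.
exists (ev (pp T * f) s / T.[s]); exists T; split=> //; last by rewrite divfK.
by apply: cT => //; exact: nm_ge0.
Qed.

(** Beyond [pole_at 0] the coefficient [bpol q A B 0] has no zero on the spiral, so the functional
    equation determines [f] at a point from its values at the [n] preceding ones. *)
Lemma f_reg_next k : (forall i, (i < n)%N -> exists y, reg f (xs (k.+1 + i)) y) ->
  exists y, reg f (xs (k.+1 + n)) y.
Proof.
move=> H.
have Hc (i : 'I_n) : exists y, reg f (q ^+ (bump 0 i) * xs (k.+1 + n)) y.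
  have iN := ltn_ord i.
  have [|z Hz] := H (n - i.+1)%N; first by lia.
  exists z; rewrite /bump add1n.
  have -> : (k.+1 + n = k.+1 + (n - i.+1) + i.+1)%N by lia.
  by rewrite xsE.
have [y Hy] := boolp.choice Hc.
set s := xs _ in Hy *.
have := hyp_feq Hf sA sB.
rewrite big_ord_recl /= expr0 sc1 => /eqP; rewrite addr_eq0 => /eqP E.
have b0 : (bpol q A B 0).[s] != 0.
  rewrite horner_bpol expr0 divr1 subr_eq0; apply/eqP => E2.
  have Es : s = xs 0.
    have E3 : B`_0 / A`_0 = s by rewrite E2 mulrAC mulfV // mul1r.
    by rewrite [RHS]/pole_at expr0 divr1 E3.
  have := xsE 0 (k.+1 + n); rewrite add0n -/s Es -[RHS]mul1r => /(mulIf (xs_neq0 0)) /(congr1 (@nm R)).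
  rewrite nmX nm1 => E3; have : nm q ^+ (k.+1 + n) < 1 by rewrite exprn_ilt1 ?nm_ge0.
  by rewrite E3 ltxx.
eexists; apply: (reg_mulI b0); rewrite E -mulN1r.
apply: regM; first by rewrite -(rmorph1 (@pp C)) -rmorphN; apply: reg_pp.
apply: reg_sum => i; apply: regM; first exact: reg_pp.
by apply: reg_sc; rewrite ?expf_neq0 //; apply: Hy.
Qed.

Lemma f_reg_all k : (0 < n)%N -> (forall i, (i < n)%N -> exists y, reg f (xs (k.+1 + i)) y) ->
  forall j, (k < j)%N -> exists y, reg f (xs j) y.
Proof.
move=> n0 H; have P j : forall i, (i < n)%N -> exists y, reg f (xs (k.+1 + j + i)) y.
  elim: j => [|j IH] i iN; first by rewrite addn0; apply: H.
  case: (ltnP i.+1 n) => h.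
    have -> : (k.+1 + j.+1 + i = k.+1 + j + i.+1)%N by lia.
    exact: IH.
  have -> : (k.+1 + j.+1 + i = (k + j).+1 + n)%N by lia.
  by apply: f_reg_next => i' i'n; have := IH i' i'n; rewrite addSn.
move=> j kj; have := P (j - k.+1)%N 0%N n0.
by rewrite addn0 subnKC.
Qed.

Lemma cv_lin_inv F s r : s != 0 -> 0 <= r -> r < nm s -> cv (pp (1 - s^-1 *: 'X) * F) r -> cv F r.
Proof.
move=> s0 r0 rs c; pose G : ps C := fun m => s ^- m.
have bG : bnd G (nm s) 1.
  by move=> m; rewrite /G nmV nmX mulVf // expf_neq0 // gt_eqF // nm_gt0.
have E : pp (1 - s^-1 *: 'X) * G = 1.
  apply: psP => m; rewrite rmorphB rmorph1 /= mulrBl mul1r psB.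
  have -> : pp (s^-1 *: 'X) = pp (s^-1)%:P * psX C ^+ 1 by rewrite -rmorphM /= mul_polyC.
  rewrite -mulrA psCM psXnM ps1; case: m => [|m] /=; first by rewrite mulr0 subr0 /G expr0 invr1.
  by rewrite subn1 /= /G exprS invfM subrr.
have -> : F = G * (pp (1 - s^-1 *: 'X) * F) by rewrite mulrA [G * _]mulrC E mul1r.
by apply: cvM => //; exists (nm s), 1.
Qed.

(** The roots of the multiplier are removed one by one: a root outside the disc by a geometric
    series, a root inside because the product vanishes there, [F] being regular. *)
Lemma cv_divide T F r : 0 <= r -> T.[0] != 0 -> cv (pp T * F) r ->
  (forall s, nm s <= r -> exists y, reg F s y) -> cv F r.
Proof.
move=> r0; have [m] := ubnP (size T); elim: m T => // m IH T sT T0 cT rF.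
have [sT1|sT1] := boolP (size T == 1%N).
  have /size_poly1P [c c0 Tc] := sT1.
  have -> : F = pp (c^-1)%:P * (pp T * F).
    by rewrite mulrA -rmorphM /= Tc -polyCM mulVf // rmorph1 mul1r.
  by apply: cvM => //; exact: cv_pp.
have /closed_rootP [s rs] := sT1.
have s0 : s != 0 by apply: contraNneq T0 => sE; have := rs; rewrite sE.
have [Q TQ] : exists Q, T = (1 - s^-1 *: 'X) * Q.
  have /factor_theorem [Q TQ] := rs.
  exists (- s *: Q); rewrite [RHS]mulrC TQ -!scalerAl; rewrite scalerAr; congr (_ * _).
  rewrite scalerBr scalerA mulNr mulfV // scaleN1r opprK alg_polyC rmorphN /= addrC.
  by [].
have Tn0 : T != 0 by apply: contraNneq T0 => ->; rewrite horner0.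
have Q0 : Q.[0] != 0 by apply: contraNneq T0 => Q0; rewrite TQ hornerM Q0 mulr0.
apply: (IH Q) => //.
  have Qn0 : Q != 0 by apply: contraNneq Tn0 => Q00; rewrite TQ Q00 mulr0.
  have si0 : s^-1 != 0 by rewrite invr_eq0.
  by move: sT; rewrite TQ size_mul ?lin_neq0 // (lin_size si0) add2n /= ltnS.
case: (ltP r (nm s)) => rs'.
  by apply: (cv_lin_inv s0) => //; rewrite mulrA -rmorphM -TQ.
have [y Hy] := rF s rs'.
have cs := cv_le rs' cT.
have Es : ev (pp T * F) s = 0.
  rewrite (reg_ev cs (regM (reg_pp T s) Hy)).
  by move/rootP: rs => ->; rewrite mul0r.
have [r' [M [rr b]]] := cT.
have sr' : nm s < r' by apply: le_lt_trans rr.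
have [G [M' [bG EG]]] := ev_div s0 sr' b Es.
have -> : pp Q * F = G; last by exists r', M'.
have L0 : pp (1 - s^-1 *: 'X : {poly C}) != 0 by rewrite pp_eq0 lin_neq0.
by apply: (mulfI L0); rewrite -EG TQ rmorphM /= mulrA.
Qed.

(** The multiplier that removes the first [k] poles makes [f] entire, and [entire_mul_rational]
    applies. *)
Lemma f_rational_of_reg k : (forall j, (k <= j)%N -> exists y, reg f (xs j) y) -> fps_rational f.
Proof.
move=> H; have [T [T0 rT cT]] := mero_multiplier k.
apply: (entire_mul_rational Hf q1 T0 hyp_ratio_tends); first by rewrite mulf_neq0 ?invr_eq0.
have regF s : exists y, reg (pp T * f) s y.
  case: (pselect (exists j, s = xs j)) => [[j sj]|ns].
    case: (leqP k j) => kj.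
      have [y Hy] := H j kj; exists (T.[s] * y); rewrite sj.
      by apply: regM => //; apply: reg_pp.
    exists (ev (pp T * f) s); apply: reg_cv; apply: cT; first exact: nm_ge0.
    rewrite sj; apply: lt_le_trans (xs_mono kj).
    by rewrite -(xsE j 1) addn1 expr1 nmM -[X in _ < X]mul1r ltr_pM2r // nm_gt0 xs_neq0.
  have [|y Hy] := @f_reg_off s; first by move=> j; apply/eqP => E; apply: ns; exists j.
  by exists (T.[s] * y); apply: regM => //; apply: reg_pp.
move=> r; apply: (@cv_le _ _ (`|r|)); first exact: ler_norm.
have r0 := normr_ge0 r.
have [K HK] := xs_big `|r|.
have [T2 [T20 rT2 cT2]] := mero_multiplier K.
apply: (cv_divide (T := T2)) => //.
  by apply/eqP => /rootP /rT2 [j /esym /eqP]; rewrite (negbTE (xs_neq0 j)).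
rewrite mulrCA; apply: cvM => //; [exact: cv_pp | exact: cT2].
Qed.

End Poles.

(** * Finite generation of modules over a polynomial ring *)

Section Noether.
Variables (F : fieldType) (I : eqType).
Local Notation V := (I -> {poly F}).

Definition submod (L : V -> Prop) :=
  [/\ L (fun=> 0), (forall u v, L u -> L v -> L (fun i => u i + v i)) &
      (forall (p : {poly F}) u, L u -> L (fun i => p * u i))].

(* Finite generation, phrased as: every submodule that contains [gs] contains [L]. *)
Lemma submod_fg (r : seq I) (L : V -> Prop) : submod L -> (forall u, L u -> forall i, i \notin r -> u i = 0) ->
  exists gs : seq V, (forall P : V -> Prop, submod P -> (forall k, (k < size gs)%N -> P (nth (fun=> 0) gs k)) ->
     forall u, L u -> P u) /\ (forall k, (k < size gs)%N -> L (nth (fun=> 0) gs k)).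
Proof.
elim: r L => [|i r IH] L [L0 LD LM] supp.
  exists [::]; split=> // P [P0 _ _] _ u Lu.
  by have -> : u = (fun=> 0) by apply/funext => i; apply: supp.
pose L' u := L u /\ u i = 0.
have sL' : submod L'.
  split; first by split.
    by move=> u v [Lu ui] [Lv vi]; split; [exact: LD | rewrite ui vi addr0].
  by move=> p u [Lu ui]; split; [exact: LM | rewrite ui mulr0].
have [|gs [Hgs Lgs]] := IH L' sL'.
  move=> u [Lu ui] j jr; have [->//|ji] := eqVneq j i.
  by apply: supp => //; rewrite inE negb_or ji.
case: (pselect (exists u, L u /\ u i != 0)) => [Hex|Hn]; last first.
  exists gs; split=> [P sP Pg u Lu|k /Lgs []//].
  apply: Hgs => //; split=> //; apply/eqP/negPn/negP => ui.
  by apply: Hn; exists u.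
(* A coordinate of least degree: division with remainder by it clears this coordinate in every other
   element of [L]. *)
have [v [[Lv vi] vmin]] : exists v, (L v /\ v i != 0) /\ forall u, L u -> u i != 0 ->
  (size (v i) <= size (u i))%N.
  have : exists m, `[< exists u, (L u /\ u i != 0) /\ (size (u i) <= m)%N >].
    by have [u Hu] := Hex; exists (size (u i)); apply/asboolP; exists u.
  move=> Hm; case: (ex_minnP Hm) => m /asboolP [v [Hv sv]] mmin.
  exists v; split=> // u Lu ui; apply: leq_trans sv _; apply: mmin.
  by apply/asboolP; exists u.
exists (v :: gs); split; last by move=> [|k] //= /Lgs [].
move=> P sP Pg u Lu; have [P0 PD PM] := sP.
pose w : V := fun j => u j + (- (u i %/ v i)) * v j.
have Lw : L w by apply: LD => //; apply: LM.
have wi : w i = 0.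
  apply/eqP/negPn/negP => wi0; have := vmin w Lw wi0; rewrite leqNgt.
  have -> : w i = u i %% v i by rewrite /w {1}(divp_eq (u i) (v i)) mulNr addrAC subrr add0r.
  by rewrite ltn_modp vi.
have Pw : P w by apply: (Hgs P sP) => // k kg; apply: (Pg k.+1).
have -> : u = (fun j => w j + (u i %/ v i) * v j).
  by apply/funext => j; rewrite /w mulNr subrK.
by apply: PD => //; apply: PM; apply: (Pg 0%N).
Qed.
End Noether.

(** * An identity theorem on a spiral going to infinity *)

Section Spiral.
Variable R : realType.
Local Notation C := R[i].
Implicit Types (F G : ps C) (s : C).
Variables (q s0 : C).
Hypotheses (q0 : q != 0) (q1 : nm q < 1) (s0n : s0 != 0).

Definition pt (k : int) : C := s0 / q ^ k.
Lemma pt_neq0 k : pt k != 0. Proof. by rewrite /pt mulf_neq0 // invr_eq0 expfz_neq0. Qed.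
Lemma ptE k : q * pt k = pt (k - 1).
Proof. by rewrite /pt expfzDr // exprN1 invfM invrK; ring. Qed.

(* [F] lies in a finite module, stable under [x |-> q * x], of functions regular along the spiral [pt]. *)
Definition spi F := exists (I : finType) (G : I -> ps C) (d : {poly C}) (D : I -> I -> {poly C})
  (c : I -> {poly C}) (w : I -> int -> C),
  [/\ forall i, cv (G i) 0, forall k, d.[pt k] != 0, forall i k, reg (G i) (pt k) (w i k),
      forall i, pp d * sc q (G i) = \sum_j pp (D i j) * G j & F = \sum_i pp (c i) * G i].

Lemma spi_pp (p : {poly C}) : spi (pp p).
Proof.
exists unit, (fun=> 1), 1, (fun _ _ => 1), (fun=> p), (fun _ _ => 1); split.
- by move=> _; apply: cv_1.
- by move=> k; rewrite hornerE oner_neq0.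
- by move=> _ k; have := reg_pp (1 : {poly C}) (pt k); rewrite rmorph1 hornerE.
- move=> _; rewrite rmorph1 mul1r big_const card_unit /= mul1r addr0; exact: rmorph1.
- by rewrite big_const card_unit /= mulr1 addr0.
Qed.

Lemma spiD F F' : spi F -> spi F' -> spi (F + F').
Proof.
move=> [I [G [d [D [c [w [Gc d0 rG E EF]]]]]]] [I' [G' [d' [D' [c' [w' [Gc' d0' rG' E' EF']]]]]]].
exists (I + I')%type, (fun i => match i with inl i => G i | inr i => G' i end), (d * d'),
  (fun i j => match i, j with inl i, inl j => d' * D i j | inr i, inr j => d * D' i j | _, _ => 0 end),
  (fun i => match i with inl i => c i | inr i => c' i end),
  (fun i => match i with inl i => w i | inr i => w' i end); split.
- by case.
- by move=> k; rewrite hornerM mulf_neq0.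
- by case.
- case=> i; rewrite big_sumType /= rmorphM /=.
    rewrite [X in _ + X]big1 ?addr0; last by move=> j _; rewrite rmorph0 mul0r.
    rewrite mulrAC E mulrC big_distrr; apply: eq_bigr => j _; by rewrite rmorphM /= mulrA.
  rewrite [X in X + _]big1 ?add0r; last by move=> j _; rewrite rmorph0 mul0r.
  rewrite -mulrA E' big_distrr; apply: eq_bigr => j _; by rewrite rmorphM /= mulrA.
by rewrite big_sumType /= EF EF'.
Qed.

Lemma spiM F F' : spi F -> spi F' -> spi (F * F').
Proof.
move=> [I [G [d [D [c [w [Gc d0 rG E EF]]]]]]] [I' [G' [d' [D' [c' [w' [Gc' d0' rG' E' EF']]]]]]].
exists (I * I')%type, (fun i => G i.1 * G' i.2), (d * d'),
  (fun i j => D i.1 j.1 * D' i.2 j.2), (fun i => c i.1 * c' i.2), (fun i k => w i.1 k * w' i.2 k); split.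
- by move=> i; apply: cvM.
- by move=> k; rewrite hornerM mulf_neq0.
- by move=> i k; apply: regM.
- move=> [i i'] /=; rewrite !rmorphM /= mulrACA E E' big_distrl /=.
  rewrite (eq_bigr (fun j => \sum_j' (pp (D i j) * G j) * (pp (D' i' j') * G' j'))); last by move=> j _;
    rewrite big_distrr.
  by rewrite pair_big /=; apply: eq_bigr => j _; rewrite rmorphM /= mulrACA.
rewrite EF EF' big_distrl /=.
rewrite (eq_bigr (fun j => \sum_j' (pp (c j) * G j) * (pp (c' j') * G' j'))); last by move=> j _;
  rewrite big_distrr.
by rewrite pair_big /=; apply: eq_bigr => j _; rewrite rmorphM /= mulrACA.
Qed.

Lemma spi_sc F : spi F -> spi (sc q F).
Proof.
move=> [I [G [d [D [c [w [Gc d0 rG E EF]]]]]]].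
exists I, (fun i => sc q (G i)), (d \Po (q *: 'X)), (fun i j => D i j \Po (q *: 'X)),
  (fun i => c i \Po (q *: 'X)), (fun i k => w i (k - 1)); split.
- by move=> i; apply: cv_sc => //; rewrite mulr0.
- by move=> k; rewrite horner_scX ptE.
- by move=> i k; apply: reg_sc => //; rewrite ptE.
- move=> i; rewrite -sc_pp -rmorphM E rmorph_sum; apply: eq_bigr => j _.
  by rewrite rmorphM /= sc_pp.
by rewrite EF rmorph_sum; apply: eq_bigr => j _; rewrite rmorphM /= sc_pp.
Qed.

(** Zeros far out do not accumulate, so vanishing has to be carried inwards. The combinations of the
    generators that vanish at all far points form a submodule; finite generation provides one bound
    [K0] for all of them, and stability under x -> qx then carries the vanishing from [pt k] to
    [pt (k - 1)], down to the origin. *)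
Lemma spi_identity F : spi F -> (exists K : int, forall k, K <= k -> reg F (pt k) 0) -> F = 0.
Proof.
move=> [I [G [d [D [c [w [Gc d0 rG E EF]]]]]]] [K HK].
have val (u : I -> {poly C}) k : reg (\sum_i pp (u i) * G i) (pt k) (\sum_i (u i).[pt k] * w i k).
  by apply: reg_sum => i; apply: regM => //; apply: reg_pp.
pose van k (u : I -> {poly C}) := \sum_i (u i).[pt k] * w i k = 0.
pose L u := exists K : int, forall k, K <= k -> van k u.
have vsub k : submod (van k).
  split.
  - by rewrite /van big1 // => i _; rewrite horner0 mul0r.
  - move=> u v; rewrite /van => hu hv.
    under eq_bigr do rewrite hornerD mulrDl.
    by rewrite big_split /= hu hv addr0.
  - move=> p u; rewrite /van => hu.
    under eq_bigr do rewrite hornerM -mulrA.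
    by rewrite -big_distrr /= hu mulr0.
have sL : submod L.
  split.
  - by exists 0 => k _; have [] := vsub k.
  - move=> u v [K1 H1] [K2 H2]; exists (Num.max K1 K2) => k; rewrite ge_max => /andP[h1 h2].
    by have [_ vD _] := vsub k; apply: vD; [exact: H1 | exact: H2].
  - by move=> p u [K1 H1]; exists K1 => k h1; have [_ _ vM] := vsub k; apply: vM; exact: H1.
have [|gs [Hgs Lgs]] := submod_fg (r := enum I) sL; first by move=> u _ i; rewrite mem_enum.
have [K0 HK0] : exists K0 : int, forall j, (j < size gs)%N -> forall k, K0 <= k -> van k (nth (fun=> 0) gs j).
  elim: gs Lgs {Hgs} => [|g gs IH] Lgs; first by exists 0.
  have [|K1 H1] := IH; first by move=> j jg; apply: (Lgs j.+1).
  have [K2 H2] := Lgs 0%N isT; exists (Num.max K1 K2) => -[|j] /= jg k; rewrite ge_max => /andP[h1 h2].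
    exact: H2.
  exact: H1.
have step k : (forall u, L u -> van k u) -> forall u, L u -> van (k - 1) u.
  move=> Vk u [K1 H1].
  (* [u'] holds the coordinates of [d] times the dilation of [u]. It lies in [L] again, and [d] has
     no zero on the spiral. *)
  pose u' j : {poly C} := \sum_i (u i \Po (q *: 'X)) * D i j.
  have Eu m : \sum_j (u' j).[pt m] * w j m = d.[pt m] * \sum_i (u i).[pt (m - 1)] * w i (m - 1).
    have Ei i : \sum_j (D i j).[pt m] * w j m = d.[pt m] * w i (m - 1).
      apply: (reg_unique (val (D i) m)); rewrite -E; apply: regM; first exact: reg_pp.
      by apply: reg_sc => //; rewrite ptE.
    rewrite big_distrr /= (eq_bigr (fun j => \sum_i (u i).[pt (m - 1)] * ((D i j).[pt m] * w j m))); last first.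
      move=> j _; rewrite horner_sum big_distrl; apply: eq_bigr => i _ /=.
      by rewrite hornerM horner_scX ptE mulrA.
    rewrite exchange_big /=; apply: eq_bigr => i _.
    by rewrite -big_distrr /= Ei; ring.
  have Lu' : L u'.
    by exists (K1 + 1) => m h; rewrite /van Eu [X in _ * X]H1 ?mulr0 //; lia.
  by have /eqP := Vk u' Lu'; rewrite /van Eu mulf_eq0 (negbTE (d0 k)) /= => /eqP.
have base u : L u -> van K0 u.
  by move=> Lu; apply: (Hgs _ (vsub K0)) => // j jg; apply: HK0.
have all m : forall u, L u -> van (K0 - m%:Z) u.
  elim: m => [|m IH]; first by rewrite subr0.
  by have := step _ IH; have -> : K0 - m%:Z - 1 = K0 - m.+1%:Z by lia.
have Lc : L c.
  exists K => k /HK h; rewrite /van; apply: (reg_unique (val c k)); by rewrite -EF.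
have cF : cv F 0 by rewrite EF; apply: cv_sum => // i _; apply: cvM => //; exact: cv_pp.
have ptm m : pt (K0 - m%:Z) = pt K0 * q ^+ m.
  by rewrite /pt expfzDr // -exprnN invfM invrK mulrA.
have q0l : tends (fun m => pt (K0 - m%:Z)) 0.
  apply: (@tends_ext _ (fun m => pt K0 * q ^+ m)); last by move=> m; rewrite ptm.
  by rewrite -[X in tends _ X](mulr0 (pt K0)); apply: flimM; [exact: flim_cst | exact: tends_expr].
apply: (ev_identity cF q0l); first by move=> m; exact: pt_neq0.
have [r [M [r0 b]]] := cF; have /tendsP := q0l => /(_ r r0) [N HN]; exists N => m Nm.
apply: (@reg_ev _ F); first by exists r, M; split=> //; have := HN m Nm; rewrite subr0.
have h := val c (K0 - m%:Z); rewrite -EF in h.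
by rewrite -(all m c Lc).
Qed.

End Spiral.

(** * Linear dependence and transcendence degree *)

Section Closed.
Variables (A : idomainType) (X : A -> Prop).
Hypotheses (X1 : X 1) (XB : forall a b, X a -> X b -> X (a - b)) (XM : forall a b, X a -> X b -> X (a * b)).

Lemma closed0 : X 0. Proof. by rewrite -(subrr 1); exact: XB. Qed.
Lemma closedN a : X a -> X (- a). Proof. by move=> h; rewrite -sub0r; apply: XB => //; exact: closed0. Qed.
Lemma closedD a b : X a -> X b -> X (a + b).
Proof. by move=> ha hb; rewrite -[b]opprK; apply: XB => //; exact: closedN. Qed.
Lemma closedX a n : X a -> X (a ^+ n).
Proof. by move=> h; elim: n => [|n IH]; rewrite ?expr0 // exprS; exact: XM. Qed.
Lemma closed_sum (I : Type) (r : seq I) (F : I -> A) : (forall i, X (F i)) -> X (\sum_(i <- r) F i).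
Proof. by move=> H; elim: r => [|i r IH]; rewrite ?big_nil ?big_cons; [exact: closed0 | exact: closedD]. Qed.
Lemma closed_nat n : X n%:R.
Proof. by elim: n => [|n IH]; [exact: closed0 | rewrite -addn1 natrD; exact: closedD]. Qed.

(** Gaussian elimination by cross-multiplication: without divisions the solution stays in the
    subring [X]. *)
Lemma lindep_in n m (M : nat -> nat -> A) : (n < m)%N -> (forall i j, X (M i j)) ->
  exists c : nat -> A, [/\ forall i, X (c i), exists2 i, (i < m)%N & c i != 0 &
    forall j, (j < n)%N -> \sum_(i < m) c i * M i j = 0].
Proof.
elim: n m M => [|n IH] m M nm XMij.
  by exists (fun=> 1); split=> //; exists 0%N => //; exact: oner_neq0.
case: (pselect (exists i0 : 'I_m, M i0 n != 0)) => [[i0 p0]|Hn]; last first.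
  have [c [Xc c0 Hc]] := IH m M (ltnW nm) XMij; exists c; split=> // j;
    rewrite ltnS leq_eqVlt => /orP[/eqP ->|]; last exact: Hc.
  by apply: big1 => i _; have [->|h] := eqVneq (M i n) 0; [rewrite mulr0 | case: Hn; exists i].
case: m nm i0 p0 => // m nm i0 p0.
pose b := bump i0; pose M' i j := M i0 n * M (b i) j - M (b i) n * M i0 j.
have [|c' [Xc' [i1 i1m ci1] Hc]] := IH m M' nm; first by move=> i j; apply: XB; apply: XM.
pose S := \sum_(i < m) c' i * M (b i) n.
exists (fun k => if k == i0 :> nat then - S else M i0 n * c' (unbump i0 k)); split.
- move=> i; case: eqP => _; last exact: XM.
  by apply: closedN; apply: closed_sum => j; exact: XM.
- exists (b i1); first by rewrite /b /bump; case: (i0 <= i1)%N => /=; lia.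
  have -> : (b i1 == i0) = false by rewrite eq_sym; apply/negbTE/neq_bump.
  by rewrite /b bumpK mulf_neq0.
have E j : \sum_(i < m.+1) (if i == i0 :> nat then - S else M i0 n * c' (unbump i0 i)) * M i j =
    - S * M i0 j + \sum_(i < m) M i0 n * c' i * M (b i) j.
  rewrite (bigD1_ord i0) //= eqxx; congr (_ + _); apply: eq_bigr => i _.
  by rewrite /= eq_sym (negbTE (neq_bump _ _)) bumpK.
move=> j; rewrite ltnS leq_eqVlt E => /orP[/eqP ->|jn].
  rewrite /S mulNr mulr_suml -sumrN -big_split big1 // => i _ /=; ring.
rewrite /S mulNr mulr_suml -sumrN -big_split -[RHS](Hc j jn); apply: eq_bigr => i _.
by rewrite /M' /=; ring.
Qed.
End Closed.

Lemma lindep (A : idomainType) n m (M : nat -> nat -> A) : (n < m)%N ->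
  exists c : nat -> A, (exists2 i, (i < m)%N & c i != 0) /\
    forall j, (j < n)%N -> \sum_(i < m) c i * M i j = 0.
Proof.
move=> nm; have [|c [_ h1 h2]] := @lindep_in A (fun=> True) I (fun _ _ _ _ => I) (fun _ _ _ _ => I) n m M nm;
  first by [].
by exists c.
Qed.

Section Trdeg.
Variable F : fieldType.
Local Notation ps := (ps F).
Implicit Types (u v w : ps).

(** Exponent vectors of length [m] with all entries below [D]. Bounding each exponent separately
    makes their number exactly [D ^ m]. *)
Fixpoint MI D m : finType := if m is m'.+1 then ('I_D * MI D m')%type : finType else unit.
Fixpoint mon D m : (nat -> ps) -> MI D m -> ps :=
  match m with 0 => fun _ _ => 1 | m'.+1 => fun y a => y 0%N ^+ a.1 * mon (fun j => y j.+1) a.2 end.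

Lemma card_MI D m : #|MI D m| = (D ^ m)%N.
Proof. by elim: m => [|m IH]; rewrite ?card_unit // card_prod IH card_ord expnS. Qed.

Definition sp (I : finType) (w : I -> ps) (h : ps) := exists p : I -> {poly F}, h = \sum_i pp (p i) * w i.

Section Sp.
Variables (I : finType) (w : I -> ps).
Lemma sp0 : sp w 0.
Proof. by exists (fun=> 0); rewrite big1 // => i _; rewrite rmorph0 mul0r. Qed.
Lemma spD' h h' : sp w h -> sp w h' -> sp w (h + h').
Proof.
move=> [p ->] [p' ->]; exists (fun i => p i + p' i); rewrite -big_split.
by apply: eq_bigr => i _; rewrite rmorphD mulrDl.
Qed.
Lemma spZ p h : sp w h -> sp w (pp p * h).
Proof. by move=> [q ->]; exists (fun i => p * q i); rewrite big_distrr /=; apply: eq_bigr => i _;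
  rewrite rmorphM mulrA. Qed.
Lemma spN h : sp w h -> sp w (- h).
Proof. by move=> /(spZ (-1)); rewrite rmorphN rmorph1 mulN1r. Qed.
Lemma sp_in i : sp w (w i).
Proof.
exists (fun j => (j == i)%:R); rewrite (bigD1 i) //= eqxx rmorph1 mul1r big1 ?addr0 // => j /negbTE ->.
by rewrite rmorph0 mul0r.
Qed.
Lemma sp_sum (J : Type) (r : seq J) (h : J -> ps) : (forall j, sp w (h j)) -> sp w (\sum_(j <- r) h j).
Proof. by move=> H; elim/big_ind: _ => //; [exact: sp0 | exact: spD']. Qed.
Lemma sp_trans (J : finType) (v : J -> ps) h : (forall j, sp w (v j)) -> sp v h -> sp w h.
Proof. by move=> H [p ->]; apply: sp_sum => j; apply: spZ. Qed.
End Sp.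
Lemma sp_mul (I J K : finType) (w : K -> ps) (u : I -> ps) (v : J -> ps) h h' :
  (forall i j, sp w (u i * v j)) -> sp u h -> sp v h' -> sp w (h * h').
Proof.
move=> H [p ->] [p' ->]; rewrite big_distrl; apply: sp_sum => i /=.
rewrite big_distrr; apply: sp_sum => j /=; rewrite mulrACA -rmorphM; exact: spZ.
Qed.

Lemma mon_mul E E' m (y : nat -> ps) (a : MI E.+1 m) (b : MI E'.+1 m) : exists c : MI (E + E').+1 m,
  mon y a * mon y b = mon y c.
Proof.
elim: m y a b => [|m IH] y a b; first by exists tt; rewrite /= mulr1.
case: a b => [i a] [j b]; have [c Hc] := IH (fun j => y j.+1) a b.
have ij : (i + j < (E + E').+1)%N by have := ltn_ord i; have := ltn_ord j; lia.
by exists (Ordinal ij, c); rewrite /= -Hc exprD mulrACA.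
Qed.
Lemma sp_monM E E' m (y : nat -> ps) h h' :
  sp (@mon E.+1 m y) h -> sp (@mon E'.+1 m y) h' -> sp (@mon (E + E').+1 m y) (h * h').
Proof. by apply: sp_mul => a b; have [c ->] := mon_mul y a b; exact: sp_in. Qed.
Lemma sp_mon1 E m (y : nat -> ps) : sp (@mon E.+1 m y) 1.
Proof.
suff [a <-] : exists a, @mon E.+1 m y a = 1 by exact: sp_in.
elim: m y => [|m IH] y; first by exists tt.
by have [a Ha] := IH (fun j => y j.+1); exists (ord0, a); rewrite /= Ha mulr1.
Qed.
Lemma sp_monW E E' m (y : nat -> ps) h : (E <= E')%N -> sp (@mon E.+1 m y) h -> sp (@mon E'.+1 m y) h.
Proof. by move=> EE /sp_monM /(_ (sp_mon1 (E' - E) m y)); rewrite mulr1 subnKC. Qed.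
Lemma sp_mon_var m (y : nat -> ps) i : (i < m)%N -> sp (@mon 2 m y) (y i).
Proof.
move=> im; suff [a <-] : exists a, @mon 2 m y a = y i by exact: sp_in.
elim: m i y im => // m IH [|i] y im.
  have [a Ha] : exists a, @mon 2 m (fun j => y j.+1) a = 1.
    elim: m {IH im} (fun j => y j.+1) => [|m IH] z; first by exists tt.
    by have [a Ha] := IH (fun j => z j.+1); exists (ord0, a); rewrite /= Ha mulr1.
  by exists (ord_max, a); rewrite /= Ha mulr1 expr1.
by have [a Ha] := IH i (fun j => y j.+1) im; exists (ord0, a); rewrite /= Ha mul1r.
Qed.
Lemma sp_monX E m (y : nat -> ps) h k : sp (@mon E.+1 m y) h -> sp (@mon (k * E).+1 m y) (h ^+ k).
Proof. by move=> H; elim: k => [|k IH]; [apply: sp_mon1 | rewrite exprS mulSn; apply: sp_monM]. Qed.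

(** Each use of the relation costs one factor [c d] and degree [E] in the coefficients. This growth
    is linear in [s], on which the dimension count below depends. *)
Lemma alg_reduce n E d (g : nat -> ps) (c : nat -> ps) y : (0 < d)%N ->
  (forall i, sp (@mon E.+1 n g) (c i)) -> \sum_(i < d.+1) c i * y ^+ i = 0 ->
  forall s, exists w : nat -> ps, (forall i, sp (@mon (s * E).+1 n g) (w i)) /\
    c d ^+ s * y ^+ s = \sum_(i < d) w i * y ^+ i.
Proof.
case: d => // d _ Hc E0; elim=> [|s [w [Hw Ew]]].
  exists (fun i => (i == 0%N)%:R); split.
    by case=> [|i]; [apply: sp_mon1 | apply: sp0].
  by rewrite big_ord_recl /= mulr1 big1 ?addr0 // => i _; rewrite mul0r.
exists (fun i => (if i is i'.+1 then w i' * c d.+1 else 0) - w d * c i); split.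
  have h F1 F2 : sp (@mon (s * E).+1 n g) F1 -> sp (@mon E.+1 n g) F2 -> sp (@mon (s.+1 * E).+1 n g) (F1 * F2).
    by move=> h1 h2; rewrite mulSn addnC; apply: sp_monM.
  move=> i; apply: spD'; last by apply/spN/h.
  by case: i => [|i]; [exact: sp0 | apply: h].
rewrite !exprSr mulrACA Ew big_ord_recr /= mulrDl.
have -> : w d * y ^+ d * (c d.+1 * y) = - \sum_(i < d.+1) w d * c i * y ^+ i.
  have -> : w d * y ^+ d * (c d.+1 * y) = w d * (c d.+1 * y ^+ d.+1) by rewrite exprSr; ring.
  move: E0; rewrite big_ord_recr /= addrC => /eqP; rewrite addr_eq0 => /eqP ->.
  by rewrite mulrN big_distrr /=; congr (- _); apply: eq_bigr => i _; rewrite mulrA.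
under [RHS]eq_bigr do rewrite mulrBl.
rewrite sumrB; congr (_ - _); rewrite big_ord_recl /= mul0r add0r big_distrl.
by apply: eq_bigr => i _ /=; rewrite /bump /= add1n exprSr; ring.
Qed.

Definition alg_rel n E d (g : nat -> ps) y := exists c : nat -> ps,
  [/\ forall i, sp (@mon E.+1 n g) (c i), c d != 0 & \sum_(i < d.+1) c i * y ^+ i = 0].

(** The variables are reduced one after the other; [P] collects the top coefficients, each to the
    power [D], so that it serves all monomials at once. *)
Lemma mon_reduce n E d (g y : nat -> ps) D m : (0 < d)%N -> (forall j, alg_rel n E d g (y j)) ->
  exists P, P != 0 /\ forall a, sp (fun x : MI (m * (D * E)).+1 n * MI d m =>
    mon g x.1 * mon y x.2) (P * @mon D.+1 m y a).
Proof.
move=> d0; elim: m y => [|m IH] y H.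
  exists 1; split; first exact: oner_neq0.
  move=> a; rewrite /= mulr1; apply: (sp_trans _ (sp_mon1 0 n g)) => j.
  by have := sp_in (fun x : MI 1 n * unit => mon g x.1 * 1) (j, tt); rewrite mulr1.
have [P [P0 HP]] := IH (fun j => y j.+1) (fun j => H j.+1).
have [c [Hc c0 Ec]] := H 0%N; exists (c d ^+ D * P); split; first by rewrite mulf_neq0 // expf_neq0.
move=> [k a] /=; have kD : (k <= D)%N by rewrite -ltnS.
have [w [Hw Ew]] := alg_reduce d0 Hc Ec k.
have E2 : c d ^+ D * P * (y 0%N ^+ k * mon (fun j => y j.+1) a) =
    \sum_(i < d) (w i * c d ^+ (D - k)) * (y 0%N ^+ i * (P * mon (fun j => y j.+1) a)).
  rewrite (eq_bigr (fun i : 'I_d => (w i * y 0%N ^+ i) * (c d ^+ (D - k) * (P * mon (fun j => y j.+1) a))));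
    last first.
    by move=> i _; ring.
  by rewrite -big_distrl -Ew /= -{1}(subnKC kD) exprD; ring.
rewrite E2; apply: sp_sum => i; have [p ->] := HP a.
rewrite !big_distrr /=; apply: sp_sum => -[x b] /=.
have h : sp (@mon (D * E).+1 n g) (w i * c d ^+ (D - k)).
  by have := sp_monM (Hw i) (sp_monX (D - k) (Hc d)); rewrite -mulnDl subnKC.
have := sp_monM h (sp_in (@mon (m * (D * E)).+1 n g) x); rewrite -mulSn => h2.
have -> : w i * c d ^+ (D - k) * (y 0%N ^+ i * (pp (p (x, b)) * (mon g x * mon (fun j => y j.+1) b))) =
   pp (p (x, b)) * ((w i * c d ^+ (D - k) * mon g x) * (y 0%N ^+ i * mon (fun j => y j.+1) b)) by ring.
apply: spZ; have [p2 ->] := h2; rewrite big_distrl; apply: sp_sum => z /=.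
rewrite -mulrA; apply: spZ.
exact: (sp_in (fun x : MI (m.+1 * (D * E)).+1 n * MI d m.+1 => mon g x.1 * mon y x.2) (z, (i, b))).
Qed.

Lemma sp_dep (I J : finType) (w : J -> ps) (h : I -> ps) : (#|J| < #|I|)%N -> (forall i, sp w (h i)) ->
  exists p : I -> {poly F}, (exists i, p i != 0) /\ \sum_i pp (p i) * h i = 0.
Proof.
move=> IJ /boolp.choice [M HM].
pose M' i j := if (insub i, insub j) is (Some i,
  Some j) then M (enum_val (i : 'I_#|I|)) (enum_val (j : 'I_#|J|)) else 0.
have [c [[i0 i0I ci0] Hc]] := lindep M' IJ.
exists (fun i => c (enum_rank i)); split.
  by exists (enum_val (Ordinal i0I)); rewrite enum_valK.
under eq_bigr do rewrite HM big_distrr /=.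
rewrite exchange_big big1 //= => j _.
transitivity (pp (\sum_(i < #|I|) c i * M' i (enum_rank j)) * w j); last by rewrite Hc // rmorph0 mul0r.
rewrite rmorph_sum big_distrl (reindex_onto (fun i : 'I_#|I| => enum_val i) enum_rank) /=; last by move=> i _;
  rewrite enum_rankK.
apply: eq_big => [i|i _]; first by rewrite enum_valK eqxx.
by rewrite enum_valK rmorphM mulrA /M' !valK enum_rankK.
Qed.

(** Transcendence degree by counting: the [D.+1 ^ n.+1] monomials in [n.+1] of the [y] reduce to a
    space whose dimension grows only like [D ^ n]. *)
Lemma trdeg_dep n E d (g y : nat -> ps) : (forall j, alg_rel n E d g (y j)) ->
  exists D m (p : MI D m -> {poly F}), (exists a, p a != 0) /\ \sum_a pp (p a) * mon y a = 0.
Proof.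
move=> H; have d0 : (0 < d)%N.
  case: d H => // H; have [c [_ c0]] := H 0%N.
  by rewrite big_ord1 expr0 mulr1 => c0'; rewrite c0' eqxx in c0.
(* [K] gives [(n.+1 * (D * E)).+1 <= D.+1 * K], so the dimension is at most [D.+1 ^ n * D], less
   than the number of monomials. *)
pose K := (n.+1 * E).+1; pose D := (K ^ n * d ^ n.+1)%N.
have [P [P0 HP]] := mon_reduce D n.+1 d0 H.
have [|p [Hp Ep]] := sp_dep _ HP.
  rewrite card_prod !card_MI.
  have h : ((n.+1 * (D * E)).+1 <= D.+1 * K)%N by rewrite /K; nia.
  have h1 : (((n.+1 * (D * E)).+1) ^ n * d ^ n.+1 <= (D.+1 * K) ^ n * d ^ n.+1)%N.
    by rewrite leq_mul2r; apply/orP; right; case: (n) h => // n' h; rewrite leq_exp2r.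
  apply: leq_ltn_trans h1 _; rewrite expnMn -mulnA -/D expnS mulnC ltn_pmul2r //.
  by rewrite expn_gt0.
exists D.+1, n.+1, p; split=> //; apply: (mulfI P0); rewrite mulr0 -[RHS]Ep big_distrr /=.
by apply: eq_bigr => a _; rewrite mulrCA.
Qed.

(* The [{poly F}]-algebra generated by [Y]. *)
Definition subr (Y : ps -> Prop) (h : ps) := forall X : ps -> Prop, (forall p, X (pp p)) ->
  (forall u v, X u -> X v -> X (u + v)) -> (forall u v, X u -> X v -> X (u * v)) ->
  (forall u, Y u -> X u) -> X h.
Lemma subr_sub (Y X : ps -> Prop) : (forall p, X (pp p)) ->
  (forall u v, X u -> X v -> X (u + v)) -> (forall u v, X u -> X v -> X (u * v)) ->
  (forall u, Y u -> X u) -> forall h, subr Y h -> X h.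
Proof. by move=> h1 h2 h3 h4 h H; apply: H. Qed.
Lemma subr_pp Y p : subr Y (pp p). Proof. by move=> X. Qed.
Lemma subrD Y u v : subr Y u -> subr Y v -> subr Y (u + v).
Proof. by move=> hu hv X h1 h2 h3 h4; apply: (h2); [exact: (hu X h1 h2 h3 h4) | exact: (hv X h1 h2 h3 h4)]. Qed.
Lemma subrM Y u v : subr Y u -> subr Y v -> subr Y (u * v).
Proof. by move=> hu hv X h1 h2 h3 h4; apply: (h3); [exact: (hu X h1 h2 h3 h4) | exact: (hv X h1 h2 h3 h4)]. Qed.
Lemma subr_gen (Y : ps -> Prop) u : Y u -> subr Y u. Proof. by move=> hu X h1 h2 h3 h4; apply: h4. Qed.
Lemma subr_sum Y (J : Type) (r : seq J) (h : J -> ps) : (forall j, subr Y (h j)) -> subr Y (\sum_(j <- r) h j).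
Proof. by move=> H; elim/big_ind: _ => //; [rewrite -(rmorph0 (@pp F)); exact: subr_pp | exact: subrD]. Qed.
Lemma subrX Y u k : subr Y u -> subr Y (u ^+ k).
Proof. by move=> H; elim: k => [|k IH]; [rewrite expr0 -(rmorph1 (@pp F)); exact: subr_pp | rewrite exprS;
  exact: subrM]. Qed.

Lemma subr_mono (Y Y' : ps -> Prop) h : (forall u, Y u -> Y' u) -> subr Y h -> subr Y' h.
Proof. by move=> YY H X h1 h2 h3 h4; apply: (H X) => // u /YY; exact: h4. Qed.
Lemma mon_subr D m (y : nat -> ps) (b : MI D m) : subr (fun u => exists i, u = y i) (mon y b).
Proof.
elim: m y b => [|m IH] y b; first by rewrite /= -(rmorph1 (@pp F)); exact: subr_pp.
case: b => [i b] /=; apply: subrM; first by apply: subrX; apply: subr_gen; exists 0%N.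
by apply: subr_mono (IH _ b) => u [l ->]; exists l.+1.
Qed.
Lemma subr_sc (Y Y' : ps -> Prop) a h : (forall u, Y u -> subr Y' (sc a u)) -> subr Y h -> subr Y' (sc a h).
Proof.
move=> H; move: h; apply: subr_sub => [p|u v hu hv|u v hu hv|]; last exact: H.
- by rewrite sc_pp; exact: subr_pp.
- by rewrite rmorphD; exact: subrD.
- by rewrite rmorphM; exact: subrM.
Qed.

(** The degree [d] is positive automatically: for [d = 0] the last two clauses contradict each
    other. *)
Definition algover (Y : ps -> Prop) u := exists d (H : nat -> ps),
  [/\ forall k, subr Y (H k), H d != 0 & \sum_(k < d.+1) H k * u ^+ k = 0].

(** The relation is a polynomial in [y 0]. If the coefficient of index [k] is a nonzero series,
    [y 0] is algebraic over the later functions; if it is 0, it is itself a nontrivial relation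
    among these. *)
Lemma mon_algover D m (y : nat -> ps) (p : MI D m -> {poly F}) : (exists a, p a != 0) ->
  \sum_a pp (p a) * mon y a = 0 -> exists j, algover (fun u => exists2 i, (j < i)%N & u = y i) (y j).
Proof.
elim: m y p => [|m IH] y p [a pa] E0.
  have := E0; rewrite /= (bigD1 a) //= big1 ?addr0 ?mulr1; last by move=> [] ; case: a {pa E0}.
  by move/eqP; rewrite pp_eq0 (negbTE pa).
case: a pa => [k a] pa.
pose H j : ps := if insub j is Some j then \sum_b pp (p (j : 'I_D, b)) * mon (fun j => y j.+1) b else 0.
have E1 : \sum_(j < D) H j * y 0%N ^+ j = 0.
  transitivity (\sum_(j < D) \sum_b pp (p (j, b)) * @mon D m.+1 y (j, b)).
    by apply: eq_bigr => j _; rewrite /H valK big_distrl; apply: eq_bigr => b _ /=; ring.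
  rewrite (pair_bigA _ (fun j b => pp (p (j, b)) * @mon D m.+1 y (j, b))) -[RHS]E0.
  by apply: eq_bigr => -[j b] _.
case: (pselect (H k = 0)) => [Hk0|Hk].
  have [||j Hj] := IH (fun j => y j.+1) (fun b => p (k, b)).
  - by exists a.
  - by move: Hk0; rewrite /H valK.
  - exists j.+1; have [d [H' [H1 H2 H3]]] := Hj; exists d, H'; split=> // i.
    by apply: subr_mono (H1 i) => u [l jl ->]; exists l.+1.
have exH : exists j, (j < D)%N && (H j != 0) by exists k; rewrite ltn_ord; apply/eqP.
have [d /andP[dD Hd] dmax] := ex_maxnP exH (fun j => fun h => ltnW (proj1 (andP h))).
exists 0%N, d, H; split=> //.
  move=> j; rewrite /H; case: insubP => [u _ _|_]; last by rewrite -(rmorph0 (@pp F)); exact: subr_pp.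
  apply: subr_sum => b; apply: subrM; first exact: subr_pp.
  apply: (@subr_mono (fun u => exists i, u = y i.+1)) => [v [l ->]|]; first by exists l.+1.
  refine (@mon_subr D m (fun j => y j.+1) b).
rewrite -[RHS]E1 -!(big_mkord xpredT (fun j => H j * y 0%N ^+ j)) [RHS](big_cat_nat (n := d.+1)) //=.
rewrite [X in _ + X]big_nat [X in _ + X]big1 ?addr0 // => i /andP[di iD].
have [->|h] := eqVneq (H i) 0; first by rewrite mul0r.
by have := dmax i; rewrite iD h => /(_ isT); rewrite leqNgt di.
Qed.
End Trdeg.

(** * The meromorphic case *)

Section MCase.
Variable R : realType.
Local Notation C := R[i].
Implicit Types (f g h : ps C).

Lemma shift_span (e : C) g n (b : nat -> {poly C}) : e != 0 -> b n.+1 != 0 ->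
  \sum_(i < n.+2) pp (b i) * sc (e ^+ i) g = 0 ->
  forall j, exists T, T != 0 /\ sp (fun i : 'I_n.+1 => sc (e ^+ i) g) (pp T * sc (e ^+ j) g).
Proof.
move=> e0 bn E; elim=> [|j [T [T0 [p Ep]]]].
  exists 1; split; first exact: oner_neq0.
  by rewrite rmorph1 mul1r; exact: (sp_in (fun i : 'I_n.+1 => sc (e ^+ i) g) ord0).
have scT : T \Po (e *: 'X) != 0 by rewrite -pp_eq0 -sc_pp sc_eq0 // pp_eq0.
exists (b n.+1 * (T \Po (e *: 'X))); split; first by rewrite mulf_neq0.
rewrite rmorphM /= -sc_pp exprS -sc_comp -mulrA -rmorphM /= Ep rmorph_sum big_distrr.
apply: sp_sum => i /=; rewrite rmorphM /= sc_pp sc_comp mulrCA; apply: spZ; rewrite -exprS.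
have [iN|iN] := ltnP i n; first exact: (spZ _ (sp_in (fun i : 'I_n.+1 =>
  sc (e ^+ i) g) (Ordinal (iN : (i.+1 < n.+1)%N)))).
have -> : i = n :> nat by apply/eqP; rewrite eqn_leq iN -ltnS ltn_ord.
move: E; rewrite big_ord_recr /= addrC => /eqP; rewrite addr_eq0 => /eqP ->; apply: spN.
by apply: sp_sum => k; apply: spZ; exact: (sp_in (fun i : 'I_n.+1 => sc (e ^+ i) g)).
Qed.

(** All shifts of [f] are algebraic over the same [n.+1] shifts of [g], with the same degrees [E]
    and [d]; so they are dependent, one of them is algebraic over later ones, and dilating back
    reaches [f] itself. *)
Lemma shift_algover (e : C) f g n (b : nat -> {poly C}) : e != 0 -> b n.+1 != 0 ->
  \sum_(i < n.+2) pp (b i) * sc (e ^+ i) g = 0 -> algover (fun u => u = g) f ->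
  algover (fun u => exists j, u = sc (e ^+ j.+1) f) f.
Proof.
move=> e0 bn Eg [d [H [HS Hd EH]]].
pose G i := sc (e ^+ i) g.
have key h : subr (fun u => u = g) h -> exists E, forall j, exists T,
  T != 0 /\ sp (@mon _ E.+1 n.+1 G) (pp T * sc (e ^+ j) h).
  move: h; apply: subr_sub => [p|u v [E1 H1] [E2 H2]|u v [E1 H1] [E2 H2]|u ->].
  - exists 0%N => j; exists 1; split; first exact: oner_neq0.
    by rewrite sc_pp -rmorphM /= -[pp _]mulr1; apply: spZ; refine (sp_mon1 0 n.+1 G).
  - exists (maxn E1 E2) => j; have [T1 [T10 h1]] := H1 j; have [T2 [T20 h2]] := H2 j.
    exists (T1 * T2); split; first by rewrite mulf_neq0.
    rewrite rmorphD mulrDr; apply: spD'.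
      by rewrite rmorphM /= [pp T1 * _]mulrC -mulrA; apply: spZ; apply: sp_monW h1; exact: leq_maxl.
    by rewrite rmorphM /= -mulrA; apply: spZ; apply: sp_monW h2; exact: leq_maxr.
  - exists (E1 + E2)%N => j; have [T1 [T10 h1]] := H1 j; have [T2 [T20 h2]] := H2 j.
    exists (T1 * T2); split; first by rewrite mulf_neq0.
    by rewrite !rmorphM /= mulrACA; refine (sp_monM h1 h2).
  - exists 1%N => j; have [T [T0 hT]] := shift_span e0 bn Eg j; exists T; split=> //.
    by apply: sp_trans hT => i; exact: (sp_mon_var G).
have [E HE] : exists E, forall k j, (k <= d)%N ->
  exists T, T != 0 /\ sp (@mon _ E.+1 n.+1 G) (pp T * sc (e ^+ j) (H k)).
  elim: d {Hd EH} => [|d [E1 H1]].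
    by have [E H0] := key _ (HS 0%N); exists E => k j; rewrite leqn0 => /eqP ->.
  have [E2 H2] := key _ (HS d.+1); exists (maxn E1 E2) => k j; rewrite leq_eqVlt => /orP[/eqP ->|kd].
    by have [T [T0 h]] := H2 j; exists T; split=> //; apply: sp_monW h; exact: leq_maxr.
  by have [T [T0 h]] := H1 k j kd; exists T; split=> //; apply: sp_monW h; exact: leq_maxl.
have rel j : alg_rel n.+1 E d G (sc (e ^+ j) f).
  have [P [P0 HP]] : exists P, P != 0 /\ forall k, (k <= d)%N ->
    sp (@mon _ E.+1 n.+1 G) (pp P * sc (e ^+ j) (H k)).
    elim: {Hd EH} d HE => [|d IH] HE.
      by have [T [T0 h]] := HE 0%N j (leqnn _); exists T; split=> // k; rewrite leqn0 => /eqP ->.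
    have [|P [P0 HP]] := IH; first by move=> k j' kd; apply: HE; exact: leqW.
    have [T [T0 h]] := HE d.+1 j (leqnn _); exists (P * T); split; first by rewrite mulf_neq0.
    move=> k; rewrite leq_eqVlt => /orP[/eqP ->|kd]; first by rewrite rmorphM /= -mulrA; apply: spZ.
    by rewrite rmorphM /= [pp P * _]mulrC -mulrA; apply: spZ; exact: HP.
  exists (fun k => if (k <= d)%N then pp P * sc (e ^+ j) (H k) else 0); split.
  - by move=> k; case: leqP => [/HP//|_]; exact: sp0.
  - by rewrite leqnn mulf_neq0 ?pp_eq0 // sc_eq0 // expf_neq0.
  - transitivity (pp P * sc (e ^+ j) (\sum_(i < d.+1) H i * f ^+ i)); last by rewrite EH rmorph0 mulr0.
    rewrite rmorph_sum big_distrr; apply: eq_bigr => i _ /=.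
    by rewrite -ltnS ltn_ord rmorphM /= rmorphXn /= mulrA.
have [D [m [p [Hp Ep]]]] := trdeg_dep rel.
have [j [d' [H' [H1 H2 H3]]]] := mon_algover Hp Ep.
have ej : e ^- j != 0 by rewrite invr_eq0 expf_neq0.
exists d', (fun k => sc (e ^- j) (H' k)); split.
- move=> k; apply: subr_sc (H1 k) => u [i ji ->]; apply: subr_gen; exists (i - j.+1)%N.
  by rewrite sc_comp; congr sc; rewrite -subSn // subSS -[X in _ * e ^+ X](subnKC (ltnW ji)) exprD mulKf //
    expf_neq0.
- by rewrite sc_eq0.
- transitivity (sc (e ^- j) (\sum_(k < d'.+1) H' k * sc (e ^+ j) f ^+ k)); last by rewrite H3 rmorph0.
  have Ef : sc (e ^- j) (sc (e ^+ j) f) = f by rewrite sc_comp mulVf ?sc1 // expf_neq0.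
  by rewrite rmorph_sum; apply: eq_bigr => k _; rewrite rmorphM rmorphXn /= Ef.
Qed.

Section Pole.
Variables (q : C) (A B : {poly C}) (f : ps C) (n : nat).
Hypotheses (Hf : hyp q A B f) (q1 : nm q < 1) (A0 : A`_0 != 0) (B0 : B`_0 != 0).
Hypotheses (sA : (size A <= n.+1)%N) (sB : (size B <= n.+1)%N) (n0 : (0 < n)%N).
Local Notation s0 := (B`_0 / A`_0).
Local Notation xs := (pole_at q A B).
Let q0 : q != 0. Proof. by case: Hf. Qed.
Let s0n : s0 != 0. Proof. by rewrite mulf_neq0 ?invr_eq0. Qed.

(** At a pole of [f] the top coefficient [H d] must vanish, as all the [H k] are regular on the
    spiral. If [f] is not rational, any [n] consecutive far points contain a pole, so the product of
    [n] dilations of [H d] vanishes at all far points and is 0 by [spi_identity]. *)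
Lemma algover_poles_rational (e : C) : e != 0 -> (forall j (k : int), e ^+ j.+1 * q ^ k != 1) ->
  (forall j (k : int), (bpol q A B n).[e ^+ j.+1 * pt q s0 k] != 0) ->
  algover (fun u => exists j, u = sc (e ^+ j.+1) f) f -> fps_rational f.
Proof.
move=> e0 H1 H2 [d [H [HS Hd EH]]]; apply: contrapT => nrat.
have regj j i (k : int) : exists y, reg f (e ^+ j.+1 * q ^+ i * pt q s0 k) y.
  apply: (f_reg_off Hf q1 A0 B0 sA sB) => k'; apply: contra (H1 j (i%:Z - k + k'%:Z)) => /eqP E.
  apply/eqP; apply: (mulIf s0n); rewrite mul1r !expfzDr // -!exprnP -invr_expz.
  move: E; rewrite /pt /pole_at => E.
  have qk' : q ^+ k' != 0 by rewrite expf_neq0.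
  transitivity (e ^+ j.+1 * q ^+ i * (s0 / q ^ k) * q ^+ k'); first by ring.
  by rewrite E divfK.
(* The module is generated by [n] consecutive dilations. The functional equation brings the next one
   back into it, and its top coefficient, free of zeros on the spiral by [H2], is the [d] of
   [spi]. *)
have spij j : spi q s0 (sc (e ^+ j.+1) f).
  have [w Hw] : exists w : 'I_n * int -> C, forall x : 'I_n * int,
    reg f (e ^+ j.+1 * q ^+ x.1 * pt q s0 x.2) (w x).
    by have [w Hw] := boolp.choice (fun x : 'I_n * int => regj j x.1 x.2); exists w.
  pose b i : {poly C} := (bpol q A B i) \Po (e ^+ j.+1 *: 'X).
  exists 'I_n, (fun i : 'I_n => sc (e ^+ j.+1 * q ^+ i) f), (b n),
    (fun i i' : 'I_n => if (i.+1 < n)%N then (i' == i.+1 :> nat)%:R * b n else - b i'),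
    (fun i : 'I_n => (i == 0 :> nat)%:R), (fun (i : 'I_n) k => w (i, k)); split.
  - move=> i; apply: cv_sc; first by rewrite mulf_neq0 ?expf_neq0.
    rewrite mulr0; apply: (cv_below_pole Hf) => //.
    by rewrite nm_gt0; exact: (xs_neq0 Hf).
  - by move=> k; rewrite /b horner_scX.
  - by move=> i k; apply: reg_sc (Hw (i, k)); rewrite mulf_neq0 // expf_neq0.
  - move=> i; rewrite sc_comp mulrCA -exprS; case: (ltnP i.+1 n) => iN.
      rewrite (bigD1 (Ordinal iN)) //= eqxx mul1r big1 ?addr0 // => i' /eqP ne.
      by case: eqP => [E|_]; [case: ne; apply: val_inj | rewrite mul0r rmorph0 mul0r].
    have -> : i.+1 = n by apply/eqP; rewrite eqn_leq ltn_ord.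
    have := congr1 (sc (e ^+ j.+1)) (hyp_feq Hf sA sB); rewrite rmorph0 rmorph_sum big_ord_recr /=.
    rewrite rmorphM /= sc_pp sc_comp addrC => /eqP; rewrite addr_eq0 => /eqP ->.
    by rewrite -sumrN; apply: eq_bigr => i' _; rewrite rmorphM /= sc_pp sc_comp rmorphN mulNr.
  - rewrite (bigD1 (Ordinal n0)) //= rmorph1 mul1r expr0 mulr1 big1 ?addr0 // => i /eqP ne.
    by case: eqP => [E|_]; [case: ne; apply: val_inj | rewrite rmorph0 mul0r].
have key k : spi q s0 (H k) /\ forall l, exists y, reg (H k) (xs l) y.
  move: (H k) (HS k); apply: subr_sub => [p|u v [s1 r1] [s2 r2]|u v [s1 r1] [s2 r2]|u [j ->]].
  - by split; [exact: spi_pp | move=> l; eexists; exact: reg_pp].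
  - split; first exact: spiD.
    by move=> l; have [y1 h1] := r1 l; have [y2 h2] := r2 l; exists (y1 + y2); exact: regD.
  - split; first exact: spiM.
    by move=> l; have [y1 h1] := r1 l; have [y2 h2] := r2 l; exists (y1 * y2); exact: regM.
  - split; first exact: spij.
    move=> l; have [y Hy] := regj j 0%N l%:Z; exists y; apply: reg_sc; first by rewrite expf_neq0.
    by move: Hy; rewrite expr0 mulr1.
have pole0 l : (forall y, ~ reg f (xs l) y) -> reg (H d) (xs l) 0.
  move=> np; have [T [T0 rT cT]] := mero_multiplier Hf q1 A0 B0 sA sB l.+1.
  have ll : nm (xs l) < nm (xs l.+1).
    rewrite -(xsE Hf A0 l 1) addn1 expr1 nmM -[X in _ < X]mul1r ltr_pM2r // nm_gt0; exact: (xs_neq0 Hf).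
  have [Q [Qs cQ vQ]] := pole_order (xs_neq0 Hf A0 B0 l) T0 (cT _ (nm_ge0 _) ll) np.
  have [hh Hh] := boolp.choice (fun k => (key k).2 l).
  (* After multiplication by [Q ^+ d], every term but the top one keeps a factor [Q], which vanishes
     at the pole. *)
  have := congr1 (fun u => pp Q ^+ d * u) EH; rewrite mulr0 big_distrr /= => E.
  have E2 : \sum_(i < d.+1) H i * (pp (Q ^+ (d - i)) * (pp Q * f) ^+ i) = 0.
    rewrite -[RHS]E; apply: eq_bigr => i _; have id : (i <= d)%N by rewrite -ltnS.
    have Qd : pp Q ^+ d = pp Q ^+ (d - i) * pp Q ^+ i by rewrite -exprD subnK.
    by rewrite rmorphXn /= Qd exprMn; ring.
  have regX F y i : reg F (xs l) y -> reg (F ^+ i) (xs l) (y ^+ i).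
    move=> rF; elim: i => [|i IH]; last by rewrite !exprS; exact: regM.
    by have := reg_pp 1 (xs l); rewrite rmorph1 !expr0 hornerE.
  have := @reg_sum _ _ (index_enum 'I_d.+1) (fun i => H i * (pp (Q ^+ (d - i)) * (pp Q * f) ^+ i))
     (fun i => hh i * ((Q ^+ (d - i)).[xs l] * ev (pp Q * f) (xs l) ^+ i)) (xs l).
  move=> /(_ (fun i => regM (Hh i) (regM (reg_pp _ _) (regX _ _ _ (reg_cv cQ))))).
  rewrite E2 => rs; have := reg_pp 0 (xs l); rewrite rmorph0 horner0 => r0.
  have := reg_unique rs r0; rewrite big_ord_recr /= big1; last first.
    by move=> i _; rewrite horner_exp Qs expr0n subn_eq0 leqNgt ltn_ord mul0r mulr0.
  have Q1 : (Q ^+ (d - d)).[xs l] = 1 by rewrite subnn expr0 hornerC.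
  rewrite add0r Q1 mul1r => /eqP; rewrite mulf_eq0 expf_eq0 (negbTE vQ) andbF orbF => /eqP hd.
  by have := Hh d; rewrite hd.
pose Hs := \prod_(i < n) sc (q ^+ i) (H d).
have : Hs = 0.
  apply: (spi_identity q0 q1 s0n).
    rewrite /Hs; elim/big_ind: _ => [|u v|i _]; [|exact: spiM|].
      by rewrite -(rmorph1 (@pp C)); exact: spi_pp.
    elim: (i : nat) => [|m IH]; first by rewrite expr0 sc1; exact: (key d).1.
    by rewrite exprS -sc_comp; exact: spi_sc.
  exists n.+1%:Z => k nk; have [k' Ek] : exists k' : nat, k = k'%:Z by exists (absz k); lia.
  rewrite {k}Ek in nk *; have {}nk : (n < k')%N by lia.
  have -> : pt q s0 k'%:Z = xs k' by [].
  have [i [iN Hi]] : exists i, (i < n)%N /\ forall y, ~ reg f (xs (k' - i)) y.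
    apply: contrapT => Hno; apply: nrat.
    have reg' i : (i < n)%N -> exists y, reg f (xs (k' - i)) y.
      move=> iN; apply: contrapT => h; apply: Hno; exists i; split=> // y ry; apply: h; by exists y.
    apply: (f_rational_of_reg Hf q1 A0 B0 sA sB (k := (k' - n).+1)).
    apply: (f_reg_all Hf q1 A0 B0 sA sB n0) => i iN.
    have := reg' (n - i.+1)%N; have -> : (k' - (n - i.+1) = (k' - n).+1 + i)%N by lia.
    by apply; lia.
  have -> : 0 = \prod_(i0 < n) (fun i0 : nat =>
    if i0 == i then 0 else sval (cid ((key d).2 (k' - i0)%N))) i0 :> C.
    by rewrite (bigD1 (Ordinal iN)) //= eqxx mul0r.
  rewrite /Hs; elim/big_ind2: _ => [|u y v z|i0 _]; [|exact: regM|].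
    by have := reg_pp 1 (xs k'); rewrite rmorph1 hornerE.
  apply: reg_sc; first by rewrite expf_neq0.
  have lt0 := ltn_ord i0; rewrite -[X in xs X](@subnK i0 k') ?(xsE Hf A0); last by lia.
  case: eqP => [->|_]; first exact: pole0.
  exact: (svalP (cid ((key d).2 (k' - i0)%N))).
move/eqP; rewrite prodf_seq_eq0 => /hasP [i _ /=]; rewrite sc_eq0 ?expf_neq0 //.
by rewrite (negbTE Hd).
Qed.
End Pole.

(** The condition on [bpol q A B n] can fail for [e] or for [e^-1], but not for both: its single
    root would lie on two dilated spirals, which gives a relation between [e] and [q]. Hence the
    equations of [g] in both directions. *)
Lemma meromorphic_rational (q e : C) (A B : {poly C}) f g n m (b b' : nat -> {poly C}) : hyp q A B f ->
  nm q < 1 ->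
  A`_0 != 0 -> B`_0 != 0 -> (size A <= n.+1)%N -> (size B <= n.+1)%N -> (0 < n)%N -> bpol q A B n != 0 ->
  e != 0 -> (forall j k : int, e ^ j * q ^ k = 1 -> j = 0 /\ k = 0) ->
  b m.+1 != 0 -> \sum_(i < m.+2) pp (b i) * sc (e ^+ i) g = 0 ->
  b' m.+1 != 0 -> \sum_(i < m.+2) pp (b' i) * sc (e^-1 ^+ i) g = 0 ->
  algover (fun u => u = g) f -> fps_rational f.
Proof.
move=> Hf q1 A0 B0 sA sB n0 bn e0 ind bm Eb bm' Eb' alg.
have q0 : q != 0 by case: Hf.
have ei0 : e^-1 != 0 by rewrite invr_eq0.
have P1 j (k : int) : e ^+ j.+1 * q ^ k != 1.
  by apply/eqP => /(ind j.+1%:Z) [].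
have P2 j (k : int) : e^-1 ^+ j.+1 * q ^ k != 1.
  by rewrite exprVn; apply/eqP => /(ind (- j.+1%:Z)) [].
case: (pselect (forall j (k : int), (bpol q A B n).[e ^+ j.+1 * pt q (B`_0 / A`_0) k] != 0)) => [Hg|Hb].
  exact: (algover_poles_rational Hf q1 A0 B0 sA sB n0 e0 P1 Hg (shift_algover e0 bm Eb alg)).
apply: (algover_poles_rational Hf q1 A0 B0 sA sB n0 ei0 P2 _ (shift_algover ei0 bm' Eb' alg)).
move=> j' k'; apply/eqP => E'; apply: Hb => j k; apply/eqP => E.
have s0 : B`_0 / A`_0 != 0 by rewrite mulf_neq0 ?invr_eq0.
move: E E'; rewrite !horner_bpol => /eqP; rewrite subr_eq0 => /eqP E /eqP; rewrite subr_eq0 => /eqP E'.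
have An : A`_n != 0.
  by apply: contraNneq bn => An; rewrite /bpol An scale0r subr0; move: E; rewrite An mul0r => ->.
have : e ^+ j.+1 * pt q (B`_0 / A`_0) k = e^-1 ^+ j'.+1 * pt q (B`_0 / A`_0) k'.
  by apply: (mulfI An); rewrite -E -E'.
rewrite /pt exprVn => /(congr1 (fun z => z * (e ^+ j'.+1 * q ^ k * q ^ k' / (B`_0 / A`_0)))).
have e1 : e ^+ j.+1 != 0 by rewrite expf_neq0.
have e2 : e ^+ j'.+1 != 0 by rewrite expf_neq0.
have k1 : q ^ k != 0 by rewrite expfz_neq0.
have k2 : q ^ k' != 0 by rewrite expfz_neq0.
move=> E3; have E4 : e ^+ j.+1 * e ^+ j'.+1 * q ^ k' = q ^ k.
  transitivity (e ^+ j.+1 * (B`_0 / A`_0 / q ^ k) * (e ^+ j'.+1 * q ^ k * q ^ k' / (B`_0 / A`_0))).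
    by field; rewrite k1 A0 B0.
  by rewrite E3; field; rewrite k2 e2 A0 B0.
have := ind (j.+1 + j'.+1)%N%:Z (k' - k).
rewrite expfzDr // -exprnP exprD mulrA E4 -invr_expz divff // => /(_ erefl) [] //.
Qed.
End MCase.

(** * Growth of the coefficients of an algebraic series *)

Section Majorant.
Variable R : realType.
Local Notation C := R[i].
Implicit Types (f g F G y : ps C) (K M : R).
Variables (w : nat -> R) (c : R).
Hypotheses (w1 : forall n, 1 <= w n) (wS : forall n, w n <= w n.+1) (wM : forall i j, w i * w j <= w (i + j)%N).
Hypotheses (c1 : 1 <= c) (wc : forall n, w n.+1 <= c ^+ n.+1 * w n).
Let w0 n : 0 < w n. Proof. by apply: lt_le_trans (w1 n). Qed.

(** Partial sums of a weighted l1 norm, submultiplicative because [w i * w j <= w (i + j)]. The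
    weight 1 describes convergent series, the weight [qw b] divergent ones. *)
Definition nrm K N F := \sum_(n < N) nm (F n) / (w n * K ^+ n).
Definition maj F := exists K M, 1 <= K /\ forall N, nrm K N F <= M.

Lemma conv_sum_le (a b : nat -> R) N : (forall n, 0 <= a n) -> (forall n, 0 <= b n) ->
  \sum_(n < N) \sum_(k < n.+1) a k * b (n - k)%N <= (\sum_(n < N) a n) * (\sum_(n < N) b n).
Proof.
move=> a0 b0.
have -> : \sum_(n < N) \sum_(k < n.+1) a k * b (n - k)%N = \sum_(k < N) a k * \sum_(j < (N - k)%N) b j.
  elim: N => [|N IH]; first by rewrite !big_ord0.
  rewrite big_ord_recr /= IH [RHS]big_ord_recr /= subSnn big_ord1.
  rewrite [in LHS]big_ord_recr /= subnn addrA; congr (_ + _).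
  rewrite -big_split; apply: eq_bigr => k _ /=.
  by rewrite subSn ?(ltnW (ltn_ord k)) // big_ord_recr /= mulrDr.
rewrite big_distrl /=; apply: ler_sum => k _; apply: ler_wpM2l => //.
rewrite -!(big_mkord xpredT b) [leRHS](big_cat_nat (n := (N - k)%N)) ?leq_subr //=.
by rewrite lerDl sumr_ge0.
Qed.

Section Fixed.
Variable K : R.
Hypothesis K1 : 1 <= K.
Let K0 : 0 < K. Proof. exact: lt_le_trans ltr01 K1. Qed.
Let d0 n : 0 < w n * K ^+ n.
Proof. by rewrite mulr_gt0 ?w0 ?exprn_gt0 ?K0. Qed.
Lemma nrm_term F n : 0 <= nm (F n) / (w n * K ^+ n).
Proof. by rewrite divr_ge0 ?nm_ge0 // ltW ?d0. Qed.
Lemma nrm_ge0 N F : 0 <= nrm K N F. Proof. by apply: sumr_ge0 => i _; exact: nrm_term. Qed.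
Lemma nrmD N F G : nrm K N (F + G) <= nrm K N F + nrm K N G.
Proof.
rewrite -big_split; apply: ler_sum => n _ /=; rewrite -mulrDl; apply: ler_wpM2r;
  [by rewrite invr_ge0 ltW ?d0 | exact: nmD].
Qed.
Lemma nrmM N F G : nrm K N (F * G) <= nrm K N F * nrm K N G.
Proof.
apply: le_trans (conv_sum_le N (nrm_term F) (nrm_term G)); apply: ler_sum => n _.
rewrite ler_pdivrMr ?d0 // big_distrl /=; apply: le_trans (nmM_conv F G n) _; apply: ler_sum => k _ /=.
have kn : (k <= n)%N by rewrite -ltnS.
have h := wM k (n - k); rewrite subnKC // in h.
have -> : nm (F k) / (w k * K ^+ k) * (nm (G (n - k)%N) / (w (n - k)%N * K ^+ (n - k))) * (w n * K ^+ n) =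
  nm (F k) * nm (G (n - k)%N) * (w n / (w k * w (n - k)%N)).
  have Kn : K ^+ n = K ^+ k * K ^+ (n - k) by rewrite -exprD subnKC.
  rewrite Kn; field.
  by rewrite !gt_eqF ?exprn_gt0 ?w0 ?K0.
rewrite -[leLHS]mulr1; apply: ler_wpM2l; first by rewrite mulr_ge0 ?nm_ge0.
by rewrite ler_pdivlMr ?mulr_gt0 ?w0 // mul1r.
Qed.
Lemma nrm_le K' N F : K <= K' -> nrm K' N F <= nrm K N F.
Proof.
move=> KK; apply: ler_sum => n _; apply: ler_wpM2l; first exact: nm_ge0.
have K'0 : 0 < K' by exact: lt_le_trans K0 KK.
rewrite lef_pV2 ?posrE ?mulr_gt0 ?exprn_gt0 ?w0 ?K0 //.
by apply: ler_wpM2l; [exact: ltW (w0 n) | apply: lerXn2r; rewrite ?nnegrE // ltW].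
Qed.
Lemma nrm1 N : nrm K N 1 <= 1.
Proof.
case: N => [|N]; rewrite /nrm ?big_ord0 // big_ord_recl big1 ?addr0; last by move=> i _; rewrite ps1 nm0 mul0r.
by rewrite ps1 nm1 expr0 mulr1 mul1r invf_le1 ?w0.
Qed.
Lemma nrmX N F k S : nrm K N F <= S -> nrm K N (F ^+ k) <= S ^+ k.
Proof.
move=> h; elim: k => [|k IH]; first exact: nrm1.
rewrite !exprS; apply: le_trans (nrmM _ _ _) _; apply: ler_pM => //; exact: nrm_ge0.
Qed.
Lemma nrm_psX N F : nrm K N.+1 (psX _ * F) <= nrm K N F / K.
Proof.
have E n : (psX _ * F) n = if n is n'.+1 then F n' else 0.
  by have := psXnM 1 F n; rewrite expr1 => ->; case: n => // n; rewrite subn1.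
rewrite /nrm big_ord_recl /= E nm0 mul0r add0r big_distrl; apply: ler_sum => n _ /=.
rewrite E -mulrA; apply: ler_wpM2l; first exact: nm_ge0.
rewrite -invfM lef_pV2 ?posrE ?mulr_gt0 ?exprn_gt0 ?w0 ?K0 //.
by rewrite -mulrA -exprSr; apply: ler_wpM2r; [rewrite exprn_ge0 // ltW ?K0 | exact: wS].
Qed.
Lemma nrm_sum N (I : Type) (r : seq I) (F : I ->
  ps C) : nrm K N (\sum_(i <- r) F i) <= \sum_(i <- r) nrm K N (F i).
Proof.
elim: r => [|i r IH]; last by rewrite !big_cons; apply: le_trans (nrmD _ _ _) _; rewrite lerD2l.
by rewrite !big_nil /nrm big1 // => n _; rewrite ps0 nm0 mul0r.
Qed.
Lemma nrm_pp N (p : {poly C}) : nrm K N (pp p) <= \sum_(i < size p) nm p`_i.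
Proof.
have h m : nrm K m (pp p) <= \sum_(i < m) nm p`_i.
  apply: ler_sum => i _; rewrite ler_pdivrMr ?d0 // -[leLHS]mulr1; apply: ler_wpM2l; first exact: nm_ge0.
  by have := w1 i; have := exprn_ege1 i K1 => ? ?; rewrite -[leLHS]mulr1; apply: ler_pM.
have h2 m : \sum_(i < m) nm p`_i <= \sum_(i < size p) nm p`_i.
  rewrite -!(big_mkord xpredT (fun i => nm p`_i)); case: (leqP m (size p)) => h2.
    rewrite [leRHS](big_cat_nat (n := m)) //= lerDl sumr_ge0 // => ? _; exact: nm_ge0.
  rewrite (big_cat_nat (leq0n _) (ltnW h2)) /= [X in _ + X]big_nat [X in _ + X]big1 ?addr0 // => i /andP[hi _].
  by rewrite nth_default ?nm0.
exact: le_trans (h N) (h2 N).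
Qed.
End Fixed.

Lemma maj_common F G : maj F -> maj G -> exists K M, 1 <= K /\ forall N, nrm K N F <= M /\ nrm K N G <= M.
Proof.
move=> [K [M [K1 H]]] [K' [M' [K1' H']]]; exists (Num.max K K'), (Num.max M M').
split; first by rewrite le_max K1.
by move=> N; split; rewrite le_max; apply/orP; [left|right];
  [apply: le_trans (H N) | apply: le_trans (H' N)]; apply: nrm_le; rewrite // le_max lexx ?orbT.
Qed.
Lemma majD F G : maj F -> maj G -> maj (F + G).
Proof.
move=> hF hG; have [K [M [K1 H]]] := maj_common hF hG; exists K, (M + M); split=> // N; have [h1 h2] := H N.
by apply: le_trans (nrmD K1 _ _ _) _; exact: lerD.
Qed.
Lemma majM F G : maj F -> maj G -> maj (F * G).
Proof.
move=> hF hG; have [K [M [K1 H]]] := maj_common hF hG; exists K, (M * M); split=> // N; have [h1 h2] := H N.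
by apply: le_trans (nrmM K1 _ _ _) _; apply: ler_pM => //; exact: nrm_ge0.
Qed.
Lemma maj_pp p : maj (pp p).
Proof. by exists 1, (\sum_(i < size p) nm p`_i); split=> // N; exact: nrm_pp. Qed.
Lemma maj_sum (I : Type) (r : seq I) (F : I -> ps C) : (forall i, maj (F i)) -> maj (\sum_(i <- r) F i).
Proof. by move=> H; elim/big_ind: _ => //; [rewrite -(rmorph0 (@pp C)); exact: maj_pp | exact: majD]. Qed.
Lemma majX F k : maj F -> maj (F ^+ k).
Proof. by move=> H; elim: k => [|k IH]; [rewrite expr0 -(rmorph1 (@pp C)); exact: maj_pp | rewrite exprS;
  exact: majM]. Qed.
Lemma majN F : maj F -> maj (- F).
Proof. by move=> /(majM (maj_pp (-1))); rewrite rmorphN rmorph1 mulN1r. Qed.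
Lemma maj_natmul F k : maj F -> maj (F *+ k).
Proof. by move=> /(majM (maj_pp k%:R)); rewrite rmorph_nat mulr_natl. Qed.
Lemma maj_horner (p : {poly ps C}) F : (forall i, maj p`_i) -> maj F -> maj p.[F].
Proof. by move=> hp hF; rewrite horner_coef; apply: maj_sum => i; apply: majM => //; exact: majX. Qed.

Lemma maj_bound F : maj F -> exists K M, 1 <= K /\ forall n, nm (F n) <= M * K ^+ n * w n.
Proof.
move=> [K [M [K1 H]]]; exists K, M; split=> // n.
have d0 : 0 < w n * K ^+ n by rewrite mulr_gt0 ?w0 ?exprn_gt0 //; lra.
rewrite -mulrA [K ^+ n * _]mulrC -ler_pdivrMr //; apply: le_trans (H n.+1).
by rewrite /nrm big_ord_recr /= lerDr; exact: nrm_ge0.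
Qed.
Lemma bound_maj F K M : 1 <= K -> (forall n, nm (F n) <= M * K ^+ n * w n) -> maj F.
Proof.
move=> K1 H; exists (2 * K), (M * (1 - 2^-1)^-1); split=> [|N]; first by lra.
have M0 : 0 <= M.
  have := le_trans (nm_ge0 _) (H 0%N); rewrite expr0 mulr1 pmulr_lge0 ?w0 //.
apply: le_trans (_ : \sum_(n < N) M * 2^-1 ^+ n <= _); last first.
  by rewrite -big_distrr /=; apply: ler_wpM2l => //; apply: geo_sum_le; lra.
apply: ler_sum => n _; rewrite ler_pdivrMr ?mulr_gt0 ?exprn_gt0 ?w0 //; last by lra.
apply: le_trans (H n) _; rewrite exprMn exprVn le_eqVlt; apply/orP; left; apply/eqP; field.
by rewrite expf_neq0 // pnatr_eq0.
Qed.

Lemma maj_shift F : maj (psX _ * F) -> maj F.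
Proof.
move=> /maj_bound [K [M [K1 H]]].
have cK : 1 <= c * K by rewrite -[leLHS]mulr1; apply: ler_pM.
apply: (@bound_maj F (c * K) (M * c * K)) => // n.
have := H n.+1; have := psXnM 1 F n.+1; rewrite expr1 /= subn1 /= => -> h; apply: le_trans h _.
have M0 : 0 <= M by have := le_trans (nm_ge0 _) (H 0%N); rewrite expr0 mulr1 pmulr_lge0 ?w0 //.
have -> : M * c * K * (c * K) ^+ n * w n = M * K ^+ n.+1 * (c ^+ n.+1 * w n) by rewrite exprMn !exprS; ring.
by apply: ler_wpM2l => //; rewrite mulr_ge0 // exprn_ge0 //; lra.
Qed.
Lemma maj_shiftn d F : maj (psX _ ^+ d * F) -> maj F.
Proof. by elim: d F => [|d IH] F; rewrite ?expr0 ?mul1r // exprSr -mulrA => /IH /maj_shift. Qed.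

Lemma maj_family (W : nat -> ps C) d : (forall k, maj (W k)) ->
  exists K M, [/\ 1 <= K, 0 <= M & forall k N, (k < d)%N -> nrm K N (W k) <= M].
Proof.
move=> H; elim: d => [|d [K [M [K1 M0 HK]]]]; first by exists 1, 0; split.
have [K' [M' [K1' H']]] := H d; exists (Num.max K K'), (Num.max M M').
split; [by rewrite le_max K1 | by rewrite le_max M0 | ].
move=> k N; rewrite ltnS leq_eqVlt => /orP[/eqP -> | kd]; rewrite le_max; apply/orP; [right|left].
  by apply: le_trans (H' N); apply: nrm_le => //; rewrite le_max lexx orbT.
by apply: le_trans (HK k N kd); apply: nrm_le => //; rewrite le_max lexx.
Qed.

(** Induction on the number of terms: the factor [psX] defers the nonlinear part by one index and
    divides its norm by [K], so a large [K] preserves the bound [S]. *)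
Lemma maj_fix y d (a : C) (W : nat -> ps C) : (forall k, maj (W k)) ->
  y = pp a%:P + psX _ * \sum_(k < d) W k * y ^+ k -> maj y.
Proof.
move=> HW Ey; have [K0 [M [K01 M0 HM]]] := maj_family d HW.
set S := nm a + 1; have S1 : 1 <= S by rewrite /S; have := nm_ge0 a; lra.
pose K := K0 + d%:R * (M * S ^+ d).
have dS : 0 <= d%:R * (M * S ^+ d) by rewrite !mulr_ge0 // ?exprn_ge0 //; lra.
have KK : K0 <= K by rewrite /K; lra.
have K1 : 1 <= K by lra.
exists K, S; split=> //; elim=> [|N IH]; first by rewrite /nrm big_ord0; lra.
rewrite Ey; apply: le_trans (nrmD K1 _ _ _) _; rewrite [leRHS](_ : S = nm a + 1) //; apply: lerD.
  apply: le_trans (nrm_pp K1 _ _) _; have [->|a0] := eqVneq a 0.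
    by rewrite polyC0 size_poly0 big_ord0 nm0.
  by rewrite size_polyC a0 big_ord1 coefC.
apply: le_trans (nrm_psX K1 _ _) _; rewrite ler_pdivrMr ?mul1r; last by lra.
apply: le_trans (nrm_sum K1 _ _ _) _; apply: le_trans (_ : d%:R * (M * S ^+ d) <= _); last by rewrite /K; lra.
rewrite -[X in X%:R](card_ord d) -sum1_card natr_sum big_distrl /=; apply: ler_sum => k _; rewrite mul1r.
apply: le_trans (nrmM K1 _ _ _) _; apply: ler_pM; [exact: nrm_ge0|exact: nrm_ge0| | ].
  by apply: le_trans (nrm_le K01 _ _ KK) (HM _ _ _).
apply: le_trans (nrmX K1 k IH) _; apply: ler_weXn2l => //; exact: ltnW.
Qed.

(** Newton's method around a truncation. If [v] is the order of p'(g) and g = t + x^(v+1) y with [t]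
    a polynomial, Taylor's formula divided by x^(2v+1) is an equation for y whose linear coefficient
    [u] is invertible and whose higher terms carry a factor x: the situation of [maj_fix]. *)
Lemma hensel (p : {poly ps C}) g : (forall i, maj p`_i) -> p.[g] = 0 -> p^`().[g] != 0 -> maj g.
Proof.
move=> hp pg p'g; have [v [p'v p'lt]] := ps_neq0P p'g.
have majT (F : ps C) : maj (pp (trunc v.+1 F)) by exact: maj_pp.
set t := pp (trunc v.+1 g); have [y gE] : exists y, g = t + psX _ ^+ v.+1 * y.
  exists (fun n => g (n + v.+1)%N); have := @ps_shift _ v.+1 (g - t).
  move=> h; apply/eqP; rewrite addrC -subr_eq; apply/eqP; rewrite h.
    congr (_ * _); apply/funext => n; rewrite psB /t /pp coef_poly ltnNge leq_addl /= subr0 //.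
  by move=> k kv; rewrite psB /t /pp coef_poly kv subrr.
have taylor (r : {poly ps C}) : exists Q : {poly ps C},
  r.[g] = r.[t] + r^`().[t] * (psX _ ^+ v.+1 * y) + (psX _ ^+ v.+1) ^+ 2 * y ^+ 2 * Q.[y]
   /\ ((forall i, maj r`_i) -> forall i, maj Q`_i).
  exists (\poly_(i < size r) (r^`N(i.+2).[t] * (psX _ ^+ v.+1) ^+ i)); split; last first.
    move=> hr i; rewrite coef_poly; case: ltnP => _; last by rewrite -(rmorph0 (@pp C)); exact: maj_pp.
    apply: majM; last by apply/majX/majX; exact: maj_pp.
    by apply: maj_horner; [move=> j; rewrite coef_nderivn; exact: maj_natmul | exact: majT].
  rewrite {1}gE nderiv_taylor; last exact: mulrC.
  have -> : \sum_(i < size r) r^`N(i).[t] * (psX _ ^+ v.+1 * y) ^+ i = \sum_(i < (size r).+2) r^`N(i).[t] *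
    (psX _ ^+ v.+1 * y) ^+ i.
    rewrite 2!big_ord_recr /= !nderivn_poly0 ?leqnSn // !horner0 !mul0r !addr0 //.
  rewrite 2!big_ord_recl /= nderivn0 nderivn1 expr0 mulr1 expr1 -addrA; congr (_ + (_ + _)).
  rewrite horner_poly big_distrr; apply: eq_bigr => i _ /=.
  by rewrite /bump /= !add1n !exprMn !exprS; ring.
have [Q [EQ HQ]] := taylor p; have [Q' [EQ' _]] := taylor p^`().
pose X := (psX C : ps C).
have lowX m (F : ps C) k : (k < m)%N -> (X ^+ m * F) k = 0 by move=> km; rewrite psXnM km.
have [u [Eu u0]] : exists u, p^`().[t] = X ^+ v * u /\ u 0%N != 0.
  have E1 k : (k <= v)%N -> p^`().[t] k = p^`().[g] k.
    move=> kv; rewrite EQ' !psD.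
    rewrite [p^`()^`().[t] * _]mulrCA lowX ?ltnS // -mulrA exprS -mulrA -/X lowX ?ltnS // !addr0 //.
  exists (fun n => p^`().[t] (n + v)%N); split; last by rewrite add0n E1.
  by apply: ps_shift => k kv; rewrite E1 ?p'lt // ltnW.
have Ep : p.[t] = X ^+ (v + v.+1) * - (u * y + X * y ^+ 2 * Q.[y]).
  move: EQ; rewrite pg Eu -/X => /esym/eqP; rewrite -addrA addr_eq0 => /eqP ->.
  by rewrite !exprD !exprS; ring.
set a := - (u * y + X * y ^+ 2 * Q.[y]) in Ep.
have ma : maj a.
  by apply: (@maj_shiftn (v + v.+1)); rewrite -Ep; apply: maj_horner => //; exact: majT.
have mu : maj u.
  apply: (@maj_shiftn v); rewrite -/X -Eu; apply: maj_horner; last exact: majT.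
  by move=> i; rewrite coef_deriv; exact: maj_natmul.
have split0 F : maj F -> exists F', F = pp (F 0%N)%:P + X * F' /\ maj F'.
  move=> mF; have E := @ps_shift _ 1 (F - pp (F 0%N)%:P).
  exists (fun n => (F - pp (F 0%N)%:P) (n + 1)%N).
  have E2 : F - pp (F 0%N)%:P = X * (fun n => (F - pp (F 0%N)%:P) (n + 1)%N).
    by rewrite {1}E ?expr1 // => -[|k] //= _; rewrite psB /pp coefC /= subrr.
  split; first by rewrite -E2 addrC subrK.
  by apply: maj_shift; rewrite -/X -E2; apply: majD => //; apply: majN; exact: maj_pp.
have [a1 [Ea ma1]] := split0 _ ma; have [u1 [Eu1 mu1]] := split0 _ mu.
(* The constant term of [u] is isolated on one side. The coefficients of the remaining terms,
   divided by it, are the [W k]: the rest of [a], the rest of [u], and the Taylor coefficients from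
   degree 2 on. *)
pose W k := pp (- (u 0%N)^-1)%:P * (match k with 0 => a1 | 1 => u1 | k.+2 => Q`_k end).
rewrite gE; apply: majD; first exact: majT.
apply: majM; first by apply: majX; exact: maj_pp.
apply: (@maj_fix y (size Q).+2 (- (u 0%N)^-1 * a 0%N) W).
  by move=> k; apply: majM; [exact: maj_pp | case: k => [|[|k]] //; exact: HQ].
rewrite 2!big_ord_recl /= expr0 mulr1 expr1.
have -> : \sum_(i < size Q) W (bump 0 (bump 0 i)) * y ^+ (bump 0 (bump 0 i)) = pp (- (u 0%N)^-1)%:P * (y ^+ 2 *
  Q.[y]).
  rewrite horner_coef !big_distrr; apply: eq_bigr => i _ /=.
  by rewrite /bump !add1n /W !exprS; ring.
have U : pp (u 0%N)%:P * pp (- (u 0%N)^-1)%:P = -1 :> ps C.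
  by rewrite -rmorphM /= -polyCM mulrN divff // polyCN rmorphN rmorph1.
rewrite /bump /=.
have Eay : a = - (u * y + X * y ^+ 2 * Q.[y]) by [].
have Epp : pp (- (u 0%N)^-1 * a 0%N)%:P = pp (- (u 0%N)^-1)%:P * pp (a 0%N)%:P by rewrite polyCM rmorphM.
have U0 : pp (u 0%N)%:P != 0 :> ps C by rewrite pp_eq0 polyC_eq0.
apply: (mulfI U0); rewrite Epp /W -/X; set V := pp (- (u 0%N)^-1)%:P in U *.
transitivity (- (pp (u 0%N)%:P * V) * (pp (u 0%N)%:P * y)); first by rewrite U opprK mul1r.
have -> : pp (u 0%N)%:P * y = - pp (a 0%N)%:P - X * a1 - X * u1 * y - X * y ^+ 2 * Q.[y].
  have -> : pp (u 0%N)%:P = u - X * u1 by rewrite [X in X - _]Eu1 addrK.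
  have -> : pp (a 0%N)%:P = a - X * a1 by rewrite [X in X - _]Ea addrK.
  by rewrite Eay; ring.
rewrite (_ : (1 + 0)%N = 1%N) //; ring.
Qed.
End Majorant.

(** * Relations between two series *)

Section Dependence.
Variable R : realType.
Local Notation C := R[i].
Implicit Types (f g F G y : ps C).

Lemma comm_pp f : commr_rmorph (@pp C) f. Proof. by move=> x; exact: mulrC. Qed.
Definition phi f : {poly {poly C}} -> ps C := horner_morph (comm_pp f).
HB.instance Definition _ f := GRing.RMorphism.on (phi f).
Lemma comm_phi f g : commr_rmorph (phi f) g. Proof. by move=> x; exact: mulrC. Qed.
Definition ev2 f g : {poly {poly {poly C}}} -> ps C := horner_morph (comm_phi f g).
HB.instance Definition _ f g := GRing.RMorphism.on (ev2 f g).
Lemma phiC f c : phi f c%:P = pp c. Proof. exact: horner_morphC. Qed.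
Lemma phiX f : phi f 'X = f. Proof. exact: horner_morphX. Qed.
Lemma ev2C f g c : ev2 f g c%:P = phi f c. Proof. exact: horner_morphC. Qed.
Lemma ev2X f g : ev2 f g 'X = g. Proof. exact: horner_morphX. Qed.
Lemma phiE f c : phi f c = \sum_(i < size c) pp c`_i * f ^+ i.
Proof.
rewrite {1}(_ : c = \sum_(i < size c) (c`_i)%:P * 'X^i); last by rewrite -[LHS]coefK poly_def;
  apply: eq_bigr => i _; rewrite mul_polyC.
by rewrite rmorph_sum; apply: eq_bigr => i _; rewrite rmorphM rmorphXn /= phiC phiX.
Qed.
Lemma ev2E f g P : ev2 f g P = \sum_(i < size P) phi f P`_i * g ^+ i.
Proof.
rewrite {1}(_ : P = \sum_(i < size P) (P`_i)%:P * 'X^i); last by rewrite -[LHS]coefK poly_def;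
  apply: eq_bigr => i _; rewrite mul_polyC.
by rewrite rmorph_sum; apply: eq_bigr => i _; rewrite rmorphM rmorphXn /= ev2C ev2X.
Qed.
Definition algebraic f := exists2 c, c != 0 & phi f c = 0.
(* In [ev2 f g P] the inner variable is [f] and the outer one [g]; [dY] differentiates in the inner variable. *)
Definition dY (P : {poly {poly {poly C}}}) := map_poly (@deriv _) P.

Lemma nat_poly_neq0 n : (n.+1%:R : {poly {poly C}}) != 0.
Proof. by rewrite -(rmorph_nat polyC) polyC_eq0 -(rmorph_nat polyC) polyC_eq0 pnatr_eq0. Qed.
Lemma nat_poly_neq0' n : (n.+1%:R : {poly C}) != 0.
Proof. by rewrite -(rmorph_nat polyC) polyC_eq0 pnatr_eq0. Qed.

Lemma deriv_eq0_const (A : idomainType) (p : {poly A}) : (forall n, (n.+1%:R : A) != 0) -> p^`() = 0 ->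
  p = (p`_0)%:P.
Proof.
move=> ch E; apply/polyP => -[|i]; rewrite coefC //=.
have /polyP /(_ i) := E; rewrite coef_deriv coef0 -mulr_natr => /eqP.
by rewrite mulf_eq0 (negbTE (ch i)) orbF => /eqP.
Qed.

(** In a relation of least degree, in the outer variable first and then in the inner one, a partial
    derivative that vanishes at the two series is identically 0; the relation would then involve one
    series only. *)
Lemma dep_min f g P : P != 0 -> ev2 f g P = 0 -> ~ algebraic f -> ~ algebraic g ->
  exists P, [/\ ev2 f g P = 0, ev2 f g (dY P) != 0 & ev2 f g P^`() != 0].
Proof.
move=> P0 EP nf ng.
pose Q1 m := `[< exists P, [/\ P != 0, ev2 f g P = 0 & (size P <= m)%N] >].
have ex1 : exists m, Q1 m by exists (size P); apply/asboolP; exists P.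
case: (ex_minnP ex1) => m1 /asboolP [P1 [P10 EP1 sP1]] min1.
pose Q2 m := `[< exists P, [/\ P != 0, ev2 f g P = 0, (size P <= m1)%N & forall i, (size (P`_i)%R <= m)%N] >].
have ex2 : exists m, Q2 m.
  exists (\max_(i < size P1) size (P1`_i)%R); apply/asboolP; exists P1; split=> // i.
  case: (ltnP i (size P1)) => h; last by rewrite nth_default // size_poly0.
  exact: (leq_bigmax (Ordinal h)).
case: (ex_minnP ex2) => m2 /asboolP [S [S0 ES sS sSi]] min2; exists S; split=> //.
- apply/eqP => E; have D0 : dY S = 0.
    apply/eqP/negPn/negP => D0; have : Q2 m2.-1.
      apply/asboolP; exists (dY S); split=> //; first by apply: leq_trans sS; exact: size_poly.
      move=> i; rewrite /dY coef_map_id0 ?linear0 //.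
      have [->|n0] := eqVneq S`_i 0; first by rewrite linear0 size_poly0.
      by have := lt_size_deriv n0; have := sSi i; case: (m2) => [|m] /= h1 h2;
        [have := leq_trans h2 h1 | have := leq_trans h2 h1].
    move/min2; have : (0 < m2)%N by apply: leq_trans (sSi (size S).-1);
      rewrite size_poly_gt0 -lead_coefE lead_coef_eq0.
    by case: (m2) => // m _; rewrite /= ltnn.
  have cst i : S`_i = (S`_i`_0)%:P.
    apply: (deriv_eq0_const nat_poly_neq0'); have /polyP /(_ i) := D0.
    by rewrite /dY coef_map_id0 ?linear0 // coef0.
  apply: ng; exists (\poly_(i < size S) S`_i`_0).
    have h : (\poly_(i < size S) S`_i`_0)`_(size S).-1 != 0.
      rewrite coef_poly prednK ?size_poly_gt0 // leqnn.
      apply: contraNneq S0 => h; rewrite -lead_coef_eq0 lead_coefE cst h; exact/eqP.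
    by apply: contraNneq h => ->; rewrite coef0.
  have -> : phi g (\poly_(i < size S) S`_i`_0) = ev2 f g S; last by [].
  rewrite ev2E poly_def rmorph_sum; apply: eq_bigr => i _ /=.
  by rewrite -mul_polyC rmorphM rmorphXn /= phiC phiX [in RHS]cst phiC.
- apply/eqP => E; have D0 : S^`() = 0.
    apply/eqP/negPn/negP => D0; have : Q1 (size S^`()) by apply/asboolP; exists S^`().
    by move/min1; have := lt_size_deriv S0; have := sS; lia.
  have := deriv_eq0_const nat_poly_neq0 D0 => SE; apply: nf; exists S`_0; last by rewrite -(ev2C f g) -SE.
  by apply: contraNneq S0 => h; rewrite SE h; exact/eqP.
Qed.
End Dependence.

Lemma bin2D m n : 'C(m + n, 2) = ('C(m, 2) + 'C(n, 2) + m * n)%N.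
Proof. by elim: n => [|n IH]; [by rewrite addn0 muln0 bin0n /= !addn0|]; rewrite addnS !binS !bin1 IH mulnS;
  lia. Qed.

Section DCase.
Variable R : realType.
Local Notation C := R[i].
Implicit Types (f g F G y : ps C) (K M b : R).

(** * The divergent case *)

Section Weights.
Variable b : R.
Hypothesis b1 : 1 < b.
Definition qw b n : R := b ^+ 'C(n, 2).
Local Notation w := (qw b).
Let b0 : 0 < b. Proof. exact: lt_trans ltr01 b1. Qed.
Lemma qw_ge1 n : 1 <= w n. Proof. by rewrite /qw exprn_ege1 // ltW. Qed.
Lemma qw_gt0 n : 0 < w n. Proof. exact: lt_le_trans (qw_ge1 n). Qed.
Lemma qw_mono m n : (m <= n)%N -> w m <= w n.
Proof. by move=> mn; rewrite /qw ler_eXn2l // leq_bin2l. Qed.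
Lemma qwM i j : w i * w j <= w (i + j)%N.
Proof. by rewrite /qw -exprD bin2D ler_eXn2l // leq_addr. Qed.
Lemma qwD m n : w (m + n)%N = w m * w n * b ^+ (m * n).
Proof. by rewrite /qw -!exprD bin2D. Qed.
Lemma qwS n : w n.+1 <= b ^+ n.+1 * w n.
Proof. by rewrite -exprD ler_eXn2l // binS bin1; lia. Qed.
(** ['C(k, 2)] is convex, so in a convolution the products of extreme terms dominate those of inner
    terms. *)
Lemma qw_convex a k n : (a <= k)%N -> (a + k <= n)%N -> w k * w (n - k)%N <= w a * w (n - a)%N.
Proof.
move=> ak akn; have [i Ei] : exists i, k = (a + i)%N by exists (k - a)%N; lia.
have [j Ej] : exists j, n = (a + i + (a + j))%N by exists (n - (a + i) - a)%N; lia.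
rewrite {}Ej {}Ei /qw -!exprD ler_eXn2l //.
have -> : (a + i + (a + j) - (a + i) = a + j)%N by lia.
have -> : (a + i + (a + j) - a = a + (i + j))%N by lia.
by rewrite !bin2D; nia.
Qed.

(* Growth at most that of [f], and growth at most that of the tail [f_(n-s-1)], up to geometric factors. *)
Definition gev K F := exists M, forall n, nm (F n) <= M * K ^+ n * w n.
Definition err K s F := exists M, forall n, nm (F n) <= M * K ^+ n * w (n - s.+1).

Lemma gev_ge0 K F M : (forall n, nm (F n) <= M * K ^+ n * w n) -> 0 <= M.
Proof. by move=> /(_ 0%N) H; have := le_trans (nm_ge0 _) H; rewrite expr0 mulr1 pmulr_lge0 ?qw_gt0. Qed.
Lemma err_ge0 K s F M : (forall n, nm (F n) <= M * K ^+ n * w (n - s.+1)) -> 0 <= M.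
Proof. by move=> /(_ 0%N) H; have := le_trans (nm_ge0 _) H; rewrite expr0 mulr1 pmulr_lge0 ?qw_gt0. Qed.
Lemma powK_le K K' n : 1 <= K -> K <= K' -> K ^+ n <= K' ^+ n.
Proof. by move=> K1 KK; apply: lerXn2r => //; rewrite nnegrE; lra. Qed.
Lemma gev_le K K' F : 1 <= K -> K <= K' -> gev K F -> gev K' F.
Proof.
move=> K1 KK [M H]; exists M => n; apply: le_trans (H n) _; apply: ler_wpM2r; first exact: ltW (qw_gt0 _).
by apply: ler_wpM2l; [exact: gev_ge0 H | exact: powK_le].
Qed.
Lemma err_le K K' s F : 1 <= K -> K <= K' -> err K s F -> err K' s F.
Proof.
move=> K1 KK [M H]; exists M => n; apply: le_trans (H n) _; apply: ler_wpM2r; first exact: ltW (qw_gt0 _).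
by apply: ler_wpM2l; [exact: err_ge0 H | exact: powK_le].
Qed.
Section FixK.
Variable K : R.
Hypothesis K1 : 1 <= K.
Let K0 : 0 < K. Proof. exact: lt_le_trans ltr01 K1. Qed.
Lemma gevD F G : gev K F -> gev K G -> gev K (F + G).
Proof.
move=> [M H] [M' H']; exists (M + M') => n; apply: le_trans (nmD _ _) _.
by rewrite !mulrDl; apply: lerD.
Qed.
Lemma errD s F G : err K s F -> err K s G -> err K s (F + G).
Proof.
move=> [M H] [M' H']; exists (M + M') => n; apply: le_trans (nmD _ _) _.
by rewrite !mulrDl; apply: lerD.
Qed.
Lemma errC s (c : C) F : err K s F -> err K s (pp c%:P * F).
Proof.
move=> [M H]; exists (nm c * M) => n; rewrite psCM nmM -!mulrA; apply: ler_wpM2l; first exact: nm_ge0.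
by rewrite mulrA.
Qed.
Lemma errN s F : err K s F -> err K s (- F).
Proof. by move=> [M H]; exists M => n; rewrite psN nmN. Qed.
Lemma psX1M F n : (psX _ * F) n = if n is n'.+1 then F n' else 0.
Proof. by have := psXnM 1 F n; rewrite expr1 => ->; case: n => // n; rewrite subn1. Qed.
Lemma errX s F : err K s F -> err K s (psX _ * F).
Proof.
move=> [M H]; have M0 := err_ge0 H; exists M => -[|n]; rewrite psX1M.
  by rewrite nm0 !mulr_ge0 // ?exprn_ge0 ?ltW ?qw_gt0.
apply: le_trans (H n) _; apply: ler_pM.
- by rewrite mulr_ge0 // exprn_ge0 // ltW.
- by rewrite ltW ?qw_gt0.
- by apply: ler_wpM2l => //; rewrite ler_weXn2l.
- by apply: qw_mono; lia.
Qed.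
Lemma errM s p F : err K s F -> err K s (pp p * F).
Proof.
move=> H; elim/poly_ind: p => [|p c IH]; first by rewrite rmorph0 mul0r -(mul0r F) -(rmorph0 (@pp C)) -polyC0;
  exact: errC.
rewrite rmorphD rmorphM /= mulrDl; apply: errD; last exact: errC.
by rewrite -mulrA mulrCA; exact: errX.
Qed.
Lemma err_pp s p : err K s (pp p).
Proof.
rewrite -[pp p]mulr1; apply: errM; exists 1 => n; rewrite mul1r ps1.
have h : 1 <= K ^+ n * w (n - s.+1) by have := exprn_ege1 n K1; have := qw_ge1 (n - s.+1) => ? ?;
  rewrite -[leLHS]mulr1; apply: ler_pM.
by case: eqP => _; rewrite ?nm1 ?nm0 //; apply: le_trans h.
Qed.
Lemma err_shift s F : gev K F -> err K s (psX _ ^+ s.+1 * F).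
Proof.
move=> [M H]; have M0 := gev_ge0 H; exists M => n; rewrite psXnM; case: ltnP => h.
  by rewrite nm0 !mulr_ge0 // ?exprn_ge0 ?ltW ?qw_gt0.
apply: le_trans (H _) _; apply: ler_wpM2r; first by rewrite ltW ?qw_gt0.
by apply: ler_wpM2l => //; rewrite ler_weXn2l // leq_subr.
Qed.
Lemma gev_pp p : gev K (pp p).
Proof.
have [M H] := err_pp 0 p; exists M => n; apply: le_trans (H n) _; apply: ler_wpM2l.
  by rewrite mulr_ge0 ?(err_ge0 H) // exprn_ge0 // ltW.
by apply: qw_mono; lia.
Qed.
Lemma nat_exp2 n : n.+1%:R <= 2 ^+ n :> R.
Proof. by rewrite -natrX ler_nat ltn_expl. Qed.
Lemma gevM F G : gev K F -> gev K G -> gev (2 * K) (F * G).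
Proof.
move=> [M H] [M' H']; exists (M * M') => n.
have M0 := gev_ge0 H; have M0' := gev_ge0 H'.
apply: le_trans (nmM_conv _ _ _) _; apply: le_trans (_ : \sum_(k < n.+1) M * M' * K ^+ n * w n <= _).
  apply: ler_sum => k _; have kn : (k <= n)%N by rewrite -ltnS.
  have h := qwM k (n - k); rewrite subnKC // in h.
  have -> : M * M' * K ^+ n * w n = (M * M' * (K ^+ k * K ^+ (n - k))) * w n by rewrite -exprD subnKC.
  apply: le_trans (ler_pM (nm_ge0 _) (nm_ge0 _) (H k) (H' (n - k)%N)) _.
  have -> : M * K ^+ k * w k * (M' * K ^+ (n - k) * w (n - k)%N) = M * M' * (K ^+ k * K ^+ (n - k)) * (w k * w
    (n - k)%N) by ring.
  by apply: ler_wpM2l => //; rewrite !mulr_ge0 // ?exprn_ge0 // ltW.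
rewrite sumr_const card_ord -[_ *+ n.+1]mulr_natl.
have -> : M * M' * (2 * K) ^+ n * w n = 2 ^+ n * (M * M' * K ^+ n * w n) by rewrite exprMn; ring.
by apply: ler_wpM2r (nat_exp2 n); rewrite !mulr_ge0 // ?exprn_ge0 // ltW ?qw_gt0.
Qed.
(** The product of two tails is of second order: by convexity each of its terms is at most
    [w s.+1 * w (n - s.+1)]. The number of terms goes into the factor 2 on [K]. *)
Lemma err_tails s F G : gev K F -> gev K G -> (forall k, (k <= s)%N -> F k = 0) -> (forall k, (k <= s)%N ->
  G k = 0) ->
  err (2 * K) s (F * G).
Proof.
move=> [M H] [M' H'] F0 G0; exists (M * M' * w s.+1) => n.
have M0 := gev_ge0 H; have M0' := gev_ge0 H'.
have rhs0 : 0 <= M * M' * K ^+ n * (w s.+1 * w (n - s.+1)).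
  by rewrite !mulr_ge0 // ?exprn_ge0 // ltW ?qw_gt0.
apply: le_trans (nmM_conv _ _ _) _; apply: le_trans (_ : \sum_(k < n.+1) M * M' * K ^+ n * (w s.+1 * w (n -
  s.+1)) <= _).
  apply: ler_sum => k _; have kn : (k <= n)%N by rewrite -ltnS.
  case: (leqP k s) => ks; first by rewrite F0 // nm0 mul0r.
  case: (leqP (n - k) s) => nks; first by rewrite G0 // nm0 mulr0.
  have h : w k * w (n - k)%N <= w s.+1 * w (n - s.+1) by apply: qw_convex; lia.
  have -> : M * M' * K ^+ n * (w s.+1 * w (n - s.+1)) = (M * M' * (K ^+ k * K ^+ (n - k))) * (w s.+1 * w (n -
    s.+1)) by rewrite -exprD subnKC.
  apply: le_trans (ler_pM (nm_ge0 _) (nm_ge0 _) (H k) (H' (n - k)%N)) _.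
  have -> : M * K ^+ k * w k * (M' * K ^+ (n - k) * w (n - k)%N) = M * M' * (K ^+ k * K ^+ (n - k)) * (w k * w
    (n - k)%N) by ring.
  by apply: ler_wpM2l => //; rewrite !mulr_ge0 // ?exprn_ge0 // ltW.
rewrite sumr_const card_ord -[_ *+ n.+1]mulr_natl.
have -> : M * M' * w s.+1 * (2 * K) ^+ n * w (n - s.+1) = 2 ^+ n * (M * M' * K ^+ n * (w s.+1 * w (n - s.+1)))
  by rewrite exprMn; ring.
exact: ler_wpM2r (nat_exp2 n).
Qed.
End FixK.

Variables (f g : ps C) (K0 : R).
Hypotheses (K01 : 1 <= K0) (gf : gev K0 f) (gg : gev K0 g).
(* First-order Taylor expansion: the coefficients [F_n] are those of [A f + B g] up to terms of the size of [f_(n-s-1)]. *)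
Definition der F A B := exists K, [/\ 1 <= K, gev K F &
  forall s, err K s (F - pp (trunc s.+1 A) * f - pp (trunc s.+1 B) * g)].

Lemma trunc0 s : trunc s (0 : ps C) = 0.
Proof. by apply/polyP => i; rewrite coef_poly coef0; case: ifP. Qed.
Lemma trunc1 s : trunc s.+1 (1 : ps C) = 1.
Proof. by apply/polyP => i; rewrite coef_poly coef1 ps1; case: i => [|i] //=; case: ifP. Qed.
Lemma truncD s F G : trunc s (F + G) = trunc s F + trunc s G.
Proof. by apply/polyP => i; rewrite coefD !coef_poly; case: ifP; rewrite ?addr0. Qed.
Lemma der_pp p : der (pp p) 0 0.
Proof.
exists K0; split=> // [|s]; first exact: gev_pp.
by rewrite trunc0 rmorph0 !mul0r !subr0; exact: err_pp.
Qed.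
Lemma der_f : der f 1 0.
Proof.
exists K0; split=> // s; rewrite trunc0 trunc1 rmorph0 rmorph1 mul0r mul1r subr0 subrr -(rmorph0 (@pp C)).
exact: err_pp.
Qed.
Lemma der_g : der g 0 1.
Proof.
exists K0; split=> // s; rewrite trunc0 trunc1 rmorph0 rmorph1 mul0r mul1r subr0 subrr -(rmorph0 (@pp C)).
exact: err_pp.
Qed.
Lemma derD F A B F' A' B' : der F A B -> der F' A' B' -> der (F + F') (A + A') (B + B').
Proof.
move=> [K [K1 gF eF]] [K' [K1' gF' eF']]; exists (K + K').
have h1 : K <= K + K' by lra. have h2 : K' <= K + K' by lra.
split=> [||s]; first by lra.
  by apply: gevD; [apply: gev_le h1 gF | apply: gev_le h2 gF'].
have := errD (err_le K1 h1 (eF s)) (err_le K1' h2 (eF' s)); congr (err _ _ _).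
by rewrite !truncD !rmorphD /=; ring.
Qed.
Lemma trunc_mul s F A F' A' : exists r, trunc s.+1 F * trunc s.+1 A' + trunc s.+1 F' * trunc s.+1 A =
  trunc s.+1 (F * A' + F' * A) + r * 'X^(s.+1).
Proof.
set p := _ + _; exists (drop_poly s.+1 p); rewrite -[LHS](poly_take_drop s.+1); congr (_ + _).
apply/polyP => i; rewrite coef_poly /take_poly coef_poly; case: ltnP => // h.
by rewrite psD coefD -!(ps_mul_trunc _ _ h).
Qed.
Lemma derM F A B F' A' B' : der F A B -> der F' A' B' -> der (F * F') (F * A' + F' * A) (F * B' + F' * B).
Proof.
move=> [K [K1 gF eF]] [K' [K1' gF' eF']]; pose Km := K0 + K + K'; exists (2 * Km).
have p0 : 0 <= K0 by exact: le_trans ler01 K01.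
have p1 : 0 <= K by exact: le_trans ler01 K1.
have p2 : 0 <= K' by exact: le_trans ler01 K1'.
have h0 : K0 <= Km by rewrite /Km -addrA lerDl addr_ge0.
have h1 : K <= Km by rewrite /Km addrAC lerDr addr_ge0.
have h2 : K' <= Km by rewrite /Km lerDr addr_ge0.
have Km1 : 1 <= Km by exact: le_trans K01 h0.
have K2m : Km <= 2 * Km by rewrite mulr_natl mulr2n lerDl; exact: le_trans ler01 Km1.
have K2m1 : 1 <= 2 * Km by exact: le_trans Km1 K2m.
clearbody Km.
have gmF := gev_le K1 h1 gF; have gmF' := gev_le K1' h2 gF'.
split=> // [|s]; first exact: gevM.
have [r Er] := trunc_mul s F A F' A'; have [r' Er'] := trunc_mul s F B F' B'.
set L := pp (trunc s.+1 F); set L' := pp (trunc s.+1 F').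
pose E := F - pp (trunc s.+1 A) * f - pp (trunc s.+1 B) * g.
pose E' := F' - pp (trunc s.+1 A') * f - pp (trunc s.+1 B') * g.
have pr := congr1 (@pp C) Er; have pr' := congr1 (@pp C) Er'.
rewrite !rmorphD !rmorphM /= -/L -/L' in pr pr'.
(* From FF' = LF' + L'F - LL' + (F - L)(F' - L'): the linear parts carry the given errors, LL' is a
   polynomial, and the last product is one of two tails. The terms with [r] and [r'] repair the
   truncation of the new derivatives. *)
have -> : F * F' - pp (trunc s.+1 (F * A' + F' * A)) * f - pp (trunc s.+1 (F * B' + F' * B)) * g =
  pp r * (pp 'X^(s.+1) * f) + pp r' * (pp 'X^(s.+1) * g) + L * E' + L' * E - L * L' + (F - L) * (F' - L').
  have -> : pp (trunc s.+1 (F * A' + F' * A)) = L * pp (trunc s.+1 A') + L' * pp (trunc s.+1 A) - pp r * pp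
    'X^(s.+1) by rewrite pr; ring.
  have -> : pp (trunc s.+1 (F * B' + F' * B)) = L * pp (trunc s.+1 B') + L' * pp (trunc s.+1 B) - pp r' * pp
    'X^(s.+1) by rewrite pr'; ring.
  by rewrite /E /E'; ring.
have tail H : (forall k, (k <= s)%N -> (H - pp (trunc s.+1 H)) k = 0).
  by move=> k ks; rewrite psB /pp coef_poly ltnS ks subrr.
have gL H : gev Km H -> gev Km (H - pp (trunc s.+1 H)).
  by move=> gH; apply: gevD => //; rewrite -rmorphN; exact: gev_pp.
have eX H : gev K0 H -> err (2 * Km) s (pp 'X^(s.+1) * H).
  by move=> gH; rewrite rmorphXn /= -/(psX C); apply: err_shift => //; apply: gev_le gH => //;
    exact: le_trans h0 K2m.
apply: errD; last by apply: (err_tails Km1 (gL _ gmF) (gL _ gmF')); exact: tail.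
apply: errD; last by apply: errN; rewrite /L /L' -rmorphM; exact: err_pp.
apply: errD; last by apply: errM => //; apply: err_le (eF s) => //; exact: le_trans h1 K2m.
apply: errD; last by apply: errM => //; apply: err_le (eF' s) => //; exact: le_trans h2 K2m.
by apply: errD; apply: errM => //; exact: eX.
Qed.

Lemma der_phi c : der (phi f c) (phi f c^`()) 0.
Proof.
elim/poly_ind: c => [|c a IH]; first by rewrite linear0 rmorph0 -(rmorph0 (@pp C)); rewrite {2 3}rmorph0;
  exact: der_pp.
have := derD (derM IH der_f) (der_pp a).
rewrite derivD derivM derivX derivC addr0 mulr1 !rmorphD !rmorphM /= !phiX !phiC addr0 mulr1.
have -> : phi f c^`() * f + phi f c + pp 0 = phi f c + f * phi f c^`() by rewrite rmorph0; ring.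
by rewrite !mulr0 addr0.
Qed.
Lemma der_ev2 P : der (ev2 f g P) (ev2 f g (dY P)) (ev2 f g P^`()).
Proof.
elim/poly_ind: P => [|P c IH].
  by rewrite /dY map_poly0 linear0 !rmorph0; have := der_pp 0; rewrite rmorph0.
have := derD (derM IH der_g) (der_phi c).
have -> : dY (P * 'X + c%:P) = dY P * 'X + c^`()%:P.
  apply/polyP => i; rewrite /dY coef_map_id0 ?linear0 // !coefD !coefMX !coefC.
  by case: i => [|i] /=; rewrite ?add0r ?addr0 // coef_map_id0 ?linear0.
rewrite derivD derivM derivX derivC addr0 mulr1 !rmorphD !rmorphM /= !ev2X !ev2C.
have -> : ev2 f g (dY P) * g + phi f c^`() = ev2 f g P * 0 + g * ev2 f g (dY P) + phi f c^`() by ring.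
by have -> : ev2 f g P^`() * g + ev2 f g P + phi f 0 = ev2 f g P * 1 + g * ev2 f g P^`() by rewrite rmorph0;
  ring.
Qed.
End Weights.
End DCase.

(** * The quotient of two dependent divergent series *)

Section DCase.
Variable R : realType.
Local Notation C := R[i].
Implicit Types (f g F G y : ps C) (K M b : R).

Lemma trunc_mul_coef (A : ps C) F m n : (m <= n.+1)%N ->
  (pp (trunc m A) * F) n = \sum_(i < m) A i * F (n - i)%N.
Proof.
move=> mn; rewrite psM_poly; last by apply: leq_trans (size_poly _ _) mn.
rewrite -!(big_mkord xpredT (fun i => (trunc m A)`_i * F (n - i)%N)) -(big_mkord xpredT (fun i =>
  A i * F (n - i)%N)).
rewrite [RHS](big_cat_nat (leq0n _) (size_poly m A)) /= [X in _ = _ + X]big_nat [X in _ = _ + X]big1 ?addr0.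
  rewrite !big_nat; apply: eq_bigr => i /andP[_ h].
  by rewrite coef_poly (leq_trans h (size_poly m A)).
move=> i /andP[h1 h2]; have : (trunc m A)`_i = 0 by rewrite nth_default.
by rewrite coef_poly h2 => ->; rewrite mul0r.
Qed.

Lemma bounded_rec (a : nat -> R) L N0 c2 : 0 <= c2 ->
  (forall m B, (N0 <= m)%N -> (forall i, (i < L)%N -> a (m - i.+1)%N <= B) -> 0 <= B -> a m <= c2 + B / 2) ->
  exists B, 0 <= B /\ forall m, a m <= B.
Proof.
move=> c20 H; exists (\sum_(i < N0) `|a i| + 2 * c2).
have S0 : 0 <= \sum_(i < N0) `|a i| by apply: sumr_ge0.
have B0 : 0 <= \sum_(i < N0) `|a i| + 2 * c2 by lra.
split=> // m; have [k] := ubnP m; elim: k m => // k IH m mk; case: (ltnP m N0) => mN.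
  rewrite (bigD1 (Ordinal mN)) //=; have := ler_norm (a m).
  have : 0 <= \sum_(i < N0 | i != Ordinal mN) `|a i| by apply: sumr_ge0. lra.
(* At index 0 the truncated subtraction makes the recurrence refer to [a 0] itself. *)
case: m mk mN => [|m] mk mN.
  have N00 : N0 = 0%N by lia.
  have := H 0%N (Num.max 0 (a 0%N)); rewrite N00 => /(_ (leqnn _)).
  set T := Num.max 0 (a 0%N); have T0 : 0 <= T by rewrite /T le_max lexx.
  have aT : a 0%N <= T by rewrite /T le_max lexx orbT.
  have TE : T = 0 \/ T = a 0%N by rewrite /T; case: (leP 0 (a 0%N)); [right|left].
  by move=> /(_ (fun i _ => aT) T0); rewrite N00 in S0 *; case: TE => ->; lra.
have h : forall i, (i < L)%N -> a (m.+1 - i.+1)%N <= \sum_(i < N0) `|a i| + 2 * c2.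
  by move=> i _; apply: IH; lia.
by have := H _ _ mN h B0; lra.
Qed.

(** Feedback coefficients that tend to 0 keep the solution bounded, whereupon it follows its
    inhomogeneous term. *)
Lemma rec_limit (U T : nat -> C) L (be : nat -> nat -> C) l : tends T l -> (forall i, (i < L)%N ->
  tends (be i) 0) ->
  (exists N0, forall N, (N0 <= N)%N -> U N = T N - \sum_(i < L) be i N * U (N - i.+1)%N) -> tends U l.
Proof.
move=> Tl bl [N0 HN0]; have [c2 Hc2] := seq_bounded Tl.
have c20 : 0 <= c2 by apply: le_trans (Hc2 0%N); exact: nm_ge0.
have [N1 HN1] : exists N1, forall i N, (i < L)%N -> (N1 <= N)%N -> nm (be i N) <= (2 * L.+1%:R)^-1.
  have p : 0 < (2 * L.+1%:R)^-1 :> R by rewrite invr_gt0 mulr_gt0 // ltr0n.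
  suff gen L' : (forall i, (i < L')%N -> tends (be i) 0) ->
    exists N1, forall i N, (i < L')%N -> (N1 <= N)%N -> nm (be i N) <= (2 * L.+1%:R)^-1 by exact: gen.
  elim: L' => [|L' IH] bl'; first by exists 0%N.
  have [|N1 H1] := IH; first by move=> i iL; apply: bl'; exact: ltnW.
  have /tendsP /(_ _ p) [N2 H2] := bl' L' (ltnSn _); exists (maxn N1 N2) => i N;
    rewrite geq_max ltnS leq_eqVlt => /orP[/eqP ->|h] /andP[h1 h2].
    by have := H2 N h2; rewrite subr0 => /ltW.
  exact: H1.
have [B [B0 HB]] : exists B, 0 <= B /\ forall m, nm (U m) <= B.
  apply: (@bounded_rec (fun m => nm (U m)) L (maxn N0 N1) c2) => // m B; rewrite geq_max => /andP[h0 h1] HB B0.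
  rewrite HN0 //; apply: le_trans (nmD _ _) _; rewrite nmN; apply: lerD => //.
  apply: le_trans (nm_sum _ _ _) _; apply: le_trans (_ : \sum_(i < L) (2 * L.+1%:R)^-1 * B <= _).
    apply: ler_sum => i _; rewrite nmM; apply: ler_pM; rewrite ?nm_ge0 //; [exact: HN1 | exact: HB].
  rewrite sumr_const card_ord -[_ *+ L]mulr_natl invfM.
  have -> : L%:R * (2^-1 * L.+1%:R^-1 * B) = (L%:R / L.+1%:R) * (B / 2) by ring.
  rewrite -[leRHS]mul1r; apply: ler_wpM2r; first by rewrite divr_ge0.
  by rewrite ler_pdivrMr ?ltr0n // mul1r ler_nat.
have h : tends (fun N => T N - \sum_(i < L) be i N * U (N - i.+1)%N) (l - \sum_(i < L) 0).
  apply: flimD => //; apply: flimN; apply: flim_sum => i; apply/tendsP => e e0.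
  have e'0 : 0 < e / (B + 1) by rewrite divr_gt0 //; lra.
  have /tendsP /(_ _ e'0) [N2 H2] := bl i (ltn_ord i); exists N2 => N h2; rewrite subr0 nmM.
  have := H2 N h2; rewrite subr0 ltr_pdivlMr; last by lra.
  apply: le_lt_trans; apply: ler_pM; rewrite ?nm_ge0 //; have := HB (N - i.+1)%N; lra.
rewrite big1 ?subr0 in h; last by [].
by apply: tends_near h _; exists N0 => N hN; rewrite HN0.
Qed.

Section Main.
Variables (f g : ps C) (be c0 : C).
Hypotheses (f0 : forall n, f n != 0) (be0 : be != 0) (be1 : nm be < 1) (c00 : c0 != 0).
Hypothesis fr : tends (fun n => f n.+1 / f n * be ^+ n) c0.
Local Notation b := (nm be)^-1.
Local Notation w := (qw b).
Let nb : 0 < nm be. Proof. by rewrite nm_gt0. Qed.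
Let b1 : 1 < b. Proof. by rewrite invf_gt1. Qed.

Let w0E : w 0 = 1. Proof. by rewrite /qw bin0n. Qed.

Lemma divergent_upper : exists K M, 1 <= K /\ forall n, nm (f n) <= M * K ^+ n * w n.
Proof.
have [k Hk] := seq_bounded fr; exists (Num.max 1 k), (nm (f 0%N)); split; first by rewrite le_max lexx.
elim=> [|n IH]; first by rewrite w0E expr0 !mulr1.
have E : nm (f n.+1) = nm (f n.+1 / f n * be ^+ n) * b ^+ n * nm (f n).
  rewrite !nmM nmV nmX exprVn; field; by rewrite !gt_eqF ?exprn_gt0 ?nm_gt0.
rewrite E (_ : w n.+1 = b ^+ n * w n); last by rewrite /qw -exprD binS bin1 addnC.
have -> : nm (f 0%N) * Num.max 1 k ^+ n.+1 * (b ^+ n * w n) = Num.max 1 k * b ^+ n * (nm (f 0%N) * Num.max 1 k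
  ^+ n * w n) by rewrite exprS; ring.
apply: ler_pM => //; [by rewrite mulr_ge0 ?nm_ge0 // exprn_ge0 // invr_ge0 ltW | exact: nm_ge0 |].
apply: ler_wpM2r; first by rewrite exprn_ge0 // invr_ge0 ltW.
by apply: le_trans (Hk n) _; rewrite le_max lexx orbT.
Qed.
Lemma divergent_lower : exists k, 0 < k /\ forall n, nm (f 0%N) * k ^+ n * w n <= nm (f n).
Proof.
have [|k [k0 Hk]] := seq_bounded_below fr c00.
  by move=> n; rewrite !mulf_neq0 ?invr_eq0 // expf_neq0.
exists k; split=> //; elim=> [|n IH]; first by rewrite w0E expr0 !mulr1.
have -> : nm (f n.+1) = nm (f n.+1 / f n * be ^+ n) * b ^+ n * nm (f n).
  rewrite !nmM nmV nmX exprVn; field; by rewrite !gt_eqF ?exprn_gt0 ?nm_gt0.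
rewrite (_ : w n.+1 = b ^+ n * w n); last by rewrite /qw -exprD binS bin1 addnC.
have -> : nm (f 0%N) * k ^+ n.+1 * (b ^+ n * w n) = k * b ^+ n * (nm (f 0%N) * k ^+ n * w n) by rewrite exprS;
  ring.
have bn : 0 <= b ^+ n by rewrite exprn_ge0 // invr_ge0 ltW.
apply: ler_pM => //; [by rewrite mulr_ge0 // ltW | | exact: ler_wpM2r].
apply: mulr_ge0; last exact: ltW (qw_gt0 b1 n).
by rewrite mulr_ge0 ?nm_ge0 // exprn_ge0 // ltW.
Qed.
Lemma divergent_back i m : (0 < i)%N -> tends (fun N => f (N + m - i)%N / f (N + m)%N) 0.
Proof.
have inv0 : tends (fun n => f n / f n.+1) 0.
  have h : tends (fun n => be ^+ n * (f n.+1 / f n * be ^+ n)^-1) (0 * c0^-1).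
    by apply: flimM; [exact: tends_expr | exact: flimV].
  rewrite mul0r in h; apply: tends_ext h _ => n; have := f0 n; have := f0 n.+1 => h1 h2.
  by field; rewrite h1 h2 expf_neq0.
case: i => // i _; elim: i m => [|i IH] m.
  apply: (@tends_near _ (fun N => f (N + m - 1)%N / f (N + m - 1).+1)).
    apply/tendsP => e e0; have /tendsP /(_ e e0) [N0 HN] := inv0; exists N0.+1 => N h; apply: HN; lia.
  by exists 1%N => N h; congr (_ / f _); lia.
have h : tends (fun N => (f (N + m - 1 - i.+1)%N / f (N + m - 1)%N) * (f (N + m - 1)%N / f (N + m)%N)) (0 * 0).
  apply: flimM.
    case: m => [|m].
      apply/tendsP => e e0; have /tendsP /(_ e e0) [N0 HN] := IH 0%N; exists N0.+1 => N h.
      by have := HN N.-1; rewrite !addn0 -subn1; apply; lia.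
    by apply: tends_ext (IH m) _ => N; rewrite addnS subn1.
  apply: (@tends_near _ (fun N => f (N + m - 1)%N / f (N + m - 1).+1)).
    apply/tendsP => e e0; have /tendsP /(_ e e0) [N0 HN] := inv0; exists N0.+1 => N h; apply: HN; lia.
  by exists 1%N => N h; congr (_ / f _); lia.
rewrite mul0r in h; apply: tends_ext h _ => N; rewrite mulrA divfK //.
by congr (f _ / _); lia.
Qed.

(** The error at index N + d has the size of [w (N - t.+1)]. Being [t.+1] indices behind [f (N + u)]
    gains a factor of order [b ^+ t.+1] per unit of N, which beats the geometric loss [K / k]. *)
Lemma divergent_err (k K Me : R) (E : ps C) d t u : 0 < k ->
  (forall n, nm (f 0%N) * k ^+ n * w n <= nm (f n)) ->
  0 < K -> K / k < b ^+ t.+1 -> (forall n, nm (E n) <= Me * K ^+ n * w (n - (d + t).+1)) ->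
  tends (fun N => E (N + d)%N / f (N + u)%N) 0.
Proof.
move=> k_0 Hk K_0 Ht HMe.
have bt0 : 0 < b ^+ t.+1 by rewrite exprn_gt0 // (lt_trans ltr01 b1).
pose x := K / k / b ^+ t.+1.
have x0 : 0 <= x by rewrite !divr_ge0 // ltW.
have x1 : x < 1 by rewrite /x ltr_pdivrMr // mul1r.
have Me0 : 0 <= Me.
  by have := le_trans (nm_ge0 _) (HMe 0%N); rewrite expr0 mulr1 pmulr_lge0 ?qw_gt0.
pose cst := Me * K ^+ d / (nm (f 0%N) * k ^+ u) * (K / k) ^+ t.+1.
have cst0 : 0 <= cst.
  rewrite /cst; apply: mulr_ge0; last by rewrite exprn_ge0 // divr_ge0 // ltW.
  by rewrite divr_ge0 ?mulr_ge0 ?nm_ge0 // ?exprn_ge0 // ltW.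
have cst1 : 0 < cst + 1 by exact: ltr_wpDl.
apply/tendsP => e e0; have e'0 : 0 < e / (cst + 1) by rewrite divr_gt0.
have [N0 HN0] := expr_small x0 x1 e'0; exists (N0 + t.+1)%N => N hN; rewrite subr0.
have [m Em] : exists m, N = (t.+1 + m)%N by exists (N - t.+1)%N; clear -hN; lia.
have mN0 : (N0 <= m)%N by clear -hN Em; lia.
apply: (@le_lt_trans _ _ (cst * x ^+ m)); last first.
  apply: le_lt_trans (_ : (cst + 1) * x ^+ m < _); first by rewrite ler_wpM2r ?exprn_ge0 // lerDl.
  by rewrite mulrC -ltr_pdivlMr //; exact: HN0.
have fN0 : 0 < nm (f (N + u)%N) by rewrite nm_gt0.
rewrite nmM nmV ler_pdivrMr //.
have he : nm (E (N + d)%N) <= Me * K ^+ (N + d) * w m.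
  by have := HMe (N + d)%N; rewrite (_ : N + d - (d + t).+1 = m)%N //; clear -Em; lia.
apply: le_trans he _.
have hw : w m * (b ^+ t.+1) ^+ m <= w (N + u).
  apply: le_trans (_ : w N <= _); last by apply: qw_mono => //; exact: leq_addr.
  rewrite Em qwD -exprM; apply: ler_wpM2r; first by rewrite exprn_ge0 // ltW // (lt_trans ltr01 b1).
  by rewrite ler_peMl ?qw_ge1 // ltW ?qw_gt0.
apply: le_trans (_ : cst * x ^+ m * (nm (f 0%N) * k ^+ (N + u) * (w m * (b ^+ t.+1) ^+ m)) <= _); last first.
  apply: ler_wpM2l; first by rewrite mulr_ge0 // exprn_ge0.
  by apply: le_trans (Hk _); apply: ler_wpM2l => //; rewrite mulr_ge0 ?nm_ge0 // exprn_ge0 // ltW.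
rewrite le_eqVlt; apply/orP; left; apply/eqP; rewrite /cst /x Em.
set T := b ^+ t.+1 in bt0 *; rewrite !exprD !expr_div_n.
have a1 : k != 0 by rewrite gt_eqF.
have a2 : nm (f 0%N) != 0 by rewrite gt_eqF ?nm_gt0.
have a3 : T != 0 by rewrite gt_eqF.
clearbody T; field; by rewrite ?expf_neq0 ?a1 ?a2 ?a3.
Qed.

(** Let [v] and [u] be the orders of the two partial derivatives [A] and [B]. In the coefficient of
    index N + v + u of A f + B g the terms [A v * f (N + u)] and [B u * g (N + v)] lead, and the
    whole is negligible; hence the limit [- (A v / B u)]. [hensel] supplies the growth bound for [g]
    that the expansion requires. *)
Lemma divergent_ratio P : ev2 f g P = 0 -> ev2 f g (dY P) != 0 -> ev2 f g P^`() != 0 ->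
  exists v u (k : C), k != 0 /\ tends (fun N => g (N + v)%N / f (N + u)%N) k.
Proof.
move=> EP EA EB; have [K1 [M1 [K11 HK1]]] := divergent_upper; have [k [k0 Hk]] := divergent_lower.
have mf : maj w f by apply: (bound_maj (qw_ge1 b1) K11); exact: HK1.
have wS n : w n <= w n.+1 by exact: qw_mono.
have mphi c : maj w (phi f c).
  rewrite phiE; apply: (maj_sum (qw_ge1 b1)) => i; apply: (majM (qw_ge1 b1) (qwM b1)).
    exact: maj_pp (qw_ge1 b1) _.
  exact: (majX (qw_ge1 b1) (qwM b1)).
have mg : maj w g.
  have bb : 1 <= b by exact: ltW.
  apply: (@hensel _ w b (qw_ge1 b1) wS (qwM b1) bb (qwS b1) (map_poly (phi f) P)).
  - by move=> i; rewrite coef_map; exact: mphi.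
  - exact: EP.
  - by rewrite deriv_map; exact: EB.
have [K2 [M2 [K21 HK2]]] := maj_bound (qw_ge1 b1) mg.
pose K0 := K1 + K2.
have K10 : 0 <= K1 by exact: le_trans ler01 K11.
have K20 : 0 <= K2 by exact: le_trans ler01 K21.
have K1K0 : K1 <= K0 by rewrite /K0 lerDl.
have K2K0 : K2 <= K0 by rewrite /K0 lerDr.
have K01 : 1 <= K0 by exact: le_trans K11 K1K0.
have gf : gev b K0 f by apply: (gev_le b1 K11 K1K0); exists M1.
have gg : gev b K0 g by apply: (gev_le b1 K21 K2K0); exists M2.
have [K [K_1 _ HE]] := der_ev2 b1 K01 gf gg P; rewrite EP in HE.
set A := ev2 f g (dY P) in EA HE; set B := ev2 f g P^`() in EB HE.
have [v [Av Alt]] := ps_neq0P EA; have [u [Bu Blt]] := ps_neq0P EB.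
have [t Ht] : exists t, K / k < b ^+ t.+1.
  have [t Ht] := expr_big (K / k) b1; exists t; exact: Ht.
pose S := (v + u + t)%N; have [Me HMe] := HE S.
have [K_0 k_0] : 0 < K /\ 0 < k by split=> //; exact: lt_le_trans ltr01 K_1.
exists v, u, (- (A v / B u)); split; first by rewrite oppr_eq0 mulf_neq0 // invr_eq0.
pose e_ N := (pp (trunc S.+1 A) * f + pp (trunc S.+1 B) * g) (N + v + u)%N.
have E0 : tends (fun N => e_ N / f (N + u)%N) 0.
  have h := @divergent_err k K Me (pp (trunc S.+1 A) * f + pp (trunc S.+1 B) * g) (v + u) t u k_0 Hk K_0 Ht.
  apply: tends_ext (h _) _ => [n|N]; last by rewrite /e_ addnA.
  have := HMe n; rewrite -/S (_ : 0 - _ - _ = - (pp (trunc S.+1 A) * f + pp (trunc S.+1 B) * g)); last by ring.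
  by rewrite psN nmN.
have key N : (S.+1 <= N)%N -> g (N + v)%N / f (N + u)%N = - (B u)^-1 * (A v +
    \sum_(i < u + t) A (v + i.+1)%N * (f (N + u - i.+1)%N / f (N + u)%N) - e_ N / f (N + u)%N)
    - \sum_(i < v + t) (B (u + i.+1)%N / B u * (f (N + u - i.+1)%N / f (N + u)%N)) * (g (N - i.+1 + v)%N / f (N
      - i.+1 + u)%N).
  move=> SN; have eN : e_ N = A v * f (N + u)%N + \sum_(i < u + t) A (v + i.+1)%N * f (N + u - i.+1)%N +
      (B u * g (N + v)%N + \sum_(i < v + t) B (u + i.+1)%N * g (N + v - i.+1)%N).
    have one (Z h : ps C) (z l : nat) : (z + l).+1 = S.+1 -> (S <= N + v + u)%N -> (forall k, (k < z)%N ->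
      Z k = 0) ->
        (pp (trunc S.+1 Z) * h) (N + v + u)%N = Z z * h (N + v + u - z)%N + \sum_(i < l) Z (z + i.+1)%N * h (N
          + v + u - z - i.+1)%N.
      move=> zy SNN Z0; rewrite trunc_mul_coef; last by rewrite ltnS.
      rewrite -zy -addnS big_split_ord /= big1 ?add0r; last by move=> i _; rewrite Z0 ?mul0r.
      rewrite big_ord_recl /= addn0; congr (_ + _); apply: eq_bigr => i _.
      by rewrite /bump /= add1n subnDA.
    have c1 : (v + (u + t)).+1 = S.+1 by rewrite /S; clear; lia.
    have c2 : (u + (v + t)).+1 = S.+1 by rewrite /S; clear; lia.
    have c3 : (S <= N + v + u)%N by clear -SN; lia.
    rewrite /e_ psD (one A f v _ c1 c3 Alt) (one B g u _ c2 c3 Blt).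
    have -> : (N + v + u - v = N + u)%N by clear; lia.
    by have -> : (N + v + u - u = N + v)%N by clear; lia.
  have fn := f0 (N + u)%N.
  have -> : \sum_(i < v + t) (B (u + i.+1)%N / B u * (f (N + u - i.+1)%N / f (N + u)%N)) * (g (N - i.+1 + v)%N
    / f (N - i.+1 + u)%N)
     = (B u)^-1 * ((\sum_(i < v + t) B (u + i.+1)%N * g (N + v - i.+1)%N) / f (N + u)%N).
    rewrite !big_distrl big_distrr /=; apply: eq_bigr => i _; have iL := ltn_ord i.
    rewrite (_ : N - i.+1 + v = N + v - i.+1)%N; last by rewrite /S in SN; clear -SN iL; lia.
    rewrite (_ : N - i.+1 + u = N + u - i.+1)%N; last by rewrite /S in SN; clear -SN iL; lia.
    by field; rewrite Bu f0 f0.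
  have -> : \sum_(i < u + t) A (v + i.+1)%N * (f (N + u - i.+1)%N / f (N + u)%N) = (\sum_(i < u + t) A (v +
    i.+1)%N * f (N + u - i.+1)%N) / f (N + u)%N.
    by rewrite big_distrl; apply: eq_bigr => i _; rewrite mulrA.
  by rewrite eN; field; rewrite Bu f0.
apply: (@rec_limit _ (fun N => - (B u)^-1 * (A v + \sum_(i < u + t) A (v + i.+1)%N * (f (N + u - i.+1)%N / f (N
  + u)%N) - e_ N / f (N + u)%N))
   (v + t)%N (fun i N => B (u + i.+1)%N / B u * (f (N + u - i.+1)%N / f (N + u)%N)));
     last by exists S.+1 => N; exact: key.
  have h : tends (fun N => A v + \sum_(i < u + t) A (v + i.+1)%N * (f (N + u - i.+1)%N / f (N + u)%N) - e_ N /
    f (N + u)%N)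
     (A v + \sum_(i < u + t) A (v + i.+1)%N * 0 - 0).
    apply: flimD; last exact: flimN.
    apply: flimD; first exact: flim_cst.
    by apply: flim_sum => i; apply: flimM; [exact: flim_cst | exact: divergent_back].
  rewrite subr0 big1 ?addr0 in h; last by move=> i _; rewrite mulr0.
  have -> : - (A v / B u) = - (B u)^-1 * A v by rewrite mulNr mulrC.
  by apply: flimM => //; exact: flim_cst.
move=> i _; rewrite -(mulr0 (B (u + i.+1)%N / B u)); apply: flimM; [exact: flim_cst | exact: divergent_back].
Qed.
End Main.
End DCase.

(** * Incompatibility of the two recurrences *)

Section DEnd.
Variable R : realType.
Local Notation C := R[i].
Implicit Types (f g F G : ps C) (q z : C).

(** Two powers close to a common ultralimit have a quotient close to 1. *)
Lemma unit_recurrent q (e : R) N0 : nm q = 1 -> 0 < e -> exists N, (N0 <= N)%N /\ nm (q ^+ N - 1) < e.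
Proof.
move=> q1 e0; have [U [UU FU]] := ultra_ex; have PU := @ultra_proper _ _ UU.
have [|l Hl] := @ulim_ex R U UU (fun n => q ^+ n) 1.
  by apply: FU; exists 0%N => // n _ /=; rewrite nmX q1 expr1n.
have e2 : 0 < e / 2 by lra.
have [n Hn] := filter_ex (Hl _ e2); rewrite /= in Hn.
have far : U [set m | (n + N0 <= m)%N] by apply: FU; exists (n + N0)%N.
have [m [/= Hm nm_]] := filter_ex (filterI (Hl _ e2) far).
exists (m - n)%N; split; first by clear -nm_; lia.
have mn : (n <= m)%N by clear -nm_; lia.
have -> : nm (q ^+ (m - n) - 1) = nm (q ^+ m - q ^+ n).
  have -> : q ^+ m - q ^+ n = (q ^+ (m - n) - 1) * q ^+ n by rewrite mulrBl mul1r -exprD subnK.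
  by rewrite nmM nmX q1 expr1n mulr1.
have -> : q ^+ m - q ^+ n = (q ^+ m - l) + (l - q ^+ n) by ring.
apply: le_lt_trans (nmD _ _) _; rewrite [X in _ + X]nm_sym; lra.
Qed.

Lemma poly_val0 (V : {poly C}) : V != 0 -> exists e V', [/\ V = V' * 'X^e, V'.[0] != 0 & V' != 0].
Proof.
move=> V0; have [e [V' V'0 VE]] := multiplicity_XsubC V 0.
rewrite V0 /= in V'0; rewrite subr0 in VE; exists e, V'; split=> //.
by apply: contraNneq V'0 => ->; rewrite root0.
Qed.

Lemma pow_limit1 z (k : C) : k != 0 -> tends (fun n => z ^+ n) k -> z = 1.
Proof.
move=> k0 h; have h1 : tends (fun n => z ^+ n.+1) k by apply: (tends_sub (s := succn)) h.
have h2 : tends (fun n => z ^+ n.+1) (z * k).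
  by apply: (@tends_ext _ (fun n => z * z ^+ n)) => [|n]; [apply: flimM => //; exact: flim_cst | rewrite exprS].
by have := flim_unique _ h1 h2; rewrite -{1}[k]mul1r => E; apply/esym/(mulIf k0); apply: E.
Qed.

(** Consecutive quotients show that A2/B2 at q2^(N+v), times be^N, has a nonzero limit. For |q2| < 1
    the orders of [A2] and [B2] at 0 give a relation between [be] and [q2]. For |q2| = 1 it forces
    B2(q2^N) to tend to 0, while powers of [q2] return near 1, where [B2] does not vanish. *)
Lemma divergent_ratio_absurd f g (be c0 : C) (q2 : C) (A2 B2 : {poly C}) v u (k : C) : (forall n,
  f n != 0) -> be != 0 -> nm be < 1 -> c0 != 0 ->
  tends (fun n => f n.+1 / f n * be ^+ n) c0 -> hyp q2 A2 B2 g -> nm q2 <= 1 ->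
  (forall j : int, be * q2 ^ j != 1) -> k != 0 -> tends (fun N => g (N + v)%N / f (N + u)%N) k -> False.
Proof.
move=> f0 be0 be1 c00 fr Hg q21 ind k0 gf.
have g0 := hyp_neq0 Hg; have [q20 _ _ AB _] := Hg.
have R1 : tends (fun N => A2.[q2 ^+ (N + v)] / B2.[q2 ^+ (N + v)] * be ^+ N) (c0 / be ^+ u).
  have h1 : tends (fun N => g (N.+1 + v)%N / f (N.+1 + u)%N) k by apply: (tends_sub (s := succn)) gf.
  have h2 : tends (fun N => f (N + u).+1 / f (N + u)%N * be ^+ (N + u)) c0.
    by apply: (@tends_sub _ _ _ (fun N => N + u)%N) fr => n; exact: leq_addr.
  have h3 : tends (fun N => (g (N.+1 + v)%N / f (N.+1 + u)%N) * (g (N + v)%N / f (N + u)%N)^-1 *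
      (f (N + u).+1 / f (N + u)%N * be ^+ (N + u)) * be ^- u) (k * k^-1 * c0 * be ^- u).
    apply: flimM; last exact: flim_cst.
    by apply: flimM => //; apply: flimM => //; exact: flimV.
  rewrite divff // mul1r in h3; apply: tends_ext h3 _ => N.
  rewrite -(hyp_ratio _ Hg) !addSn exprD; field.
  by rewrite !f0 !g0 expf_neq0.
have c'0 : c0 / be ^+ u != 0 by rewrite mulf_neq0 // invr_eq0 expf_neq0.
have A0 : A2 != 0 by apply/eqP => E; have [+ _] := AB 0%N; rewrite E horner0 eqxx.
have B0 : B2 != 0 by apply/eqP => E; have [_ +] := AB 0%N; rewrite E horner0 eqxx.
have [q2u|q2l] := eqVneq (nm q2) 1; last first.
  have {}q21 : nm q2 < 1 by rewrite lt_neqAle q2l.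
  have [a [A' [EA A'0 _]]] := poly_val0 A0; have [b [B' [EB B'0 _]]] := poly_val0 B0.
  have tq : tends (fun N => q2 ^+ (N + v)) 0.
    by apply: (@tends_sub _ _ _ (fun N => N + v)%N) (tends_expr q21) => n; exact: leq_addr.
  have hA := tends_horner A' tq; have hB := tends_horner B' tq.
  have B'n n : B'.[q2 ^+ n] != 0 by have [_] := AB n; rewrite EB hornerM mulf_eq0 negb_or => /andP[].
  have A'n n : A'.[q2 ^+ n] != 0 by have [+ _] := AB n; rewrite EA hornerM mulf_eq0 negb_or => /andP[].
  pose z := be * q2 ^ (a%:Z - b%:Z).
  have hz : tends (fun N => z ^+ N) ((c0 / be ^+ u) * (A'.[0]^-1 * B'.[0]) * (q2 ^ (a%:Z - b%:Z)) ^- v).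
    have h : tends (fun N => (A2.[q2 ^+ (N + v)] / B2.[q2 ^+ (N + v)] * be ^+ N) * (A'.[q2 ^+ (N + v)]^-1 *
      B'.[q2 ^+ (N + v)]) * (q2 ^ (a%:Z - b%:Z)) ^- v)
      ((c0 / be ^+ u) * (A'.[0]^-1 * B'.[0]) * (q2 ^ (a%:Z - b%:Z)) ^- v).
      apply: flimM; last exact: flim_cst.
      by apply: flimM => //; apply: flimM => //; exact: flimV.
    apply: tends_ext h _ => N.
    have qab : q2 ^ (a%:Z - b%:Z) = q2 ^+ a / q2 ^+ b by rewrite expfzDr // -exprnN.
    have Ya x : (q2 ^+ (N + v)) ^+ x = (q2 ^+ x) ^+ N * (q2 ^+ x) ^+ v.
      by rewrite -!exprM -exprD; congr (_ ^+ _); rewrite mulnDl ![(_ * x)%N]mulnC.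
    have qa : q2 ^+ a != 0 by rewrite expf_neq0.
    have qb : q2 ^+ b != 0 by rewrite expf_neq0.
    have aN := A'n (N + v)%N; have bN := B'n (N + v)%N.
    rewrite EA EB !hornerM !hornerXn !Ya /z exprMn qab !expr_div_n.
    by field; rewrite ?aN ?bN ?expf_neq0.
  have := pow_limit1 _ hz; rewrite /z => E; have := ind (a%:Z - b%:Z); rewrite E ?eqxx //.
  by rewrite !mulf_neq0 ?invr_eq0 ?expf_neq0 ?expfz_neq0.
have Bt : tends (fun N => B2.[q2 ^+ (N + v)]) 0.
  have [M HM] : exists M, forall n, nm A2.[q2 ^+ n] <= M.
    exists (\sum_(i < size A2) nm A2`_i) => n; rewrite horner_coef; apply: le_trans (nm_sum _ _ _) _.
    by apply: ler_sum => i _; rewrite nmM !nmX q2u !expr1n mulr1.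
  have M0 : 0 <= M by apply: le_trans (HM 0%N); exact: nm_ge0.
  have h1 : tends (fun N => A2.[q2 ^+ (N + v)] * be ^+ N) 0.
    apply/tendsP => e e0; have e'0 : 0 < e / (M + 1) by rewrite divr_gt0 // ltr_wpDl.
    have /tendsP /(_ _ e'0) [N0 H0] := tends_expr be1; exists N0 => N hN; rewrite subr0 nmM.
    have := H0 N hN; rewrite subr0 ltr_pdivlMr ?ltr_wpDl //; apply: le_lt_trans; rewrite mulrC.
    by apply: ler_wpM2l; [exact: nm_ge0 | apply: le_trans (HM _) _; rewrite lerDl].
  have h2 : tends (fun N => (A2.[q2 ^+ (N + v)] * be ^+ N) * (A2.[q2 ^+ (N + v)] / B2.[q2 ^+ (N + v)] * be ^+
    N)^-1)
    (0 * (c0 / be ^+ u)^-1) by apply: flimM => //; exact: flimV.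
  rewrite mul0r in h2; apply: tends_ext h2 _ => N; have [a b] := AB (N + v)%N; field.
  by rewrite a b expf_neq0.
have [s Hs] : exists s : nat -> nat, forall n, (n + v <= s n)%N /\ nm (q2 ^+ s n - 1) < n.+1%:R^-1.
  have rec n : exists m, (n + v <= m)%N /\ nm (q2 ^+ m - 1) < n.+1%:R^-1.
    by apply: unit_recurrent => //; rewrite invr_gt0 ltr0n.
  by have [s Hs] := boolp.choice rec; exists s.
have s1 : tends (fun n => q2 ^+ s n) 1.
  apply/tendsP => e e0; have [N HN] := natr_big e^-1; exists N => n Nn.
  apply: lt_trans (Hs n).2 _; rewrite -[e]invrK ltf_pV2 ?posrE ?invr_gt0 ?ltr0n //.
  by apply: HN; exact: leqW.
have h1 := tends_horner B2 s1.
have h2 : tends (fun n => B2.[q2 ^+ s n]) 0.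
  have h := @tends_sub _ _ _ (fun n => s n - v)%N _ Bt.
  apply: tends_ext (h _) _ => n; have [hn _] := Hs n; first by clear -hn; lia.
  by rewrite subnK //; clear -hn; lia.
have [_ +] := AB 0%N; rewrite expr0 (flim_unique _ h1 h2) ?eqxx //.
Qed.
End DEnd.

(** * Entire series of q-exponential growth *)

Section EType.
Variable R : realType.
Local Notation C := R[i].
Implicit Types (f g F G : ps C) (K s : R).

Lemma tends_shift (u : nat -> C) l j : tends (fun n => u (n + j)%N) l -> tends u l.
Proof.
move=> /tendsP H; apply/tendsP => e /H [N HN]; exists (N + j)%N => n hn.
by have := HN (n - j)%N; rewrite subnK; [apply; clear -hn; lia | clear -hn; lia].
Qed.
Lemma tends_addn (u : nat -> C) l j : tends u l -> tends (fun n => u (n + j)%N) l.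
Proof. by apply: (@tends_sub _ _ _ (fun n => n + j)%N) => n; exact: leq_addr. Qed.

Lemma tannery (d : nat -> nat -> R) (V : nat -> R) (e : R) : 0 < e -> (forall N k, 0 <= d N k <= V k) ->
  (forall e, 0 < e -> exists L, forall m, \sum_(k < m) V (L + k)%N <= e) ->
  (forall k e, 0 < e -> exists N0, forall N, (N0 <= N)%N -> d N k <= e) ->
  exists N0, forall N m, (N0 <= N)%N -> \sum_(k < m) d N k <= e.
Proof.
move=> e0 dV Vt d0; have e2 : 0 < e / 2 by rewrite divr_gt0.
have [L HL] := Vt _ e2.
have [N0 HN0] : exists N0, forall N, (N0 <= N)%N -> \sum_(k < L) d N k <= e / 2.
  have p : 0 < e / 2 / L.+1%:R by rewrite divr_gt0 // ltr0n.
  suff [N0 H0] : exists N0, forall k N, (k < L)%N -> (N0 <= N)%N -> d N k <= e / 2 / L.+1%:R.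
    exists N0 => N hN; apply: le_trans (_ : \sum_(k < L) e / 2 / L.+1%:R <= _).
      by apply: ler_sum => k _; apply: H0.
    rewrite sumr_const card_ord -[_ *+ L]mulr_natl mulrCA -[leRHS]mulr1.
    by apply: ler_wpM2l; [exact: ltW | rewrite ler_pdivrMr ?ltr0n // mul1r ler_nat].
  suff gen L' : exists N0, forall k N, (k < L')%N -> (N0 <= N)%N -> d N k <= e / 2 / L.+1%:R by exact: gen.
  elim: L' => [|L' [N1 H1]]; first by exists 0%N.
  have [N2 H2] := d0 L' _ p; exists (maxn N1 N2) => k N; rewrite ltnS leq_eqVlt geq_max =>
    /orP[/eqP ->|h] /andP[h1 h2].
    exact: H2.
  exact: H1.
exists N0 => N m hN; apply: le_trans (_ : \sum_(k < L + m) d N k <= _).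
  rewrite -!(big_mkord xpredT (d N)) [leRHS](big_cat_nat (leq0n _) (leq_addl L m)) /= lerDl.
  by apply: sumr_ge0 => k _; have /andP[] := dV N k.
rewrite big_split_ord /=; have -> : e = e / 2 + e / 2 by lra.
apply: lerD; first exact: HN0.
apply: le_trans (HL m); apply: ler_sum => k _; by have /andP[] := dV N (L + k)%N.
Qed.

Section P.
Variable p : C.
Hypotheses (p0 : p != 0) (p1 : nm p < 1).
Let np : 0 < nm p. Proof. by rewrite nm_gt0. Qed.

Definition rho F n : C := F n.+1 / F n.
(** The coefficients decay like p^(n^2/2), up to geometric factors; the zeros turn out to lie near
    [-1 / rho F n], a sequence asymptotically geometric of ratio 1/p. *)
Definition etype F := (forall n, F n != 0) /\ exists2 c0 : C, c0 != 0 & tends (fun n => rho F n / p ^+ n) c0.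

Lemma superexp_tail K e : 0 <= K -> 0 < e ->
  exists L, forall m, \sum_(k < m) K ^+ (L + k) * nm p ^+ 'C(L + k, 2) <= e.
Proof.
move=> K0 e0; pose U k := K ^+ k * nm p ^+ 'C(k, 2).
have U0 k : 0 <= U k by rewrite mulr_ge0 // exprn_ge0 // ltW.
have US k : U k.+1 = K * nm p ^+ k * U k by rewrite /U binS bin1 addnC exprD exprS; ring.
have h2 : 0 < (2 * (K + 1))^-1 by rewrite invr_gt0 mulr_gt0 // ltr_wpDl.
have [L0 HL0] := expr_small (ltW np) p1 h2.
have half k : (L0 <= k)%N -> K * nm p ^+ k <= 2^-1.
  move=> hk; apply: le_trans (_ : (K + 1) * (2 * (K + 1))^-1 <= _).
    apply: ler_pM => //; [by rewrite exprn_ge0 // ltW | by rewrite lerDl | by apply/ltW/HL0].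
  rewrite le_eqVlt; apply/orP; left; apply/eqP; field; rewrite gt_eqF // ltr_wpDl //.
have geo k : U (L0 + k)%N <= U L0 * 2^-1 ^+ k.
  elim: k => [|k IH]; first by rewrite addn0 expr0 mulr1.
  have -> : U L0 * 2^-1 ^+ k.+1 = 2^-1 * (U L0 * 2^-1 ^+ k) by rewrite exprS; ring.
  rewrite addnS US; apply: ler_pM => //; first by rewrite mulr_ge0 // exprn_ge0 // ltW.
  by apply: half; exact: leq_addr.
have e'0 : 0 < e / (2 * (U L0 + 1)) by rewrite divr_gt0 // mulr_gt0 // ltr_wpDl.
have hh : (0 : R) <= 2^-1 by rewrite invr_ge0. have hh1 : (2^-1 : R) < 1 by rewrite invf_lt1 // ltr1n.
have [j Hj] := expr_small hh hh1 e'0; exists (L0 + j)%N => m.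
apply: le_trans (_ : \sum_(k < m) U L0 * 2^-1 ^+ j * 2^-1 ^+ k <= _).
  apply: ler_sum => k _; rewrite -/(U (L0 + j + k)%N) -addnA; apply: le_trans (geo _) _; by rewrite exprD mulrA.
rewrite -big_distrr /=; apply: le_trans (ler_wpM2l _ (geo_sum_le m hh hh1)) _.
  by rewrite mulr_ge0 // exprn_ge0.
have -> : (1 - 2^-1 : R)^-1 = 2 by field.
have h := Hj j (leqnn j); rewrite ltr_pdivlMr ?mulr_gt0 ?ltr_wpDl // in h.
apply: le_trans (ltW h); rewrite mulrAC mulrC; apply: ler_wpM2l; first by rewrite exprn_ge0.
by rewrite mulrC ler_wpM2l // lerDl.
Qed.

Section One.
Variable F : ps C.
Hypothesis EF : etype F.
Let F0 n : F n != 0. Proof. by case: EF. Qed.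
Lemma rho_neq0 n : rho F n != 0. Proof. by rewrite mulf_neq0 ?invr_eq0. Qed.
Lemma rho_shift j : tends (fun N => rho F (N + j) / rho F N) (p ^+ j).
Proof.
have [_ [c0 c00 h]] := EF.
have h2 : tends (fun N => p ^+ j * ((rho F (N + j) / p ^+ (N + j)) * (rho F N / p ^+ N)^-1)) (p ^+ j * (c0 *
  c0^-1)).
  by apply: flimM; [exact: flim_cst | apply: flimM; [exact: (tends_addn j h) | exact: flimV]].
rewrite mulfV // mulr1 in h2; apply: tends_ext h2 _ => N; have r0 := rho_neq0 N; rewrite exprD; field.
by rewrite r0 !expf_neq0.
Qed.
Lemma rho_tends0 : tends (rho F) 0.
Proof.
have [_ [c0 c00 h]] := EF.
have h2 : tends (fun N => rho F N / p ^+ N * p ^+ N) (c0 * 0) by apply: flimM => //; exact: tends_expr.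
by rewrite mulr0 in h2; apply: tends_ext h2 _ => N; rewrite divfK // expf_neq0.
Qed.
Lemma etype_cv r : cv F r.
Proof.
apply: (@cv_le _ _ `|r|); first exact: ler_norm.
by apply: (cv_ratio (normr_ge0 r) F0 rho_tends0); rewrite nm0 mul0r ltr01.
Qed.
Lemma rho_bounds : exists k1 k2, [/\ 0 < k1, 0 < k2 & forall n,
  k1 * nm p ^+ n <= nm (rho F n) <= k2 * nm p ^+ n].
Proof.
have [_ [c0 c00 h]] := EF; have [k2 H2] := seq_bounded h.
have [|k1 [k10 H1]] := seq_bounded_below h c00.
  by move=> n; rewrite mulf_neq0 ?rho_neq0 // invr_eq0 expf_neq0.
exists k1, k2; split=> //; first by apply: lt_le_trans (H2 0%N); apply: lt_le_trans (H1 0%N).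
move=> n; have pn : 0 < nm p ^+ n by rewrite exprn_gt0.
have := H1 n; have := H2 n; rewrite nmM nmV nmX => h2 h1.
by rewrite -ler_pdivlMr // h1 -ler_pdivrMr.
Qed.
Lemma rho_ratio_bound : exists K, 1 <= K /\ forall n j, nm (rho F (n + j) / rho F n) <= K * nm p ^+ j.
Proof.
have [k1 [k2 [k10 k20 H]]] := rho_bounds; exists (k2 / k1); split.
  rewrite ler_pdivlMr // mul1r; have /andP[h1 h2] := H 0%N.
  by have := le_trans h1 h2; rewrite expr0 !mulr1.
move=> n j; have /andP[a1 a2] := H n; have /andP[b1 b2] := H (n + j)%N.
have pn : 0 < nm p ^+ n by rewrite exprn_gt0.
rewrite nmM nmV ler_pdivrMr; last by rewrite nm_gt0 rho_neq0.
apply: le_trans b2 _; apply: le_trans (ler_wpM2l _ a1); last first.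
  by rewrite !mulr_ge0 ?invr_ge0 ?exprn_ge0 // ltW.
rewrite exprD le_eqVlt; apply/orP; left; apply/eqP; field; by rewrite gt_eqF.
Qed.

Definition aR N k : C := F (N + k)%N / F N / rho F N ^+ k.
Definition aL N j : C := F (N - j)%N / F N * rho F N ^+ j.
Lemma aRS N k : aR N k.+1 = aR N k * (rho F (N + k) / rho F N).
Proof.
have E : rho F (N + k) = F (N + k).+1 / F (N + k)%N by [].
by rewrite /aR E addnS exprS; have := F0 (N + k)%N; have := rho_neq0 N => h1 h2; field;
  rewrite !F0 ?h1 ?h2 ?expf_neq0.
Qed.
Lemma aLS N j : (j < N)%N -> aL N j.+1 = aL N j * (rho F (N - j.+1 + j.+1) / rho F (N - j.+1)).
Proof.
move=> jN; have E : rho F (N - j.+1) = F (N - j)%N / F (N - j.+1)%N by rewrite /rho subnSK.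
rewrite /aL E exprS subnK //.
by have := F0 (N - j)%N; have := F0 (N - j.+1)%N => h1 h2; field; rewrite !F0.
Qed.
(** The limit depends on [p] alone: rescaled, all series of type [p] have the same profile near
    their zeros. *)
Lemma aR_lim k : tends (aR^~ k) (p ^+ 'C(k, 2)).
Proof.
elim: k => [|k IH].
  by apply: (tends_ext (flim_cst _ _)) => N; rewrite /aR addn0 divff // expr0 divr1 bin0n expr0.
rewrite binS bin1 exprD mulrC.
have h : tends (fun N => aR N k * (rho F (N + k) / rho F N)) (p ^+ 'C(k, 2) * p ^+ k) by apply: flimM => //;
  exact: rho_shift.
by rewrite mulrC; apply: tends_ext h _ => N; rewrite aRS.
Qed.
Lemma aL_lim j : tends (aL^~ j) (p ^+ 'C(j.+1, 2)).
Proof.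
elim: j => [|j IH].
  by apply: (tends_ext (flim_cst _ _)) => N; rewrite /aL subn0 divff // expr0 mulr1 expr0.
rewrite binS bin1 exprD; apply: (@tends_shift _ _ j.+1).
have h : tends (fun N => aL (N + j.+1) j * (rho F (N + j.+1) / rho F N)) (p ^+ 'C(j.+1, 2) * p ^+ j.+1).
  by apply: flimM; [exact: (@tends_addn (aL^~ j) _ j.+1 IH) | exact: rho_shift].
by apply: tends_ext h _ => N; rewrite aLS ?addnK // ?addnS ?ltnS ?leq_addl.
Qed.
Lemma aR_bound : exists K, 1 <= K /\ forall N k, nm (aR N k) <= K ^+ k * nm p ^+ 'C(k, 2)
   /\ ((k <= N)%N -> nm (aL N k) <= K ^+ k * nm p ^+ 'C(k, 2)).
Proof.
have [K [K1 HK]] := rho_ratio_bound; exists K; split=> // N k.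
have K0 : 0 <= K by exact: le_trans ler01 K1.
split.
  elim: k => [|k IH]; first by rewrite /aR addn0 divff // expr0 divr1 nm1 expr0 mul1r.
  rewrite aRS nmM.
  have -> : K ^+ k.+1 * nm p ^+ 'C(k.+1, 2) = (K ^+ k * nm p ^+ 'C(k, 2)) * (K * nm p ^+ k).
    by rewrite binS bin1 exprS exprD; ring.
  by apply: ler_pM; rewrite ?nm_ge0.
elim: k => [|k IH] kN; first by rewrite /aL subn0 divff // expr0 mulr1 nm1 expr0 mul1r.
rewrite aLS // nmM.
have -> : K ^+ k.+1 * nm p ^+ 'C(k.+1, 2) = (K ^+ k * nm p ^+ 'C(k, 2)) * (K * nm p ^+ k).
  by rewrite binS bin1 exprS exprD; ring.
apply: ler_pM; rewrite ?nm_ge0 //; first by apply: IH; exact: ltnW.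
apply: le_trans (HK _ _) _; apply: ler_wpM2l => //; rewrite exprS ler_piMl ?exprn_ge0 ?ltW //.
Qed.
Lemma psum_split N m y : y != 0 -> let z := y / rho F N in
  psum F z (N + m) / (F N * z ^+ N) = \sum_(j < N) aL N j.+1 * y ^- j.+1 + \sum_(k < m) aR N k * y ^+ k.
Proof.
move=> y0 z; have r0 := rho_neq0 N; have z0 : z != 0 by rewrite /z mulf_neq0 // invr_eq0.
have yE : y = z * rho F N by rewrite /z divfK.
clearbody z.
rewrite /psum big_split_ord /= mulrDl !big_distrl /=; congr (_ + _).
  rewrite (reindex_inj rev_ord_inj) /=; apply: eq_bigr => j _; have jN := ltn_ord j.
  have zN : z ^+ N = z ^+ (N - j.+1) * z ^+ j.+1 by rewrite -exprD subnK.
  have r1 : rho F N ^+ j.+1 != 0 by rewrite expf_neq0.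
  have z1 : z ^+ (N - j.+1) != 0 by rewrite expf_neq0.
  have z2 : z ^+ j.+1 != 0 by rewrite expf_neq0.
  rewrite zN /aL yE [(z * _) ^+ _]exprMn; set a1 := z ^+ (N - j.+1) in z1 *; set a2 := z ^+ j.+1 in z2 *;
    set a3 := rho F N ^+ j.+1 in r1 *.
  by field; rewrite !F0 z1 z2 r1.
apply: eq_bigr => k _; rewrite /aR yE [(z * _) ^+ _]exprMn exprD.
have r1 : rho F N ^+ k != 0 by rewrite expf_neq0.
have z1 : z ^+ N != 0 by rewrite expf_neq0.
set a1 := z ^+ N in z1 *; set a2 := z ^+ k; set a3 := rho F N ^+ k in r1 *.
by field; rewrite !F0 z1 r1.
Qed.
End One.

(* [F (z)] divided by its term of index [N], at [z = y / rho F N]; its Laurent coefficients in [y] are [aL] and [aR]. *)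
Definition Phi F N y := let z := y / rho F N in ev F z / (F N * z ^+ N).

(** Dominated convergence of Laurent expansions: coefficients with equal limits, and a common
    majorant that decays faster than any geometric sequence. *)
Lemma Phi_compare F G lo hi e : etype F -> etype G -> 0 < lo -> 0 < e ->
  exists N0, forall N y, (N0 <= N)%N -> lo <= nm y -> nm y <= hi -> nm (Phi F N y - Phi G N y) <= e.
Proof.
move=> EF EG lo0 e0; have [K1 [K11 H1]] := aR_bound EF; have [K2 [K21 H2]] := aR_bound EG.
pose s := Num.max 1 (Num.max hi lo^-1); pose K := Num.max K1 K2.
have s1 : 1 <= s by rewrite /s le_max lexx.
have s0 : 0 <= s by exact: le_trans ler01 s1.
have shi : hi <= s by rewrite /s !le_max lexx orbT.
have slo : lo^-1 <= s by rewrite /s !le_max lexx !orbT.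
have KK1 : K1 <= K by rewrite le_max lexx. have KK2 : K2 <= K by rewrite le_max lexx orbT.
have K10 : 0 <= K1 by exact: le_trans ler01 K11. have K20 : 0 <= K2 by exact: le_trans ler01 K21.
have K0 : 0 <= K by exact: le_trans K10 KK1.
have e2 : 0 < e / 2 by rewrite divr_gt0.
have [nF _] := EF; have [nG _] := EG.
pose V k := 2 * ((K * s) ^+ k * nm p ^+ 'C(k, 2)).
have Vt e' : 0 < e' -> exists L, forall m, \sum_(k < m) V (L + k)%N <= e'.
  move=> e'0; have e'2 : 0 < e' / 2 by rewrite divr_gt0.
  have [L HL] := superexp_tail (mulr_ge0 K0 s0) e'2; exists L => m.
  by rewrite /V -big_distrr /= mulrC -ler_pdivlMr //; exact: HL.
have bd (a b : C) k : nm a <= K1 ^+ k * nm p ^+ 'C(k, 2) -> nm b <= K2 ^+ k * nm p ^+ 'C(k, 2) ->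
  nm (a - b) * s ^+ k <= V k.
  move=> ha hb; apply: le_trans (_ : (2 * (K ^+ k * nm p ^+ 'C(k, 2))) * s ^+ k <= _).
    apply: ler_wpM2r; first exact: exprn_ge0.
    apply: le_trans (nmD _ _) _; rewrite nmN.
    have P0 : 0 <= nm p ^+ 'C(k, 2) by rewrite exprn_ge0 // ltW.
    have h3 : K1 ^+ k * nm p ^+ 'C(k, 2) <= K ^+ k * nm p ^+ 'C(k, 2) by apply: ler_wpM2r => //;
      apply: lerXn2r; rewrite ?nnegrE.
    have h4 : K2 ^+ k * nm p ^+ 'C(k, 2) <= K ^+ k * nm p ^+ 'C(k, 2) by apply: ler_wpM2r => //;
      apply: lerXn2r; rewrite ?nnegrE.
    by rewrite mulr_natl mulr2n; apply: lerD; [exact: le_trans h3 | exact: le_trans h4].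
  by rewrite /V exprMn le_eqVlt; apply/orP; left; apply/eqP; ring.
have V0 k : 0 <= V k by rewrite !mulr_ge0 // exprn_ge0 ?mulr_ge0 // ltW.
have small (a b : nat -> C) k l : tends a l -> tends b l -> forall e', 0 < e' ->
  exists N0, forall N, (N0 <= N)%N -> nm (a N - b N) * s ^+ k <= e'.
  move=> ha hb e' e'0; have h : tends (fun N => a N - b N) (l - l) by apply: flimD => //; exact: flimN.
  have sk : 0 < s ^+ k by rewrite exprn_gt0 // (lt_le_trans ltr01).
  have e'1 : 0 < e' / s ^+ k by rewrite divr_gt0.
  have /tendsP /(_ _ e'1) [N0 HN0] := h; exists N0 => N hN.
  by have := HN0 N hN; rewrite subrr subr0 ltr_pdivlMr // => /ltW.
have [NR HR] := @tannery (fun N k => nm (aR F N k - aR G N k) * s ^+ k) V (e / 2) e2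
  (fun N k => introT andP (conj (mulr_ge0 (nm_ge0 _) (exprn_ge0 k s0)) (bd _ _ k (H1 N k).1 (H2 N k).1))) Vt
  (fun k => small _ _ k _ (aR_lim EF k) (aR_lim EG k)).
(* [aL F N k] is meaningful for k <= N only, because of the truncated subtraction in its index. *)
pose dL N k := if (k <= N)%N then nm (aL F N k - aL G N k) * s ^+ k else 0.
have [NL HL] : exists N0, forall N m, (N0 <= N)%N -> \sum_(k < m) dL N k <= e / 2.
  apply: (@tannery dL V (e / 2) e2 _ Vt).
    move=> N k; rewrite /dL; case: ifP => kN; last by rewrite lexx V0.
    by rewrite mulr_ge0 ?nm_ge0 ?exprn_ge0 //=; apply: bd; [apply: (H1 N k).2 | apply: (H2 N k).2].
  move=> k e' e'0; have [N0 HN0] := small _ _ k _ (aL_lim EF k) (aL_lim EG k) e' e'0.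
  by exists N0 => N hN; rewrite /dL; case: ifP => _; [exact: HN0 | exact: ltW].
exists (maxn NR NL) => N y; rewrite geq_max => /andP[hR hL] ylo yhi.
have y0 : y != 0 by rewrite -nm_gt0; exact: lt_le_trans lo0 ylo.
pose D m := psum F (y / rho F N) (N + m) / (F N * (y / rho F N) ^+ N) - psum G (y / rho G N) (N + m) / (G N *
  (y / rho G N) ^+ N).
have Dl : tends D (Phi F N y - Phi G N y).
  have h H : etype H -> tends (fun m => psum H (y / rho H N) (N + m) / (H N * (y / rho H N) ^+ N)) (Phi H N y).
    move=> EH; apply: flimM; last exact: flim_cst.
    have := tends_addn N (ev_tends (etype_cv EH (nm (y / rho H N)))).
    by move=> h; apply: tends_ext h _ => m; rewrite addnC.
  by apply: flimD; [exact: h | apply: flimN; exact: h].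
apply: flim_le Dl _; exists 0%N => // m _ /=.
rewrite /D !psum_split // opprD addrACA -!sumrB.
apply: le_trans (nmD _ _) _; have -> : e = e / 2 + e / 2 by lra.
apply: lerD.
  apply: le_trans (HL N N.+1 hL); rewrite big_ord_recl /=.
  apply: le_trans (nm_sum _ _ _) _; apply: ler_wpDl; first by rewrite /dL leq0n mulr_ge0 ?nm_ge0 ?exprn_ge0.
  apply: ler_sum => j _; rewrite /dL /bump /= add1n ltn_ord -mulrBl nmM; apply: ler_wpM2l; first exact: nm_ge0.
  rewrite nmV nmX -exprVn; apply: lerXn2r; rewrite ?nnegrE ?invr_ge0 ?nm_ge0 //.
  by apply: le_trans slo; rewrite lef_pV2 ?posrE // nm_gt0.
apply: le_trans (HR N m hR); apply: le_trans (nm_sum _ _ _) _; apply: ler_sum => k _.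
rewrite -mulrBl nmM nmX; apply: ler_wpM2l; first exact: nm_ge0.
by apply: lerXn2r; rewrite ?nnegrE ?nm_ge0 //; exact: le_trans shi.
Qed.
End P.
End EType.

(** * A minimum modulus principle for polynomials *)

Section MinModulus.
Variable R : realType.
Local Notation C := R[i].
(** Geometric means over [n] points of the circle: the product of the a + d w^i - z is (a - z)^n -
    d^n, of modulus at most 2 |a - z|^n for a root z outside the disc, and the product of the points
    themselves is close to a^n. The constants 2 are lost under n-th roots as [n] grows. *)
Lemma min_modulus_pole (c a : C) (rs : seq C) (d m : R) (N0 : nat) : 0 < d -> d < nm a ->
  (forall z, z \in rs -> d < nm (a - z)) ->
  (forall y, nm (y - a) = d -> m * nm y ^+ N0 <= nm (c * \prod_(z <- rs) (y - z))) ->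
  m * nm a ^+ N0 <= nm (c * \prod_(z <- rs) (a - z)).
Proof.
move=> d0 da Hz Hm; have a0 : 0 < nm a by exact: lt_trans da.
have [m0|m0] := leP m 0; first by apply: le_trans (nm_ge0 _); rewrite mulr_le0_ge0 ?exprn_ge0 ?nm_ge0.
rewrite leNgt; apply/negP => lt; set T := c * _ in lt.
have T0 : T != 0.
  rewrite mulf_neq0 //.
    apply/eqP => c0; have := Hm (a + d%:C%C); rewrite c0 mul0r nm0 => h.
    have : m * nm (a + d%:C%C) ^+ N0 <= 0 by apply: h; rewrite addrC addKr nm_real gtr0_norm.
    rewrite pmulr_rle0 // => h2; have ad : 0 < nm (a + d%:C%C).
      by have := nm_sub_ge a (- d%:C%C); rewrite nmN nm_real gtr0_norm // opprK; lra.
    by have := exprn_gt0 N0 ad; lra.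
  rewrite prodf_seq_neq0; apply/allP => z zr /=; rewrite -nm_gt0; have := Hz z zr; lra.
have Tp : 0 < nm T by rewrite nm_gt0.
have q1 : 1 < m * nm a ^+ N0 / nm T by rewrite ltr_pdivlMr // mul1r.
have [N HN] := expr_big (2 ^+ (size rs + N0)) q1.
have x0 : 0 <= d / nm a by rewrite divr_ge0 ?nm_ge0 // ltW.
have x1 : d / nm a < 1 by rewrite ltr_pdivrMr // mul1r.
have [N' HN'] := expr_small x0 x1 (ltac:(lra) : 0 < (2^-1 : R)).
have [w Hw] := prim2 R (N + N')%N; set n := (2 ^ _)%N in Hw.
have n0 : (0 < n)%N := prim_order_gt0 Hw.
have NNn : (N + N' <= n)%N by rewrite ltnW // (leq_trans (ltn_expl _ (isT : (1 < 2)%N))) // leq_exp2l.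
have Nn : (N <= n)%N by apply: leq_trans NNn; exact: leq_addr.
have Nn' : (N' <= n)%N by apply: leq_trans NNn; exact: leq_addl.
have w1 := prim_nm Hw.
have dC : d%:C%C != 0 by rewrite -nm_gt0 nm_real gtr0_norm.
have PE (t : C) : \prod_(i < n) (t + d%:C%C * w ^+ i) = t ^+ n - d%:C%C ^+ n.
  have := congr1 (fun p : {poly C} => p.[- t / d%:C%C]) (factor_Xn_sub_1 Hw).
  rewrite horner_prod !hornerE big_mkord => E.
  have even : ~~ odd n by rewrite /n expnS oddM.
  have sg : (-1 : C) ^+ n = 1 by rewrite -signr_odd (negbTE even).
  transitivity (\prod_(i < n) (- d%:C%C * (- t / d%:C%C - w ^+ i))).
    by apply: eq_bigr => i _; field.
  rewrite big_split /= prodr_const card_ord.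
  under eq_bigr do rewrite -[_ - _]/(- t / d%:C%C - w ^+ _).
  have -> : \prod_(i < n) (- t / d%:C%C - w ^+ i) = (- t / d%:C%C) ^+ n - 1.
    by rewrite -E; apply: eq_bigr => i _; rewrite !hornerE.
  rewrite mulrBr mulr1 -exprMn; congr (_ - _); last by rewrite -mulN1r exprMn sg mul1r.
  by congr (_ ^+ _); field.
have U : m ^+ n * nm (a ^+ n - d%:C%C ^+ n) ^+ N0 <= nm T ^+ n * 2 ^+ size rs.
  apply: le_trans (_ : \prod_(i < n) nm (c * \prod_(z <- rs) (a + d%:C%C * w ^+ i - z)) <= _).
    rewrite -PE nm_prod -prodrXl -[X in m ^+ X]card_ord -prodr_const -big_split /=.
    apply: ler_prod => i _; rewrite mulr_ge0 ?exprn_ge0 ?nm_ge0 ?(ltW m0) //=.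
    apply: Hm; rewrite addrC addKr nmM nmX w1 expr1n mulr1 nm_real gtr0_norm //.
  rewrite -nm_prod big_split /= prodr_const card_ord exchange_big /= /T !nmM nmX exprMn -mulrA.
  rewrite ler_wpM2l ?exprn_ge0 ?nm_ge0 //.
  rewrite !nm_prod -prodrXl.
  have -> : 2 ^+ size rs = \prod_(z <- rs) (2 : R) by rewrite big_const_seq count_predT -Monoid.iteropE.
  rewrite -big_split /= big_seq [X in _ <= X]big_seq; apply: ler_prod => z zr; rewrite nm_ge0 /=.
  have -> : \prod_(i < n) (a + d%:C%C * w ^+ i - z) = (a - z) ^+ n - d%:C%C ^+ n.
    by rewrite -PE; apply: eq_bigr => i _; rewrite addrAC.
  apply: le_trans (nmB _ _) _; rewrite !nmX nm_real gtr0_norm // mulr2n mulrDr !mulr1 lerD2l.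
  by rewrite lerXn2r // ?nnegrE ?nm_ge0 ?(ltW d0) // (ltW (Hz z zr)).
have U2 : (nm a ^+ N0) ^+ n <= nm (a ^+ n - d%:C%C ^+ n) ^+ N0 * 2 ^+ N0.
  rewrite -exprM mulnC exprM -exprMn; apply: lerXn2r; rewrite ?nnegrE ?mulr_ge0 ?exprn_ge0 ?nm_ge0 //.
  have := nm_sub_ge (a ^+ n) (d%:C%C ^+ n); rewrite !nmX nm_real gtr0_norm // => h.
  have := HN' n Nn'; rewrite expr_div_n ltr_pdivrMr ?exprn_gt0 // => h2.
  by have := exprn_gt0 n a0; lra.
have := HN n Nn; rewrite expr_div_n ltr_pdivlMr ?exprn_gt0 // exprMn => h.
have : m ^+ n * (nm a ^+ N0) ^+ n <= nm T ^+ n * 2 ^+ size rs * 2 ^+ N0.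
  apply: le_trans (ler_wpM2l _ U2) _; first by rewrite exprn_ge0 // ltW.
  by rewrite mulrA; apply: ler_wpM2r => //; rewrite exprn_ge0.
by move: h; rewrite exprD; lra.
Qed.

(** From index [j0] on the s x^j sum to at most 1/2, and a product of factors 1 - t is at least 1
    minus the sum of the t; the finitely many earlier factors are positive. *)
Lemma prod_lower (x s : R) : 0 < x -> 0 < s -> x < 1 -> s * x < 1 ->
  exists k, 0 < k /\ forall J, k <= \prod_(j < J) (1 - s * x ^+ j.+1).
Proof.
move=> x0 s0 x1 sx.
have fac j : 0 < 1 - s * x ^+ j.+1 <= 1.
  have := exprn_gt0 j x0; have := exprn_ile1 j (ltW x0) (ltW x1); rewrite exprS => h1 h2.
  have h3 : s * (x * x ^+ j) = s * x * x ^+ j by ring.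
  have h4 : 0 < s * x * x ^+ j by rewrite !mulr_gt0.
  have h5 : s * x * x ^+ j <= s * x by rewrite ler_piMr // mulr_ge0 ?ltW.
  rewrite h3; lra.
have e0 : 0 < (1 - x) / (2 * s) by rewrite divr_gt0 ?mulr_gt0 //; lra.
have [j0 Hj0] := expr_small (ltW x0) x1 e0.
have tail J : 2^-1 <= \prod_(j < J) (1 - s * x ^+ (j0 + j).+1).
  have W : 1 - \sum_(j < J) s * x ^+ (j0 + j).+1 <= \prod_(j < J) (1 - s * x ^+ (j0 + j).+1).
    elim: J => [|J IH]; first by rewrite !big_ord0 subr0.
    rewrite !big_ord_recr /=; set P := \prod_(i < J) _ in IH *; set S := \sum_(i < J) _ in IH *.
    have /andP[f1 f2] := fac (j0 + J)%N; set t := s * x ^+ _ in f1 f2 *.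
    have P1 : P <= 1 by apply: prodr_ile1 => i _; have /andP[g1 g2] := fac (j0 + i)%N; rewrite g2 ltW.
    have t0 : 0 <= t by lra.
    have : 0 <= (1 - P) * t by rewrite mulr_ge0 //; lra.
    lra.
  apply: le_trans W; suff : \sum_(j < J) s * x ^+ (j0 + j).+1 <= 2^-1 by lra.
  apply: le_trans (_ : \sum_(j < J) (s * x ^+ j0) * x ^+ j <= _).
    apply: ler_sum => j _; rewrite -mulrA -exprD ler_wpM2l ?(ltW s0) //.
    by rewrite exprS ler_piMl ?exprn_ge0 ?ltW.
  rewrite -big_distrr /=; apply: le_trans (ler_wpM2l _ (geo_sum_le J (ltW x0) x1)) _.
    by rewrite mulr_ge0 ?exprn_ge0 ?ltW.
  rewrite ler_pdivrMr; last lra.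
  have := Hj0 j0 (leqnn _); rewrite ltr_pdivlMr ?mulr_gt0 // => h; lra.
have P0 : 0 < \prod_(j < j0) (1 - s * x ^+ j.+1) by apply: prodr_gt0 => j _; have /andP[] := fac j.
exists (\prod_(j < j0) (1 - s * x ^+ j.+1) / 2); split; first by rewrite divr_gt0.
move=> J; have -> : \prod_(j < J) (1 - s * x ^+ j.+1) = \prod_(0 <= j < J) (1 - s * x ^+ j.+1) by rewrite
  big_mkord.
apply: le_trans (_ : \prod_(j < j0 + J) (1 - s * x ^+ j.+1) <= _).
  by rewrite big_split_ord /=; apply: ler_wpM2l; [exact: ltW | exact: tail].
rewrite -(big_mkord xpredT (fun j => 1 - s * x ^+ j.+1)) (big_cat_nat (leq0n _) (leq_addl j0 J)) /=.
rewrite -[leRHS]mulr1; apply: ler_wpM2l; first by apply: prodr_ge0 => j _; have /andP[/ltW] := fac j.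
by apply: prodr_ile1 => j _; have /andP[g1 g2] := fac j; rewrite g2 ltW.
Qed.
End MinModulus.

(** * Euler's series *)

Section Euler.
Variable R : realType.
Local Notation C := R[i].
Variables (p : C) (u : R).
Hypotheses (p0 : p != 0) (u0 : 0 < u) (u1 : u < 1) (pu : nm p = u ^+ 4).
Local Notation x := (nm p).
Let x0 : 0 < x. Proof. by rewrite nm_gt0. Qed.
Let x1 : x < 1. Proof. by rewrite pu exprn_ilt1 ?ltW. Qed.
Lemma one_sub n : 1 - p ^+ n.+1 != 0.
Proof.
rewrite -nm_gt0; have := nm_sub_ge 1 (p ^+ n.+1); rewrite nm1 nmX.
have : x ^+ n.+1 < 1 by apply: exprn_ilt1 => //; exact: ltW.
lra.
Qed.
(* Euler's series, whose zeros are known from its product expansion; it is the comparison function for all of type [p]. *)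
Definition Fs : ps C := fun k => \prod_(i < k) (p ^+ i / (1 - p ^+ i.+1)).
Lemma FsS k : Fs k.+1 = Fs k * (p ^+ k / (1 - p ^+ k.+1)).
Proof. by rewrite /Fs big_ord_recr. Qed.
Lemma Fs_neq0 k : Fs k != 0.
Proof. by rewrite /Fs; apply/prodf_neq0 => i _; rewrite mulf_neq0 ?invr_eq0 ?one_sub // expf_neq0. Qed.
Lemma rho_Fs n : rho Fs n = p ^+ n / (1 - p ^+ n.+1).
Proof. by rewrite /rho FsS mulrAC mulfV ?mul1r // Fs_neq0. Qed.
Lemma etype_Fs : etype p Fs.
Proof.
split; first exact: Fs_neq0.
exists 1; first exact: oner_neq0.
have h : tends (fun n => (1 - p ^+ (n + 1))^-1) (1 - 0)^-1.
  apply: flimV; first by rewrite subr0 oner_neq0.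
  by apply: flimD; [exact: flim_cst | apply: flimN; apply: (@tends_addn _ (fun n => p ^+ n));
    exact: tends_expr].
rewrite subr0 invr1 in h; apply: tends_ext h _ => n; rewrite rho_Fs addn1.
by field; rewrite one_sub expf_neq0.
Qed.
(** Iterated, this produces the factors 1 + p^i t, hence the zeros -p^-n. *)
Lemma ev_Fs t : ev Fs t = (1 + t) * ev Fs (p * t).
Proof.
have cvF r : cv Fs r by exact: (etype_cv p0 x1 etype_Fs).
have E : Fs = pp (1 + 'X) * sc p Fs.
  apply: psP => -[|k]; rewrite rmorphD rmorph1 /= mulrDl mul1r psD -/(psX C) psX1M /sc.
    by rewrite expr0 mul1r addr0.
  by have := one_sub k; rewrite FsS exprS => h; field.
rewrite {1}E evM ?ev_sc ?ev_pp ?hornerD ?hornerC ?hornerX //; first exact: cv_pp.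
by apply: cv_sc.
Qed.
Lemma ev_Fs_prod t n : ev Fs t = \prod_(i < n) (1 + p ^+ i * t) * ev Fs (p ^+ n * t).
Proof.
elim: n => [|n IH]; first by rewrite big_ord0 expr0 !mul1r.
rewrite IH big_ord_recr /= -mulrA; congr (_ * _).
have -> : p ^+ n.+1 * t = p * (p ^+ n * t) by rewrite exprS mulrA.
exact: ev_Fs.
Qed.
Lemma Fs_zero n : ev Fs (- p ^- n) = 0.
Proof.
rewrite (ev_Fs_prod _ n.+1) big_ord_recr /= mulrN mulfV ?expf_neq0 // subrr mulr0 mul0r //.
Qed.

(** At t = y / rho the product has one critical factor, 1 + y (1 - p^(n+1)). The earlier factors are
    comparable to p^i t and multiply to the term of index [n], the later ones are close to 1.
    Neighbouring zeros are at distance |p| = u^4 on the multiplicative scale, outside the annulus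
    from u^3 to u^-3, while the annuli of consecutive [n] overlap. *)
Lemma Fs_lower : exists c1 N0, 0 < c1 /\ forall n y, (N0 <= n)%N -> u ^+ 3 <= nm y -> nm y <= (u ^+ 3)^-1 ->
  c1 * nm (1 + y * (1 - p ^+ n.+1)) <= nm (Phi Fs n y).
Proof.
have u0' := u0; have u1' := u1.
pose v := (1 + u) / 2; have uv : u < v by rewrite /v; lra.
have v1 : v < 1 by rewrite /v; lra. have v0 : 0 < v by exact: lt_trans u0 uv.
clearbody v.
have v1' : 0 < 1 - v by rewrite subr_gt0.
have half0 : 0 < (2^-1 : R) by rewrite invr_gt0 ltr0n.
have u3 : 0 < u ^+ 3 by rewrite exprn_gt0.
(* [s] bounds both |y'| and 1/|y'|; the slack [v] between [u] and 1 absorbs the factor 1 - p^(n+1),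
   and s|p| = u/v is still below 1. *)
pose s := (u ^+ 3 * v)^-1; have s0 : 0 < s by rewrite invr_gt0 mulr_gt0.
have sx : s * x < 1.
  have -> : s * x = u / v by rewrite /s pu exprSr; field; rewrite !gt_eqF.
  by rewrite ltr_pdivrMr // mul1r.
have [k1 [k10 Hk1]] := prod_lower x0 ltr01 x1 (eq_ind_r (fun z => z < 1) x1 (mul1r x)).
have [k2 [k20 Hk2]] := prod_lower x0 s0 x1 sx.
have [N0 HN0] := expr_small (ltW x0) x1 v1'.
exists (k1 * k2 * k2 / 2), N0; split; first by rewrite divr_gt0 ?mulr_gt0.
move=> n y hn ylo yhi; have y0 : 0 < nm y by exact: lt_le_trans u3 ylo.
have yn0 : y != 0 by rewrite -nm_gt0.
have xn : x ^+ n.+1 < 1 - v by apply: HN0; exact: leqW.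
set y' := y * (1 - p ^+ n.+1).
have om := one_sub n.
have b1 : v <= nm (1 - p ^+ n.+1) by have := nm_sub_ge 1 (p ^+ n.+1); rewrite nm1 nmX; lra.
have b2 : nm (1 - p ^+ n.+1) <= v^-1.
  have := nmB 1 (p ^+ n.+1); rewrite nm1 nmX => h.
  apply: le_trans (_ : 2 - v <= _); first lra.
  rewrite -[leRHS]mul1r ler_pdivlMr //; have h2 : 0 <= (1 - v) ^+ 2 by exact: sqr_ge0.
  by rewrite expr2 in h2; lra.
have y'lo : (nm y')^-1 <= s.
  rewrite /s lef_pV2 ?posrE ?mulr_gt0 // /y' nmM ?mulr_gt0 ?nm_gt0 //.
  by apply: ler_pM => //; rewrite ltW.
have y'hi : nm y' <= s.
  by rewrite /y' nmM /s invfM; apply: ler_pM; rewrite ?nm_ge0.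
have y'0 : y' != 0 by rewrite /y' mulf_neq0.
pose t := y' / p ^+ n; have tE : y / rho Fs n = t.
  by rewrite /t /y' rho_Fs; field; rewrite om expf_neq0.
have pit i j : p ^+ (i + j) * t = p ^+ j * (p ^+ i * t) by rewrite exprD; ring.
have pnt : p ^+ n * t = y' by rewrite /t mulrC divfK // expf_neq0.
have [J HJ] : exists J, 2^-1 <= nm (ev Fs (p ^+ (n.+1 + J) * t)).
  have h : tends (fun J => p ^+ (n.+1 + J) * t) 0.
    apply: (@tends_ext _ (fun J => p ^+ n.+1 * t * p ^+ J)); last by move=> J; rewrite exprD; ring.
    by rewrite -(mulr0 (p ^+ n.+1 * t)); apply: flimM; [exact: flim_cst | exact: tends_expr].
  have [r [M [r0 bF]]] := etype_cv p0 x1 etype_Fs 0.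
  have e0 : tends (fun J => ev Fs (p ^+ (n.+1 + J) * t)) (ev Fs 0) by apply: (ev_cont _ r0 bF) => //;
    rewrite nm0.
  have /tendsP /(_ 2^-1 half0) [J HJ] := e0; exists J; have := HJ J (leqnn J).
  rewrite ev0 /Fs big_ord0 nm_sym => h1; have := nm_sub_ge 1 (ev Fs (p ^+ (n.+1 + J) * t)).
  by rewrite /Fs nm1; lra.
have lowA : k2 * \prod_(i < n) nm (p ^+ i * t) <= \prod_(i < n) nm (1 + p ^+ i * t).
  rewrite (reindex_inj rev_ord_inj) /= [X in _ <= X](reindex_inj rev_ord_inj) /=.
  apply: le_trans (ler_wpM2r _ (Hk2 n)) _; first by apply: prodr_ge0 => i _; exact: nm_ge0.
  rewrite -big_split /=; apply: ler_prod => i _.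
  have f0 : 0 <= 1 - s * x ^+ i.+1.
    have := exprn_ile1 i (ltW x0) (ltW x1); rewrite exprS mulrA => h.
    have : s * x * x ^+ i <= s * x by rewrite ler_piMr // mulr_ge0 ?ltW.
    by lra.
  rewrite mulr_ge0 ?nm_ge0 //=.
  have i_n := ltn_ord i.
  have E : y' = p ^+ i.+1 * (p ^+ (n - i.+1) * t) by rewrite -pnt -pit subnK.
  have zn0 : p ^+ (n - i.+1) * t != 0 by rewrite mulf_neq0 ?expf_neq0 // /t mulf_neq0 // invr_eq0 expf_neq0.
  set z := p ^+ (n - i.+1) * t in E zn0 *.
  have z1 : 1 <= s * x ^+ i.+1 * nm z.
    have -> : s * x ^+ i.+1 * nm z = s * nm y' by rewrite E nmM nmX; ring.
    by rewrite -ler_pdivrMr ?nm_gt0 // mul1r.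
  by have := nm_sub_ge z (-1); rewrite nmN nm1 opprK [z + 1]addrC; lra.
have lowB : k2 <= \prod_(i < J) nm (1 + p ^+ (n.+1 + i) * t).
  apply: le_trans (Hk2 J) _; apply: ler_prod => i _.
  have f0 : 0 <= 1 - s * x ^+ i.+1.
    have := exprn_ile1 i (ltW x0) (ltW x1); rewrite exprS mulrA => h.
    have : s * x * x ^+ i <= s * x by rewrite ler_piMr // mulr_ge0 ?ltW.
    by lra.
  rewrite f0 /=; have E : p ^+ (n.+1 + i) * t = p ^+ i.+1 * y' by rewrite addSnnS pit pnt.
  rewrite E; have := nm_sub_ge 1 (- (p ^+ i.+1 * y')); rewrite nmN nm1 opprK nmM nmX => h.
  have : x ^+ i.+1 * nm y' <= x ^+ i.+1 * s by rewrite ler_wpM2l // exprn_ge0 // ltW.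
  by rewrite [x ^+ _ * s]mulrC; lra.
have upC : k1 * nm (Fs n * t ^+ n) <= \prod_(i < n) nm (p ^+ i * t).
  rewrite nmM nmX /Fs nm_prod mulrA.
  have -> : \prod_(i < n) nm (p ^+ i * t) = (\prod_(i < n) nm (p ^+ i)) * nm t ^+ n.
    by rewrite -[X in nm t ^+ X]card_ord -prodr_const -big_split; apply: eq_bigr => i _; rewrite nmM.
  apply: ler_wpM2r; first by rewrite exprn_ge0 ?nm_ge0.
  apply: le_trans (ler_wpM2r _ (Hk1 n)) _; first by apply: prodr_ge0 => i _; exact: nm_ge0.
  rewrite -big_split /=; apply: ler_prod => i _.
  have fi : 0 < 1 - 1 * x ^+ i.+1 by rewrite mul1r subr_gt0; apply: exprn_ilt1 => //; exact: ltW.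
  rewrite mulr_ge0 ?nm_ge0 ?(ltW fi) //= nmM nmV mulrCA -[leRHS]mulr1; apply: ler_wpM2l; first exact: nm_ge0.
  rewrite ler_pdivrMr ?nm_gt0 ?one_sub // mul1r.
  by have := nm_sub_ge 1 (p ^+ i.+1); rewrite nm1 nmX mul1r.
rewrite /Phi tE nmM nmV ler_pdivlMr; last first.
  by rewrite nm_gt0 mulf_neq0 ?Fs_neq0 // expf_neq0 // /t mulf_neq0 // invr_eq0 expf_neq0.
set W := nm (Fs n * t ^+ n) in upC *.
rewrite (ev_Fs_prod t (n.+1 + J)) big_split_ord /= big_ord_recr /= pnt !nmM !nm_prod.
set PA := \prod_(i < n) nm (p ^+ i * t) in lowA upC.
set A := \prod_(i < n) nm (1 + p ^+ i * t) in lowA *; set B := \prod_(i < J) _ in lowB *.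
have A0 : 0 <= A by apply: prodr_ge0 => i _; exact: nm_ge0.
have P0 : 0 <= PA by apply: prodr_ge0 => i _; exact: nm_ge0.
have FT : 0 <= W by exact: nm_ge0.
have -> : k1 * k2 * k2 / 2 * nm (1 + y') * W = (k2 * (k1 * W)) * nm (1 + y') * k2 * 2^-1 by ring.
apply: ler_pM => //; [by rewrite !mulr_ge0 ?nm_ge0 ?ltW | by rewrite invr_ge0 |].
apply: ler_pM => //; [by rewrite !mulr_ge0 ?nm_ge0 ?ltW | by rewrite ltW |].
apply: ler_wpM2r; first exact: nm_ge0.
apply: le_trans lowA; apply: ler_wpM2l => //; exact: ltW.
Qed.
End Euler.

(** * Location of the zeros of a series of type p *)

Section Zeros.
Variable R : realType.
Local Notation C := R[i].
Variables (p : C) (u : R).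
Hypotheses (p0 : p != 0) (u0 : 0 < u) (u1 : u < 1) (pu : nm p = u ^+ 4).
Local Notation x := (nm p).
Let x0 : 0 < x. Proof. by rewrite nm_gt0. Qed.
Let x1 : x < 1. Proof. by rewrite pu exprn_ilt1 ?ltW. Qed.
Let u3 : 0 < u ^+ 3. Proof. by rewrite exprn_gt0. Qed.

(** The bound for Euler's series passes to [f] by [Phi_compare]. The factor 1 + y accounts for the
    single zero near y = -1, and [e] for the error of the comparison. *)
Lemma etype_lower f : etype p f -> exists c1, 0 < c1 /\ forall e, 0 < e -> exists N0, forall N y, (N0 <= N)%N ->
  u ^+ 3 <= nm y -> nm y <= (u ^+ 3)^-1 -> c1 * nm (1 + y) - e <= nm (Phi f N y).
Proof.
move=> Ef; have [c1 [N1 [c10 H1]]] := Fs_lower p0 u0 u1 pu; exists c1; split=> // e e0.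
have e2 : 0 < e / 2 by rewrite divr_gt0.
have [N2 H2] := Phi_compare p0 x1 (u ^+ 3)^-1 Ef (etype_Fs p0 u0 u1 pu) u3 e2.
have e3 : 0 < e / 2 / (c1 * (u ^+ 3)^-1) by rewrite divr_gt0 // mulr_gt0 // invr_gt0.
have [N3 H3] := expr_small (ltW x0) x1 e3.
exists (N1 + N2 + N3)%N => N y hN ylo yhi.
have hN1 : (N1 <= N)%N by clear -hN; lia. have hN2 : (N2 <= N)%N by clear -hN; lia.
have hN3 : (N3 <= N.+1)%N by clear -hN; lia.
have h1 := H1 N y hN1 ylo yhi; have h2 := H2 N y hN2 ylo yhi.
have h3 := nm_sub_ge (Phi (Fs p) N y) (Phi f N y); rewrite nm_sym in h3.
have h4 : nm (1 + y) - nm y * x ^+ N.+1 <= nm (1 + y * (1 - p ^+ N.+1)).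
  have -> : 1 + y * (1 - p ^+ N.+1) = 1 + y - y * p ^+ N.+1 by ring.
  by have := nm_sub_ge (1 + y) (y * p ^+ N.+1); rewrite nmM nmX.
have h5 : c1 * (nm y * x ^+ N.+1) <= e / 2.
  have := H3 N.+1 hN3; rewrite ltr_pdivlMr ?mulr_gt0 ?invr_gt0 // => h.
  apply: le_trans (ltW h); rewrite [x ^+ _ * _]mulrC -mulrA; apply: ler_wpM2l; first exact: ltW.
  by apply: ler_wpM2r => //; rewrite exprn_ge0 // ltW.
have h6 := ler_wpM2l (ltW c10) h4; rewrite mulrBr in h6.
by lra.
Qed.

Lemma scaled_gap (A t a b c : R) : 5 * A * t <= a -> b <= A * t -> a - b <= c -> 4 * A * t <= c.
Proof. lra. Qed.

Lemma bigD1_seq_root (rs : seq C) (z : C) : z \in rs -> \prod_(w <- rs) (z - w) = 0.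
Proof. by move=> zr; apply/eqP; rewrite prodf_seq_eq0; apply/hasP; exists z => //=; rewrite subrr eqxx. Qed.

Lemma ev_disc_tail F (r e : R) : (forall r, cv F r) -> 0 < r -> 0 < e ->
  exists K0, forall K z, (K0 <= K)%N -> nm z <= r ->
  nm (ev F z - (trunc K F).[z]) <= e.
Proof.
move=> cF r0 e0; have [r' [M [rr b]]] := cF r.
have M0 := bnd_ge0 b; have r'0 : 0 < r' by exact: lt_trans rr.
have y0 : 0 <= r / r' by rewrite divr_ge0 // ltW.
have y1 : r / r' < 1 by rewrite ltr_pdivrMr // mul1r.
have y1' : 0 < 1 - r / r' by rewrite subr_gt0.
have e1 : 0 < e * (1 - r / r') / (M + 1) by rewrite divr_gt0 ?mulr_gt0 // ltr_wpDl.
have [N HN] := expr_small y0 y1 e1; exists N => K z hK zr.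
have zr' : nm z < r' by exact: le_lt_trans rr.
rewrite -psum_horner; apply: le_trans (ev_tail K zr' b) _.
have a1 : nm z / r' <= r / r' by rewrite ler_wpM2r // invr_ge0 ltW.
have a0 : 0 <= nm z / r' by rewrite divr_ge0 ?nm_ge0 // ltW.
rewrite ler_pdivrMr; last by rewrite subr_gt0; exact: le_lt_trans a1 y1.
apply: le_trans (_ : e * (1 - r / r') <= _); last by apply: ler_wpM2l; [exact: ltW | rewrite lerD2l lerN2].
have := HN K hK; rewrite ltr_pdivlMr ?ltr_wpDl // => h; apply: le_trans (ltW h).
rewrite mulrC; apply: ler_pM => //; [by rewrite exprn_ge0 | apply: lerXn2r;
  rewrite ?nnegrE // | by rewrite lerDl].
Qed.

(** A substitute for Rouche's theorem: around a zero of Euler's series, [f] is large on a small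
    circle and small at its centre, so by [min_modulus_pole] its truncations have zeros in the disc.
    An ultralimit of these is a zero of [f]. *)
Lemma etype_zero f : etype p f -> forall dl, 0 < dl -> exists N0, forall N, (N0 <= N)%N ->
  exists z, [/\ ev f z = 0, z != 0 & nm (z * rho f N + 1) <= dl].
Proof.
move=> Ef; have cvf := etype_cv p0 x1 Ef; have [f0 _] := Ef.
(* A small [dl] keeps the disc within the annulus where the estimates hold. *)
suff H dl : 0 < dl -> dl <= (1 - u ^+ 3) / 2 -> exists N0, forall N, (N0 <= N)%N ->
  exists z, [/\ ev f z = 0, z != 0 & nm (z * rho f N + 1) <= dl].
  move=> dl dl0; have u31 : u ^+ 3 < 1 by rewrite exprn_ilt1 // ltW.
  have dm : 0 < (1 - u ^+ 3) / 2 by rewrite divr_gt0 // subr_gt0.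
  have [||N0 HN0] := H (Num.min dl ((1 - u ^+ 3) / 2)).
  - by rewrite lt_min dl0 dm.
  - by rewrite ge_min lexx orbT.
  exists N0 => N hN; have [z [h1 h2 h3]] := HN0 N hN; exists z; split=> //.
  by apply: le_trans h3 _; rewrite ge_min lexx.
move=> dl0 dlu; have u31 : u ^+ 3 < 1 by rewrite exprn_ilt1 // ltW.
have u30 := u3.
have u3i : 2 - u ^+ 3 <= (u ^+ 3)^-1.
  rewrite -[leRHS]mul1r ler_pdivlMr //; have h2 : 0 <= (1 - u ^+ 3) ^+ 2 by exact: sqr_ge0.
  by rewrite expr2 in h2; move: h2; set t := u ^+ 3; lra.
have [c1 [c10 HL]] := etype_lower Ef.
pose d := dl / 2; have d0 : 0 < d by rewrite divr_gt0.
have dd : dl = 2 * d by rewrite /d; field.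
clearbody d; subst dl.
pose m := c1 * d / 2; have m0 : 0 < m by rewrite divr_gt0 ?mulr_gt0.
have e1 : 0 < c1 * d / 8 by rewrite divr_gt0 ?mulr_gt0.
have [N1 H1] := HL _ e1.
have [N2 H2] := Phi_compare p0 x1 (u ^+ 3)^-1 Ef (etype_Fs p0 u0 u1 pu) u30 e1.
have d8 : 0 < Num.min (d / 8) 2^-1 by rewrite lt_min divr_gt0 //= invr_gt0.
have [N3 H3] := expr_small (ltW x0) x1 d8.
exists (N1 + N2 + N3)%N => N hN.
have hN1 : (N1 <= N)%N by clear -hN; lia. have hN2 : (N2 <= N)%N by clear -hN; lia.
have hN3 : (N3 <= N.+1)%N by clear -hN; lia.
have {H3} := H3 N.+1 hN3; rewrite lt_min => /andP[xd xh].
have [om ] : 1 - p ^+ N.+1 != 0 /\ 2^-1 <= nm (1 - p ^+ N.+1).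
  have h : 2^-1 <= nm (1 - p ^+ N.+1) by have := nm_sub_ge 1 (p ^+ N.+1); rewrite nm1 nmX; lra.
  by split=> //; rewrite -nm_gt0; apply: lt_le_trans h; rewrite invr_gt0.
(* The exact zero of the rescaled Euler series: [yN / rho (Fs p) N] is -p^-N. *)
move=> om2; pose yN := - (1 - p ^+ N.+1)^-1.
have yN1 : nm (yN + 1) <= d / 4.
  have -> : yN + 1 = - (p ^+ N.+1 / (1 - p ^+ N.+1)) by rewrite /yN; field.
  rewrite nmN nmM nmV nmX ler_pdivrMr ?nm_gt0 //.
  apply: le_trans (_ : d / 4 * 2^-1 <= _); last by apply: ler_wpM2l => //; rewrite divr_ge0 // ltW.
  by lra.
have r0 := rho_neq0 Ef N; have rp : 0 < nm (rho f N) by rewrite nm_gt0.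
have fN : 0 < nm (f N) by rewrite nm_gt0.
have ann y : nm (y - yN) <= d -> u ^+ 3 <= nm y <= (u ^+ 3)^-1.
  move=> h; have e3 : y + 1 = (y - yN) + (yN + 1) by ring.
  have := nmD (y - yN) (yN + 1); rewrite -e3 => h2.
  have h3 := nm_sub_ge y (-1); rewrite nmN nm1 opprK in h3.
  have h4 := nm_sub_ge (-1) y; rewrite nmN nm1 in h4.
  have h5 : nm (-1 - y) = nm (y + 1) by rewrite -opprD addrC nmN.
  apply/andP; split; first by lra.
  by apply: le_trans u3i; lra.
pose a := yN / rho f N; pose dR := d / nm (rho f N).
have dR0 : 0 < dR by rewrite divr_gt0.
have scale z : nm (z - a) <= dR -> nm (z * rho f N - yN) <= d.
  move=> h; have -> : z * rho f N - yN = (z - a) * rho f N by rewrite /a mulrBl divfK.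
  by rewrite nmM -ler_pdivlMr.
have disc z : nm (z - a) <= dR -> u ^+ 3 / nm (rho f N) <= nm z <= (u ^+ 3)^-1 / nm (rho f N).
  move=> /scale /ann; rewrite nmM => /andP[h1 h2].
  by rewrite ler_pdivrMr // h1 /= ler_pdivlMr.
have PhiE z : nm (ev f z) = nm (Phi f N (z * rho f N)) * (nm (f N) * nm z ^+ N) \/ z = 0.
  have [->|z0] := eqVneq z 0; [by right | left].
  rewrite /Phi mulfK // nmM nmV nmM nmX divfK // gt_eqF // mulr_gt0 ?exprn_gt0 ?nm_gt0 //.
have zn0 z : nm (z - a) <= dR -> z <> 0.
  move=> /disc /andP[h _] z0; move: h; rewrite z0 nm0 => h.
  by have := divr_gt0 u30 rp; lra.
(* [A] is the unit of the estimates, c1 d = 8A. On the circle |1 + y| >= 3d/4 gives 6A - A = 5A, at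
   the centre [f] is at most A, and truncation costs A: at least 4A against at most 2A. *)
set A := c1 * d / 8 in e1 H1 H2 *.
have circ z : nm (z - a) = dR -> 5 * A * (nm (f N) * nm z ^+ N) <= nm (ev f z).
  move=> h; have hz : nm (z - a) <= dR by rewrite h.
  have [->|/(zn0 _ hz) []//] := PhiE z; apply: ler_wpM2r; first by rewrite mulr_ge0 ?exprn_ge0 ?nm_ge0.
  have /andP[b1 b2] := ann _ (scale _ hz); have := H1 N _ hN1 b1 b2.
  have e3 : nm (z * rho f N - yN) = d.
    have -> : z * rho f N - yN = (z - a) * rho f N by rewrite /a mulrBl divfK.
    by rewrite nmM h /dR divfK // gt_eqF.
  have := nm_sub_ge (z * rho f N - yN) (- (yN + 1)).
  have -> : z * rho f N - yN - - (yN + 1) = 1 + z * rho f N by ring.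
  rewrite nmN e3 => h5 h6.
  have h7 : c1 * (d * (3 / 4)) <= c1 * nm (1 + z * rho f N).
    by apply: ler_wpM2l; [exact: ltW | lra].
  by move: h6 h7; rewrite /A; lra.
have aa : nm (a - a) <= dR by rewrite subrr nm0 ltW.
have ya : a * rho f N = yN by rewrite /a divfK.
have cent : nm (ev f a) <= A * (nm (f N) * nm a ^+ N).
  have [->|/(zn0 _ aa) []//] := PhiE a; apply: ler_wpM2r; first by rewrite mulr_ge0 ?exprn_ge0 ?nm_ge0.
  have /andP[b1 b2] := ann _ (scale _ aa); have := H2 N _ hN2 b1 b2; rewrite ya.
  have -> : Phi (Fs p) N yN = 0; last by rewrite subr0.
  rewrite /Phi (_ : yN / rho (Fs p) N = - p ^- N) ?(Fs_zero p0 u0 u1 pu) ?mul0r //.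
  by rewrite (rho_Fs p0 u0 u1 pu) /yN; field; rewrite om expf_neq0.
pose zl := u ^+ 3 / nm (rho f N); have zl0 : 0 < zl by rewrite divr_gt0.
pose r := (u ^+ 3)^-1 / nm (rho f N); have r_0 : 0 < r by rewrite divr_gt0 // invr_gt0.
have eta0 : 0 < A * (nm (f N) * zl ^+ N) by apply: mulr_gt0 => //; apply: mulr_gt0 => //; exact: exprn_gt0.
have etaz z : nm (z - a) <= dR -> A * (nm (f N) * zl ^+ N) <= A * (nm (f N) * nm z ^+ N).
  move=> /disc /andP[h _]; rewrite !ler_pM2l //; apply: lerXn2r; rewrite ?nnegrE ?nm_ge0 //; exact: ltW zl0.
have [K0 HK0] := ev_disc_tail cvf r_0 eta0.
have roots K : (K0 <= K)%N -> exists z, (trunc K f).[z] = 0 /\ nm (z - a) <= dR.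
  move=> hK; apply: contrapT => Hno.
  have tl z : nm (z - a) <= dR -> nm (ev f z - (trunc K f).[z]) <= A * (nm (f N) * nm z ^+ N).
    move=> h; apply: le_trans (etaz z h); apply: HK0 => //; by have /andP[] := disc z h.
  have [rs Trs] := closed_field_poly_normal (trunc K f).
  have TE y : (trunc K f).[y] = lead_coef (trunc K f) * \prod_(z <- rs) (y - z).
    by rewrite {1}Trs hornerZ horner_prod; congr (_ * _); apply: eq_bigr => z _; rewrite hornerXsubC.
  have da : dR < nm a.
    have -> : nm a = nm yN / nm (rho f N) by rewrite /a nmM nmV.
    rewrite ltr_pM2r ?invr_gt0 //; have h4 := nm_sub_ge (-1) (- (yN + 1)); rewrite !nmN nm1 in h4.
    have h5 : nm (-1 - - (yN + 1)) = nm yN by congr nm; ring.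
    by lra.
  have := @min_modulus_pole R (lead_coef (trunc K f)) a rs dR (4 * A * nm (f N)) N dR0 da.
  have sub1 : forall z, z \in rs -> dR < nm (a - z).
    move=> z zr; rewrite nm_sym ltNge; apply/negP => h; apply: Hno; exists z; split=> //.
    by rewrite TE bigD1_seq_root // mulr0.
  move=> /(_ sub1); rewrite -TE => H.
  have : 4 * A * nm (f N) * nm a ^+ N <= nm (trunc K f).[a].
    apply: H => y hy; rewrite -TE; have hy' : nm (y - a) <= dR by rewrite hy.
    have h1 := circ y hy; have h2 := tl y hy'; have h3 := nm_sub_ge (ev f y) (ev f y - (trunc K f).[y]).
    have h4 : ev f y - (ev f y - (trunc K f).[y]) = (trunc K f).[y] by ring.
    rewrite h4 in h3; rewrite -[4 * A * _ * _]mulrA; move: h1 h2 h3; exact: scaled_gap.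
  have h1 := tl a aa; have h3 := nm_sub_ge (trunc K f).[a] (ev f a); rewrite nm_sym in h3.
  have tpos : 0 < A * (nm (f N) * nm a ^+ N) by apply: lt_le_trans eta0 (etaz a aa).
  rewrite -[4 * A * _ * _]mulrA; move: h1 h3 tpos cent; set t := nm (f N) * nm a ^+ N; lra.
have [zz Hzz] := boolp.choice (fun k => roots (K0 + k)%N (leq_addr _ _)).
have zzr k : nm (zz k) <= r by have /andP[] := disc _ (Hzz k).2.
have [U [UU FU]] := ultra_ex; have PU := @ultra_proper _ _ UU.
have [|z Hz] := @ulim_ex R U UU zz r; first by apply: FU; exists 0%N => // k _ /=; exact: zzr.
have za : nm (z - a) <= dR.
  apply: (@flim_le _ U (fun k => zz k - a)) => //.
    by apply: flimD => //; exact: flim_cst.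
  by apply: FU; exists 0%N => // k _; exact: (Hzz k).2.
have [r' [M [zr' b]]] := cvf (nm z).
have r'0 : 0 < r' by exact: le_lt_trans (nm_ge0 _) zr'.
exists z; split; last 2 first.
- exact/eqP/(zn0 _ za).
- have -> : z * rho f N + 1 = (z * rho f N - yN) + (yN + 1) by ring.
  have := nmD (z * rho f N - yN) (yN + 1); have := scale z za; lra.
have h1 := ev_cont PU r'0 b zr' Hz.
apply: (flim_unique PU h1) => e e0; apply: FU.
have e2 : 0 < e / 2 by rewrite divr_gt0.
have [K1 HK1] := ev_disc_tail cvf r_0 e2; exists K1 => // k /= hk; rewrite subr0.
have := HK1 (K0 + k)%N (zz k) (leq_trans hk (leq_addl _ _)) (zzr k); rewrite (Hzz k).1 subr0 => h;
  apply: le_lt_trans h _.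
by rewrite ltr_pdivrMr // ltr_pMr // ltr1n.
Qed.
End Zeros.

(** * Zeros of algebraically dependent entire functions *)

Section Growth.
Variable R : realType.
Local Notation C := R[i].
Implicit Types (f g : ps C) (z y : C).

Lemma poly_upper (T : {poly C}) : exists M, 0 < M /\ forall z, 1 <= nm z -> nm T.[z] <= M * nm z ^+ size T.
Proof.
exists (\sum_(i < size T) nm T`_i + 1).
have S0 : 0 <= \sum_(i < size T) nm T`_i by apply: sumr_ge0 => i _; exact: nm_ge0.
split; first by apply: ltr_wpDl.
move=> z z1; rewrite horner_coef; apply: le_trans (nm_sum _ _ _) _.
apply: le_trans (_ : (\sum_(i < size T) nm T`_i) * nm z ^+ size T <= _).
  rewrite big_distrl /=; apply: ler_sum => i _; rewrite nmM nmX; apply: ler_wpM2l; first exact: nm_ge0.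
  by apply: ler_weXn2l => //; exact: ltnW.
by apply: ler_wpM2r; [rewrite exprn_ge0 ?nm_ge0 | rewrite lerDl].
Qed.

Lemma poly_large (T : {poly C}) : T != 0 -> exists d r, [/\ 0 < d, 1 <= r & forall z, r <= nm z ->
  d <= nm T.[z]].
Proof.
move=> T0; have lc : 0 < nm (lead_coef T) by rewrite nm_gt0 lead_coef_eq0.
have [n sT] : exists n, size T = n.+1 by exists (size T).-1; rewrite prednK // size_poly_gt0.
pose S := \sum_(i < n) nm T`_i; have S0 : 0 <= S by apply: sumr_ge0 => i _; exact: nm_ge0.
have SL : 0 <= S / nm (lead_coef T) by rewrite divr_ge0 // ltW.
exists (nm (lead_coef T)), (S / nm (lead_coef T) + 1); split=> //; first by rewrite lerDr.
move=> z hz; have z1 : 1 <= nm z by apply: le_trans hz; rewrite lerDr.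
rewrite horner_coef sT big_ord_recr /=.
have lcE : T`_n = lead_coef T by rewrite lead_coefE sT.
rewrite lcE; have h1 := nm_sub_ge (lead_coef T * z ^+ n) (- \sum_(i < n) T`_i * z ^+ i).
rewrite nmN nmM nmX opprK [_ + \sum_(i < n) _]addrC in h1.
have h2 : nm (\sum_(i < n) T`_i * z ^+ i) <= S * nm z ^+ n.-1.
  apply: le_trans (nm_sum _ _ _) _; rewrite /S big_distrl /=; apply: ler_sum => i _.
  rewrite nmM nmX; apply: ler_wpM2l; first exact: nm_ge0.
  by apply: ler_weXn2l => //; rewrite -ltnS prednK ?ltn_ord //; exact: leq_ltn_trans (leq0n _) (ltn_ord i).
apply: le_trans h1; case: (posnP n) => [n0|n0].
  have S00 : S = 0 by rewrite /S n0 big_ord0.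
  by rewrite S00 mul0r in h2; rewrite n0 expr0 mulr1; rewrite n0 in h2; lra.
have h3 : S + nm (lead_coef T) <= nm (lead_coef T) * nm z.
  have := ler_wpM2l (ltW lc) hz; rewrite mulrDr mulr1 mulrCA divff ?mulr1 // gt_eqF //.
have zk : 1 <= nm z ^+ n.-1 by exact: exprn_ege1.
rewrite -[n in nm z ^+ n](prednK n0) exprS mulrA.
have h4 := ler_wpM2r (le_trans ler01 zk) h3; rewrite mulrDl in h4.
have h5 : nm (lead_coef T) <= nm (lead_coef T) * nm z ^+ n.-1 by rewrite ler_peMr // ltW.
lra.
Qed.

(** For large z the leading coefficient is bounded away from 0, and Cauchy's bound for roots grows
    like a power of z. *)
Lemma root_growth (Q : {poly {poly C}}) : Q != 0 -> exists c M r, [/\ 0 < M, 1 <= r &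
  forall z y, r <= nm z -> \sum_(j < size Q) (Q`_j).[z] * y ^+ j = 0 -> nm y <= M * nm z ^+ c].
Proof.
move=> Q0; have [n sQ] : exists n, size Q = n.+1 by exists (size Q).-1; rewrite prednK // size_poly_gt0.
have [d [r [d0 r1 HL]]] : exists d r, [/\ 0 < d, 1 <= r & forall z, r <= nm z -> d <= nm (lead_coef Q).[z]].
  by apply: poly_large; rewrite lead_coef_eq0.
have [M HM] := boolp.choice (fun j => poly_upper Q`_j).
pose c := \max_(j < n) size (Q`_j)%R; pose MM := \sum_(j < n) M j.
have MM0 : 0 <= MM by apply: sumr_ge0 => j _; rewrite ltW // (HM j).1.
exists c, (MM / d + 1), r; split=> //; first by rewrite ltr_wpDl // divr_ge0 // ltW.
move=> z y hz; rewrite sQ big_ord_recr /= => E.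
have z1 : 1 <= nm z by exact: le_trans hz.
have zc : 1 <= nm z ^+ c by exact: exprn_ege1.
have [y1|y1] := leP (nm y) 1.
  apply: le_trans y1 _; rewrite -[leLHS]mulr1; apply: ler_pM => //.
  by rewrite lerDr divr_ge0 // ltW.
have lcE : Q`_n = lead_coef Q by rewrite lead_coefE sQ.
have h1 : nm ((lead_coef Q).[z] * y ^+ n) <= MM * nm z ^+ c * nm y ^+ n.-1.
  have -> : (lead_coef Q).[z] * y ^+ n = - \sum_(j < n) (Q`_j).[z] * y ^+ j.
    by apply/eqP; rewrite -addr_eq0 addrC -lcE; apply/eqP.
  rewrite nmN; apply: le_trans (nm_sum _ _ _) _; rewrite /MM !big_distrl /=; apply: ler_sum => j _.
  rewrite nmM nmX; apply: ler_pM; rewrite ?nm_ge0 ?exprn_ge0 ?nm_ge0 //.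
    apply: le_trans ((HM j).2 z z1) _; apply: ler_wpM2l; first by rewrite ltW // (HM j).1.
    by apply: ler_weXn2l => //; exact: (leq_bigmax (F := fun j : 'I_n => size (Q`_j)%R)).
  by apply: ler_weXn2l; [exact: ltW | rewrite -ltnS prednK ?ltn_ord //;
    exact: leq_ltn_trans (leq0n _) (ltn_ord j)].
case: (posnP n) => [n0|n0].
  rewrite /MM n0 big_ord0 !mul0r expr0 mulr1 in h1; have := HL z hz; lra.
have y0 : 0 < nm y by exact: lt_trans ltr01 y1.
have yk : 0 < nm y ^+ n.-1 by rewrite exprn_gt0.
have h2 : d * nm y <= MM * nm z ^+ c.
  rewrite -(ler_pM2r yk) -mulrA -exprS prednK //; apply: le_trans h1; rewrite nmM nmX.
  by apply: ler_wpM2r; [rewrite exprn_ge0 ?nm_ge0 | exact: HL].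
apply: le_trans (_ : MM / d * nm z ^+ c <= _).
  by rewrite mulrAC ler_pdivlMr // mulrC.
by apply: ler_wpM2r; [exact: le_trans ler01 zc | rewrite lerDl].
Qed.

(* The relation at a zero of [f]. *)
Definition at0 (P : {poly {poly {poly C}}}) : {poly {poly C}} := map_poly (fun c : {poly {poly C}} => c`_0) P.
Lemma coef_at0 P j : (at0 P)`_j = (P`_j)`_0.
Proof. by rewrite /at0 coef_map_id0 ?coef0. Qed.

(** As [f] is not 0, factors equal to its variable can be cancelled until the relation survives
    setting that variable to 0. *)
Lemma dep_at0 f g P : f != 0 -> P != 0 -> ev2 f g P = 0 -> exists P, [/\ P != 0, ev2 f g P = 0 & at0 P != 0].
Proof.
move=> f0; have [m] : exists m, forall j, (size (P`_j)%R <= m)%N.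
  exists (\max_(i < size P) size (P`_i)%R) => i.
  case: (ltnP i (size P)) => h; last by rewrite nth_default // size_poly0.
  exact: (leq_bigmax (F := fun i : 'I_(size P) => size (P`_i)%R) (Ordinal h)).
elim: m P => [|m IH] P sP P0 EP.
  case/eqP: P0; apply/polyP => j; rewrite coef0; apply/eqP; by rewrite -size_poly_leq0.
have [A0|A0] := eqVneq (at0 P) 0; last by exists P.
pose Q := \poly_(j < size P) (drop_poly 1 P`_j).
have QE : P = 'X%:P * Q.
  apply/polyP => j; rewrite coefCM coef_poly; case: ltnP => h; last by rewrite nth_default // mulr0.
  rewrite mulrC -[LHS](poly_take_drop 1); rewrite expr1 (_ : take_poly 1 P`_j = 0) ?add0r //.
  apply/polyP => -[|i]; rewrite coef0 /take_poly coef_poly //=.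
  by have := congr1 (fun q : {poly {poly C}} => q`_j) A0; rewrite coef_at0 coef0.
apply: (IH Q).
- move=> j; rewrite coef_poly; case: ltnP => _; last by rewrite size_poly0.
  by rewrite size_drop_poly; have := sP j; lia.
- by apply: contraNneq P0 => Q0; rewrite QE Q0 mulr0.
- have := EP; rewrite QE rmorphM /= ev2C phiX => /eqP; rewrite mulf_eq0 (negbTE f0) => /eqP //.
Qed.

Lemma ev_phi f c z : (forall r, cv f r) -> (forall r, cv (phi f c) r) /\
  ev (phi f c) z = \sum_(i < size c) (c`_i).[z] * ev f z ^+ i.
Proof.
move=> cf.
have cvt i r : cv (pp c`_i * f ^+ i) r.
  apply: (@cv_le _ _ `|r|); first exact: ler_norm.
  by apply: cvM => //; [exact: cv_pp | apply: cvX => //].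
split.
  by move=> r; rewrite phiE; apply: (@cv_le _ _ `|r|); [exact: ler_norm | apply: cv_sum => // i _; exact: cvt].
rewrite phiE ev_sum //; apply: eq_bigr => i _; rewrite evM ?ev_pp ?evX //; [exact: cv_pp | apply: cvX => //;
  exact: nm_ge0].
Qed.

Lemma ev_ev2 f g P z : (forall r, cv f r) -> (forall r, cv g r) ->
  ev (ev2 f g P) z = \sum_(j < size P) (ev (phi f P`_j) z) * ev g z ^+ j.
Proof.
move=> cf cg; rewrite ev2E ev_sum; last first.
  by move=> j _; apply: cvM; [exact: nm_ge0 | exact: (ev_phi _ z cf).1 | apply: cvX => //; exact: nm_ge0].
apply: eq_bigr => j _; rewrite evM ?evX //; [exact: (ev_phi _ z cf).1 | apply: cvX => //; exact: nm_ge0].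
Qed.

(** At a zero z of [f] the relation becomes an equation for g(z) with polynomial coefficients in z,
    to which [root_growth] applies. *)
Lemma zero_growth f g P : f != 0 -> (forall r, cv f r) -> (forall r, cv g r) -> P != 0 -> ev2 f g P = 0 ->
  exists c M r, [/\ 0 < M, 1 <= r & forall z, r <= nm z -> ev f z = 0 -> nm (ev g z) <= M * nm z ^+ c].
Proof.
move=> f0 cf cg P0 EP; have [S [S0 ES S1]] := dep_at0 f0 P0 EP.
have [c [M [r [M0 r1 H]]]] := root_growth S1; exists c, M, r; split=> // z hz fz.
apply: H hz _; have := ev_ev2 S z cf cg; rewrite ES.
have -> : ev (0 : ps C) z = 0 by rewrite -(rmorph0 (@pp C)) ev_pp horner0.
move/esym => E; rewrite -[RHS]E.
have sS : (size (at0 S) <= size S)%N by exact: size_poly.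
rewrite -(big_mkord xpredT (fun j => ((at0 S)`_j).[z] * ev g z ^+ j)) -(big_mkord xpredT (fun j =>
  ev (phi f S`_j) z * ev g z ^+ j)).
rewrite [RHS](big_cat_nat (leq0n _) sS) /= [X in _ = _ + X]big_nat [X in _ = _ + X]big1 ?addr0.
  apply: eq_bigr => j _; congr (_ * _); rewrite (ev_phi _ z cf).2 fz coef_at0.
  case: (size S`_j) (nth_default 0 (s := S`_j) (n := 0)) => [|k] nd; first by rewrite big_ord0 nd ?horner0.
  by rewrite big_ord_recl big1 ?addr0 ?expr0 ?mulr1 // => i _; rewrite expr0n mulr0.
move=> j /andP[h1 _]; rewrite (ev_phi _ z cf).2 fz.
have c0 : (S`_j)`_0 = 0 by rewrite -coef_at0 nth_default.
case: (size S`_j) => [|k]; first by rewrite big_ord0 mul0r.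
by rewrite big_ord_recl c0 horner0 mul0r add0r big1 ?mul0r // => i _; rewrite expr0n mulr0.
Qed.
End Growth.

(** * Shared zeros and commensurable types *)

Section Annulus.
Variable R : realType.
Local Notation C := R[i].
Implicit Types (f g : ps C) (z y : C).

Lemma fourth_root (p : C) : p != 0 -> nm p < 1 -> exists u : R, [/\ 0 < u, u < 1 & nm p = u ^+ 4].
Proof.
move=> p0 p1; have np : 0 < nm p by rewrite nm_gt0.
exists (Num.sqrt (Num.sqrt (nm p))).
have s1 : 0 < Num.sqrt (nm p) by rewrite sqrtr_gt0.
split; first by rewrite sqrtr_gt0.
  by rewrite -sqrtr1 ltr_sqrt // -sqrtr1 ltr_sqrt.
by rewrite (exprM _ 2 2) !sqr_sqrtr // ltW.
Qed.

Lemma tends_nm (v : nat -> C) l e : tends v l -> 0 < e -> exists N0, forall n, (N0 <= n)%N ->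
  nm l - e < nm (v n) < nm l + e.
Proof.
move=> /tendsP H /H [N0 HN]; exists N0 => n /HN h.
have := nm_sub_ge (v n) l; have := nm_sub_ge l (v n); rewrite nm_sym => h1 h2; apply/andP; split; lra.
Qed.

Section Fix.
Variables (p : C) (u : R).
Hypotheses (p0 : p != 0) (u0 : 0 < u) (u1 : u < 1) (pu : nm p = u ^+ 4).
Local Notation x := (nm p).
Let x0 : 0 < x. Proof. by rewrite nm_gt0. Qed.
Let x1 : x < 1. Proof. by rewrite pu exprn_ilt1 ?ltW. Qed.

(** Let [n] be the first index with |z rho| <= u^-2. The previous value exceeded u^-2 and the ratio
    of consecutive ones is eventually above u^5, so the value at [n] is at least u^3. *)
Lemma annulus f n0 : etype p f -> exists r, forall z, r <= nm z -> exists n, (n0 <= n)%N /\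
  u ^+ 3 <= nm (z * rho f n) <= (u ^+ 3)^-1.
Proof.
move=> Ef; have rn := rho_neq0 Ef.
have u0' := u0; have u1' := u1.
have e0 : 0 < nm p - u ^+ 5.
  by rewrite pu (exprS u 4) subr_gt0 -[X in _ < X]mul1r ltr_pM2r ?exprn_gt0.
have [n1 Hn1] := tends_nm (rho_shift p0 Ef 1) e0.
pose m := (n0 + n1)%N.
have [r Hr] : exists r, forall z, r <= nm z -> forall i, (i <= m)%N -> (u ^+ 2)^-1 < nm (z * rho f i).
  elim: m => [|m [r Hr]].
    exists ((u ^+ 2)^-1 / nm (rho f 0%N) + 1) => z hz i; rewrite leqn0 => /eqP ->.
    by rewrite nmM -ltr_pdivrMr ?nm_gt0 //; apply: lt_le_trans hz; rewrite ltrDl.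
  exists (Num.max r ((u ^+ 2)^-1 / nm (rho f m.+1) + 1)) => z; rewrite ge_max => /andP[h1 h2] i.
  rewrite leq_eqVlt => /orP[/eqP ->|h]; last exact: Hr.
  by rewrite nmM -ltr_pdivrMr ?nm_gt0 //; apply: lt_le_trans h2; rewrite ltrDl.
exists (Num.max r 1) => z; rewrite ge_max => /andP[hz z1].
have z0 : 0 < nm z by exact: lt_le_trans z1.
have ex : exists n, nm (z * rho f n) <= (u ^+ 2)^-1.
  have e1 : 0 < (u ^+ 2)^-1 / nm z by rewrite divr_gt0 // invr_gt0 exprn_gt0.
  have /tendsP /(_ _ e1) [n Hn] := rho_tends0 p0 x1 Ef; exists n.
  by have := Hn n (leqnn n); rewrite subr0 ltr_pdivlMr // => /ltW; rewrite nmM mulrC.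
case: (ex_minnP ex) => n Hn nmin.
have mn : (m < n)%N by rewrite ltnNge; apply/negP => h; have := Hr z hz n h; rewrite ltNge Hn.
exists n; split; first by apply: leq_trans (ltnW mn); exact: leq_addr.
have u23 : (u ^+ 2)^-1 <= (u ^+ 3)^-1.
  by rewrite lef_pV2 ?posrE ?exprn_gt0 // exprS ler_piMl ?exprn_ge0 // ltW.
rewrite (le_trans Hn u23) andbT.
have hn1 : (n1 <= n.-1)%N by rewrite /m in mn; clear -mn; lia.
have n_0 : n = (n.-1 + 1)%N by clear -mn; lia.
have /andP[h _] := Hn1 n.-1 hn1; rewrite -n_0 expr1 in h.
have h2 : u ^+ 5 < nm (rho f n / rho f n.-1) by lra.
have h3 : (u ^+ 2)^-1 < nm (z * rho f n.-1).
  by rewrite ltNge; apply/negP => h3; have := nmin _ h3; rewrite n_0 addn1 /= ltnn.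
have -> : nm (z * rho f n) = nm (rho f n / rho f n.-1) * nm (z * rho f n.-1).
  by rewrite -nmM; congr nm; field; exact: rn.
have -> : u ^+ 3 = u ^+ 5 * (u ^+ 2)^-1 by field; rewrite gt_eqF.
by apply: ltW; apply: ltr_pM => //; rewrite ?invr_ge0 exprn_ge0 // ltW.
Qed.

Lemma term_bound f : etype p f -> exists B, 0 < B /\ forall m n z, (m <= n)%N -> u ^+ 3 <= nm (z * rho f n) ->
  nm (f m) * nm z ^+ m <= B * (nm (f n) * nm z ^+ n).
Proof.
move=> Ef; have [f0 _] := Ef; have [K [K1 HK]] := aR_bound p0 x1 Ef.
have K0 : 0 <= K by exact: le_trans ler01 K1.
have u3 : 0 < u ^+ 3 by rewrite exprn_gt0.
pose s := (u ^+ 3)^-1; have s0 : 0 <= s by rewrite invr_ge0 ltW.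
pose V k := (K * s) ^+ k * x ^+ 'C(k, 2).
have V0 k : 0 <= V k by rewrite mulr_ge0 ?exprn_ge0 ?mulr_ge0 // ltW.
have [L HL] := superexp_tail p0 x1 (mulr_ge0 K0 s0) ltr01.
have VB k : V k <= \sum_(i < L) V i + 1.
  have S0 : 0 <= \sum_(i < L) V i by apply: sumr_ge0.
  case: (ltnP k L) => kL.
    by rewrite (bigD1 (Ordinal kL)) //= -addrA lerDl addr_ge0 // sumr_ge0.
  apply: ler_wpDl => //; have := HL (k - L).+1; rewrite big_ord_recr /= subnKC // => h.
  by apply: le_trans h; rewrite lerDr sumr_ge0 // => i _; exact: V0.
exists (\sum_(i < L) V i + 1); split; first by rewrite ltr_wpDl // sumr_ge0.
move=> m n z mn hz; have r0 := rho_neq0 Ef n.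
have z0 : 0 < nm z.
  by rewrite nm_gt0; apply/eqP => z0; move: hz; rewrite z0 mul0r nm0 leNgt u3.
have T0 : 0 < nm (f n) * nm z ^+ n by rewrite mulr_gt0 ?exprn_gt0 // nm_gt0.
rewrite -ler_pdivrMr //; apply: le_trans (VB (n - m)%N).
have -> : nm (f m) * nm z ^+ m / (nm (f n) * nm z ^+ n) = nm (aL f n (n - m)) * (nm (z * rho f n))^-1 ^+ (n -
  m).
  rewrite /aL subKn //; move: r0 hz; set rr := rho f n; clearbody rr => r0 hz.
  rewrite !nmM nmV nmX exprVn exprMn.
  have zn : nm z ^+ n = nm z ^+ (n - m) * nm z ^+ m by rewrite -exprD subnK.
  rewrite zn; set a1 := nm z ^+ (n - m); set a2 := nm z ^+ m; set a3 := nm rr ^+ (n - m).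
  have b1 : a1 != 0 by rewrite gt_eqF // exprn_gt0.
  have b2 : a2 != 0 by rewrite gt_eqF // exprn_gt0.
  have b3 : a3 != 0 by rewrite gt_eqF // exprn_gt0 // nm_gt0.
  have b4 : nm (f n) != 0 by rewrite gt_eqF // nm_gt0.
  by field; rewrite b1 b2 b3 b4.
have h1 := (HK n (n - m)%N).2 (leq_subr _ _).
rewrite /V exprMn mulrAC; apply: ler_pM; rewrite ?nm_ge0 ?exprn_ge0 ?invr_ge0 ?nm_ge0 //.
apply: lerXn2r; rewrite ?nnegrE ?invr_ge0 ?nm_ge0 ?(ltW u3) //.
by rewrite lef_pV2 ?posrE //; exact: lt_le_trans hz.
Qed.

Lemma Phi_nm f n z : etype p f -> z != 0 -> nm (ev f z) = nm (Phi f n (z * rho f n)) * (nm (f n) * nm z ^+ n).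
Proof.
move=> Ef z0; have [f0 _] := Ef; rewrite /Phi mulfK ?(rho_neq0 Ef) // nmM nmV nmM nmX divfK // gt_eqF //.
by rewrite mulr_gt0 ?exprn_gt0 // nm_gt0.
Qed.

(* A value of polynomial size at [z] forces [z] close to a zero, since the dominant term exceeds every power of [z]. *)
Lemma small_value f (c : nat) M e : etype p f -> 0 < M -> 0 < e -> forall n0, exists r', forall z, r' <= nm z ->
  nm (ev f z) <= M * nm z ^+ c -> exists n, (n0 <= n)%N /\ nm (1 + z * rho f n) <= e.
Proof.
move=> Ef M0 e0; have [f0 _] := Ef; have u3 : 0 < u ^+ 3 by rewrite exprn_gt0.
have [c1 [c10 HL]] := etype_lower p0 u0 u1 pu Ef.
have e2 : 0 < c1 * e / 2 by rewrite divr_gt0 ?mulr_gt0.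
have [N0 HN0] := HL _ e2; have [B [B0 HB]] := term_bound Ef.
have fc : 0 < nm (f c.+1) by rewrite nm_gt0.
have d0 : 0 < c1 * e / 2 * nm (f c.+1) by rewrite mulr_gt0.
move=> n0.
have [r Hr] := annulus (n0 + N0 + c.+1) Ef.
exists (Num.max (Num.max 1 r) (M * B / (c1 * e / 2 * nm (f c.+1)))).
move=> z; rewrite !ge_max => /andP[/andP[z1 zr] zM] hz.
have z0 : 0 < nm z by exact: lt_le_trans z1.
have [n [hn /andP[a1 a2]]] := Hr z zr; exists n; split; first by clear -hn; lia.
have hN0 : (N0 <= n)%N by clear -hn; lia. have hc : (c.+1 <= n)%N by clear -hn; lia.
have h1 := HN0 n _ hN0 a1 a2; have h2 := HB c.+1 n z hc a1.
have T0 : 0 < nm (f n) * nm z ^+ n by rewrite mulr_gt0 ?exprn_gt0 // nm_gt0.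
have h3 : nm (Phi f n (z * rho f n)) <= c1 * e / 2.
  rewrite -(ler_pM2r T0) -Phi_nm // -?nm_gt0 //; apply: le_trans hz _.
  have h2' := ler_wpM2l (ltW e2) h2.
  rewrite -(ler_pM2r B0) (_ : c1 * e / 2 * (nm (f n) * nm z ^+ n) * B = c1 * e / 2 * (B * (nm (f n) * nm z ^+
    n))); last by ring.
  apply: le_trans h2'.
  rewrite ler_pdivrMr // in zM; rewrite exprS.
  have := ler_wpM2r (exprn_ge0 c (ltW z0)) zM; set a := nm z ^+ c; lra.
rewrite -(ler_pM2l c10); lra.
Qed.
Lemma zeros_large f (r d : R) : etype p f -> 0 < d -> exists N0, forall N, (N0 <= N)%N ->
  exists z, [/\ ev f z = 0, r <= nm z & nm (z * rho f N + 1) <= d].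
Proof.
move=> Ef d0; have dm : 0 < Num.min d 2^-1.
  by rewrite lt_min; apply/andP; split=> //; rewrite invr_gt0 ltr0n.
have [N1 HN1] := etype_zero p0 u0 u1 pu Ef dm.
have er : 0 < (2 * (`|r| + 1))^-1 by rewrite invr_gt0 mulr_gt0 // ltr_wpDl.
have /tendsP /(_ _ er) [N2 HN2] := rho_tends0 p0 x1 Ef.
exists (maxn N1 N2) => N; rewrite geq_max => /andP[h1 h2].
have [z [ez z0 hz]] := HN1 N h1; move: hz; rewrite le_min => /andP[hz hz2].
exists z; split=> //; rewrite leNgt; apply/negP => zr.
have := HN2 N h2; rewrite subr0 -[nm _]mul1r -ltr_pdivlMr ?nm_gt0 ?(rho_neq0 Ef) // => h3.
have h4 : 2^-1 <= nm z * nm (rho f N).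
  by rewrite -nmM; have := nm_sub_ge 1 (z * rho f N + 1); rewrite nm1 nm_sym addrK; lra.
have h5 : nm z <= `|r| + 1 by apply: le_trans (ltW zr) _; apply: le_trans (ler_norm r) _; rewrite lerDl.
have h6 : nm z * nm (rho f N) <= (`|r| + 1) * nm (rho f N) by apply: ler_wpM2r => //; exact: nm_ge0.
have h7 : (`|r| + 1) * nm (rho f N) < 2^-1.
  have := HN2 N h2; rewrite subr0 invfM => h7; rewrite mulrC -ltr_pdivlMr //; exact: ltr_wpDl.
lra.
Qed.
End Fix.

(** Powers of [p'] are separated on the multiplicative scale: two of them that are both close to [p]
    coincide, so the exponent is constant and the error arbitrarily small. *)
Lemma int_power_limit (p p' : C) : p != 0 -> p' != 0 -> nm p' < 1 ->
  (forall e, 0 < e -> exists k : int, nm (p' ^ k / p - 1) <= e) -> exists k : int, p' ^ k = p.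
Proof.
move=> p0 p'0 p'1 H; have np' : 0 < nm p' by rewrite nm_gt0.
pose e0 : R := (1 - nm p') / 8; have e00 : 0 < e0 by rewrite divr_gt0 // subr_gt0.
have e01 : e0 <= 8^-1 by rewrite /e0 -[leRHS]mul1r; apply: ler_wpM2r; [rewrite invr_ge0 | lra].
have far (k : int) : k != 0 -> 1 - nm p' <= nm (p' ^ k - 1).
  case: k => [[|d]|d] // _.
    rewrite -exprnP; have := nm_sub_ge 1 (p' ^+ d.+1); rewrite nm1 nmX nm_sym => h.
    have h2 : nm p' ^+ d.+1 <= nm p' by rewrite exprS ler_piMr ?exprn_ile1 ?ltW.
    lra.
  rewrite NegzE -exprnN; have := nm_sub_ge (p' ^+ d.+1)^-1 1; rewrite nm1 nmV nmX => h.
  have h2 : nm p' ^+ d.+1 <= nm p' by rewrite exprS ler_piMr ?exprn_ile1 ?ltW.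
  have h3 : (nm p')^-1 <= (nm p' ^+ d.+1)^-1 by rewrite lef_pV2 ?posrE ?exprn_gt0.
  have h4 : 2 - nm p' <= (nm p')^-1.
    rewrite -[leRHS]mul1r ler_pdivlMr //; have h2' : 0 <= (1 - nm p') ^+ 2 by exact: sqr_ge0.
    by rewrite expr2 in h2'; lra.
  lra.
have [k0 Hk0] := H _ e00; exists k0.
apply/eqP; rewrite -subr_eq0 -nm_eq0; apply/eqP/le_anti/andP; split; last exact: nm_ge0.
apply/ler_addgt0Pr => e ee; rewrite add0r.
have np : 0 < nm p by rewrite nm_gt0.
have e1 : 0 < Num.min e0 (e / nm p) by rewrite lt_min e00 divr_gt0.
have [k] := H _ e1; rewrite le_min => /andP[ka kb].
have kk : k = k0.
  apply/eqP; rewrite -subr_eq0; apply/negPn/negP => /far h.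
  set a := p' ^ k / p - 1 in ka; set b := p' ^ k0 / p - 1 in Hk0.
  have b0 : 1 - e0 <= nm (1 + b) by have := nm_sub_ge 1 (- b); rewrite nm1 nmN opprK; lra.
  have E : p' ^ (k - k0) - 1 = (a - b) / (1 + b).
    have -> : 1 + b = p' ^ k0 / p by rewrite /b; ring.
    by rewrite expfzDr // -invr_expz /a /b; field; rewrite p0 expfz_neq0.
  have bp : 0 < nm (1 + b) by lra.
  rewrite E nmM nmV ler_pdivlMr // in h.
  have h5 := nmB a b.
  have h6 : (1 - nm p') * (1 - e0) <= (1 - nm p') * nm (1 + b) by apply: ler_wpM2l => //; lra.
  have h7 : 1 - nm p' = 8 * e0 by rewrite /e0; field.
  rewrite h7 in h6 h; have : 8 * e0 * (1 - 8^-1) <= 8 * e0 * (1 - e0) by apply: ler_wpM2l; lra.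
  lra.
rewrite kk in kb; have -> : p' ^ k0 - p = (p' ^ k0 / p - 1) * p by rewrite mulrBl divfK // mul1r.
by rewrite nmM -ler_pdivlMr.
Qed.

(** At the zeros of [f] the values of [g] are of polynomial size, so these points are close to zeros
    of [g] by [small_value]. The ratio of neighbouring zeros of [f] tends to 1/p, and it is
    approximated by quotients of the [rho g], that is, by powers of [p']. *)
Lemma entire_commensurable (p p' : C) f g P : p != 0 -> nm p < 1 -> p' != 0 -> nm p' < 1 -> etype p f ->
  etype p' g ->
  P != 0 -> ev2 f g P = 0 -> exists k : int, p' ^ k = p.
Proof.
move=> p0 p1 p'0 p'1 Ef Eg P0 EP.
have [u [u0 u1 pu]] := fourth_root p0 p1; have [u' [u'0 u'1 pu']] := fourth_root p'0 p'1.
have [f0 _] := Ef; have [g0 [cg cg0 Hcg]] := Eg.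
have fn0 : f != 0 by apply/eqP => f00; have := f0 0%N; rewrite f00 eqxx.
have [c [M [r0 [M0 r01 HG]]]] := zero_growth fn0 (etype_cv p0 p1 Ef) (etype_cv p'0 p'1 Eg) P0 EP.
have gen n0 (d : R) : 0 < d -> exists N0, forall N, (N0 <= N)%N ->
  exists w : nat * C, [/\ (n0 <= w.1)%N, w.2 != 0,
    nm (w.2 * rho g w.1 + 1) <= d & nm (w.2 * rho f N + 1) <= d].
  move=> d0; have [r Hr] := small_value p'0 u'0 u'1 pu' c Eg M0 d0 n0.
  have [N1 HN1] := zeros_large p0 u0 u1 pu (Num.max (Num.max 1 r0) r) Ef d0.
  exists N1 => N /HN1 [z [ez]]; rewrite !ge_max => /andP[/andP[z1 z2] z3] hz.
  have [n [hn h]] := Hr z z3 (HG z z2 ez); exists (n, z); split=> //; last by rewrite addrC.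
  by rewrite /= -nm_gt0; exact: lt_le_trans z1.
(* Two zeros of [f], belonging to consecutive indices, each with the index of a zero of [g] nearby;
   the precision improves with [j]. *)
have step j : exists w : nat * (nat * C) * (nat * C), [/\ (j <= w.1.1)%N,
   [/\ (j <= w.1.2.1)%N, w.1.2.2 != 0, nm (w.1.2.2 * rho g w.1.2.1 + 1) <= j.+1%:R^-1 & nm (w.1.2.2 * rho f
     w.1.1 + 1) <= j.+1%:R^-1] &
   [/\ (j <= w.2.1)%N, w.2.2 != 0, nm (w.2.2 * rho g w.2.1 + 1) <= j.+1%:R^-1 & nm (w.2.2 * rho f (w.1.1 + 1) +
     1) <= j.+1%:R^-1]].
  have jp : 0 < (j.+1%:R^-1 : R) by rewrite invr_gt0 ltr0n.
  have [N0 HN0] := gen j _ jp.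
  have [w1 h1] := HN0 (N0 + j)%N (leq_addr _ _).
  have [|w2 h2] := HN0 (N0 + j + 1)%N; first by rewrite -addnA leq_addr.
  by exists ((N0 + j)%N, w1, w2); split=> //; exact: leq_addl.
have [w Hw] := boolp.choice step.
have lim1 (v : nat -> C) : (forall j, nm (v j + 1) <= j.+1%:R^-1) -> tends v (-1).
  move=> H; apply/tendsP => e e0; have [N HN] := natr_big e^-1; exists N => n Nn.
  rewrite opprK; apply: le_lt_trans (H n) _; rewrite -[e]invrK ltf_pV2 ?posrE ?invr_gt0 ?ltr0n //.
  by apply: HN; exact: leqW.
have l1 : tends (fun j => (w j).1.2.2 * rho g (w j).1.2.1) (-1) by apply: lim1 => j; have [_ []] := Hw j.
have l2 : tends (fun j => (w j).1.2.2 * rho f (w j).1.1) (-1) by apply: lim1 => j; have [_ []] := Hw j.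
have l3 : tends (fun j => (w j).2.2 * rho g (w j).2.1) (-1) by apply: lim1 => j; have [_ _ []] := Hw j.
have l4 : tends (fun j => (w j).2.2 * rho f ((w j).1.1 + 1)) (-1) by apply: lim1 => j; have [_ _ []] := Hw j.
have l5 : tends (fun j => rho g (w j).1.2.1 / p' ^+ (w j).1.2.1) cg.
  by apply: (@tends_sub _ _ _ (fun j => (w j).1.2.1)) Hcg => j; have [_ []] := Hw j.
have l6 : tends (fun j => rho g (w j).2.1 / p' ^+ (w j).2.1) cg.
  by apply: (@tends_sub _ _ _ (fun j => (w j).2.1)) Hcg => j; have [_ _ []] := Hw j.
have l7 : tends (fun j => rho f ((w j).1.1 + 1) / rho f (w j).1.1) (p ^+ 1).
  by apply: (@tends_sub _ _ _ (fun j => (w j).1.1)) (rho_shift p0 Ef 1) => j; have [] := Hw j.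
have n1 : (-1 : C) != 0 by rewrite oppr_eq0 oner_neq0.
have l : tends (fun j => (rho g (w j).2.1 / p' ^+ (w j).2.1)^-1 * (rho g (w j).1.2.1 / p' ^+ (w j).1.2.1) *
   (((w j).2.2 * rho g (w j).2.1) * ((w j).2.2 * rho f ((w j).1.1 + 1))^-1) *
   ((w j).1.2.2 * rho f (w j).1.1 * ((w j).1.2.2 * rho g (w j).1.2.1)^-1) *
   (rho f ((w j).1.1 + 1) / rho f (w j).1.1) / p) (cg^-1 * cg * (-1 * (-1)^-1) * (-1 * (-1)^-1) * p ^+ 1 / p).
  do ![apply: flimM => // | apply: flimV => // | apply: flim_cst].
have {}l : tends (fun j => p' ^ ((w j).2.1%:Z - (w j).1.2.1%:Z) / p) 1.
  have -> : (1 : C) = cg^-1 * cg * (-1 * (-1)^-1) * (-1 * (-1)^-1) * p ^+ 1 / p.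
    by rewrite expr1 mulVf // !mulfV // !mul1r mulfV.
  apply: tends_ext l _ => j; have [_ [_ z1 _ _] [_ z2 _ _]] := Hw j.
  have q1 := rho_neq0 Eg (w j).2.1; have q2 := rho_neq0 Eg (w j).1.2.1.
  have q3 := rho_neq0 Ef (w j).1.1; have q4 := rho_neq0 Ef ((w j).1.1 + 1).
  rewrite expfzDr // -exprnN -exprnP.
  have q5 : p' ^+ (w j).2.1 != 0 by rewrite expf_neq0. have q6 : p' ^+ (w j).1.2.1 != 0 by rewrite expf_neq0.
  set a1 := rho g (w j).2.1 in q1 *; set a2 := rho g (w j).1.2.1 in q2 *; set a3 := rho f (w j).1.1 in q3 *.
  set a4 := rho f ((w j).1.1 + 1) in q4 *; set a5 := p' ^+ (w j).2.1 in q5 *;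
    set a6 := p' ^+ (w j).1.2.1 in q6 *.
  set a7 := (w j).1.2.2 in z1 *; set a8 := (w j).2.2 in z2 *.
  clearbody a1 a2 a3 a4 a5 a6 a7 a8.
  by field; rewrite p0 q1 q2 q3 q4 q5 q6 z1 z2.
apply: int_power_limit => // e ee; have /tendsP /(_ e ee) [N HN] := l.
by exists ((w N).2.1%:Z - (w N).1.2.1%:Z); exact: ltW (HN N (leqnn N)).
Qed.
End Annulus.

Section Specials.
Variable R : realType.
Local Notation C := R[i].

Definition dist (m n : nat) : nat := (m - n) + (n - m).

(** Two terms of indices i <= j compared before and after the radius grows by the factor [t]: the
    later one gains t^(j - i), which the two comparisons limit. [weight_down] is the mirror
    image. *)
Lemma weight_up (c t al be : R) i j : 0 < al -> 0 < t -> (i <= j)%N ->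
  c * al <= be -> be * t ^+ j <= al * t ^+ i -> c * t ^+ (j - i) <= 1.
Proof.
move=> a0 t0 ij h1 h2; have ti : 0 < t ^+ i by rewrite exprn_gt0.
have tj : 0 <= t ^+ j by rewrite exprn_ge0 // ltW.
rewrite -(ler_pM2r (mulr_gt0 a0 ti)) mul1r.
apply: le_trans h2; apply: le_trans (ler_wpM2r tj h1).
have tj' : t ^+ j = t ^+ (j - i) * t ^+ i by rewrite -exprD subnK.
by rewrite tj' le_eqVlt; apply/orP; left; apply/eqP; ring.
Qed.
Lemma weight_down (c t al be : R) i j : 0 < be -> 0 < t -> (i <= j)%N ->
  al <= be -> c * (be * t ^+ j) <= al * t ^+ i -> c * t ^+ (j - i) <= 1.
Proof.
move=> b0 t0 ij h1 h2; have ti : 0 < t ^+ i by rewrite exprn_gt0.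
rewrite -(ler_pM2r (mulr_gt0 b0 ti)) mul1r.
apply: le_trans (ler_wpM2r (ltW ti) h1); apply: le_trans h2.
have tj' : t ^+ j = t ^+ (j - i) * t ^+ i by rewrite -exprD subnK.
by rewrite tj' le_eqVlt; apply/orP; left; apply/eqP; ring.
Qed.
(** With t >= u^(-2k) and c > u^W, everything is a power of [u] and the inequality becomes one
    between exponents. *)
Lemma weight_exp (u c t : R) W i j k : 0 < u -> u < 1 -> 0 < c -> u ^+ W < c -> 1 <= u ^+ (2 * k) * t ->
  c * u ^+ i * t ^+ j <= 1 -> (2 * k * j < i + W)%N.
Proof.
move=> u0 u1 c0 uW ht h; rewrite ltnNge; apply/negP => hij.
have h1 : 1 <= u ^+ (2 * k * j) * t ^+ j by rewrite exprM -exprMn exprn_ege1.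
have ui : 0 < u ^+ i by rewrite exprn_gt0.
have h2 : u ^+ (2 * k * j) <= u ^+ i * u ^+ W by rewrite -exprD; apply: ler_wiXn2l => //; exact: ltW.
have h3 : c * u ^+ i <= u ^+ (2 * k * j).
  apply: le_trans (_ : c * u ^+ i * (u ^+ (2 * k * j) * t ^+ j) <= _).
    by rewrite ler_peMr // mulr_ge0 ?ltW.
  rewrite [u ^+ (2 * k * j) * _]mulrC mulrA ler_piMl // exprn_ge0 // ltW //.
have h4 : u ^+ i * u ^+ W < u ^+ i * c by rewrite ltr_pM2l.
by have := le_lt_trans (le_trans h3 h2) h4; rewrite mulrC ltxx.
Qed.

(** A small product has a small factor; the index [l] of that factor is the label used in the
    pigeonhole argument. *)
Lemma root_label (A : {poly C}) : A != 0 -> exists rs : seq C, forall eta : R, 0 < eta ->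
  exists e, 0 < e /\ forall y, nm A.[y] < e -> exists l : 'I_(size rs), nm (y - rs`_l) < eta.
Proof.
move=> A0; have [rs Ars] := closed_field_poly_normal A; exists rs => eta eta0.
have lc : 0 < nm (lead_coef A) by rewrite nm_gt0 lead_coef_eq0.
exists (nm (lead_coef A) * eta ^+ size rs); split; first by rewrite mulr_gt0 // exprn_gt0.
move=> y hy; apply: contrapT => Hno; move: hy; rewrite ltNge => /negP; apply.
rewrite {2}Ars hornerZ horner_prod nmM; apply: ler_wpM2l; first exact: ltW.
have -> : eta ^+ size rs = \prod_(z <- rs) eta by rewrite big_const_seq count_predT -Monoid.iteropE.
rewrite nm_prod !big_seq; apply: ler_prod => z zr; rewrite (ltW eta0) /= hornerXsubC leNgt; apply/negP => h.
have iz : (index z rs < size rs)%N by rewrite index_mem.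
by apply: Hno; exists (Ordinal iz); rewrite /= nth_index.
Qed.

Lemma unit_separated (q : C) W : (forall m, q ^+ m.+1 != 1) ->
  exists d : R, 0 < d /\ forall m, (0 < m <= W)%N -> d <= nm (q ^+ m - 1).
Proof.
move=> ur; elim: W => [|W [d [d0 H]]]; first by exists 1; split=> // -[].
exists (Num.min d (nm (q ^+ W.+1 - 1))); split.
  by rewrite lt_min d0 nm_gt0 subr_eq0 ur.
move=> m /andP[m0]; rewrite leq_eqVlt => /orP[/eqP ->|h]; first by rewrite ge_min lexx orbT.
by rewrite ge_min H // m0.
Qed.

(** * Entire series with a base on the unit circle *)

Section Comb.
Variables (a s : nat -> R) (nu : nat -> nat) (u c2 b : R) (Cn N0 : nat) (A : {poly C}) (q : C).
Hypotheses (u0 : 0 < u) (u1 : u < 1) (c20 : 0 < c2) (c21 : c2 <= 1) (b0 : 0 <= b) (a0 : forall n,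
  0 < a n) (s0 : forall N, 0 < s N).
Hypothesis sS : forall N, (N0 <= N)%N -> s N <= u ^+ 2 * s N.+1.
Hypothesis nuP : forall N n, (N0 <= N)%N -> a n * s N ^+ n <= a (nu N) * s N ^+ nu N.
Hypothesis comp : forall N, (N0 <= N)%N -> exists n, n != nu N /\
  c2 * u ^+ dist n (nu N) * (a (nu N) * s N ^+ nu N) <= a n * s N ^+ n.
Hypothesis nuC : forall N, (N0 <= N)%N -> (nu N <= Cn * N)%N.
Hypotheses (q1 : nm q = 1) (ur : forall m, q ^+ m.+1 != 1) (A0 : A != 0) (Aa : forall n,
  nm A.[q ^+ n] * a n <= b * a n.+1).

Let sk N k : (N0 <= N)%N -> 1 <= u ^+ (2 * k) * (s (N + k) / s N).
Proof.
move=> hN; elim: k => [|k IH]; first by rewrite addn0 divff ?mulr1 ?expr0 // gt_eqF.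
apply: le_trans IH _; have h : (N0 <= N + k)%N by apply: leq_trans hN _; exact: leq_addr.
have := sS h; rewrite addnS => h1.
rewrite (_ : 2 * k.+1 = 2 * k + 2)%N; last by clear; lia.
rewrite exprD -mulrA; apply: ler_wpM2l; first by rewrite exprn_ge0 // ltW.
by rewrite mulrA; apply: ler_wpM2r => //; rewrite invr_ge0 ltW.
Qed.
Let tE N k n : a n * s N ^+ n * (s (N + k) / s N) ^+ n = a n * s (N + k) ^+ n.
Proof. by rewrite -mulrA -exprMn; congr (_ * _ ^+ _); rewrite mulrC divfK ?gt_eqF. Qed.
Let t0 N k : 0 < s (N + k) / s N. Proof. by rewrite divr_gt0. Qed.

Let mono N k : (N0 <= N)%N -> (nu N <= nu (N + k))%N.
Proof.
move=> hN; case: k => [|k]; first by rewrite addn0.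
rewrite leqNgt; apply/negP => h.
have hN' : (N0 <= N + k.+1)%N by apply: leq_trans hN _; exact: leq_addr.
have h1 := nuP (nu (N + k.+1)) hN; have h2 := nuP (nu N) hN'.
rewrite -!tE in h2.
have h3 : 1 * (s (N + k.+1) / s N) ^+ (nu N - nu (N + k.+1)) <= 1.
  apply: (@weight_down 1 _ (a (nu (N + k.+1)) * s N ^+ nu (N + k.+1)) (a (nu N) * s N ^+ nu N)) => //.
  - by rewrite mulr_gt0 // exprn_gt0.
  - exact: ltnW.
  - by rewrite mul1r.
have h4 : u ^+ 0 * 1 * (s (N + k.+1) / s N) ^+ (nu N - nu (N + k.+1)) <= 1 by rewrite expr0 mulr1.
have uu : u ^+ 1 < 1 by rewrite expr1.
have := @weight_exp u 1 _ 1 0 _ k.+1 u0 u1 ltr01 uu (sk k.+1 hN).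
rewrite expr0 mulr1 => /(_ _ h3); rewrite add0n; nia.
Qed.

(** [a n] is |g_n|, [s N] the modulus of a zero of [f], [nu N] the index of the largest term there,
    and [comp] gives it a companion. Both indices are labelled by roots of [A]. Within a window
    where [nu] moves little, a label determines its index, so among more than d^2 radii two share
    both indices; the spacing of the radii contradicts [same]. *)
Lemma companions_absurd : False.
Proof.
have [W0 HW0] : exists W0, u ^+ W0 < c2.
  by have [W H] := expr_small (ltW u0) u1 c20; exists W; exact: H.
(* The companion at one radius competes with the largest term at the next, which keeps it from lying
   far above; [dn] bounds it below in the same way. *)
have up N n : (N0 <= N)%N -> c2 * u ^+ dist n (nu N) * (a (nu N) * s N ^+ nu N) <= a n * s N ^+ n ->
    (n <= nu (N + 1) + (nu (N + 1) - nu N) + W0)%N.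
  move=> hN hc; have hm := mono 1 hN; case: (leqP n (nu (N + 1))) => hn; first by rewrite -addnA;
    apply: leq_trans hn _; exact: leq_addr.
  have hN' : (N0 <= N + 1)%N by apply: leq_trans hN _; exact: leq_addr.
  have h2 := nuP n hN'; rewrite -!tE in h2.
  have d0 : 0 <= c2 * u ^+ dist n (nu N) by rewrite mulr_ge0 ?exprn_ge0 // ltW.
  have h3 := le_trans (ler_wpM2l d0 (nuP (nu (N + 1)) hN)) hc.
  have h4 := weight_up (mulr_gt0 (a0 _) (exprn_gt0 _ (s0 _))) (t0 N 1) (ltnW hn) h3 h2.
  have := weight_exp u0 u1 c20 HW0 (sk 1 hN) h4; rewrite /dist; move: hm hn; clear; lia.
have dn N n : (N0 <= N)%N -> c2 * u ^+ dist n (nu (N + 1)) * (a (nu (N + 1)) * s (N + 1) ^+ nu (N + 1)) <= a n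
  * s (N + 1) ^+ n ->
    (2 * nu N <= n + nu (N + 1) + W0)%N.
  move=> hN hc; have hm := mono 1 hN; case: (leqP (nu N) n) => hn; first by move: hm hn; clear; lia.
  have hN' : (N0 <= N + 1)%N by apply: leq_trans hN _; exact: leq_addr.
  have d0 : 0 <= c2 * u ^+ dist n (nu (N + 1)) by rewrite mulr_ge0 ?exprn_ge0 // ltW.
  have h1 := le_trans (ler_wpM2l d0 (nuP (nu N) hN')) hc; rewrite -!tE in h1.
  have h4 := weight_down (mulr_gt0 (a0 _) (exprn_gt0 _ (s0 _))) (t0 N 1) (ltnW hn) (nuP n hN) h1.
  have := weight_exp u0 u1 c20 HW0 (sk 1 hN) h4; rewrite /dist; move: hm hn; clear; lia.
(* Growth of the radius by u^(-2k) changes the ratio of two fixed distinct terms by at least that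
   factor, so they stay comparable only for k up to [W0]. *)
have same N k n : (N0 <= N)%N -> nu (N + k) = nu N -> n != nu N ->
    c2 * u ^+ dist n (nu N) * (a (nu N) * s N ^+ nu N) <= a n * s N ^+ n ->
    c2 * u ^+ dist n (nu N) * (a (nu N) * s (N + k) ^+ nu N) <= a n * s (N + k) ^+ n -> (k <= W0)%N.
  move=> hN E nn hc hc'; have hN' : (N0 <= N + k)%N by apply: leq_trans hN _; exact: leq_addr.
  case: (ltngtP n (nu N)) nn => // hn _.
    rewrite -!tE in hc'.
    have h4 := weight_down (mulr_gt0 (a0 _) (exprn_gt0 _ (s0 _))) (t0 N k) (ltnW hn) (nuP n hN) hc'.
    have := weight_exp u0 u1 c20 HW0 (sk k hN) h4; rewrite /dist; move: hn; clear; nia.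
  have h2 := nuP n hN'; rewrite E -!tE in h2.
  have h4 := weight_up (mulr_gt0 (a0 _) (exprn_gt0 _ (s0 _))) (t0 N k) (ltnW hn) hc h2.
  have := weight_exp u0 u1 c20 HW0 (sk k hN) h4; rewrite /dist; move: hn; clear; nia.
have [rs Hrs] := root_label A0; pose d := size rs.
(* [L] has room for d^2 + 1 radii spaced by [W0.+1]; [D0] is a displacement of [nu] too large to
   occur in every window of length [L], given the linear bound with slope [Cn]; [W'] bounds the
   distance of any two indices of the same kind in the window. *)
pose L := (d * d * W0.+1 + 2)%N; pose D0 := (2 * Cn.+1 * L)%N; pose W' := (3 * D0 + 2 * W0)%N.
have [de [de0 Hde]] := unit_separated W' ur.
have eta0 : 0 < de / 2 by rewrite divr_gt0.
have [e [e0 He]] := Hrs _ eta0.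
pose T := b / (c2 * u ^+ W') / e + 1.
have [M0 [hM0 HM0]] : exists M0, (N0 <= M0)%N /\ forall M, (M0 <= M)%N -> T < s M.
  have ui : 1 < (u ^+ 2)^-1 by rewrite invf_gt1 ?exprn_gt0 // exprn_ilt1 // ltW.
  have [k Hk] := expr_big (T / s N0) ui; exists (N0 + k)%N; split; first exact: leq_addr.
  move=> M hM; have [j Ej] : exists j, M = (N0 + (k + j))%N by exists (M - (N0 + k))%N; move: hM; clear; lia.
  have := Hk (k + j)%N (leq_addr _ _); rewrite ltr_pdivrMr // => h; apply: lt_le_trans h _.
  have h2 := sk (k + j) (leqnn N0); rewrite -Ej in h2 *.
  rewrite mulrA ler_pdivlMr // mul1r in h2.
  rewrite exprVn -exprM ler_pdivrMl ?exprn_gt0 //.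
have [M [hM hst]] : exists M, (M0 <= M)%N /\ (nu (M + L) <= nu M + D0)%N.
  apply: contrapT => Hno.
  have st M : (M0 <= M)%N -> (nu M + D0 < nu (M + L))%N.
    by move=> hM; rewrite ltnNge; apply/negP => h; apply: Hno; exists M.
  have it j : (j * D0 <= nu (M0 + j * L))%N.
    elim: j => [|j IH]; first by rewrite mul0n.
    have := st (M0 + j * L)%N (leq_addr _ _); rewrite -addnA -mulSnr => h; rewrite mulSn; move: h IH; clear;
      lia.
  have := leq_trans (it M0.+1) (nuC (leq_trans hM0 (leq_addr _ _))).
  have L0 : (0 < L)%N by rewrite /L addn2.
  rewrite /D0; move: L0; clear; nia.
have N0M : (N0 <= M)%N by exact: leq_trans hM.
pose NN (i : nat) := (M + (i * W0.+1 + 1))%N.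
have N0N i : (N0 <= NN i)%N by apply: leq_trans N0M _; exact: leq_addr.
have [cn Hcn] := boolp.choice (fun i => comp (N0N i)).
have inL i : (i <= d * d)%N -> (i * W0.+1 + 1 + 1 <= L)%N.
  by move=> h; rewrite /L -addnA leq_add2r leq_mul2r h orbT.
have nuL i : (i <= L)%N -> (nu M <= nu (M + i) <= nu M + D0)%N.
  move=> h; rewrite mono //= ; apply: leq_trans hst.
  have := @mono (M + i)%N (L - i)%N (leq_trans N0M (leq_addr _ _)).
  by rewrite -addnA subnKC.
have bnds i : (i <= d * d)%N -> [/\ (nu M <= nu (NN i))%N, (nu (NN i) <= nu M + D0)%N,
  (nu M <= cn i + D0 + W0)%N & (cn i <= nu M + 2 * D0 + W0)%N].
  move=> hi; have /andP[n1 n2] := nuL _ (leq_trans (leq_addr _ _) (inL i hi)).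
  have /andP[n3 n4] := nuL _ (inL i hi).
  have [_ hc] := Hcn i.
  have u_ := up _ _ (N0N i) hc.
  rewrite (_ : NN i + 1 = M + (i * W0.+1 + 1 + 1))%N in u_; last by rewrite /NN; clear; lia.
  have N0P : (N0 <= M + i * W0.+1)%N by apply: leq_trans N0M _; exact: leq_addr.
  have E : NN i = (M + i * W0.+1 + 1)%N by rewrite /NN addnA.
  rewrite E in hc; have d_ := dn _ _ N0P hc; rewrite -E in d_.
  have /andP[n5 n6] : (nu M <= nu (M + i * W0.+1) <= nu M + D0)%N.
    apply: nuL; apply: leq_trans (inL i hi); rewrite -addnA; exact: leq_addr.
  rewrite /NN in n1 n2 d_ u_ *; split=> //; move: n1 n2 n3 n4 n5 n6 u_ d_; clear; lia.
(* The next term is at most the largest one, so the recurrence bounds |A(q^n)| by a constant over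
   [s N]. *)
have small N n : (M <= N)%N -> (dist n (nu N) <= W')%N ->
  c2 * u ^+ dist n (nu N) * (a (nu N) * s N ^+ nu N) <= a n * s N ^+ n -> nm A.[q ^+ n] < e.
  move=> hMN hd hc; have hN : (N0 <= N)%N by exact: leq_trans hMN.
  have h1 := nuP n.+1 hN; have hT := HM0 N (leq_trans hM hMN).
  have uW : 0 < c2 * u ^+ W' by rewrite mulr_gt0 // exprn_gt0.
  have h2 : c2 * u ^+ W' * (a n.+1 * s N ^+ n.+1) <= a n * s N ^+ n.
    apply: le_trans hc; apply: ler_pM => //; rewrite ?mulr_ge0 ?exprn_ge0 ?(ltW c20) ?(ltW u0) ?(ltW (a0 _))
      ?(ltW (s0 _)) //.
    by apply: ler_wpM2l; [exact: ltW | apply: ler_wiXn2l => //; exact: ltW].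
  have sn : 0 < s N ^+ n by rewrite exprn_gt0.
  have h3 : c2 * u ^+ W' * (a n.+1 * s N) <= a n.
    by rewrite -(ler_pM2r sn); move: h2; rewrite exprS !mulrA.
  have h4 : nm A.[q ^+ n] * (c2 * u ^+ W' * s N) <= b.
    have an : 0 < a n.+1 by exact: a0.
    rewrite -(ler_pM2r an); apply: le_trans (Aa n); rewrite -[nm _ * _ * a n.+1]mulrA; apply: ler_wpM2l;
      first exact: nm_ge0.
    by apply: le_trans h3; rewrite le_eqVlt; apply/orP; left; apply/eqP; ring.
  rewrite /T in hT; have h5 : b / (c2 * u ^+ W') / e < s N by apply: lt_trans hT; rewrite ltrDl.
  rewrite !ltr_pdivrMr // in h5.
  have h6 : nm A.[q ^+ n] * (c2 * u ^+ W' * s N) < e * (c2 * u ^+ W' * s N).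
    apply: le_lt_trans h4 _; have -> : e * (c2 * u ^+ W' * s N) = s N * e * (c2 * u ^+ W') by ring.
    exact: h5.
  by move: h6; rewrite ltr_pM2r // mulr_gt0.
have lab (i : 'I_(d * d).+1) : exists l : 'I_d * 'I_d,
  nm (q ^+ nu (NN i) - rs`_l.1) < de / 2 /\ nm (q ^+ cn i - rs`_l.2) < de / 2.
  have hi : (i <= d * d)%N by rewrite -ltnS.
  have [b1 b2 b3 b4] := bnds i hi; have [_ hc] := Hcn i.
  have MN : (M <= NN i)%N by exact: leq_addr.
  have dd : (dist (cn i) (nu (NN i)) <= W')%N by rewrite /dist /W'; move: b1 b2 b3 b4; clear; lia.
  have [l1 Hl1] : exists l : 'I_(size rs), nm (q ^+ nu (NN i) - rs`_l) < de / 2.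
    apply: He; apply: (small (NN i)) => //; rewrite /dist subnn ?addn0 ?expr0 ?mulr1 //.
    rewrite -[leRHS]mul1r; apply: ler_wpM2r => //; by rewrite mulr_ge0 ?exprn_ge0 // ltW.
  have [l2 Hl2] : exists l : 'I_(size rs), nm (q ^+ cn i - rs`_l) < de / 2 by apply: He; apply: (small (NN i)).
  by exists (l1, l2).
have [lb Hlb] := boolp.choice lab.
have inj m n (r : C) : (n - m <= W')%N -> nm (q ^+ m - r) < de / 2 -> nm (q ^+ n - r) < de / 2 -> (n <= m)%N.
  move=> hW h1 h2; rewrite leqNgt; apply/negP => mn.
  have := Hde (n - m)%N; rewrite subn_gt0 mn hW => /(_ isT).
  have -> : nm (q ^+ (n - m) - 1) = nm (q ^+ n - q ^+ m).
    have -> : q ^+ n - q ^+ m = (q ^+ (n - m) - 1) * q ^+ m by rewrite mulrBl mul1r -exprD subnK // ltnW.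
    by rewrite nmM nmX q1 expr1n mulr1.
  have -> : q ^+ n - q ^+ m = (q ^+ n - r) + (r - q ^+ m) by ring.
  have := nmD (q ^+ n - r) (r - q ^+ m); rewrite [nm (r - _)]nm_sym; lra.
have [i [j [ij Eij]]] : exists i j : 'I_(d * d).+1, (i < j)%N /\ lb i = lb j.
  apply: contrapT => Hno.
  have /leq_card : injective lb.
    move=> i j E; apply/val_inj => /=; case: (ltngtP i j) => // h; exfalso; apply: Hno;
      [exists i, j | exists j, i]; by split.
  by rewrite card_prod !card_ord ltnn.
have hi : (i <= d * d)%N by rewrite -ltnS. have hj : (j <= d * d)%N by rewrite -ltnS.
have [b1 b2 b3 b4] := bnds i hi; have [b5 b6 b7 b8] := bnds j hj.
have [l1 l2] := Hlb i; have [l3 l4] := Hlb j; rewrite -Eij in l3 l4.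
have Enu : nu (NN i) = nu (NN j).
  apply/eqP; rewrite eqn_leq; apply/andP; split.
    by apply: inj l3 l1; rewrite /W'; move: b1 b2 b5 b6; clear; lia.
  by apply: inj l1 l3; rewrite /W'; move: b1 b2 b5 b6; clear; lia.
have Ecn : cn i = cn j.
  apply/eqP; rewrite eqn_leq; apply/andP; split.
    by apply: inj l4 l2; rewrite /W'; move: b3 b4 b7 b8; clear; lia.
  by apply: inj l2 l4; rewrite /W'; move: b3 b4 b7 b8; clear; lia.
have [nn hc] := Hcn i; have [_ hc'] := Hcn j; rewrite -Enu -Ecn in hc'.
have ENj : NN j = (NN i + (j - i) * W0.+1)%N.
  have h5 : (i * W0.+1 <= j * W0.+1)%N by rewrite leq_mul2r ltnW // orbT.
  by rewrite /NN mulnBl; move: h5; clear; lia.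
rewrite ENj in hc' Enu.
have := same _ _ _ (N0N i) (esym Enu) nn hc hc'.
have : (0 < j - i)%N by rewrite subn_gt0.
clear; nia.
Qed.
End Comb.
End Specials.

(** * Estimates for comparable terms and for roots *)

Section UnitCase.
Variable R : realType.
Local Notation C := R[i].
Implicit Types (f g : ps C) (z y : C).

Lemma max_term g (s : R) : (forall r, cv g r) -> (forall n, g n != 0) -> 0 < s ->
  exists v, forall n, nm (g n) * s ^+ n <= nm (g v) * s ^+ v.
Proof.
move=> cg g0 s0; have [r [M [sr b]]] := cg s; have r0 : 0 < r by exact: lt_trans sr.
have y0 : 0 <= s / r by rewrite divr_ge0 // ltW.
have y1 : s / r < 1 by rewrite ltr_pdivrMr // mul1r.
have M0 := bnd_ge0 b; have gp : 0 < nm (g 0%N) by rewrite nm_gt0.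
have e0 : 0 < nm (g 0%N) / (M + 1) by rewrite divr_gt0 // ltr_wpDl.
have [N HN] := expr_small y0 y1 e0.
have far n : (N <= n)%N -> nm (g n) * s ^+ n <= nm (g 0%N).
  move=> hn; have := HN n hn; rewrite ltr_pdivlMr ?ltr_wpDl // => h; apply: le_trans (ltW h).
  have rn : 0 < r ^+ n by rewrite exprn_gt0.
  have -> : s ^+ n = (s / r) ^+ n * r ^+ n by rewrite expr_div_n divfK // gt_eqF.
  rewrite mulrCA; apply: ler_wpM2l; first exact: exprn_ge0.
  by apply: le_trans (b n) _; rewrite lerDl.
have [v Hv] : exists v, forall n, (n < N.+1)%N -> nm (g n) * s ^+ n <= nm (g v) * s ^+ v.
  elim: (N.+1) => [|m [v Hv]]; first by exists 0%N.
  have [h|h] := leP (nm (g m) * s ^+ m) (nm (g v) * s ^+ v).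
    by exists v => n; rewrite ltnS leq_eqVlt => /orP[/eqP ->|] //; exact: Hv.
  by exists m => n; rewrite ltnS leq_eqVlt => /orP[/eqP ->|hn] //; apply: le_trans (Hv n hn) (ltW h).
exists v => n; case: (ltnP n N.+1) => hn; first exact: Hv.
apply: le_trans (far n (ltnW hn)) _; by have := Hv 0%N isT; rewrite expr0 mulr1.
Qed.

Lemma dist_sum (u : R) v l : 0 <= u -> u < 1 -> \sum_(n < v + l) u ^+ dist n v <= 2 / (1 - u).
Proof.
move=> u0 u1; rewrite big_split_ord /=; have ->
  : 2 / (1 - u) = (1 - u)^-1 + (1 - u)^-1 by rewrite mulr_natl mulr2n.
apply: lerD.
  apply: le_trans (geo_sum_le v u0 u1); rewrite (reindex_inj rev_ord_inj) /=; apply: ler_sum => i _.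
  apply: ler_wiXn2l => //; first exact: ltW.
  by rewrite /dist; have := ltn_ord i; lia.
apply: le_trans (geo_sum_le l u0 u1); apply: ler_sum => i _; apply: ler_wiXn2l => //; first exact: ltW.
by rewrite /dist; lia.
Qed.

(** Otherwise the geometric weights would sum the remaining terms to at most a quarter of the
    largest, and the value at [z] could not drop below its half. *)
Lemma comparable_coefficient g z (u : R) v : (forall r, cv g r) -> (forall n, g n != 0) -> 0 < u -> u < 1 ->
  z != 0 ->
  (forall n, nm (g n) * nm z ^+ n <= nm (g v) * nm z ^+ v) -> nm (ev g z) < nm (g v) * nm z ^+ v / 2 ->
  exists n, n != v /\ (1 - u) / 8 * u ^+ dist n v * (nm (g v) * nm z ^+ v) <= nm (g n) * nm z ^+ n.
Proof.
move=> cg g0 u0 u1 z0 Hv small; apply: contrapT => Hno.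
set mu := nm (g v) * nm z ^+ v in Hv small Hno *.
have mu0 : 0 < mu by rewrite mulr_gt0 ?exprn_gt0 ?nm_gt0.
have h n : n != v -> nm (g n) * nm z ^+ n <= (1 - u) / 8 * u ^+ dist n v * mu.
  by move=> nv; rewrite leNgt; apply/negP => h; apply: Hno; exists n; split=> //; exact: ltW.
suff : mu / 2 <= nm (ev g z) by rewrite leNgt small.
apply: (flim_ge _ (ev_tends (cg (nm z)))); exists v.+1 => // m /= hm.
have [l El] : exists l, m = (v + l.+1)%N by exists (m - v.+1)%N; move: hm; clear; lia.
have vm : (v < m)%N by [].
rewrite /psum (bigD1 (Ordinal vm)) //=.
set S := \sum_(i < m | _) _; have := nm_sub_ge (g v * z ^+ v) (- S); rewrite nmN opprK nmM nmX -/mu => h1.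
suff h2 : nm S <= mu / 4 by lra.
apply: le_trans (nm_sum _ _ _) _; apply: le_trans (_ : \sum_(i < m) (1 - u) / 8 * mu * u ^+ dist i v <= _).
  rewrite [leRHS](bigD1 (Ordinal vm)) //=; apply: ler_wpDl.
    have h2 := ltW mu0; have h3 := ltW u0; have h4 := ltW u1.
    by rewrite !mulr_ge0 ?exprn_ge0 ?nm_ge0 ?subr_ge0 ?invr_ge0.
  apply: ler_sum => i iv; rewrite nmM nmX mulrAC; apply: h.
  by apply: contraNneq iv => E; apply/eqP/val_inj.
rewrite -big_distrr El /=; apply: le_trans (ler_wpM2l _ (dist_sum v l.+1 (ltW u0) u1)) _.
  have h2 := ltW mu0; have h4 := ltW u1; by rewrite !mulr_ge0 ?exprn_ge0 ?nm_ge0 ?subr_ge0 ?invr_ge0.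
rewrite le_eqVlt; apply/orP; left; apply/eqP; field; by rewrite gt_eqF // subr_gt0.
Qed.

Lemma lead_lower n (a : nat -> C) (w : C) (d S e : R) : 0 <= S -> d <= nm (a n) -> (forall j, (j < n)%N ->
  nm (a j) <= S) ->
  1 <= nm w -> e <= d -> 0 <= e -> e + n%:R * S <= d * nm w -> e <= nm (\sum_(j < n.+1) a j * w ^+ j).
Proof.
move=> S0 an aS w1 ed e0 big; have w0 : 0 < nm w by exact: lt_le_trans ltr01 w1.
rewrite big_ord_recr /=; case: (posnP n) => [n0|n0].
  by rewrite n0 big_ord0 add0r mulr1 -n0; exact: le_trans an.
set T := \sum_(j < n) _; have hT : nm T <= n%:R * S * nm w ^+ n.-1.
  apply: le_trans (nm_sum _ _ _) _; apply: le_trans (_ : \sum_(j < n) S * nm w ^+ n.-1 <= _).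
    apply: ler_sum => j _; rewrite nmM nmX; apply: ler_pM; rewrite ?nm_ge0 ?exprn_ge0 ?nm_ge0 //;
      first exact: aS.
    by apply: ler_weXn2l => //; rewrite -ltnS prednK ?ltn_ord //; exact: leq_ltn_trans (leq0n _) (ltn_ord j).
  by rewrite sumr_const card_ord -[_ *+ n]mulr_natl mulrA.
have := nm_sub_ge (a n * w ^+ n) (- T); rewrite nmN opprK addrC => h; apply: le_trans h.
rewrite nmM nmX -[n in nm w ^+ n](prednK n0) exprS mulrA.
apply: le_trans (_ : e * nm w ^+ n.-1 <= _); first by rewrite ler_peMr // exprn_ege1.
rewrite lerBrDr; apply: le_trans (lerD (lexx _) hT) _; rewrite -mulrDl; apply: ler_wpM2r;
  first by rewrite exprn_ge0 ?nm_ge0.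
by apply: le_trans big _; apply: ler_wpM2r => //; exact: nm_ge0.
Qed.

Lemma root_bound n (a : nat -> C) (w : C) (d S : R) : 0 < d -> 0 <= S -> d <= nm (a n) ->
  (forall j, (j < n)%N -> nm (a j) <= S) ->
  \sum_(j < n.+1) a j * w ^+ j = 0 -> nm w <= 1 + n%:R * S / d.
Proof.
move=> d0 S0 an aS E; have nS : 0 <= n%:R * S / d by rewrite divr_ge0 ?mulr_ge0 // ltW.
rewrite leNgt; apply/negP => w1; have w1' : 1 <= nm w by move: w1 nS; lra.
have := @lead_lower n a w d S d S0 an aS w1' (lexx _) (ltW d0); rewrite E nm0 => h.
suff : d + n%:R * S <= d * nm w by move=> /h; rewrite leNgt d0.
by rewrite -ler_pdivrMl // mulrDr mulVf ?gt_eqF // mulrC; exact: ltW.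
Qed.

(* Off a polynomial-size set of values [y], the top coefficient of [P] in its last variable does not vanish. *)
Lemma root_growth2 (P : {poly {poly {poly C}}}) : P != 0 -> exists c M, 1 <= M /\
  forall z y w, M <= nm z -> M * nm z ^+ c <= nm y ->
   \sum_(j < size P) (\sum_(i < size P`_j) (P`_j`_i).[z] * y ^+ i) * w ^+ j = 0 ->
     nm w <= M * nm z ^+ c * nm y ^+ c.
Proof.
move=> P0; have [n sP] : exists n, size P = n.+1 by exists (size P).-1; rewrite prednK // size_poly_gt0.
pose L := lead_coef P; have L0 : L != 0 by rewrite lead_coef_eq0.
have [m sL] : exists m, size L = m.+1 by exists (size L).-1; rewrite prednK // size_poly_gt0.
have [d [r [d0 r1 HL]]] : exists d r, [/\ 0 < d, 1 <= r & forall z, r <= nm z -> d <= nm (lead_coef L).[z]].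
  by apply: poly_large; rewrite lead_coef_eq0.
have [c [S [S1 HS]]] : exists c S, 1 <= S /\ forall z y, 1 <= nm z -> 1 <= nm y ->
   (forall j, nm (\sum_(i < size P`_j) (P`_j`_i).[z] * y ^+ i) <= S * nm z ^+ c * nm y ^+ c) /\
   (forall i, nm (L`_i).[z] <= S * nm z ^+ c).
  have one (T : {poly C}) : exists c S, 1 <= S /\ forall z, 1 <= nm z -> nm T.[z] <= S * nm z ^+ c.
    have [M [M0 HM]] := poly_upper T; exists (size T), (M + 1); split; first by rewrite lerDr ltW.
    move=> z z1; apply: le_trans (HM z z1) _; apply: ler_wpM2r; rewrite ?exprn_ge0 ?nm_ge0 // lerDl //.
  have two (Q : {poly {poly C}}) : exists c S, 1 <= S /\ forall z, 1 <= nm z ->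
     (forall i, nm (Q`_i).[z] <= S * nm z ^+ c) /\ (forall y, 1 <= nm y ->
       nm (\sum_(i < size Q) (Q`_i).[z] * y ^+ i) <= S * nm z ^+ c * nm y ^+ c).
    have [c [S [S1 H]]] : exists c S, 1 <= S /\ forall i z, (i < size Q)%N -> 1 <= nm z ->
      nm (Q`_i).[z] <= S * nm z ^+ c.
      elim: (size Q) => [|k [c [S [S1 H]]]]; first by exists 0%N, 1.
      have [c' [S' [S1' H']]] := one Q`_k; exists (maxn c c'), (Num.max S S'); split;
        first by rewrite le_max S1.
      move=> i z; rewrite ltnS leq_eqVlt => /orP[/eqP ->|hi] z1.
        apply: le_trans (H' z z1) _; apply: ler_pM; rewrite ?exprn_ge0 ?nm_ge0 ?(le_trans ler01 S1') //.
          by rewrite le_max lexx orbT.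
        by apply: ler_weXn2l => //; exact: leq_maxr.
      apply: le_trans (H i z hi z1) _; apply: ler_pM; rewrite ?exprn_ge0 ?nm_ge0 ?(le_trans ler01 S1) //.
        by rewrite le_max lexx.
      by apply: ler_weXn2l => //; exact: leq_maxl.
    have S0 := le_trans ler01 S1.
    exists (maxn c (size Q)), ((size Q)%:R * S + S); split.
      by apply: le_trans S1 _; rewrite lerDr mulr_ge0.
    move=> z z1; have zc : nm z ^+ c <= nm z ^+ maxn c (size Q) by apply: ler_weXn2l => //; exact: leq_maxl.
    have HH i : nm (Q`_i).[z] <= S * nm z ^+ maxn c (size Q).
      case: (ltnP i (size Q)) => hi; first by apply: le_trans (H i z hi z1) _; exact: ler_wpM2l.
      by rewrite nth_default // horner0 nm0 mulr_ge0 // exprn_ge0 ?nm_ge0.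
    split=> [i|y y1].
      apply: le_trans (HH i) _; apply: ler_wpM2r; first by rewrite exprn_ge0 ?nm_ge0.
      by rewrite lerDr mulr_ge0.
    apply: le_trans (nm_sum _ _ _) _; apply: le_trans (_ : \sum_(i < size Q) S * nm z ^+ maxn c (size Q) * nm y
      ^+ maxn c (size Q) <= _).
      apply: ler_sum => i _; rewrite nmM nmX; apply: ler_pM; rewrite ?nm_ge0 ?exprn_ge0 ?nm_ge0 //.
      by apply: ler_weXn2l => //; apply: leq_trans (leq_maxr _ _); exact: ltnW.
    rewrite sumr_const card_ord -[_ *+ size Q]mulr_natl !mulrA.
    do 2![apply: ler_wpM2r; first by rewrite exprn_ge0 ?nm_ge0].
    by rewrite lerDl.
  have [cL [SL [SL1 HSL]]] := two L.
  have [c [S [S1 H]]] : exists c S, 1 <= S /\ forall j z y, (j < size P)%N -> 1 <= nm z -> 1 <= nm y ->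
    nm (\sum_(i < size P`_j) (P`_j`_i).[z] * y ^+ i) <= S * nm z ^+ c * nm y ^+ c.
    elim: (size P) => [|k [c [S [S1 H]]]]; first by exists 0%N, 1.
    have [c' [S' [S1' H']]] := two P`_k; exists (maxn c c'), (Num.max S S'); split; first by rewrite le_max S1.
    have S0 := le_trans ler01 S1; have S0' := le_trans ler01 S1'.
    move=> i z y; rewrite ltnS leq_eqVlt => /orP[/eqP ->|hi] z1 y1.
      apply: le_trans ((H' z z1).2 y y1) _; do 2?apply: ler_pM;
        rewrite ?mulr_ge0 ?exprn_ge0 ?nm_ge0 // ?le_max ?lexx ?orbT //;
      by apply: ler_weXn2l => //; exact: leq_maxr.
    apply: le_trans (H i z y hi z1 y1) _; do 2?apply: ler_pM;
      rewrite ?mulr_ge0 ?exprn_ge0 ?nm_ge0 // ?le_max ?lexx ?orbT //;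
    by apply: ler_weXn2l => //; exact: leq_maxl.
  have S0 := le_trans ler01 S1; have SL0 := le_trans ler01 SL1.
  exists (c + cL)%N, (S + SL); split; first by apply: le_trans S1 _; rewrite lerDl.
  move=> z y z1 y1; split=> [j|i].
    case: (ltnP j (size P)) => hj.
      apply: le_trans (H j z y hj z1 y1) _; do 2?apply: ler_pM;
        rewrite ?mulr_ge0 ?exprn_ge0 ?nm_ge0 // ?lerDl //;
      by apply: ler_weXn2l => //; exact: leq_addr.
    by rewrite nth_default // size_poly0 big_ord0 nm0 !mulr_ge0 ?exprn_ge0 ?nm_ge0 ?addr_ge0.
  apply: le_trans ((HSL z z1).1 i) _; apply: ler_pM; rewrite ?exprn_ge0 ?nm_ge0 // ?lerDr //.
  by apply: ler_weXn2l => //; exact: leq_addl.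
have S0 := le_trans ler01 S1.
have mS : 0 <= m%:R * S by rewrite mulr_ge0.
have nS : 0 <= n%:R * S by rewrite mulr_ge0.
pose e := Num.min d 1; have e0 : 0 < e by rewrite lt_min d0 ltr01.
have ed : e <= d by rewrite ge_min lexx.
have nSe : 0 <= n%:R * S / e by rewrite divr_ge0 // ltW.
have mSd : 0 <= (e + m%:R * S) / d by rewrite divr_ge0 // ?addr_ge0 // ltW.
pose M0 := r + (e + m%:R * S) / d + 1 + n%:R * S / e.
exists c, M0; split; first by rewrite /M0; lra.
move=> z y w hz hy E.
have z1 : 1 <= nm z by apply: le_trans hz; rewrite /M0; lra.
have zr : r <= nm z by apply: le_trans hz; rewrite /M0; lra.
have zc : 1 <= nm z ^+ c by exact: exprn_ege1.
have zc0 : 0 < nm z ^+ c by exact: lt_le_trans ltr01 zc.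
have y1 : 1 <= nm y by apply: le_trans hy; apply: le_trans zc _; rewrite ler_peMl ?(ltW zc0) // /M0; lra.
have yc : 1 <= nm y ^+ c by exact: exprn_ege1.
have [HS1 HS2] := HS z y z1 y1.
have zyc : 1 <= nm z ^+ c * nm y ^+ c by apply: mulr_ege1.
have top : e <= nm (\sum_(i < size L) (L`_i).[z] * y ^+ i).
  rewrite sL; apply: (@lead_lower m (fun i => (L`_i).[z]) y d (S * nm z ^+ c) e) => //;
    rewrite ?mulr_ge0 ?(ltW zc0) ?(ltW e0) //.
    by have := HL z zr; rewrite lead_coefE sL.
  have : (e + m%:R * S) / d * nm z ^+ c <= nm y by apply: le_trans hy; apply: ler_wpM2r; rewrite ?ltW // /M0;
    lra.
  rewrite mulrAC ler_pdivrMr // mulrC [nm y * d]mulrC => h; apply: le_trans h;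
    rewrite mulrDr [_ * (m%:R * S)]mulrC -!mulrA lerD2r.
  by rewrite ler_peMl // ltW.
have := @root_bound n (fun j => \sum_(i < size P`_j) (P`_j`_i).[z] * y ^+ i) w e (S * nm z ^+ c * nm y ^+ c) e0.
rewrite -sP => /(_ _ _ _ E) h; apply: le_trans (h _ _ _) _.
- by rewrite -!mulrA !mulr_ge0 // ?exprn_ge0 // nm_ge0.
- by move: top; rewrite /L lead_coefE sP.
- by move=> j _; exact: HS1.
rewrite -[M0 * _ * _]mulrA; have hh : 1 + n%:R * S / e <= M0 by rewrite /M0; lra.
apply: le_trans (_ : (1 + n%:R * S / e) * (nm z ^+ c * nm y ^+ c) <= _); last by apply: ler_wpM2r => //;
  exact: le_trans ler01 zyc.
rewrite mulrDl mul1r; apply: lerD => //; rewrite -!mulrA le_eqVlt; apply/orP; left; apply/eqP; ring.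
Qed.

Section Etype.
Variables (p : C) (u : R).
Hypotheses (p0 : p != 0) (u0 : 0 < u) (u1 : u < 1) (pu : nm p = u ^+ 4).
Local Notation x := (nm p).
Let x0 : 0 < x. Proof. by rewrite nm_gt0. Qed.
Let x1 : x < 1. Proof. by rewrite pu exprn_ilt1 ?ltW. Qed.

Lemma superexp_sup (K : R) : 0 <= K -> exists S, 1 <= S /\ forall k, K ^+ k * x ^+ 'C(k, 2) <= S.
Proof.
move=> K0; pose V k := K ^+ k * x ^+ 'C(k, 2).
have V0 k : 0 <= V k by rewrite mulr_ge0 ?exprn_ge0 // ltW.
have [L HL] := superexp_tail p0 x1 K0 ltr01.
have S0 : 0 <= \sum_(i < L) V i by apply: sumr_ge0.
exists (\sum_(i < L) V i + 1); split; first by rewrite lerDr.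
move=> k; case: (ltnP k L) => kL.
  by rewrite (bigD1 (Ordinal kL)) //= -addrA lerDl addr_ge0 // sumr_ge0.
apply: ler_wpDl => //; have := HL (k - L).+1; rewrite big_ord_recr /= subnKC // => h.
by apply: le_trans h; rewrite lerDr sumr_ge0 // => i _; exact: V0.
Qed.

(** 1/|rho f N| is of size |p|^-N, and the maximum over n of |p|^(n(n-1)/2 - Nn) is of size
    |p|^(-N^2/2), up to geometric factors. *)
Lemma etype_upper f : etype p f -> exists D, 1 <= D /\ forall N z, (0 < N)%N -> nm (z * rho f N) <= 1 ->
  nm z <= D ^+ (N ^ 2) /\ nm (ev f z) <= D ^+ (N ^ 2).
Proof.
move=> Ef; have [f0 _] := Ef; have [K [K1 HK]] := aR_bound p0 x1 Ef.
have K0 : 0 <= K by exact: le_trans ler01 K1.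
have [k1 [k2 [k10 _ Hk]]] := rho_bounds p0 Ef.
pose H := 2 * K * nm (rho f 0) / k1 + 1.
have H0 : 0 <= 2 * K * nm (rho f 0) / k1 by rewrite divr_ge0 ?mulr_ge0 ?nm_ge0 ?(ltW k10).
have H1 : 1 <= H by rewrite /H lerDr.
have [S [S1 HS]] := superexp_sup (le_trans ler01 H1).
pose X := x^-1; have xX : x * X = 1 by rewrite mulfV // gt_eqF.
have X1 : 1 <= X by rewrite invf_ge1 // ltW.
have X0 : 0 <= X by exact: le_trans ler01 X1.
have S0 : 0 <= S by exact: le_trans ler01 S1. have HH0 : 0 <= H by exact: le_trans ler01 H1.
(* The square is completed: ['C(N + k, 2)] contains the cross term [N * k], which cancels the excess
   power of [X]. *)
have key N n : H ^+ n * x ^+ 'C(n, 2) * X ^+ (N * n) <= S * H ^+ N * X ^+ (N ^ 2).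
  case: (leqP N n) => Nn; last first.
    apply: ler_pM; rewrite ?mulr_ge0 ?exprn_ge0 ?(ltW x0) //; last first.
      by apply: ler_weXn2l => //; rewrite -mulnn leq_mul2l ltnW // orbT.
    apply: le_trans (_ : H ^+ N * 1 <= _).
      apply: ler_pM; rewrite ?exprn_ge0 ?exprn_ile1 ?(ltW x0) ?(ltW x1) //.
      by apply: ler_weXn2l => //; exact: ltnW.
    by rewrite mulr1 ler_peMl // exprn_ge0.
  rewrite -(subnKC Nn); move: (n - N)%N => k.
  have -> : H ^+ (N + k) * x ^+ 'C(N + k, 2) * X ^+ (N * (N + k)) = (H ^+ k * x ^+ 'C(k,
    2)) * (H ^+ N * X ^+ (N ^ 2)) * x ^+ 'C(N, 2).
    rewrite bin2D mulnDr !exprD mulnn; set a1 := X ^+ (N ^ 2).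
    have h : x ^+ (N * k) * X ^+ (N * k) = 1 by rewrite -exprMn xX expr1n.
    rewrite -[RHS]mulr1 -h; ring.
  rewrite -[leRHS]mulr1 -[S * _ * _]mulrA; apply: ler_pM; rewrite ?mulr_ge0 ?exprn_ge0 ?(ltW x0) //.
    by apply: ler_wpM2r; rewrite ?mulr_ge0 ?exprn_ge0.
  by rewrite exprn_ile1 ?(ltW x0) ?(ltW x1).
pose F0 := nm (f 0%N); have F00 : 0 <= F0 by exact: nm_ge0.
pose D0 := 2 * F0 * S + 1; have D01 : 1 <= D0 by rewrite /D0 lerDr !mulr_ge0.
pose k1' := k1^-1 + 1; have k11 : 1 <= k1' by rewrite /k1' lerDr invr_ge0 ltW.
exists (D0 * H * X * k1'); have D01' := le_trans ler01 D01. have k11' := le_trans ler01 k11.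
have DD1 : 1 <= D0 * H * X * k1' by rewrite !mulr_ege1.
split=> // N z N0; have rN : 0 < nm (rho f N) by rewrite nm_gt0 (rho_neq0 Ef).
rewrite nmM -ler_pdivlMr // mul1r => hz.
have xN : 0 < x ^+ N by rewrite exprn_gt0.
have hz2 : nm z <= k1^-1 * X ^+ N.
  apply: le_trans hz _; rewrite /X exprVn -invfM lef_pV2 ?posrE ?mulr_gt0 //.
  by have /andP[] := Hk N.
have NN2 : (N <= N ^ 2)%N by rewrite -mulnn leq_pmulr.
have up (a b : R) m : 0 <= a -> a <= b -> 1 <= b -> (m <= N ^ 2)%N -> (0 < m)%N -> a <= b ^+ (N ^ 2).
  move=> a0 ab b1 hm m0; apply: le_trans ab _; rewrite -[leLHS]expr1; apply: ler_weXn2l => //;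
    exact: leq_trans hm.
have Ha : k1^-1 <= k1' ^+ (N ^ 2) by apply: (up _ _ 1%N) => //;
  rewrite ?invr_ge0 ?(ltW k10) // ?/k1' ?lerDl // expn_gt0 N0.
have XN : X ^+ N <= X ^+ (N ^ 2) by exact: ler_weXn2l.
have HN : H ^+ N <= H ^+ (N ^ 2) by exact: ler_weXn2l.
have DN : 2 * F0 * S <= D0 ^+ (N ^ 2) by apply: (up _ _ 1%N) => //;
  rewrite ?mulr_ge0 // ?/D0 ?lerDl // expn_gt0 N0.
rewrite !exprMn; set a1 := D0 ^+ _ in DN *; set a2 := H ^+ (N ^ 2) in HN *; set a3 := X ^+ (N ^ 2) in XN *;
  set a4 := k1' ^+ _ in Ha *.
have a11 : 1 <= a1 by exact: exprn_ege1. have a21 : 1 <= a2 by exact: exprn_ege1.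
have a31 : 1 <= a3 by exact: exprn_ege1. have a41 : 1 <= a4 by exact: exprn_ege1.
have a10 := le_trans ler01 a11. have a20 := le_trans ler01 a21. have a30 := le_trans ler01 a31.
  have a40 := le_trans ler01 a41.
split.
  apply: le_trans hz2 _; rewrite mulrC; apply: ler_pM; rewrite ?exprn_ge0 ?invr_ge0 ?(ltW k10) ?(ltW x0) //.
  by apply: le_trans XN _; rewrite ler_peMl // mulr_ege1.
have b : bnd f (2 * (k1^-1 * X ^+ N)) (F0 * (S * H ^+ N * X ^+ (N ^ 2))).
  move=> n; have -> : nm (f n) = F0 * nm (rho f 0) ^+ n * nm (aR f 0 n).
    have := rho_neq0 Ef 0; rewrite /aR add0n; set rr := rho f 0; clearbody rr => rr0.
    have r0 : nm rr ^+ n != 0 by rewrite expf_neq0 // gt_eqF // nm_gt0.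
    rewrite !nmM !nmV nmX /F0; move: r0; set r2 := _ ^+ n => r0; field.
    by rewrite r0 gt_eqF // nm_gt0.
  have [h1 _] := HK 0%N n.
  have -> : (2 * (k1^-1 * X ^+ N)) ^+ n = (2 / k1) ^+ n * X ^+ (N * n) by rewrite !mulrA [LHS]exprMn exprM.
  have r0 : 0 <= nm (rho f 0) ^+ n by rewrite exprn_ge0 // nm_ge0.
  have X0' : 0 <= X ^+ (N * n) by rewrite exprn_ge0.
  have k10' : 0 <= (2 / k1) ^+ n by rewrite exprn_ge0 // divr_ge0 // ltW.
  apply: le_trans (_ : F0 * nm (rho f 0) ^+ n * (K ^+ n * x ^+ 'C(n, 2)) * ((2 / k1) ^+ n * X ^+ (N * n)) <= _).
    by apply: ler_wpM2r; [rewrite mulr_ge0 | apply: ler_wpM2l; rewrite ?mulr_ge0].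
  rewrite -!mulrA; apply: ler_wpM2l => //; rewrite !mulrA; apply: le_trans (key N n).
  apply: ler_wpM2r => //; rewrite mulrAC; apply: ler_wpM2r; first by rewrite exprn_ge0 // ltW.
  rewrite -!exprMn; apply: lerXn2r; rewrite ?nnegrE ?mulr_ge0 ?nm_ge0 ?invr_ge0 ?(ltW k10) //.
  by rewrite /H (_ : nm (rho f 0) * K * (2 / k1) = 2 * K * nm (rho f 0) / k1) ?lerDl //; ring.
have r0 : 0 < k1^-1 * X ^+ N by rewrite mulr_gt0 ?invr_gt0 // exprn_gt0 // invr_gt0.
have zr : nm z < 2 * (k1^-1 * X ^+ N) by apply: le_lt_trans hz2 _; rewrite ltr_pMl // ltr1n.
apply: le_trans (ev_bound zr b) _.
have h2 : (1 - nm z / (2 * (k1^-1 * X ^+ N)))^-1 <= 2.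
  have h3 : nm z / (2 * (k1^-1 * X ^+ N)) <= 2^-1.
    rewrite ler_pdivrMr; last by apply: mulr_gt0.
    by rewrite mulKf // pnatr_eq0.
  rewrite -[leRHS]invrK lef_pV2 ?posrE ?invr_gt0 //; move: h3; set h := nm z / _; clearbody h; lra.
apply: le_trans (ler_wpM2l _ h2) _; first by rewrite !mulr_ge0 ?exprn_ge0.
rewrite -/a3; apply: le_trans (_ : (2 * F0 * S) * a2 * a3 <= _).
  rewrite (_ : F0 * (S * H ^+ N * a3) * 2 = 2 * F0 * S * H ^+ N * a3); last by ring.
  by do 2!(apply: ler_pM; rewrite ?mulr_ge0 ?exprn_ge0 //).
apply: le_trans (_ : a1 * a2 * a3 <= _); last by rewrite ler_peMr // !mulr_ge0.
by do 2!(apply: ler_pM; rewrite ?mulr_ge0 //).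
Qed.

End Etype.
End UnitCase.

(** * Exclusion of an entire partner with base on the unit circle *)

Section UnitCase.
Variable R : realType.
Local Notation C := R[i].
Implicit Types (f g : ps C) (z y : C).
Variables (p : C) (u : R).
Hypotheses (p0 : p != 0) (u0 : 0 < u) (u1 : u < 1) (pu : nm p = u ^+ 4).
Local Notation x := (nm p).
Let x0 : 0 < x. Proof. by rewrite nm_gt0. Qed.
Let x1 : x < 1. Proof. by rewrite pu exprn_ilt1 ?ltW. Qed.

(* On a circle midway between consecutive rings of zeros, [f] is large and [g] is bounded by a power of [f]. *)
Lemma dep_growth f g P : etype p f -> (forall r, cv g r) -> P != 0 -> ev2 f g P = 0 ->
  exists E N0, forall N n, (N0 <= N)%N -> nm (g n) * (u ^+ 2 / nm (rho f N)) ^+ n * u ^+ (E * N ^ 2) <= 1.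
Proof.
move=> Ef cg P0 EP; have [f0 _] := Ef; have cf := etype_cv p0 x1 Ef.
have u2 : 0 < u ^+ 2 by rewrite exprn_gt0.
have u21 : u ^+ 2 < 1 by rewrite exprn_ilt1 // ltW.
have u3 : 0 < u ^+ 3 by rewrite exprn_gt0.
have [c [M [M1 HM]]] := root_growth2 P0.
have M0 : 0 < M by exact: lt_le_trans M1.
have [D [D1 HD]] := etype_upper p0 u0 u1 pu Ef; have D0 := le_trans ler01 D1.
have [c1 [c10 HL]] := etype_lower p0 u0 u1 pu Ef.
pose c3 := c1 * (1 - u ^+ 2) / 2; have c30 : 0 < c3 by rewrite divr_gt0 // mulr_gt0 // subr_gt0.
have [N1 HN1] := HL _ c30; have [B [B0 HB]] := term_bound p0 u0 u1 pu Ef.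
have fc : 0 < nm (f c.+1) by rewrite nm_gt0.
pose r := M + M * B / (c3 * nm (f c.+1)).
have MB : 0 < M * B / (c3 * nm (f c.+1)) by rewrite divr_gt0 // mulr_gt0.
have r0 : 0 < r by rewrite addr_gt0.
have /tendsP /(_ (u ^+ 2 / r)) [|N2 HN2] := rho_tends0 p0 x1 Ef; first by rewrite divr_gt0.
have MD0 : 0 < (M * D ^+ c * D ^+ c + 1)^-1 by rewrite invr_gt0 ltr_wpDl // !mulr_ge0 ?exprn_ge0 // ltW.
have [E HE] := expr_small (ltW u0) u1 MD0.
exists E, (N1 + N2 + c.+2)%N => N n hN.
have hN1 : (N1 <= N)%N by move: hN; clear; lia. have hN2 : (N2 <= N)%N by move: hN; clear; lia.
have hc : (c.+1 <= N)%N by move: hN; clear; lia. have N0 : (0 < N)%N by move: hN; clear; lia.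
have rN : 0 < nm (rho f N) by rewrite nm_gt0 (rho_neq0 Ef).
set t := u ^+ 2 / nm (rho f N); have t0 : 0 < t by rewrite divr_gt0.
have tr : r <= t.
  have := HN2 N hN2; rewrite subr0 ltr_pdivlMr // mulrC => h.
  by rewrite ler_pdivlMr // ltW.
have sup z : nm z = t -> nm (ev g z) <= (M * D ^+ c * D ^+ c) ^+ (N ^ 2).
  move=> zt; have Ey : nm (z * rho f N) = u ^+ 2 by rewrite nmM zt divfK // gt_eqF.
  have z0 : z != 0 by rewrite -nm_gt0 zt.
  have y1 : u ^+ 3 <= nm (z * rho f N) by rewrite Ey; apply: ler_wiXn2l => //; exact: ltW.
  have y2 : nm (z * rho f N) <= (u ^+ 3)^-1.
    by rewrite Ey; apply: le_trans (ltW u21) _; rewrite invf_ge1 // exprn_ile1 // ltW.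
  have h1 := HN1 N _ hN1 y1 y2.
  have h2 : 1 - u ^+ 2 <= nm (1 + z * rho f N).
    have := nm_sub_ge 1 (- (z * rho f N)); rewrite nmN opprK nm1 Ey => h; exact: h.
  have h3 : c3 <= nm (Phi f N (z * rho f N)).
    have := ler_wpM2l (ltW c10) h2; move: h1; rewrite /c3; set A := c1 * (1 - _); set B' := c1 * _; lra.
  have h4 := HB c.+1 N z hc y1.
  have T0 : 0 < nm (f N) * nm z ^+ N by rewrite mulr_gt0 ?exprn_gt0 ?nm_gt0.
  have h5 : M * nm z ^+ c <= nm (ev f z).
    rewrite (Phi_nm N Ef z0); apply: le_trans (ler_wpM2r (ltW T0) h3).
    rewrite -(ler_pM2l B0) [leRHS]mulrCA; apply: le_trans (ler_wpM2l (ltW c30) h4).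
    rewrite exprS !mulrA; apply: ler_wpM2r; first by rewrite exprn_ge0 ?nm_ge0.
    rewrite zt -ler_pdivrMl ?(mulr_gt0 c30 fc) // mulrC [B * M]mulrC; apply: le_trans tr;
      by rewrite /r lerDr ltW.
  have h6 : M <= nm z by rewrite zt; apply: le_trans tr; rewrite /r lerDl ltW.
  have h7' : nm (z * rho f N) <= 1 by rewrite Ey ltW.
  have [h7 h8] := HD N z N0 h7'.
  have := HM z (ev f z) (ev g z) h6 h5; rewrite (_ : \sum_(j < _) _ = 0); last first.
    have := ev_ev2 P z cf cg; rewrite EP -(rmorph0 (@pp C)) ev_pp horner0 => /esym E0.
    by rewrite -[RHS]E0; apply: eq_bigr => j _; rewrite (ev_phi _ z cf).2.
  move=> /(_ erefl) h; apply: le_trans h _; move: h7 h8; have : (0 < N ^ 2)%N by rewrite expn_gt0 N0.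
  set n2 := (N ^ 2)%N; clearbody n2 => n20 h7 h8; rewrite ![in leRHS]exprMn -!exprM ![(c * n2)%N]mulnC !exprM.
  apply: ler_pM; rewrite ?mulr_ge0 ?exprn_ge0 ?nm_ge0 ?(ltW M0) //; last by apply: lerXn2r;
    rewrite ?nnegrE ?exprn_ge0 ?nm_ge0.
  apply: ler_pM; rewrite ?exprn_ge0 ?nm_ge0 ?(ltW M0) //; last by apply: lerXn2r;
    rewrite ?nnegrE ?exprn_ge0 ?nm_ge0.
  by rewrite -[leLHS]expr1; apply: ler_weXn2l.
have h := cauchy_ev n t0 (cg t) sup.
apply: le_trans (ler_wpM2r _ h) _; first by rewrite exprn_ge0 // ltW.
rewrite exprM -exprMn; apply: exprn_ile1; first by rewrite !mulr_ge0 ?exprn_ge0 ?(ltW M0) ?(ltW u0).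
have := HE E (leqnn E); rewrite -[X in _ < X]mul1r ltr_pdivlMr ?ltr_wpDl ?mulr_ge0 ?exprn_ge0 ?(ltW M0) // =>
  /ltW h9.
apply: le_trans h9; rewrite mulrC; apply: ler_wpM2l; first by rewrite exprn_ge0 // ltW.
by rewrite lerDl.
Qed.

(** The radii for [companions_absurd] are the moduli of zeros of [f]. There [g] is of polynomial
    size, below half of its largest term, which yields the companion; [dep_growth] yields the linear
    bound on [nu]. *)
Lemma entire_unit_absurd q A B f g P : etype p f -> hyp q A B g -> nm q = 1 -> (forall m, q ^+ m.+1 != 1) ->
  (forall r, cv g r) -> P != 0 -> ev2 f g P = 0 -> False.
Proof.
move=> Ef Hg q1 ur cg P0 EP; have [f0 _] := Ef; have cf := etype_cv p0 x1 Ef; have g0 := hyp_neq0 Hg.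
have u0' := u0; have u1' := u1; have pu' := pu.
have fz : f != 0 by apply/eqP => fz; have := f0 0%N; rewrite fz ps0 eqxx.
have [c [M [r [M0 r1 HZ]]]] := zero_growth fz cf cg P0 EP.
have gc : 0 < nm (g c.+1) by rewrite nm_gt0.
(* The ratio of consecutive radii is at least u^-3 (1 - d)/(1 + d); this [d] leaves u^-2. *)
pose d := (1 - u) / 4; have d0 : 0 < d by rewrite divr_gt0 // subr_gt0.
have d1 : d < 1 / 4 by rewrite /d; lra.
pose rr := r + 2 * M / nm (g c.+1) + 1.
have Mg : 0 < 2 * M / nm (g c.+1) by rewrite divr_gt0 // mulr_gt0.
have [N1 HN1] := zeros_large p0 u0 u1 pu rr Ef d0.
have rec N : exists z, z != 0 /\ ((N1 <= N)%N -> [/\ ev f z = 0, rr <= nm z & nm (z * rho f N + 1) <= d]).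
  case: (leqP N1 N) => hN; last by exists 1; rewrite oner_eq0.
  have [z [h1 h2 h3]] := HN1 N hN; exists z; split=> //.
  by rewrite -nm_gt0; apply: lt_le_trans h2; rewrite /rr; lra.
have [z Hz] := boolp.choice rec.
pose s N := nm (z N); have s0 N : 0 < s N by rewrite nm_gt0; case: (Hz N).
have [nu Hnu] := boolp.choice (fun N => max_term cg g0 (s0 N)).
pose rh N := nm (rho f N); have rh0 N : 0 < rh N by rewrite nm_gt0 (rho_neq0 Ef).
have sr N : (N1 <= N)%N -> 1 - d <= s N * rh N <= 1 + d.
  move=> hN; have [_ /(_ hN) [_ _ h]] := Hz N; rewrite /s /rh -nmM; move: h; set w := z N * _ => h.
  have h1 := nm_sub_ge (w + 1) 1; rewrite addrK nm1 in h1.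
  have h2 := nm_sub_ge w (-1); rewrite opprK nmN nm1 in h2.
  have h3 := nm_sub_ge 1 (w + 1); rewrite nm1 (_ : 1 - (w + 1) = - w) ?nmN in h3; last by ring.
  by apply/andP; split; lra.
have [N2 HN2] : exists N2, forall N, (N2 <= N)%N -> rh N.+1 <= u ^+ 3 * rh N.
  have e0 : 0 < u ^+ 3 - u ^+ 4 by rewrite subr_gt0 exprS gtr_pMl // exprn_gt0.
  have [N2 HN2] := tends_nm (rho_shift p0 Ef 1) e0; exists N2 => N hN.
  have /andP[_ ] := HN2 N hN; rewrite /= addn1 expr1 [nm (_ / _)]nmM nmV pu' subrKC => /ltW;
    by rewrite -/(rh N) -/(rh N.+1) ler_pdivrMr.
have [K [K1 HK]] := rho_ratio_bound p0 Ef; have K0 : 0 < K by exact: lt_le_trans K1.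
have e3 : 0 < u ^+ 2 / (2 * K) by rewrite divr_gt0 ?exprn_gt0 // mulr_gt0.
have [N3 HN3] := expr_small (ltW u0) u1 e3.
have [E [N4 HE]] := dep_growth Ef cg P0 EP.
have g00 : 0 < nm (g 0%N) by rewrite nm_gt0.
have [k Hk] := expr_small (ltW u0) u1 g00.
have [q0 _ _ HAB HH] := Hg.
have A0 : A != 0 by apply/eqP => A0; have [] := HAB 0%N; rewrite A0 horner0 eqxx.
apply: (@companions_absurd R (fun n => nm (g n)) s nu u ((1 - u) / 8) (\sum_(i < size B) nm B`_i) (k + 2 * E)
  (N1 + N2 + N3 + N4 + 1)%N A q) => //.
- by rewrite divr_gt0 // subr_gt0.
- by lra.
- by apply: sumr_ge0 => i _; exact: nm_ge0.
- by move=> n; rewrite nm_gt0.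
- move=> N hN; have hN1 : (N1 <= N)%N by move: hN; clear; lia. have hN2 : (N2 <= N)%N by move: hN; clear; lia.
  have /andP[_ h1] := sr N hN1; have /andP[h2 _] := sr N.+1 (leqW hN1); have h3 := HN2 N hN2.
  rewrite -(ler_pM2r (rh0 N)); apply: le_trans h1 _.
  have h4 : s N.+1 * rh N.+1 <= s N.+1 * (u ^+ 3 * rh N) by apply: ler_wpM2l => //; exact: ltW.
  have h5 : (1 - d) <= u * (u ^+ 2 * s N.+1 * rh N) by apply: le_trans h2 _; apply: le_trans h4 _;
    rewrite !exprS expr0; lra.
  rewrite -(ler_pM2l u0); apply: le_trans h5; move: u0' u1'; rewrite /d; nra.
- move=> N hN; apply: comparable_coefficient => //; first by case: (Hz N).
    exact: (Hnu N).
  have hN1 : (N1 <= N)%N by move: hN; clear; lia.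
  have [_ /(_ hN1) [h1 h2 _]] := Hz N; apply: le_lt_trans (HZ _ _ h1) _; first by apply: le_trans h2;
    rewrite /rr; lra.
  have := Hnu N c.+1; rewrite -/(s N) => h3; rewrite ltr_pdivlMr //; apply: lt_le_trans h3.
  rewrite exprS mulrA mulrAC; rewrite ltr_pM2r ?exprn_gt0 //.
  rewrite mulrC [_ * s N]mulrC -ltr_pdivrMr //; apply: lt_le_trans h2; by rewrite /rr ltr_wpDr // ltrDr; lra.
- move=> N hN; have hN1 : (N1 <= N)%N by move: hN; clear; lia.
  have hN3 : (N3 <= N * 2)%N by move: hN; clear; lia.
  have N0 : (0 < N)%N by move: hN; clear; lia.
  (* The growth bound is applied at index 2N, where the radius [t] exceeds [s N] by at least
     u^(-2N). As the largest term is at least |g_0|, this gives 2N nu <= k + 4 E N^2. *)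
  have h1 := HE (N * 2)%N (nu N); rewrite (_ : (N4 <= N * 2)%N = true) in h1; last by move: hN; clear; lia.
  have {h1} := h1 isT; rewrite -/(rh _); set t := u ^+ 2 / _ => h1.
  have t0 : 0 < t by rewrite divr_gt0 // exprn_gt0.
  have st : s N <= u ^+ (N * 2) * t.
    have /andP[_ h2] := sr N hN1; have := HK N N; rewrite [nm (_ / _)]nmM nmV addnn -muln2 -/(rh N) -/(rh (N *
      2)%N) ler_pdivrMr // => h3.
    rewrite /t mulrA ler_pdivlMr ?rh0 // -(ler_pM2r (rh0 N)).
    apply: le_trans (_ : (s N * rh N) * (K * x ^+ N * rh N) <= _); first by rewrite mulrAC;
      apply: ler_wpM2l => //; rewrite mulr_ge0 // ltW.
    rewrite !mulrA; apply: ler_wpM2r; first exact: ltW.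
    have := HN3 _ hN3; rewrite ltr_pdivlMr ?mulr_gt0 // => /ltW h4.
    have -> : x ^+ N = u ^+ (N * 2) * u ^+ (N * 2) by rewrite pu' -exprM -exprD; congr (_ ^+ _); clear; lia.
    set w := u ^+ (N * 2) in h4 *; have w0 : 0 < w by rewrite exprn_gt0.
    rewrite (_ : s N * rh N * K * (w * w) = w * (s N * rh N * (w * K))); last by ring.
    rewrite -[leRHS]mulrA (_ : u * u = u ^+ 2) //; apply: ler_wpM2l; first exact: ltW.
    apply: le_trans h4; have wK : 0 < w * K by rewrite mulr_gt0.
    rewrite (_ : w * (2 * K) = 2 * (w * K)); last by ring.
    by apply: ler_wpM2r; [exact: ltW | move: h2 d1; clear; lra].
  have := Hnu N 0%N; rewrite expr0 mulr1 => h4.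
  have h5 : nm (g 0%N) * u ^+ (E * (N * 2) ^ 2) <= u ^+ (N * 2 * nu N).
    apply: le_trans (_ : u ^+ (N * 2 * nu N) * (nm (g (nu N)) * t ^+ nu N * u ^+ (E * (N * 2) ^ 2)) <= _);
      last first.
      by rewrite ler_piMr // exprn_ge0 // ltW.
    rewrite mulrA; apply: ler_wpM2r; first by rewrite exprn_ge0 // ltW.
    apply: le_trans h4 _; rewrite mulrCA; apply: ler_wpM2l; first exact: nm_ge0.
    rewrite exprM -exprMn; apply: lerXn2r; [by rewrite nnegrE ltW | | exact: st].
    by rewrite nnegrE; apply: mulr_ge0; [rewrite exprn_ge0 // ltW | exact: ltW].
  have h6 : u ^+ (k + E * (N * 2) ^ 2) <= u ^+ (N * 2 * nu N).
    apply: le_trans h5; rewrite exprD; apply: ler_wpM2r; first by rewrite exprn_ge0 // ltW.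
    by apply: ltW; apply: Hk.
  rewrite ler_iXn2l // in h6; rewrite -(leq_pmul2l (_ : (0 < N * 2)%N)); last by rewrite muln_gt0 N0.
  apply: leq_trans h6 _; move: N0; clear; nia.
- move=> n; rewrite -nmM -HH nmM; apply: ler_wpM2r; first exact: nm_ge0.
  rewrite horner_coef; apply: le_trans (nm_sum _ _ _) _; apply: ler_sum => i _.
  by rewrite nmM !nmX q1 !expr1n mulr1.
Qed.
End UnitCase.

(** * Algebraic functions over the entire functions *)

Section Ode.
Variable F : fieldType.
Local Notation ps := (ps F).
Implicit Types (g h u : ps).
Variable X : ps -> Prop.
Hypotheses (X1 : X 1) (XB : forall a b, X a -> X b -> X (a - b)) (XM : forall a b, X a -> X b -> X (a * b)).
Hypothesis Xd : forall a, X a -> X (dl a).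
Let X0 := closed0 X1 XB.
Let XD := closedD X1 XB.
Let XN := closedN X1 XB.

(* The ring [X[g]]. *)
Definition adj g h := exists Q : {poly ps}, (forall i, X Q`_i) /\ h = Q.[g].

Lemma adjD g h h' : adj g h -> adj g h' -> adj g (h + h').
Proof.
move=> [Q [XQ ->]] [Q' [XQ' ->]]; exists (Q + Q'); split=> [i|]; last by rewrite hornerD.
by rewrite coefD; exact: XD.
Qed.
Lemma adjM g h h' : adj g h -> adj g h' -> adj g (h * h').
Proof.
move=> [Q [XQ ->]] [Q' [XQ' ->]]; exists (Q * Q'); split=> [i|]; last by rewrite hornerM.
by rewrite coefM; apply: (closed_sum X1 XB) => j; exact: XM.
Qed.
Lemma adjC g a : X a -> adj g a.
Proof. by move=> Xa; exists a%:P; rewrite hornerC; split=> // i; rewrite coefC; case: eqP. Qed.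
Lemma adjN g h : adj g h -> adj g (- h).
Proof. by move=> H; rewrite -mulN1r; apply: adjM => //; apply: adjC; exact: XN. Qed.
Lemma adjX g h n : adj g h -> adj g (h ^+ n).
Proof. by move=> H; elim: n => [|n IH]; rewrite ?expr0 ?exprS; [exact: adjC | exact: adjM]. Qed.
Lemma adjg g : adj g g.
Proof. by exists 'X; rewrite hornerX; split=> // i; rewrite coefX; case: eqP. Qed.

Lemma dl_expr g n : dl (g ^+ n.+1) = n.+1%:R * g ^+ n * dl g.
Proof.
elim: n => [|n IH]; first by rewrite expr0 expr1 mulr1 mul1r.
by rewrite exprS dlM IH exprS -[in RHS]addn1 natrD; ring.
Qed.
Lemma dl_horner (Q : {poly ps}) g : dl Q.[g] = (map_poly (@dl F) Q).[g] + Q^`().[g] * dl g.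
Proof.
elim/poly_ind: Q => [|Q c IH]; first by rewrite raddf0 linear0 !horner0 mul0r addr0 raddf0.
have Ed : map_poly (@dl F) (Q * 'X + c%:P) = map_poly (@dl F) Q * 'X + (dl c)%:P.
  by apply/polyP => i; rewrite coef_map_id0 ?raddf0 // !(coefD, coefMX, coefC) coef_map_id0 ?raddf0 //;
    case: i => [|i]; rewrite /= ?add0r ?addr0.
rewrite Ed derivD derivC addr0 derivM derivX mulr1 !hornerE !raddfD /= dlM IH; ring.
Qed.

(** Differentiating p(g) = 0 puts p'(g) times the derivative of [g] into X[g]. *)
Lemma dl_adj (p : {poly ps}) g h : (forall i, X p`_i) -> p.[g] = 0 -> adj g h -> adj g (p^`().[g] * dl h).
Proof.
move=> Xp pg [Q [XQ ->]].
have mapX (Q' : {poly ps}) : (forall i, X Q'`_i) -> adj g (map_poly (@dl F) Q').[g].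
  by move=> XQ'; exists (map_poly (@dl F) Q'); split=> // i; rewrite coef_map_id0 ?raddf0 //; exact: Xd.
have derX (Q' : {poly ps}) : (forall i, X Q'`_i) -> adj g Q'^`().[g].
  move=> XQ'; exists Q'^`(); split=> // i; rewrite coef_deriv -mulr_natr; apply: XM => //;
    exact: (closed_nat X1 XB).
have ug : p^`().[g] * dl g = - (map_poly (@dl F) p).[g].
  by apply/eqP; rewrite -addr_eq0 addrC -dl_horner pg raddf0.
rewrite dl_horner mulrDr mulrCA ug; apply: adjD; first by apply: adjM; [exact: derX | exact: mapX].
by apply: adjM; [exact: derX | apply: adjN; exact: mapX].
Qed.

Lemma dl_iter_adj (p : {poly ps}) g k : (forall i, X p`_i) -> p.[g] = 0 -> exists m, forall i, (i < k)%N ->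
  adj g (p^`().[g] ^+ m * iter i (@dl F) g).
Proof.
move=> Xp pg; set u := p^`().[g].
have au : adj g u.
  exists p^`(); split=> // i; rewrite coef_deriv -mulr_natr; apply: XM => //; exact: (closed_nat X1 XB).
have one i : exists m, adj g (u ^+ m * iter i (@dl F) g).
  elim: i => [|i [m IH]]; first by exists 0%N; rewrite expr0 mul1r; exact: adjg.
  exists m.+2; case: m IH => [|m] IH.
    rewrite expr0 mul1r in IH; rewrite exprS expr1 iterS -mulrA; apply: adjM => //; exact: dl_adj.
  have h1 := dl_adj Xp pg IH; rewrite -/u dlM dl_expr in h1.
  rewrite iterS; set D := iter i _ _ in IH h1 *.
  have -> : u ^+ m.+3 * dl D = u * (u * (m.+1%:R * u ^+ m * dl u * D + u ^+ m.+1 * dl D)) - m.+1%:R * (u * dl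
    u) * (u ^+ m.+1 * D).
    by rewrite !exprS; ring.
  apply: adjD; first exact: adjM.
  apply: adjN; apply: adjM => //; apply: adjM; last exact: dl_adj.
  by apply: adjC; exact: (closed_nat X1 XB).
elim: k => [|k [m IH]]; first by exists 0%N.
have [m' IH'] := one k; exists (m + m')%N => i; rewrite ltnS leq_eqVlt => /orP[/eqP ->|hi].
  by rewrite exprD -mulrA; apply: adjM => //; exact: adjX.
by rewrite addnC exprD -mulrA; apply: adjM; [exact: adjX | exact: IH].
Qed.

Definition spang g n h := exists r : nat -> ps, (forall i, X (r i)) /\ h = \sum_(i < n) r i * g ^+ i.

(** Pseudo-division by [p]: a power of the leading coefficient replaces the inverse that [X] may
    lack. *)
Lemma spang_reduce (p : {poly ps}) g d h : size p = d.+1 -> (forall i, X p`_i) -> p.[g] = 0 -> adj g h ->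
  exists N, spang g d (p`_d ^+ N * h).
Proof.
move=> sp Xp pg [Q [XQ ->]].
have : spang g (size Q) Q.[g] by exists (fun i => Q`_i); split=> //; rewrite horner_coef.
move: (size Q) (Q.[g]) => n; elim: n => [|n IH] h' [r [Xr ->]].
  by exists 0%N, (fun=> 0); split=> //; rewrite !big_ord0 mulr0 big1 // => i _; rewrite mul0r.
case: (leqP n.+1 d) => nd.
  exists 0%N, (fun i => if (i < n.+1)%N then r i else 0); split; first by move=> i; case: ltnP.
  rewrite expr0 mul1r -(subnKC nd) big_split_ord /= [X in _ + X]big1 ?addr0.
    by apply: eq_bigr => i _; rewrite ltn_ord.
  by move=> i _; rewrite ltnNge leq_addr mul0r.
have [j nE] : exists j, n = (j + d)%N by exists (n - d)%N; move: nd; clear; lia.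
have [|N [r' [Xr' E']]] := IH (p`_d * \sum_(i < n.+1) r i * g ^+ i).
  exists (fun i => p`_d * r i - (if (j <= i)%N then r n * p`_(i - j) else 0)); split.
    by move=> i; apply: XB; [exact: XM | case: leqP => // _; exact: XM].
  rewrite big_ord_recr /= mulrDr.
  have -> : p`_d * (r n * g ^+ n) = - \sum_(i < d) r n * p`_i * g ^+ (i + j).
    have E : p`_d * g ^+ d = - \sum_(i < d) p`_i * g ^+ i.
      by apply/eqP; rewrite -addr_eq0 addrC; have := pg; rewrite horner_coef sp big_ord_recr /= => ->.
    have key (a b x y : ps) : a * (b * (x * y)) = b * x * (a * y) by ring.
    rewrite nE exprD key.
    by rewrite E mulrN mulr_sumr; congr (- _); apply: eq_bigr => i _; rewrite exprD; ring.
  have -> : \sum_(i < n) (p`_d * r i - (if (j <= i)%N then r n * p`_(i - j) else 0)) * g ^+ i =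
     p`_d * (\sum_(i < n) r i * g ^+ i) - \sum_(i < n) (if (j <= i)%N then r n * p`_(i - j) else 0) * g ^+ i.
    by rewrite mulr_sumr -sumrB; apply: eq_bigr => i _; rewrite mulrBl mulrA.
  congr (_ - _).
  rewrite nE big_split_ord /= [X in _ = X + _]big1 ?add0r.
    by apply: eq_bigr => i _; rewrite leq_addr addKn [(i + j)%N]addnC.
  by move=> i _; rewrite leqNgt ltn_ord mul0r.
by exists N.+1, r'; split=> //; rewrite exprSr -mulrA.
Qed.

(** After multiplication by a common nonzero factor, [g] and its first d derivatives lie in the span
    of d powers of [g] over [X]; [lindep_in] gives a relation with coefficients in [X]. *)
Lemma ode (p : {poly ps}) g : (forall i, X p`_i) -> p.[g] = 0 -> p^`().[g] != 0 ->
  exists d (e : nat -> ps), [/\ forall k, X (e k), e d != 0 & \sum_(k < d.+1) e k * iter k (@dl F) g = 0].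
Proof.
move=> Xp pg pg'; have p0 : p != 0 by apply: contraNneq pg' => ->; rewrite linear0 horner0.
have [d sp] : exists d, size p = d.+1 by exists (size p).-1; rewrite prednK // size_poly_gt0.
have c0 : p`_d != 0 by rewrite -[d]/(d.+1.-1) -sp -lead_coefE lead_coef_eq0.
have [m Hm] := dl_iter_adj d.+1 Xp pg; set u := p^`().[g] in pg' Hm.
have [N HN] : exists N, forall i, (i < d.+1)%N -> spang g d (p`_d ^+ N * (u ^+ m * iter i (@dl F) g)).
  elim: {1 3}(d.+1) (leqnn d.+1) => [|k IH] kd; first by exists 0%N.
  have [N HN] := IH (ltnW kd); have [N' HN'] := spang_reduce sp Xp pg (Hm k kd).
  have mulc h j : spang g d h -> spang g d (p`_d ^+ j * h).
    move=> [r [Xr ->]]; exists (fun i => p`_d ^+ j * r i); split=> [i|]; first by apply: XM => //;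
      exact: (closedX X1 XM).
    by rewrite mulr_sumr; apply: eq_bigr => i _; rewrite mulrA.
  exists (N + N')%N => i; rewrite ltnS leq_eqVlt => /orP[/eqP ->|hi].
    by rewrite exprD -mulrA; exact: mulc.
  by rewrite addnC exprD -mulrA; apply: mulc; exact: HN.
have rec i : exists r : nat -> ps, (forall j, X (r j)) /\ ((i < d.+1)%N ->
  p`_d ^+ N * (u ^+ m * iter i (@dl F) g) = \sum_(j < d) r j * g ^+ j).
  case: (ltnP i d.+1) => hi; last by exists (fun=> 0); split.
  by have [r [Xr E]] := HN i hi; exists r; split.
have [M HM] := boolp.choice rec.
have [|c [Xc [i0 i0d ci0] Hc]] := lindep_in X1 XB XM (ltnSn d) (M := M); first by move=> i j; have [] := HM i.
have E : \sum_(i < d.+1) c i * iter i (@dl F) g = 0.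
  have K0 : p`_d ^+ N * u ^+ m != 0 by rewrite mulf_neq0 // expf_neq0.
  apply: (mulfI K0); rewrite mulr0 mulr_sumr.
  transitivity (\sum_(i < d.+1) \sum_(j < d) c i * M i j * g ^+ j).
    apply: eq_bigr => i _; have [_ /(_ (ltn_ord i)) h] := HM i.
    rewrite mulrCA -[_ * _ * iter _ _ _]mulrA h mulr_sumr; apply: eq_bigr => j _; exact: mulrA.
  rewrite exchange_big big1 // => j _; rewrite -mulr_suml Hc ?mul0r //.
have : exists k, (k < d.+1)%N && (c k != 0) by exists i0; rewrite i0d.
have ub k : (k < d.+1)%N && (c k != 0) -> (k <= d)%N by case/andP.
move=> ex; case: (ex_maxnP ex ub) => k /andP[kd ck] mx.
exists k, c; split=> //; move: E; rewrite -!(big_mkord xpredT (fun i => c i * iter i (@dl F) g)).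
rewrite (big_cat_nat (leq0n _) (kd : (k.+1 <= d.+1)%N)) /= [X in _ + X]big_nat [X in _ + X]big1 ?addr0 // =>
  i /andP[ki id].
have [->|h] := eqVneq (c i) 0; first by rewrite mul0r.
by have := mx i; rewrite h id => /(_ isT); rewrite leqNgt ki.
Qed.
End Ode.

(** * Entire series: inversion and zeros in a disc *)

Section Entire.
Variable R : realType.
Local Notation C := R[i].
Implicit Types (f g F G : ps C) (z s : C) (r : R).

Definition entire F := forall r, cv F r.

Lemma entire1 : entire 1. Proof. by move=> r; exact: cv_1. Qed.
Lemma entireM F G : entire F -> entire G -> entire (F * G).
Proof. by move=> h1 h2 r; apply: (@cv_le _ _ `|r|); [exact: ler_norm | apply: cvM]. Qed.
Lemma entireB F G : entire F -> entire G -> entire (F - G).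
Proof. by move=> h1 h2 r; apply: (@cv_le _ _ `|r|); [exact: ler_norm | apply: cvD => //; apply: cvN]. Qed.
Lemma entire_dl F : entire F -> entire (dl F).
Proof.
move=> h r; apply: (@cv_le _ _ (`|r| + 1)); first by have := ler_norm r; lra.
have r0 : 0 < `|r| + 1 by rewrite ltr_wpDl.
have [r' [M [rr b]]] := h (`|r| + 1 + 1).
have r1 : `|r| + 1 < r' by lra. have r'0 : 0 < r' by lra.
exists (`|r| + 1 + 1), (M * (1 - (`|r| + 1 + 1) / r')^-1); split; first by rewrite ltrDl.
set t := `|r| + 1 + 1 in rr *; have t0 : 0 <= t by rewrite /t; lra.
move=> n; rewrite /dl nmM nm_nat.
have x0 : 0 <= t / r' by rewrite divr_ge0 // ltW.
have x1 : t / r' < 1 by rewrite ltr_pdivrMr // mul1r.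
have -> : t ^+ n = (t / r') ^+ n * r' ^+ n by rewrite expr_div_n divfK // expf_neq0 // gt_eqF.
rewrite (_ : n%:R * nm (F n) * _ = (nm (F n) * r' ^+ n) * (n%:R * (t / r') ^+ n)); last by ring.
apply: ler_pM; rewrite ?mulr_ge0 ?nm_ge0 ?exprn_ge0 ?(ltW r'0) //.
apply: le_trans (nat_geo n x0 x1); apply: ler_wpM2r; first exact: exprn_ge0.
by rewrite ler_nat.
Qed.

Lemma reg_inv (T : {poly C}) F s : T.[s] != 0 -> pp T * F = 1 -> exists y, reg F s y.
Proof.
move=> T0 E; exists (1 / T.[s]); apply: reg_mulI => //; rewrite E.
have := reg_pp 1 s; by rewrite rmorph1 hornerC.
Qed.

Lemma ps_inv_ex F : F 0%N != 0 -> exists G, F * G = 1.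
Proof.
move=> F0; pose st (s : seq C) := rcons s (- (F 0%N)^-1 * \sum_(k < size s) F (size s - k)%N * s`_k).
pose H := fun n => iter n st [:: (F 0%N)^-1].
have sH n : size (H n) = n.+1 by elim: n => //= n IH; rewrite size_rcons IH.
have nH n m k : (k <= n)%N -> (H (n + m)%N)`_k = (H n)`_k.
  move=> kn; elim: m => [|m IH]; first by rewrite addn0.
  by rewrite addnS /= /st nth_rcons sH ltnS (leq_trans kn (leq_addr _ _)) IH.
pose G : ps C := fun n => (H n)`_n; exists G; apply: psP => -[|n].
  by rewrite psM big_ord_recl big_ord0 addr0 /G /= mulfV.
have GS : G n.+1 = - (F 0%N)^-1 * \sum_(k < n.+1) F (n.+1 - k)%N * G k.
  rewrite /G /= /st nth_rcons sH ltnn eqxx; congr (_ * _); apply: eq_bigr => k _.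
  have kn : (k <= n)%N by rewrite -ltnS.
  by have := nH k (n - k)%N k (leqnn k); rewrite subnKC // => ->.
rewrite mulrC psM ps1 big_ord_recr /= subnn GS mulrAC mulNr mulVf // mulN1r.
apply/eqP; rewrite subr_eq0; apply/eqP; apply: eq_bigr => k _; exact: mulrC.
Qed.

(** [F] is bounded below by some [d] on the disc, by compactness. Long truncations are then at least
    d/2 there, and Cauchy's estimate bounds the coefficients of their inverses by 2/d. *)
Lemma zero_free_inv F r : 0 < r -> cv F r -> (forall s, nm s <= r -> ev F s != 0) ->
  exists G K, F * G = 1 /\ bnd G r K.
Proof.
move=> r0 cF nz; have F0 : F 0%N != 0 by rewrite -ev0; apply: nz; rewrite nm0 ltW.
have [G FG] := ps_inv_ex F0; exists G.
have [r' [M [rr b]]] := cF; have r'0 : 0 < r' by lra.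
have [d [d0 Hd]] : exists d, 0 < d /\ forall s, nm s <= r -> d <= nm (ev F s).
  apply: contrapT => Hno.
  have rec n : exists s, nm s <= r /\ nm (ev F s) < 2^-1 ^+ n.
    apply: contrapT => H; apply: Hno; exists (2^-1 ^+ n); split; first by rewrite exprn_gt0 // invr_gt0.
    by move=> s hs; rewrite leNgt; apply/negP => h; apply: H; exists s.
  have [s Hs] := boolp.choice rec; have [U [UU UO]] := ultra_ex; have FU := @ultra_proper _ _ UU.
  have [|l Hl] := @ulim_ex _ U UU s r; first by apply: filterE => n /=; exact: (Hs n).1.
  have lr : nm l <= r by apply: flim_le Hl _; apply: filterE => n /=; exact: (Hs n).1.
  have /eqP : ev F l != 0 by exact: nz.
  apply; apply: (flim_unique FU (ev_cont FU r'0 b (le_lt_trans lr rr) Hl)).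
  apply: (@flim0_le _ U _ (fun n => 2^-1 ^+ n)).
    move=> e e0; apply: UO; apply/ooP; apply: expr_small => //; first by rewrite invr_ge0.
    by rewrite invf_lt1 // ltr1n.
  by apply: filterE => n /=; exact: ltW (Hs n).2.
have M0 := bnd_ge0 b; pose x := r / r'; have x0 : 0 <= x by rewrite divr_ge0 // ltW.
have x1 : x < 1 by rewrite ltr_pdivrMr // mul1r.
have e0 : 0 < d / 2 * (1 - x) / (M + 1) by apply: divr_gt0; [apply: mulr_gt0; [exact: divr_gt0 | lra] | lra].
have [N HN] := expr_small x0 x1 e0.
have low n s : (N <= n)%N -> nm s <= r -> d / 2 <= nm (trunc n F).[s].
  move=> Nn hs; rewrite -psum_horner; have h1 := Hd s hs; have h2 := ev_tail n (le_lt_trans hs rr) b.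
  have h3 : M * (nm s / r') ^+ n * (1 - nm s / r')^-1 <= d / 2.
    have sx : nm s / r' <= x by rewrite ler_pM2r ?invr_gt0.
    have s0 : 0 <= nm s / r' by rewrite divr_ge0 ?nm_ge0 // ltW.
    rewrite ler_pdivrMr; last by lra.
    have h4 := HN n Nn; rewrite ltr_pdivlMr in h4; last by lra.
    apply: le_trans (_ : x ^+ n * (M + 1) <= _); last by apply: le_trans (ltW h4) _; apply: ler_wpM2l;
      [rewrite divr_ge0 // ltW | lra].
    rewrite mulrC; apply: ler_pM; rewrite ?exprn_ge0 //; last by lra.
    by apply: lerXn2r; rewrite ?nnegrE.
  have := nm_sub_ge (ev F s) (ev F s - psum F s n); rewrite subKr => h5; lra.
(* The coefficient of index [n] of the inverse depends only on the coefficients of [F] up to [n],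
   which this truncation keeps. *)
exists (2 / d); split=> // n; pose T := trunc (N + n.+1) F.
have T0 : T.[0] != 0.
  rewrite -nm_gt0; apply: lt_le_trans (low _ 0 (leq_addr _ _) _); first by rewrite divr_gt0.
  by rewrite nm0 ltW.
have [H TH] : exists H, pp T * H = 1.
  by apply: ps_inv_ex; rewrite /pp -horner_coef0.
have -> : G n = H n.
  have E : G - H = (pp T - F) * (G * H) by rewrite mulrBl mulrCA TH mulrA FG mulr1 mul1r.
  apply/eqP; rewrite -subr_eq0 -psB E psM big1 // => k _.
  have kn : (k < N + n.+1)%N by apply: leq_trans (ltn_ord k) (leq_addl _ _).
  by rewrite psB /pp coef_poly kn subrr mul0r.
have Tn s : nm s <= r -> T.[s] != 0.
  by move=> hs; rewrite -nm_gt0; apply: lt_le_trans (low _ s (leq_addr _ _) hs); rewrite divr_gt0.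
have cH : cv H r.
  apply: (cv_divide (T := T)) => //; first exact: ltW.
    by rewrite TH; exact: cv_1.
  by move=> s hs; apply: reg_inv TH; exact: Tn.
apply: cauchy_ev => // s hs.
have : T.[s] * ev H s = 1.
  by rewrite -(ev_pp T) -evM ?TH ?hs //; [rewrite -(rmorph1 (@pp C)) ev_pp hornerC | exact: cv_pp].
move=> /(congr1 (@nm R)); rewrite nmM nm1 => E.
have h := low (N + n.+1)%N s (leq_addr _ _) (eq_ind_r (fun v => v <= r) (lexx r) hs).
have : d / 2 * nm (ev H s) <= 1 by apply: le_trans (ler_wpM2r (nm_ge0 _) h) _; rewrite E.
by rewrite ler_pdivlMr // => h'; rewrite mulrC -[leLHS]mulrC; move: h'; set y := nm _; lra.
Qed.

(* Each zero in the small disc makes the cofactor smaller on a large circle, while its value at 0 is fixed; so there are finitely many. *)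
Lemma entire_factor F r : entire F -> F != 0 -> 0 < r -> exists v (D : {poly C}) G w K,
  [/\ D`_0 != 0, F = psX C ^+ v * (pp D * G), G * w = 1 & bnd w r K].
Proof.
move=> eF F0 r0; have [v [Fv Hv]] := ps_neq0P F0; have FE := ps_shift Hv.
set E : ps C := fun n => F (n + v)%N in FE.
have eE : entire E.
  move=> t; apply: (@cv_le _ _ (`|t| + 1)); first by have := ler_norm t; lra.
  have [t' [M [tt b]]] := eF (`|t| + 1); exists t', (M / t' ^+ v); split=> // n.
  have t'0 : 0 < t' by have := normr_ge0 t; lra.
  by rewrite /E ler_pdivlMr ?exprn_gt0 // -mulrA -exprD; exact: b.
have E0 : E 0%N != 0 by rewrite /E add0n.
(* [k] counts the zeros divided out. On the circle of radius 3r a factor 1 - y/s with |s| <= r has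
   modulus at least 2, hence the power 2^k. *)
pose Q k := exists (D : {poly C}) G, [/\ D`_0 != 0, E = pp D * G, entire G &
   G 0%N = E 0%N /\ forall B, (forall s, nm s = 3 * r -> nm (ev E s) <= B) -> forall s, nm s = 3 * r ->
     nm (ev G s) * 2 ^+ k <= B].
have Q0 : Q 0%N.
  exists 1, E; rewrite rmorph1 mul1r coef1 oner_eq0; split=> //; split=> // B HB s hs.
  by rewrite expr0 mulr1; exact: HB.
have [k nQ] : exists k, ~ Q k.
  have r3 : 0 < 3 * r by rewrite mulr_gt0.
  have r3' : 0 < 3 * r + 1 by lra.
  have [r' [M [rr b]]] := eE (3 * r); pose B := M * (1 - 3 * r / r')^-1.
  have HB s : nm s = 3 * r -> nm (ev E s) <= B.
    by move=> hs; rewrite /B -hs; apply: ev_bound => //; rewrite hs.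
  have [k Hk] : exists k, B / nm (E 0%N) < 2 ^+ k.
    have h12 : (1 : R) < 2 by rewrite ltr1n.
    by have [k Hk] := expr_big (B / nm (E 0%N)) h12; exists k; exact: Hk.
  exists k => -[D [G [D0 EG eG [G0 HG]]]].
  have h1 s : nm s = 3 * r -> nm (ev G s) <= B / 2 ^+ k.
    by move=> hs; rewrite ler_pdivlMr ?exprn_gt0 //; exact: HG.
  have := cauchy_ev 0 r3 (eG _) h1; rewrite expr0 mulr1 G0 ler_pdivlMr ?exprn_gt0 // leNgt.
  by rewrite mulrC -ltr_pdivrMr ?nm_gt0 // Hk.
have [j [Qj nQj]] : exists j, Q j /\ ~ Q j.+1.
  elim: k nQ => [|k IH] nQ //; case: (pselect (Q k)) => [Qk|/IH //]; by exists k.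
have [D [G [D0 EG eG [G0 HG]]]] := Qj.
have nz s : nm s <= r -> ev G s != 0.
  move=> hs; apply/eqP => Gs; apply: nQj.
  have s0 : s != 0 by apply: contraNneq E0 => s0; move: Gs; rewrite s0 ev0 G0 => ->.
  have sp : 0 < nm s by rewrite nm_gt0.
  have [G' GE] : exists G', G = pp (1 - s^-1 *: 'X) * G' /\ entire G'.
    have [t [M [st b]]] := eG (nm s); have [G' [M' [b' GE]]] := ev_div s0 st b Gs.
    exists G'; split=> // t1.
    have [t2 [M2 [st2 b2]]] := eG (`|t1| + nm s).
    have st2' : nm s < t2 by apply: le_lt_trans st2; rewrite lerDr.
    have [G2 [M3 [b3 GE2]]] := ev_div s0 st2' b2 Gs.
    have -> : G' = G2.
      have L0 : pp (1 - s^-1 *: 'X : {poly C}) != 0 by rewrite pp_eq0 lin_neq0.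
      by apply: (mulfI L0); rewrite -GE -GE2.
    by exists t2, M3; split=> //; apply: le_lt_trans st2; have := ler_norm t1; lra.
  case: GE => GE eG'; exists (D * (1 - s^-1 *: 'X)), G'; split=> //.
  - by rewrite -horner_coef0 hornerM mulf_neq0 ?horner_coef0 // -horner_coef0 !hornerE subr0 oner_neq0.
  - by rewrite rmorphM /= -mulrA -GE.
  - split; first by rewrite -G0 -!ev0 GE evM ?ev_pp ?hornerE ?mulr0 ?subr0 ?mul1r //; exact: cv_pp.
    move=> B HB y hy; have h := HG B HB y hy; apply: le_trans h.
    have -> : ev G y = (1 - s^-1 * y) * ev G' y.
      by rewrite GE evM ?ev_pp ?hornerE //; exact: cv_pp.
    rewrite exprS mulrA nmM; apply: ler_wpM2r; first by rewrite exprn_ge0.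
    rewrite mulrC; apply: ler_wpM2r; first exact: nm_ge0.
    have h3 : 3 <= nm (s^-1 * y) by rewrite nmM nmV hy ler_pdivlMl // mulrC; apply: ler_wpM2l.
    by have := nm_sub_ge (s^-1 * y) 1; rewrite nm1 nm_sym; lra.
have [w [K [Gw bw]]] := zero_free_inv r0 (eG r) nz.
by exists v, D, G, w, K; split=> //; rewrite -EG.
Qed.
End Entire.

(** * Rational or entire: algebraic series with base on the unit circle *)

Section UnitEntire.
Variable R : realType.
Local Notation C := R[i].
Implicit Types (f g F G : ps C) (z s : C) (r : R).

Lemma argmax (b : nat -> R) n : exists m, (m <= n)%N /\ forall l, (l <= n)%N -> b l <= b m.
Proof.
elim: n => [|n [m [mn Hm]]]; first by exists 0%N; split=> // l; rewrite leqn0 => /eqP ->.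
have [h|h] := leP (b n.+1) (b m).
  by exists m; split; [exact: leqW | move=> l; rewrite leq_eqVlt => /orP[/eqP ->|] //; exact: Hm].
exists n.+1; split=> // l; rewrite leq_eqVlt => /orP[/eqP ->|hl] //.
by apply: le_trans (Hm l hl) _; exact: ltW.
Qed.

(** Without such indices, [b] would gain a factor [2 * ka ^+ v] within every [v] steps and outgrow
    [M * ka ^+ n]. *)
Lemma records (b : nat -> R) (M ka : R) v : 1 <= ka -> (forall n, 0 <= b n) -> (forall n, b n <= M * ka ^+ n) ->
  (forall B, exists n, B < b n) ->
  exists C0, 1 <= C0 /\ forall n0, exists n, [/\ (n0 <= n)%N, 0 < b n & forall l, (l <= n + v)%N ->
    b l <= C0 * b n].
Proof.
move=> k1 b0 bM unb; have k0 : 0 < ka by exact: lt_le_trans k1.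
pose D := 2 * ka ^+ v; have kv1 : 1 <= ka ^+ v by exact: exprn_ege1.
have D1 : 1 <= D by rewrite /D; lra.
exists D; split=> // n0; apply: contrapT => Hno.
have M0 : 0 <= M by have := le_trans (b0 0%N) (bM 0%N); rewrite expr0 mulr1.
have [N1 [n1 bp rec1]] : exists N1, [/\ (n0 <= N1)%N, 0 < b N1 & forall l, (l <= N1)%N -> b l <= b N1].
  have [m0 [_ H0]] := argmax b n0; have [n Hn] := unb (b m0).
  have [m [mn Hm]] := argmax b n; have h : b m0 < b m by apply: lt_le_trans Hn _; exact: Hm.
  exists m; split; last by move=> l lm; apply: Hm; exact: leq_trans mn.
    by rewrite leqNgt; apply/negP => h2; have := H0 m (ltnW h2); rewrite leNgt h.
  by apply: le_lt_trans h.
have step k : exists n, [/\ (N1 <= n)%N, (n <= N1 + v * k)%N, D ^+ k * b N1 <= b n & forall l, (l <= n)%N ->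
  b l <= b n].
  elim: k => [|k [n [h1 h2 h3 h4]]]; first by exists N1; rewrite muln0 addn0 expr0 mul1r.
  have bn : 0 < b n by apply: lt_le_trans h3; rewrite mulr_gt0 // exprn_gt0 // (lt_le_trans ltr01 D1).
  have [l [ln lD]] : exists l, (l <= n + v)%N /\ D * b n < b l.
    apply: contrapT => H; apply: Hno; exists n; split=> //; first exact: leq_trans h1.
    by move=> l ln; rewrite leNgt; apply/negP => h; apply: H; exists l.
  have [m [mn Hm]] := argmax b (n + v); have hm : D * b n < b m by apply: lt_le_trans lD _; exact: Hm.
  exists m; split.
  - apply: leq_trans h1 _; rewrite leqNgt; apply/negP => h; have := h4 m (ltnW h).
    by rewrite leNgt; apply/negP; rewrite negbK; apply: le_lt_trans hm; rewrite ler_peMl // ltW.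
  - by apply: leq_trans mn _; rewrite mulnS [(v + _)%N]addnC addnA leq_add2r.
  - by rewrite exprS -mulrA; apply: le_trans (ltW hm); apply: ler_wpM2l => //; exact: le_trans ler01 D1.
  - by move=> i lm; apply: Hm; exact: leq_trans mn.
have h12 : (1 : R) < 2 by rewrite ltr1n.
have [k Hk] := expr_big (M * ka ^+ N1 / b N1) h12.
have [n [_ h2 h3 _]] := step k; have := Hk k (leqnn k); rewrite ltr_pdivrMr // ltNge => /negP; apply.
have kk : 0 < ka ^+ (v * k) by rewrite exprn_gt0.
rewrite -(ler_pM2r kk); apply: le_trans (_ : D ^+ k * b N1 <= _).
  by rewrite /D exprMn -exprM; rewrite le_eqVlt; apply/orP; left; apply/eqP; ring.
apply: le_trans h3 _; apply: le_trans (bM n) _; rewrite -mulrA -exprD; apply: ler_wpM2l => //.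
exact: ler_weXn2l.
Qed.

Lemma not_mem_large (rs : seq C) (z q : C) : z != 0 -> q != 0 -> (forall m, q ^+ m.+1 != 1) ->
  exists S0, forall s : nat, (S0 <= s)%N -> z / q ^+ s \notin rs.
Proof.
move=> z0 q0 ur; elim: rs => [|y rs [S0 H]]; first by exists 0%N.
case: (pselect (exists s : nat, z / q ^+ s = y)) => [[s Es]|Hn]; last first.
  exists S0 => s hs; rewrite inE negb_or H // andbT; apply/eqP => E; apply: Hn; by exists s.
exists (maxn S0 s.+1) => t; rewrite geq_max => /andP[h1 h2]; rewrite inE negb_or H // andbT.
apply/eqP => E; have [j Ej] : exists j, t = (s + j.+1)%N by exists (t - s.+1)%N; move: h2; clear; lia.
move: E; rewrite -Es Ej exprD invfM mulrA =>
  /eqP; rewrite -[X in _ == X]mulr1 (inj_eq (mulfI _)) ?mulf_neq0 ?invr_eq0 ?expf_neq0 //.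
by rewrite -invr1 (inj_eq invr_inj) (negbTE (ur j)).
Qed.

Lemma coef_sum_bound (c : ps C) (t : R) : 0 <= t -> cv c t ->
  exists S, 0 <= S /\ forall m, \sum_(i < m) nm (c i) * t ^+ i <= S.
Proof.
move=> t0 [r [M [tr b]]]; have r0 : 0 < r by lra. have M0 := bnd_ge0 b.
have x0 : 0 <= t / r by rewrite divr_ge0 // ltW.
have x1 : t / r < 1 by rewrite ltr_pdivrMr // mul1r.
exists (M * (1 - t / r)^-1); split; first by rewrite mulr_ge0 // invr_ge0 subr_ge0 ltW.
move=> m; apply: le_trans (ler_wpM2l M0 (geo_sum_le m x0 x1)); rewrite mulr_sumr; apply: ler_sum => i _.
have -> : t ^+ i = r ^+ i * (t / r) ^+ i by rewrite expr_div_n mulrCA mulfV ?mulr1 // expf_neq0 // gt_eqF.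
by rewrite mulrA; apply: ler_wpM2r; [exact: exprn_ge0 | exact: b].
Qed.

Lemma ode_term (c g : ps C) (t C0 S : R) k n m j : 1 <= t -> 0 <= C0 ->
  (forall m, \sum_(i < m) nm (c i) * t ^+ i <= S) ->
  (forall l, (l <= m)%N -> nm (g l) * t ^+ l <= C0 * (nm (g n) * t ^+ n)) -> (n <= m + j)%N ->
  nm ((c * iter k (@dl C) g) m) <= m%:R ^+ k * C0 * nm (g n) * t ^+ j * S.
Proof.
move=> t1 C00 HS Hg nm_; have t0 : 0 < t by exact: lt_le_trans t1.
rewrite psM; apply: le_trans (nm_sum _ _ _) _.
apply: le_trans (_ : \sum_(i < m.+1) m%:R ^+ k * C0 * nm (g n) * t ^+ j * (nm (c i) * t ^+ i) <= _); last first.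
  by rewrite -mulr_sumr; apply: ler_wpM2l; [rewrite !mulr_ge0 ?exprn_ge0 ?nm_ge0 ?ler0n // ltW | exact: HS].
apply: ler_sum => i _; rewrite nmM dl_iter nmM nmX nm_nat.
have im : (i <= m)%N by rewrite -ltnS.
have h1 : nm (g (m - i)%N) <= C0 * nm (g n) * t ^+ j * t ^+ i.
  have tm : 0 < t ^+ (m - i) by rewrite exprn_gt0.
  rewrite -(ler_pM2r tm); apply: le_trans (Hg _ (leq_subr _ _)) _.
  rewrite mulrA -!mulrA; apply: ler_wpM2l => //; apply: ler_wpM2l; first exact: nm_ge0.
  by rewrite -!exprD subnKC //; apply: ler_weXn2l => //; move: nm_; clear; lia.
have h2 : (m - i)%:R ^+ k <= m%:R ^+ k :> R by apply: lerXn2r; rewrite ?nnegrE ?ler0n // ler_nat leq_subr.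
rewrite (_ : m%:R ^+ k * C0 * nm (g n) * t ^+ j * (nm (c i) * t ^+ i) = nm (c i) * (m%:R ^+ k * (C0 * nm (g n)
  * t ^+ j * t ^+ i))); last by ring.
apply: ler_wpM2l; first exact: nm_ge0.
by apply: ler_pM; rewrite ?exprn_ge0 ?nm_ge0 ?ler0n.
Qed.

Lemma flim_horner (U : set (set nat)) (P : {poly C}) (u : nat -> C) l : ProperFilter U -> flim U u l ->
  flim U (fun n => P.[u n]) P.[l].
Proof.
move=> FU ul; rewrite (_ : (fun n => P.[u n]) = (fun n => \sum_(i < size P) P`_i * u n ^+ i));
  last by apply/funext => n; exact: horner_coef.
rewrite horner_coef; apply: flim_sum => i; apply: flimM; [exact: flim_cst | exact: flimX].
Qed.

Lemma tends_shift_ratio (s : nat) : tends (fun n => (n - s)%:R / n%:R : C) 1.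
Proof.
apply/tendsP => e e0; have [N HN] := natr_big (s%:R / e); exists (N + s + 1)%N => n hn.
have n0 : 0 < n%:R :> R by rewrite ltr0n; move: hn; clear; lia.
have sn : (s <= n)%N by move: hn; clear; lia.
have nC : n%:R != 0 :> C by rewrite -nm_gt0 nm_nat.
have -> : (n - s)%:R / n%:R - 1 = - (s%:R / n%:R) :> C by rewrite natrB // mulrBl mulfV // addrC addKr.
rewrite nmN nmM nmV !nm_nat ltr_pdivrMr // mulrC -ltr_pdivrMr //; apply: HN.
by move: hn; clear; lia.
Qed.

Lemma entire_maj F : entire F -> maj (fun=> 1 : R) F.
Proof.
move=> eF; have [r [M [r1 b]]] := eF 1; apply: (@bound_maj _ (fun=> 1) (fun=> lexx _) _ 1 M) => // n.
rewrite expr1n !mulr1; by apply: le_trans (b n); rewrite ler_peMr ?nm_ge0 // exprn_ege1 // ltW.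
Qed.

(* A function algebraic over the entire functions satisfies a linear differential equation with entire coefficients;
   reading it at the indices [n] where [|g_n| t^n] is a record leaves, in the limit, a linear recurrence with
   constant coefficients, which the hypergeometric recurrence turns into a polynomial multiple of [g] being a polynomial. *)
Lemma unit_rational_or_entire q A B g (p : {poly ps C}) : hyp q A B g -> nm q = 1 ->
  (forall m, q ^+ m.+1 != 1) ->
  (forall i, entire p`_i) -> p.[g] = 0 -> p^`().[g] != 0 -> fps_rational g \/ entire g.
Proof.
move=> Hg q1 ur Ep pg pg'; case: (pselect (entire g)) => [|ne]; [by right|left].
have g0 := hyp_neq0 Hg; have [q0 _ _ _ _] := Hg.
have [d [e [ee ed0 EO]]] := ode (@entire1 R) (@entireB R) (@entireM R) (@entire_dl R) Ep pg pg'.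
have [r0 nr] : exists r, ~ cv g r.
  by apply: contrapT => H; apply: ne => r; apply: contrapT => h; apply: H; exists r.
pose t := `|r0| + 1; have t1 : 1 <= t by rewrite /t lerDr.
have t0 : 0 < t by exact: lt_le_trans t1. have t10 : 0 < t + 1 by lra.
have [v [D [G [w [K [D0 eE Gw bw]]]]]] := entire_factor (ee d) ed0 t10.
(* Multiplication by [w] cancels the zero-free factor, so that the top coefficient becomes x^v times
   a polynomial; the other coefficients still converge at radius [t]. *)
pose c k := w * e k; have cc k : cv (c k) t.
  by apply: cvM; [exact: ltW | exists (t + 1), K; split=> //; rewrite ltrDl | exact: ee].
have EO' : \sum_(k < d.+1) c k * iter k (@dl C) g = 0.
  transitivity (w * \sum_(k < d.+1) e k * iter k (@dl C) g); last by rewrite EO mulr0.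
  by rewrite mulr_sumr; apply: eq_bigr => k _; rewrite mulrA.
have cd : c d = psX C ^+ v * pp D.
  by rewrite /c eE [pp D * G]mulrC [w * _]mulrC -mulrA; congr (_ * _); rewrite mulrAC Gw mul1r.
have [S HS] := boolp.choice (fun k => coef_sum_bound (ltW t0) (cc k)).
have [Kg [Mg [Kg1 Hgm]]] := maj_bound (fun=> lexx _) (hensel (w := fun=> 1 : R) (c := 1)
  (fun=> lexx _) (fun=> lexx _) (fun _ _ => eq_ind_r (fun x => x <= 1) (lexx 1) (mulr1 1)) (lexx _)
  (fun n => eq_ind_r (fun x => 1 <= x) (lexx 1) (eq_trans (mulr1 _) (expr1n _ _))) (fun i =>
    entire_maj (Ep i)) pg pg').
pose b l := nm (g l) * t ^+ l.
have b0 n : 0 <= b n by rewrite mulr_ge0 ?nm_ge0 // exprn_ge0 // ltW.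
have Kt : 1 <= Kg * t by apply: mulr_ege1.
have bM n : b n <= Mg * (Kg * t) ^+ n.
  by rewrite exprMn mulrA; apply: ler_wpM2r; [rewrite exprn_ge0 // ltW | have := Hgm n; rewrite mulr1].
have unb Bd : exists n, Bd < b n.
  apply: contrapT => H; apply: nr; exists t, Bd; split; first by have := ler_norm r0; rewrite /t; lra.
  by move=> n; rewrite leNgt; apply/negP => h; apply: H; exists n.
have [C0 [C01 HC]] := records v Kt b0 bM unb; have C00 := le_trans ler01 C01.
have [nn Hnn] := boolp.choice HC.
have [U [UU UO]] := ultra_ex; have FU := @ultra_proper _ _ UU.
have nnge k : (k <= nn k)%N by case: (Hnn k).
have big (s : nat) : U [set k | (s <= nn k)%N] by apply: UO; apply/ooP; exists s => k hk;
  exact: leq_trans hk (nnge k).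
have gn k : g (nn k) != 0 by [].
have recA (s : nat) : exists a, flim U (fun k => g (nn k - s)%N / g (nn k)) a.
  apply: (@ulim_ex _ U UU _ (C0 * t ^+ s)); apply: filterS (big s) => k /= sk.
  have [_ _ h] := Hnn k; have := h (nn k - s)%N (leq_trans (leq_subr _ _) (leq_addr _ _)); rewrite /b => h1.
  have tk : 0 < t ^+ (nn k - s) by rewrite exprn_gt0.
  rewrite nmM nmV ler_pdivrMr ?nm_gt0 // -(ler_pM2r tk); apply: le_trans h1 _.
  by rewrite -{2}(subnK sk) exprD le_eqVlt; apply/orP; left; apply/eqP; ring.
have [a Ha] := boolp.choice recA.
have a00 : a 0%N = 1.
  by apply: (flim_unique FU (Ha 0%N)); apply: flim_near (flim_cst 1 FU) _; apply: filterE => k /=;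
    rewrite subn0 divff.
have [|z Hz] := @ulim_ex _ U UU (fun k => q ^+ nn k) 1; first by apply: filterE => k /=; rewrite nmX q1 expr1n.
have z0 : z != 0.
  by rewrite -nm_gt0; apply: lt_le_trans ltr01 _; apply: flim_ge Hz _; apply: filterE => k /=;
    rewrite nmX q1 expr1n.
(* The top derivative carries n^d and the lower ones at most n^(d-1); after division by n^d g_n only
   the polynomial [D] is left in the limit. *)
have rel j : \sum_(i < size D) D`_i * a (j + i)%N = 0.
  pose u k := \sum_(i < size D) D`_i * (((nn k - (j + i))%:R / (nn k)%:R) ^+ d * (g (nn k - (j + i))%N / g (nn
    k))).
  have lim1 : flim U u (\sum_(i < size D) D`_i * (1 ^+ d * a (j + i)%N)).
    apply: flim_sum => i; apply: flimM; first exact: flim_cst.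
    apply: flimM; last exact: Ha.
    apply: flimX; move=> x x0; apply: UO; exact: (@tends_sub _ _ _ nn nnge (tends_shift_ratio (j + i)%N)).
  have -> : \sum_(i < size D) D`_i * a (j + i)%N = \sum_(i < size D) D`_i * (1 ^+ d * a (j + i)%N).
    by apply: eq_bigr => i _; rewrite expr1n mul1r.
  apply: (flim_unique FU lim1).
  pose Cst := (1 + v)%:R ^+ d * C0 * t ^+ j * \sum_(k < d) S k.
  have Cst0 : 0 <= Cst.
    by rewrite !mulr_ge0 ?exprn_ge0 ?ler0n ?(ltW t0) // sumr_ge0 // => i _; case: (HS i).
  apply: (@flim0_le _ U _ (fun k => Cst / (nn k)%:R)).
    move=> x x0; apply: UO; apply/ooP; have [N HN] := natr_big (Cst / x); exists N.+1 => k hk.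
    have hn : (N.+1 <= nn k)%N by exact: leq_trans hk (nnge k).
    rewrite ltr_pdivrMr ?ltr0n; last by exact: leq_trans hn.
    by rewrite mulrC -ltr_pdivrMr //; apply: HN; exact: ltnW.
  apply: filterS (big (j + size D + 1)%N) => k /= hk; set n := nn k in hk *.
  have n0 : (0 < n)%N by move: hk; clear; lia.
  have nR : 0 < n%:R :> R by rewrite ltr0n.
  have nC : n%:R != 0 :> C by rewrite -nm_gt0 nm_nat.
  have gk : g n != 0 by [].
  pose m := (n - j + v)%N.
  have E1 : u k * (n%:R ^+ d * g n) = (c d * iter d (@dl C) g) m.
    have mv : (m - v)%N = (n - j)%N by rewrite /m addnK.
    have vm : (v <= m)%N by exact: leq_addl.
    have sz x y o : (y + x + 1 <= o)%N -> (x <= (o - y).+1)%N by clear; lia.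
    rewrite cd -mulrA psXnM ltnNge vm /= mv psM_poly; last exact: sz hk.
    rewrite /u mulr_suml; apply: eq_bigr => i _; rewrite dl_iter -subnDA -/n expr_div_n.
    have nd : n%:R ^+ d != 0 :> C by rewrite expf_neq0.
    by move: nd; set x1 := n%:R ^+ d; set x2 := _%:R ^+ d => nd; field; rewrite nd gk.
  have E2 : (c d * iter d (@dl C) g) m = - \sum_(k < d) (c k * iter k (@dl C) g) m.
    apply/eqP; rewrite -addr_eq0 addrC; have := congr1 (fun F : ps C => F m) EO';
      rewrite ps_sum big_ord_recr /= ps0 => ->; exact: eqxx.
  have mn : (m <= n + v)%N by rewrite /m leq_add2r leq_subr.
  have nm_ : (n <= m + j)%N by rewrite /m; move: hk; clear; lia.
  have E3 : nm (u k) * (n%:R ^+ d * nm (g n)) * n%:R <= Cst * (n%:R ^+ d * nm (g n)).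
    have -> : nm (u k) * (n%:R ^+ d * nm (g n)) = nm (u k * (n%:R ^+ d * g n)) by rewrite !nmM nmX nm_nat.
    rewrite E1 E2 nmN; apply: le_trans (ler_wpM2r (ltW nR) (nm_sum _ _ _)) _.
    rewrite /Cst mulr_suml mulr_sumr mulr_suml; apply: ler_sum => i _.
    have [S0 HSi] := HS i; have [_ _ hn] := Hnn k.
    have := ode_term i t1 C00 HSi (fun l lm => hn l (leq_trans lm mn)) nm_; rewrite -/n => h.
    apply: le_trans (ler_wpM2r (ltW nR) h) _.
    have h2 : m%:R ^+ i * n%:R <= (1 + v)%:R ^+ d * n%:R ^+ d :> R.
      apply: le_trans (_ : ((1 + v)%:R * n%:R) ^+ i * n%:R <= _).
        apply: ler_wpM2r; first exact: ltW. apply: lerXn2r; rewrite ?nnegrE ?mulr_ge0 ?ler0n //.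
        by rewrite -natrM ler_nat; apply: leq_trans mn _; rewrite mulnDl mul1n leq_add2l leq_pmulr.
      rewrite exprMn -mulrA -exprSr; apply: ler_pM; rewrite ?exprn_ge0 ?ler0n //.
        by apply: ler_weXn2l; [rewrite ler1n | exact: ltnW].
      by apply: ler_weXn2l; [rewrite ler1n | exact: ltn_ord].
    rewrite (_ : _ * S i * n%:R = (m%:R ^+ i * n%:R) * (C0 * nm (g n) * t ^+ j * S i)); last by ring.
    rewrite (_ : _ * S i * _ = ((1 + v)%:R ^+ d * n%:R ^+ d) * (C0 * nm (g n) * t ^+ j * S i)); last by ring.
    by apply: ler_wpM2r => //; rewrite !mulr_ge0 ?exprn_ge0 ?nm_ge0 // ltW.
  have gd : 0 < n%:R ^+ d * nm (g n) by rewrite mulr_gt0 ?exprn_gt0 // nm_gt0.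
  by rewrite ler_pdivlMr // -(ler_pM2r gd) mulrAC.
pose V := test_poly q A B D.
(* The limit form of [test_polyE], with z / q^(s + size D) in place of q^m. *)
have VE (s : nat) : a (s + size D)%N * V.[z / q ^+ (s + size D)] = 0.
  have L1 : flim U (fun k => \sum_(i < size D) D`_i * (g (nn k - (s + i))%N / g (nn k)) * \prod_(l < size D)
    B.[q ^+ nn k / q ^+ (s + size D - l)]) 0.
    set uu := (fun k => _); suff : flim U uu ((\sum_(i < size D) D`_i * a (s + i)%N) * \prod_(l < size D) B.[z
      / q ^+ (s + size D - l)]) by rewrite rel mul0r.
    rewrite /uu mulr_suml; apply: flim_sum => i; apply: flimM; first by apply: flimM;
      [exact: flim_cst | exact: Ha].
    apply: flim_prod => l; exact: flim_horner FU (flimM FU Hz (flim_cst _ FU)).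
  apply: (flim_unique FU _ L1).
  have L2 : flim U (fun k => g (nn k - (s + size D))%N / g (nn k) * V.[q ^+ nn k / q ^+ (s + size D)]) (a (s +
    size D)%N * V.[z / q ^+ (s + size D)]).
    by apply: flimM; [exact: Ha | exact: flim_horner FU (flimM FU Hz (flim_cst _ FU))].
  apply: flim_near L2 _; apply: filterS (big (s + size D)%N) => k /= hk.
  have [m Em] : exists m, nn k = (m + (s + size D))%N by exists (nn k - (s + size D))%N; rewrite subnK.
  have qn0 x : q ^+ x != 0 by rewrite expf_neq0.
  have := test_polyE D m Hg; rewrite /= psM_poly; last by move: (size D); clear; lia.
  rewrite -/V Em addnK [q ^+ (m + _)]exprD mulfK // => E.
  rewrite mulrAC -E mulrAC mulr_suml mulr_suml; apply: eq_bigr => i _.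
  rewrite (_ : (m + size D - i)%N = (m + (s + size D) - (s + i))%N); last by move: (ltn_ord i); clear; lia.
  congr (_ * _); first by rewrite mulrA.
  apply: eq_bigr => l _; congr (B.[_]).
  have ls : (l <= s + size D)%N by apply: leq_trans (ltnW (ltn_ord l)) (leq_addl _ _).
  by rewrite -{1}(subnKC ls) [q ^+ (l + _)]exprD mulrA mulfK // exprD.
(* A nonzero [V] has finitely many roots, so [a s] vanishes for large [s]. As [D] has a nonzero
   constant term, [rel] carries this down to [a 0], which is 1. *)
have V0 : V = 0.
  apply/eqP/negPn/negP => V0; have [rs Vrs] := closed_field_poly_normal V.
  have [S0 HS0] := not_mem_large rs z0 q0 ur.
  have az (s : nat) : (S0 + size D <= s)%N -> a s = 0.
    move=> hs; have Es : s = (s - size D + size D)%N by rewrite subnK //; move: hs; clear; lia.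
    have /eqP := VE (s - size D)%N; rewrite -Es mulf_eq0 => /orP[/eqP //|];
      rewrite Vrs hornerZ mulf_eq0 lead_coef_eq0 (negbTE V0) /=.
    rewrite -/(root _ _) root_prod_XsubC (negbTE (HS0 s _)) //; move: hs; clear; lia.
  have D1 : (0 < size D)%N by rewrite size_poly_gt0; apply: contraNneq D0 => ->; rewrite coef0.
  have back k : forall s : nat, (S0 + size D <= s + k)%N -> a s = 0.
    elim: k => [|k IH] s hs; first by apply: az; rewrite addn0 in hs.
    have := rel s; rewrite -(prednK D1) big_ord_recl addn0 big1 ?addr0.
      by move/eqP; rewrite mulf_eq0 (negbTE D0) => /eqP.
    by move=> i _; rewrite IH ?mulr0 // lift0; move: hs; clear; lia.
  by have := back (S0 + size D)%N 0%N; rewrite add0n leqnn a00 => /(_ isT) /eqP; rewrite oner_eq0.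
apply: (test_poly0_rational Hg _ V0).
by apply: contraNneq D0 => ->; rewrite coef0.
Qed.
End UnitEntire.

(** * The case of a base off the unit circle *)

Section Types.
Variable R : realType.
Local Notation C := R[i].
Implicit Types (f g F G : ps C) (z s : C).

Lemma ev2_swap f g P : ev2 g f (swapXY P) = ev2 f g P.
Proof.
have EC c : ev2 g f (swapXY c%:P) = phi f c.
  rewrite swapXY_polyC phiE ev2E size_map_polyC; apply: eq_bigr => i _.
  by rewrite coef_map /= phiC.
elim/poly_ind: P => [|P c IH]; first by rewrite !rmorph0.
by rewrite !rmorphD !rmorphM /= IH EC ev2C swapXY_X ev2C phiX ev2X.
Qed.

Lemma subr_phi g c : subr (fun u => u = g) (phi g c).
Proof. by rewrite phiE; apply: subr_sum => i; apply: subrM; [exact: subr_pp | apply: subrX; exact: subr_gen].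
  Qed.

Lemma algebraic_algover f g : algebraic f -> algover (fun u => u = g) f.
Proof.
move=> [c c0 E]; exists (size c).-1, (fun k => pp c`_k); split=> [k||].
- exact: subr_pp.
- by rewrite pp_eq0 -lead_coefE lead_coef_eq0.
- by rewrite prednK ?size_poly_gt0 // -phiE.
Qed.

Lemma dep_algover f g P : P != 0 -> ev2 f g P = 0 -> ~ algebraic g -> algover (fun u => u = g) f.
Proof.
move=> P0 E ng; have S0 : swapXY P != 0 by rewrite swapXY_eq0.
exists (size (swapXY P)).-1, (fun k => phi g (swapXY P)`_k); split=> [k||].
- exact: subr_phi.
- apply/eqP => h; apply: ng; exists (swapXY P)`_(size (swapXY P)).-1 => //.
  by rewrite -lead_coefE lead_coef_eq0.
- by rewrite prednK ?size_poly_gt0 // -ev2E ev2_swap.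
Qed.

Lemma algebraic_simple f : algebraic f -> exists c, phi f c = 0 /\ phi f c^`() != 0.
Proof.
move=> [c0 c00 E0]; pose Q m := `[< exists c, [/\ c != 0, phi f c = 0 & (size c <= m)%N] >].
have ex : exists m, Q m by exists (size c0); apply/asboolP; exists c0.
case: (ex_minnP ex) => m /asboolP [c [cn0 Ec sc]] mn; exists c; split=> //.
apply/eqP => E; have D0 : c^`() = 0.
  apply/eqP/negPn/negP => D0; have : Q (size c^`()) by apply/asboolP; exists c^`().
  by move/mn; have := lt_size_deriv cn0; move: sc; clear; lia.
have nat0 n : (n.+1%:R : {poly C}) != 0.
  by rewrite -polyC_natr polyC_eq0 -nm_gt0 nm_nat ltr0n.
have cE := deriv_eq0_const nat0 D0.
by move/eqP: Ec; rewrite cE phiC pp_eq0; apply/negP; apply: contraNneq cn0 => h; rewrite cE h.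
Qed.

Lemma phi_horner f c : phi f c = (map_poly (@pp C) c).[f]. Proof. by []. Qed.

(** Its growth would be polynomial, and Cauchy's estimate would annihilate the coefficients of large
    index. *)
Lemma algebraic_entire f : (forall n, f n != 0) -> entire f -> ~ algebraic f.
Proof.
move=> f0 ef [c c0 E]; have [k [M [r [M0 r1 H]]]] := root_growth c0.
have fk : 0 < nm (f k.+1) by rewrite nm_gt0.
pose r' := r + M / nm (f k.+1) + 1; have Mf : 0 < M / nm (f k.+1) by rewrite divr_gt0.
have r'0 : 0 < r' by rewrite /r'; lra.
have h z : nm z = r' -> nm (ev f z) <= M * r' ^+ k.
  move=> hz; rewrite -hz; apply: H; first by rewrite hz /r'; lra.
  by rewrite -(ev_phi c z ef).2 E -(rmorph0 (@pp C)) ev_pp horner0.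
have := cauchy_ev k.+1 r'0 (ef r') h; rewrite exprS mulrA ler_pM2r ?exprn_gt0 // => h2.
have : r' <= M / nm (f k.+1) by rewrite ler_pdivlMr // mulrC.
by rewrite /r'; lra.
Qed.

Lemma algebraic_bounded f : algebraic f -> exists K M, 1 <= K /\ forall n, nm (f n) <= M * K ^+ n.
Proof.
move=> /algebraic_simple [c [Ec Ec']].
have Ep i : entire (map_poly (@pp C) c)`_i by rewrite coef_map => r; exact: cv_pp.
have pg' : (map_poly (@pp C) c)^`().[f] != 0 by rewrite deriv_map -phi_horner.
have [K [M [K1 H]]] := maj_bound (fun=> lexx _) (hensel (w := fun=> 1 : R) (c := 1)
  (fun=> lexx _) (fun=> lexx _) (fun _ _ => eq_ind_r (fun x => x <= 1) (lexx 1) (mulr1 1)) (lexx _)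
  (fun n => eq_ind_r (fun x => 1 <= x) (lexx 1) (eq_trans (mulr1 _) (expr1n _ _))) (fun i =>
    entire_maj (Ep i)) Ec pg').
by exists K, M; split=> // n; have := H n; rewrite mulr1.
Qed.

Lemma algebraic_unit q A B g : hyp q A B g -> nm q = 1 -> (forall m, q ^+ m.+1 != 1) -> algebraic g ->
  fps_rational g.
Proof.
move=> Hg q1 ur ag; have [c [Ec Ec']] := algebraic_simple ag.
have Ep i : entire (map_poly (@pp C) c)`_i by rewrite coef_map => r; exact: cv_pp.
have pg' : (map_poly (@pp C) c)^`().[g] != 0 by rewrite deriv_map -phi_horner.
case: (unit_rational_or_entire Hg q1 ur Ep Ec pg') => // eg.
by case: (algebraic_entire (hyp_neq0 Hg) eg ag).
Qed.

Definition dtype be f := exists2 c0, c0 != 0 & tends (fun n => f n.+1 / f n * be ^+ n) c0.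

Lemma algebraic_dtype be f : (forall n, f n != 0) -> be != 0 -> nm be < 1 -> dtype be f -> ~ algebraic f.
Proof.
move=> f0 be0 be1 [c0 c00 h] /algebraic_bounded [K [M [K1 HM]]].
have K0 : 0 < K by exact: lt_le_trans K1.
have c0p : 0 < nm c0 by rewrite nm_gt0.
have c2 : 0 < nm c0 / 2 by rewrite divr_gt0.
have [N1 HN1] := tends_nm h c2.
have e0 : 0 < nm c0 / 2 / (2 * K) by rewrite divr_gt0 // mulr_gt0.
have [N2 HN2] := expr_small (nm_ge0 be) be1 e0.
pose N := (N1 + N2)%N.
have step n : (N <= n)%N -> 2 * K * nm (f n) <= nm (f n.+1).
  move=> hn; have h1 : (N1 <= n)%N by move: hn; rewrite /N; clear; lia.
  have h2 : (N2 <= n)%N by move: hn; rewrite /N; clear; lia.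
  have fn : 0 < nm (f n) by rewrite nm_gt0.
  have /andP[h3 _] := HN1 n h1; have h4 := HN2 n h2; rewrite ltr_pdivlMr ?mulr_gt0 // in h4.
  rewrite -ler_pdivlMr // -nmV -nmM.
  have bn : 0 < nm be ^+ n by rewrite exprn_gt0 // nm_gt0.
  rewrite -(ler_pM2r bn); rewrite /= nmM nmX in h3; apply: le_trans (ltW (lt_trans (_ : _ < nm c0 - nm c0 / 2)
    h3)) => //.
  by rewrite mulrC; lra.
have grow j : (2 * K) ^+ j * nm (f N) <= nm (f (N + j)%N).
  elim: j => [|j IH]; first by rewrite expr0 mul1r addn0.
  rewrite addnS; apply: le_trans (step _ (leq_addr _ _)); rewrite exprS -mulrA; apply: ler_wpM2l => //.
  by rewrite mulr_ge0 // ltW.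
have fN : 0 < nm (f N) by rewrite nm_gt0.
have h12 : (1 : R) < 2 by rewrite ltr1n.
have [j Hj] := expr_big (M * K ^+ N / nm (f N)) h12.
have := le_trans (grow j) (HM _); have := Hj j (leqnn j); rewrite ltr_pdivrMr // exprD exprMn => h1 h2.
have Kj : 0 < K ^+ j by rewrite exprn_gt0.
have : 2 ^+ j * nm (f N) <= M * K ^+ N by rewrite -(ler_pM2r Kj) mulrAC -mulrA [K ^+ j * _]mulrC mulrA
  -[leRHS]mulrA; move: h2; rewrite mulrAC.
by rewrite leNgt h1.
Qed.

(* Meromorphic, divergent and entire series. *)
Inductive htype q (A B : {poly C}) f : Prop :=
| TypeM of A`_0 != 0 & B`_0 != 0
| TypeD e of dtype (q ^+ e.+1) f
| TypeE e of etype (q ^+ e.+1) f.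

Lemma hyp_type q A B f : hyp q A B f -> nm q < 1 -> (A`_0 != 0) || (B`_0 != 0) -> htype q A B f.
Proof.
move=> Hf q1 nz; have f0 := hyp_neq0 Hf; have [q0 _ _ AB _] := Hf.
have A0 : A != 0 by apply/eqP => E; have [] := AB 0%N; rewrite E horner0 eqxx.
have B0 : B != 0 by apply/eqP => E; have [_] := AB 0%N; rewrite E horner0 eqxx.
have [a [A' [EA A'0 _]]] := poly_val0 A0; have [b [B' [EB B'0 _]]] := poly_val0 B0.
have tq : tends (fun n => q ^+ n) 0 by exact: tends_expr.
have hA := tends_horner A' tq; have hB := tends_horner B' tq.
have rat n : f n.+1 / f n = (A'.[q ^+ n] * (q ^+ n) ^+ a) / (B'.[q ^+ n] * (q ^+ n) ^+ b).
  by rewrite (hyp_ratio n Hf) EA EB !hornerM !hornerXn.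
have lim : tends (fun n => A'.[q ^+ n] / B'.[q ^+ n]) (A'.[0] / B'.[0]).
  by apply: flimM => //; exact: flimV.
have lim0 : A'.[0] / B'.[0] != 0 by rewrite mulf_neq0 // invr_eq0.
have B'n n : B'.[q ^+ n] != 0 by have [_] := AB n; rewrite EB hornerM mulf_eq0 negb_or => /andP[].
case: a EA rat => [|a] EA rat; case: b EB rat => [|b] EB rat.
- by apply: TypeM; rewrite -horner_coef0 ?EA ?EB expr0 mulr1.
- apply: (@TypeD _ _ _ _ b); exists (A'.[0] / B'.[0]) => //; apply: tends_ext lim _ => n.
  have qn : (q ^+ n) ^+ b.+1 != 0 by rewrite !expf_neq0.
  rewrite rat [q ^+ b.+1 ^+ n]exprAC; move: qn; set y := _ ^+ b.+1 => qn.
  by field; rewrite qn B'n.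
- apply: (@TypeE _ _ _ _ a); split=> //; exists (A'.[0] / B'.[0]) => //; apply: tends_ext lim _ => n.
  have qn : (q ^+ n) ^+ a.+1 != 0 by rewrite !expf_neq0.
  rewrite /rho rat [q ^+ a.+1 ^+ n]exprAC; move: qn; set y := _ ^+ a.+1 => qn.
  by field; rewrite qn B'n.
- by rewrite EA EB !coefMXn /= eqxx in nz.
Qed.

(** The reciprocal polynomial x^n P(1/x), relative to a prescribed degree bound [n]. *)
Definition revp n (P : {poly C}) : {poly C} := \poly_(i < n.+1) P`_(n - i).
Lemma horner_revp n (P : {poly C}) x : x != 0 -> (size P <= n.+1)%N -> (revp n P).[x^-1] * x ^+ n = P.[x].
Proof.
move=> x0 sP; rewrite horner_poly (horner_coef_wide _ sP) (reindex_inj rev_ord_inj) /= mulr_suml.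
apply: eq_bigr => i _; have im : (i <= n)%N by rewrite -ltnS.
rewrite subSS subKn // -mulrA; congr (_ * _).
have -> : x ^+ n = x ^+ (n - i) * x ^+ i by rewrite -exprD subnK.
by rewrite exprVn mulKf // expf_neq0.
Qed.

(** In terms of q^-1 the recurrence has the reciprocal polynomials as coefficients. Reversing both
    at the larger of the two degrees makes a leading coefficient into a nonzero constant term. *)
Lemma hyp_inv q A B f : hyp q A B f -> (A`_0 != 0) || (B`_0 != 0) ->
  exists A' B', hyp q^-1 A' B' f /\ (A'`_0 != 0) || (B'`_0 != 0).
Proof.
move=> [q0 f0 Bq AB H] _; pose n := maxn (size A).-1 (size B).-1.
have A0 : A != 0 by apply/eqP => E; have [] := AB 0%N; rewrite E horner0 eqxx.
have B0 : B != 0 by apply/eqP => E; have [_] := AB 0%N; rewrite E horner0 eqxx.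
have sA : (size A <= n.+1)%N by rewrite -(prednK (_ : 0 < size A)%N) ?size_poly_gt0 // ltnS leq_maxl.
have sB : (size B <= n.+1)%N by rewrite -(prednK (_ : 0 < size B)%N) ?size_poly_gt0 // ltnS leq_maxr.
have E (P : {poly C}) k : (size P <= n.+1)%N -> (revp n P).[q^-1 ^+ k] * (q ^+ k) ^+ n = P.[q ^+ k].
  by move=> sP; rewrite exprVn; apply: horner_revp => //; exact: expf_neq0.
have q0' : q^-1 != 0 by rewrite invr_eq0.
have qk k : (q ^+ k) ^+ n != 0 by rewrite !expf_neq0.
exists (revp n A), (revp n B); split; last first.
  rewrite !coef_poly /= subn0; have [h|h] := leqP (size A).-1 (size B).-1.
    by rewrite /n (maxn_idPr h) -[B`_ _]/(lead_coef B) lead_coef_eq0 B0 orbT.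
  by rewrite /n (maxn_idPl (ltnW h)) -[A`_ _]/(lead_coef A) lead_coef_eq0 A0.
split=> //.
- by have := horner_revp q0' sB; rewrite invrK Bq =>
  /eqP; rewrite mulf_eq0 expf_eq0 invr_eq0 (negbTE q0) andbF orbF => /eqP.
- by move=> k; have [a b] := AB k; move: a b; rewrite -!(E _ k) // !mulf_eq0 !negb_or => /andP[-> _] /andP[->
  _].
- by move=> k; apply: (mulIf (qk k)); rewrite mulrAC E // H -E // mulrAC.
Qed.
End Types.

(** * Assembly of the cases *)

Section Core.
Variable R : realType.
Local Notation C := R[i].
Implicit Types (f g F G : ps C) (z s : C).

Lemma bpol_neq0 q (A B : {poly C}) i : q != 0 -> (A`_i != 0) || (B`_i != 0) -> bpol q A B i != 0.
Proof.
move=> q0; apply: contraTneq => E; rewrite negb_or !negbK.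
have := congr1 (fun p : {poly C} => p`_0) E; rewrite /bpol coefB coefC coefZ coefX mulr0 subr0 coef0 /= => /eqP.
rewrite mulf_eq0 invr_eq0 expf_eq0 (negbTE q0) andbF orbF => ->; rewrite andbT.
have := congr1 (fun p : {poly C} => p`_1) E; rewrite /bpol coefB coefC coefZ coefX mulr1 sub0r coef0 /= => /eqP.
by rewrite oppr_eq0.
Qed.

Lemma hyp_top q A B f : hyp q A B f -> exists n, [/\ (size A <= n.+2)%N,
  (size B <= n.+2)%N & (A`_n.+1 != 0) || (B`_n.+1 != 0)].
Proof.
move=> Hf; have [q0 _ Bq AB _] := Hf.
have A0 : A != 0 by apply/eqP => E; have [] := AB 0%N; rewrite E horner0 eqxx.
have B0 : B != 0 by apply/eqP => E; have [_] := AB 0%N; rewrite E horner0 eqxx.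
have sB : (1 < size B)%N.
  rewrite ltnNge; apply/negP => /size1_polyC BE; move: Bq B0; rewrite BE hornerC => ->; by rewrite eqxx.
have [n En] : exists n, maxn (size A) (size B) = n.+2.
  by exists (maxn (size A) (size B)).-2; move: sB; clear; lia.
exists n; rewrite -En leq_maxl leq_maxr; split=> //.
case: (leqP (size A) (size B)) => h.
  by rewrite -[n.+1]/(n.+2.-1) -En (maxn_idPr h) -[B`_ _]/(lead_coef B) lead_coef_eq0 B0 orbT.
by rewrite -[n.+1]/(n.+2.-1) -En (maxn_idPl (ltnW h)) -[A`_ _]/(lead_coef A) lead_coef_eq0 A0.
Qed.

(** The second equation is the first one read backwards after a dilation by q^-(m+1). Its top
    coefficient comes from index 0, hence the condition on the constant terms. *)
Lemma hyp_equations q A B g : hyp q A B g -> (A`_0 != 0) || (B`_0 != 0) -> exists m (b b' : nat -> {poly C}),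
  [/\ b m.+1 != 0, \sum_(i < m.+2) pp (b i) * sc (q ^+ i) g = 0, b' m.+1 != 0 &
      \sum_(i < m.+2) pp (b' i) * sc (q^-1 ^+ i) g = 0].
Proof.
move=> Hg nz; have [m [sA sB top]] := hyp_top Hg; have [q0 _ _ _ _] := Hg.
have E := hyp_feq Hg sA sB; have qm : q^-1 ^+ m.+1 != 0 by rewrite expf_neq0 // invr_eq0.
exists m, (bpol q A B), (fun i => bpol q A B (m.+1 - i) \Po (q^-1 ^+ m.+1 *: 'X)); split.
- exact: bpol_neq0.
- exact: E.
- rewrite subnn; have h := bpol_neq0 q0 nz; apply: contraNneq h => h.
  by rewrite -pp_eq0 -(sc_eq0 _ qm) sc_pp h rmorph0.
- rewrite (reindex_inj rev_ord_inj) /=; have := congr1 (sc (q^-1 ^+ m.+1)) E; rewrite rmorph0 rmorph_sum => E'.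
  transitivity (\sum_(i < m.+2) sc (q^-1 ^+ m.+1) (pp (bpol q A B i) * sc (q ^+ i) g)); last exact: E'.
  apply: eq_bigr => i _; have im : (i <= m.+1)%N by rewrite -ltnS.
  rewrite rmorphM /= sc_pp sc_comp subSS subKn //; congr (_ * sc _ _).
  move: (nat_of_ord i) im => k km.
  by rewrite -{2}(subnK km) exprD -mulrA -exprMn mulVf // expr1n mulr1.
Qed.

Definition indep (q1 q2 : C) := forall j k : int, q1 ^ j * q2 ^ k = 1 -> j = 0 /\ k = 0.

Lemma indep_sym q1 q2 : indep q1 q2 -> indep q2 q1.
Proof. by move=> H j k; rewrite mulrC => /H []. Qed.
Lemma indep_inv q1 q2 : indep q1 q2 -> indep q1^-1 q2.
Proof. by move=> H j k; rewrite exprz_inv => /H [/eqP]; rewrite oppr_eq0 => /eqP. Qed.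
Lemma indep_root q1 q2 : indep q1 q2 -> forall m, q1 ^+ m.+1 != 1.
Proof. by move=> H m; apply/eqP => E; have [] := H m.+1%:Z 0; rewrite ?expr0z ?mulr1. Qed.

Lemma meromorphic_dep_rational q e A B f g A2 B2 : hyp q A B f -> nm q < 1 -> A`_0 != 0 -> B`_0 != 0 ->
  hyp e A2 B2 g ->
  (A2`_0 != 0) || (B2`_0 != 0) -> indep e q -> algover (fun u => u = g) f -> fps_rational f.
Proof.
move=> Hf q1 A0 B0 Hg nz ind alg; have [n [sA sB top]] := hyp_top Hf; have [q0 _ _ _ _] := Hf.
have [e0 _ _ _ _] := Hg; have [m [b [b' [h1 h2 h3 h4]]]] := hyp_equations Hg nz.
by apply: (meromorphic_rational Hf q1 A0 B0 sA sB _ (bpol_neq0 q0 top) e0 ind h1 h2 h3 h4 alg).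
Qed.

Lemma algebraic_rational q e A B f : hyp q A B f -> nm q <= 1 -> (A`_0 != 0) || (B`_0 != 0) -> e != 0 ->
  indep e q ->
  algebraic f -> fps_rational f.
Proof.
move=> Hf q1 nz e0 ind af; have f0 := hyp_neq0 Hf; have [q0 _ _ _ _] := Hf.
move: q1; rewrite le_eqVlt => /orP[/eqP q1|q1].
  by apply: (algebraic_unit Hf q1 _ af); exact: indep_root (indep_sym ind).
have [A0 B0|d D|d E] := hyp_type Hf q1 nz.
- have [n [sA sB top]] := hyp_top Hf.
  (* The constant series 1 plays the second function: it satisfies a first order [e]-difference
     equation for every [e], and an algebraic [f] is algebraic over it. *)
  pose b (i : nat) : {poly C} := if i == 0%N then 1 else -1.
  have E x : \sum_(i < 2) pp (b i) * sc (x ^+ i) 1 = 0 :> ps C.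
    by rewrite big_ord_recl big_ord1 /= !rmorph1 rmorphN rmorph1 mulr1 mulr1 subrr.
  have n1 : b 1%N != 0 by rewrite oppr_eq0 oner_eq0.
  by apply: (@meromorphic_rational _ q e A B f 1 n.+1 0 b b Hf q1 A0 B0 sA sB _ (bpol_neq0 q0 top) e0 ind n1 (E
    e) n1 (E e^-1)) => //; exact: algebraic_algover.
- have qd : nm (q ^+ d.+1) < 1 by rewrite nmX exprn_ilt1 // nm_ge0.
  by case: (algebraic_dtype f0 (expf_neq0 _ q0) qd D).
- have qd : nm (q ^+ d.+1) < 1 by rewrite nmX exprn_ilt1 // nm_ge0.
  by case: (algebraic_entire f0 (etype_cv (expf_neq0 _ q0) qd E) af).
Qed.

Lemma dtype_absurd f g be q2 A2 B2 P : (forall n, f n != 0) -> be != 0 -> nm be < 1 -> dtype be f ->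
  hyp q2 A2 B2 g ->
  nm q2 <= 1 -> (forall j : int, be * q2 ^ j != 1) -> P != 0 -> ev2 f g P = 0 -> ~ algebraic f ->
    ~ algebraic g -> False.
Proof.
move=> f0 be0 be1 [c0 c00 h] Hg q21 ind P0 E nf ng; have [S [E1 E2 E3]] := dep_min P0 E nf ng.
have [v [u [k [k0 hk]]]] := divergent_ratio f0 be0 be1 c00 h E1 E2 E3.
exact: (divergent_ratio_absurd f0 be0 be1 c00 h Hg q21 ind k0 hk).
Qed.

Lemma dependent_rational_lt1 q1 q2 A1 B1 A2 B2 f g P : hyp q1 A1 B1 f -> (A1`_0 != 0) || (B1`_0 != 0) ->
  hyp q2 A2 B2 g -> (A2`_0 != 0) || (B2`_0 != 0) -> indep q1 q2 -> nm q1 < 1 -> nm q2 <= 1 ->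
  P != 0 -> ev2 f g P = 0 -> fps_rational f \/ fps_rational g.
Proof.
move=> Hf nz1 Hg nz2 ind n1 n2 P0 E.
have [q10 _ _ _ _] := Hf; have [q20 _ _ _ _] := Hg; have ind' := indep_sym ind.
have f0 := hyp_neq0 Hf; have g0 := hyp_neq0 Hg.
case: (pselect (fps_rational f)) => [|nrf]; first by left.
case: (pselect (fps_rational g)) => [|nrg]; first by right.
exfalso.
have nf : ~ algebraic f by move=> /(algebraic_rational Hf (ltW n1) nz1 q20 ind').
have ng : ~ algebraic g by move=> /(algebraic_rational Hg n2 nz2 q10 ind).
have PS0 : swapXY P != 0 by rewrite swapXY_eq0.
have ES : ev2 g f (swapXY P) = 0 by rewrite ev2_swap.
have pow d (q : C) : nm q < 1 -> nm (q ^+ d.+1) < 1 by move=> h; rewrite nmX exprn_ilt1 // nm_ge0.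
have [A0 B0|d D|d D] := hyp_type Hf n1 nz1.
- exact: nrf (meromorphic_dep_rational Hf n1 A0 B0 Hg nz2 ind' (dep_algover P0 E ng)).
- have h (j : int) : q1 ^+ d.+1 * q2 ^ j != 1 by apply/eqP => /(ind d.+1%:Z) [].
  by have := dtype_absurd f0 (expf_neq0 d.+1 q10) (pow d _ n1) D Hg n2 h P0 E nf ng.
move: n2; rewrite le_eqVlt => /orP[/eqP n2|n2].
  have [S [E1 E2 E3]] := dep_min P0 E nf ng.
  have ef : entire f := etype_cv (expf_neq0 d.+1 q10) (pow _ _ n1) D.
  have Ep i : entire (map_poly (phi f) S)`_i by rewrite coef_map => r; exact: (ev_phi _ 0 ef).1.
  have pg' : (map_poly (phi f) S)^`().[g] != 0 by rewrite deriv_map; exact: E3.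
  case: (unit_rational_or_entire Hg n2 (indep_root ind') Ep E1 pg') => // eg.
  have [u [u0 u1 pu]] := fourth_root (expf_neq0 d.+1 q10) (pow _ _ n1).
  exact: (entire_unit_absurd (expf_neq0 d.+1 q10) u0 u1 pu D Hg n2 (indep_root ind') eg P0 E).
have [A0 B0|d' D'|d' D'] := hyp_type Hg n2 nz2.
- exact: nrg (meromorphic_dep_rational Hg n2 A0 B0 Hf nz1 ind (dep_algover PS0 ES nf)).
- have h (j : int) : q2 ^+ d'.+1 * q1 ^ j != 1 by apply/eqP => /(ind' d'.+1%:Z) [].
  by have := dtype_absurd g0 (expf_neq0 d'.+1 q20) (pow d' _ n2) D' Hf (ltW n1) h PS0 ES ng nf.
have [k Ek] := entire_commensurable (expf_neq0 d.+1 q10) (pow _ _ n1) (expf_neq0 d'.+1 q20) (pow _ _ n2) D D'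
  P0 E.
have E2 : q2 ^ (d'.+1%:Z * k) = q1 ^+ d.+1 by rewrite -exprz_exp -exprnP Ek.
have [] // := ind d.+1%:Z (- (d'.+1%:Z * k)).
by rewrite -invr_expz E2 -exprnP mulfV // expf_neq0.
Qed.

Lemma dependent_rational_modulus q1 q2 A1 B1 A2 B2 f g P : hyp q1 A1 B1 f -> (A1`_0 != 0) || (B1`_0 != 0) ->
  hyp q2 A2 B2 g -> (A2`_0 != 0) || (B2`_0 != 0) -> indep q1 q2 -> nm q1 != 1 ->
  P != 0 -> ev2 f g P = 0 -> fps_rational f \/ fps_rational g.
Proof.
have step q1' q2' A1' B1' A2' B2' : hyp q1' A1' B1' f -> (A1'`_0 != 0) || (B1'`_0 != 0) ->
    hyp q2' A2' B2' g -> (A2'`_0 != 0) || (B2'`_0 != 0) -> indep q1' q2' -> nm q1' < 1 ->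
    P != 0 -> ev2 f g P = 0 -> fps_rational f \/ fps_rational g.
  move=> Hf nz1 Hg nz2 ind n1 P0 E; have [q20 _ _ _ _] := Hg.
  case: (leP (nm q2') 1) => n2; first exact: dependent_rational_lt1 Hf nz1 Hg nz2 ind n1 n2 P0 E.
  have [A [B [Hg' nz]]] := hyp_inv Hg nz2; apply: (dependent_rational_lt1 Hf nz1 Hg' nz _ n1 _ P0 E).
    by apply: indep_sym; apply: indep_inv; exact: indep_sym.
  by rewrite nmV invf_le1 ?ltW // nm_gt0.
move=> Hf nz1 Hg nz2 ind n1 P0 E; have [q10 _ _ _ _] := Hf.
case: (ltgtP (nm q1) 1) n1 => // n1 _; first exact: step Hf nz1 Hg nz2 ind n1 P0 E.
have [A [B [Hf' nz]]] := hyp_inv Hf nz1; apply: (step _ _ _ _ _ _ Hf' nz Hg nz2 (indep_inv ind) _ P0 E).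
by rewrite nmV invf_lt1 // nm_gt0.
Qed.

(** The factor 1 - qX of [B] comes from the q-factorial and gives [B.[q^-1] = 0]. If A vanishes at
    some q^n, the series breaks off and is a polynomial. *)
Lemma qhyp_hyp q f : q != 0 -> (forall m, q ^+ m.+1 != 1) -> is_qhyp q f ->
  fps_rational f \/ exists A B, hyp q A B f /\ (A`_0 != 0) || (B`_0 != 0).
Proof.
move=> q0 ur [al [be [Hbe fE]]].
pose lins (s : seq C) : {poly C} := \prod_(a <- s) (1 - a *: 'X).
have lins0 (s : seq C) : (lins s)`_0 = 1.
  by rewrite -horner_coef0 horner_prod big1_seq // => a _; rewrite !hornerE subr0.
have linsE (s : seq C) x : (lins s).[x] = \prod_(a <- s) (1 - a * x).
  by rewrite horner_prod; apply: eq_bigr => a _; rewrite !hornerE.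
(* One of the two truncated differences is 0, so the power of [- 'X] enters only one of [A] and [B],
   and the other keeps a nonzero constant term. *)
pose d1 := (size be - size al)%N; pose d2 := (size al - size be)%N.
pose A : {poly C} := (1 - q) *: lins al * (- 'X) ^+ d1.
pose B : {poly C} := lins be * (1 - q *: 'X) * (- 'X) ^+ d2.
have q1 : 1 - q != 0 by rewrite subr_eq0 eq_sym; have := ur 0%N; rewrite expr1.
have qn n : q ^+ n != 0 by exact: expf_neq0.
have poch (s : seq C) n : \prod_(a <- s) qpoch q a n.+1 = (\prod_(a <- s) qpoch q a n) * (lins s).[q ^+ n].
  by rewrite linsE -big_split; apply: eq_bigr => a _; rewrite /qpoch big_ord_recr.
have fact n : qfact q n.+1 = qfact q n * ((1 - q ^+ n.+1) / (1 - q)) by rewrite /qfact big_nat_recr.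
have bn n : (lins be).[q ^+ n] != 0.
  rewrite linsE prodf_seq_neq0; apply/allP => b bb /=; rewrite subr_eq0 eq_sym; apply/eqP => E.
  by have /eqP := Hbe b bb n; apply; rewrite -(mulfK (qn n) b) E mul1r.
have pb n : \prod_(b <- be) qpoch q b n != 0.
  by elim: n => [|n IH]; [rewrite big1 ?oner_neq0 // => b _; rewrite /qpoch big_ord0 | rewrite poch mulf_neq0].
have qf n : qfact q n != 0.
  elim: n => [|n IH]; first by rewrite /qfact big_geq // oner_neq0.
  by rewrite fact !mulf_neq0 // ?invr_eq0 // subr_eq0 eq_sym.
have w0 n : (-1) ^+ n * q ^+ 'C(n, 2) != 0 :> C by rewrite mulf_neq0 // ?expf_neq0 // oppr_eq0 oner_eq0.
have sE n : ((-1) ^+ n * q ^+ 'C(n, 2)) ^ ((size be)%:Z - (size al)%:Z) =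
   ((-1) ^+ n * q ^+ 'C(n, 2)) ^+ d1 / ((-1) ^+ n * q ^+ 'C(n, 2)) ^+ d2 :> C.
  have -> : (size be)%:Z - (size al)%:Z = d1%:Z - d2%:Z by rewrite /d1 /d2; clear; lia.
  by rewrite expfzDr // exprnN.
have rec n : B.[q ^+ n] * f n.+1 = A.[q ^+ n] * f n.
  rewrite fE /qhyp_series !poch fact !sE /A /B !hornerE /=.
  have -> : (-1) ^+ n.+1 * q ^+ 'C(n.+1, 2) = ((-1) ^+ n * q ^+ 'C(n, 2)) * (- q ^+ n) :> C.
    by rewrite binS bin1 exprS exprD; ring.
  rewrite ![(_ * - q ^+ n) ^+ _]exprMn -exprS.
  have h1 := bn n; have h2 := pb n; have h3 := qf n.
  have h4 : ((-1) ^+ n * q ^+ 'C(n, 2)) ^+ d2 != 0 :> C by rewrite expf_neq0.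
  have h5 : (- q ^+ n) ^+ d2 != 0 by rewrite expf_neq0 // oppr_eq0.
  have h6 : 1 - q ^+ n.+1 != 0 by rewrite subr_eq0 eq_sym.
  clear -h1 h2 h3 h4 h5 h6 q1; move: h1 h2 h3 h4 h5 h6.
  set a1 := (lins be).[_]; set a2 := \prod_(b <- be) _; set a3 := qfact q n; set a4 := (_ * _) ^+ d2;
    set a5 := (- _) ^+ d2.
  set a6 := q ^+ n.+1; set a7 := (_ * _) ^+ d1; set a8 := (- _) ^+ d1; set a9 := (lins al).[_];
    set a10 := \prod_(a <- al) _.
  move=> h1 h2 h3 h4 h5 h6; field; by rewrite h1 h2 h3 h4 h5 h6 q1.
have Bn n : B.[q ^+ n] != 0.
  rewrite /B !hornerE /= !mulf_neq0 ?bn ?expf_neq0 ?oppr_eq0 //.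
  by rewrite subr_eq0 eq_sym -exprS.
have f0 : f 0%N != 0.
  by rewrite fE /qhyp_series !mulf_neq0 ?invr_eq0 ?pb ?qf // ?expfz_neq0 // prodf_seq_neq0; apply/allP => a _;
    rewrite /qpoch big_ord0 oner_eq0.
case: (pselect (exists n, A.[q ^+ n] = 0)) => [[n An]|nA]; [left|right].
  have fz k : f (n.+1 + k)%N = 0.
    elim: k => [|k IH].
      by have /eqP := rec n; rewrite An mul0r mulf_eq0 (negbTE (Bn n)) addn0 => /eqP.
    by have /eqP := rec (n.+1 + k)%N; rewrite IH mulr0 mulf_eq0 (negbTE (Bn _)) addnS => /eqP.
  apply/fps_rationalP; exists (trunc n.+1 f), 1; rewrite oner_neq0 rmorph1 mul1r; split=> //.
  apply: psP => k; rewrite /pp coef_poly; case: ltnP => // h.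
  by rewrite -(subnKC h) fz.
exists A, B; split; last first.
  rewrite -!horner_coef0 /A /B !hornerE /= !horner_coef0 !lins0 /d1 /d2; case: (leqP (size be) (size al)) => h.
    by rewrite (eqP h) expr0 !mulr1 q1.
  by rewrite (eqP (ltnW h)) expr0 !mul1r subr0 mulr1 oner_eq0 orbT.
split=> //; last by move=> n; split; [apply/eqP => An; apply: nA; exists n | exact: Bn].
by rewrite /B !hornerE /= divff // subrr mulr0 mul0r.
Qed.
End Core.

(** * Isomorphisms of finitely generated subfields *)

Section Avoid.
Variable R : realType.
Local Notation C := R[i].

(** Cantor's nested intervals, one real part avoided at each step. Starting from [2, 3] gives
    modulus above 1. *)
Lemma avoid_sequence (e : nat -> C) : exists y : C, 1 < nm y /\ forall n, e n != y.
Proof.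
(* The lower alternative ends before the midpoint, so that [x] equal to the midpoint is excluded as
   well. *)
pose st (I : R * R) (x : R) := if x < (I.1 + I.2) / 2 then ((I.1 + I.2) / 2, I.2) else (I.1,
  (3 * I.1 + I.2) / 4).
pose J := fix J n := if n is n'.+1 then st (J n') (complex.Re (e n')) else (2, 3).
have Jlt n : (J n).1 < (J n).2.
  elim: n => [|n IH] /=; first lra.
  by rewrite /st; case: ifP => _ /=; lra.
have Jmono n : (J n).1 <= (J n.+1).1 /\ (J n.+1).2 <= (J n).2.
  by have := Jlt n; rewrite /= /st; case: ifP => _ /=; lra.
have mono1 n k : (J n).1 <= (J (n + k)%N).1.
  by elim: k => [|k IH]; rewrite ?addn0 // addnS; apply: le_trans IH _; case: (Jmono (n + k)%N).
have mono2 n k : (J (n + k)%N).2 <= (J n).2.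
  by elim: k => [|k IH]; rewrite ?addn0 // addnS; apply: le_trans IH; case: (Jmono (n + k)%N).
have cross n m : (J n).1 <= (J m).2.
  apply: le_trans (mono1 n m) _; apply: le_trans (ltW (Jlt _)) _; rewrite addnC; exact: mono2.
pose S : set R := [set x | exists n, x = (J n).1]%classic.
have S0 : (S !=set0)%classic by exists (J 0%N).1; exists 0%N.
have ubS n : ubound S (J n).2 by move=> x [m ->].
have hS : has_sup S by split=> //; exists (J 0%N).2.
pose y := sup S.
have y1 n : (J n).1 <= y by apply: sup_upper_bound => //; exists n.
have y2 n : y <= (J n).2 by apply: ge_sup.
exists (y%:C)%C; split.
  by have := y1 0%N; rewrite nm_real /= => h; apply: lt_le_trans (ler_norm _); lra.
move=> n; apply/eqP => E; have Ey : complex.Re (e n) = y by rewrite E.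
have := y1 n.+1; have := y2 n.+1; have := Jlt n; rewrite /= /st Ey; case: ifP => /= h; last move/negbT: h; lra.
Qed.
End Avoid.

(** * Partial isomorphisms of fields *)

Section Rel.
Variable F : fieldType.
Implicit Types (x y : F) (p r s : {poly F}).

(* Graph of an isomorphism between two subfields. *)
Definition prel (G : F -> F -> Prop) := [/\ G 1 1,
  forall x y x' y', G x x' -> G y y' -> G (x - y) (x' - y'),
  forall x y x' y', G x x' -> G y y' -> G (x * y) (x' * y'),
  forall x x', G x x' -> G x^-1 x'^-1 &
  forall x x', G x x' -> (x == 0) = (x' == 0)].

Section One.
Variable G : F -> F -> Prop.
Hypothesis HG : prel G.
Lemma rel1 : G 1 1. Proof. by case: HG. Qed.
Lemma relB x y x' y' : G x x' -> G y y' -> G (x - y) (x' - y'). Proof. by case: HG => _ h _ _ _; exact: h. Qed.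
Lemma relM x y x' y' : G x x' -> G y y' -> G (x * y) (x' * y'). Proof. by case: HG => _ _ h _ _; exact: h. Qed.
Lemma relV x x' : G x x' -> G x^-1 x'^-1. Proof. by case: HG => _ _ _ h _; exact: h. Qed.
Lemma rel_eq0 x x' : G x x' -> (x == 0) = (x' == 0). Proof. by case: HG => _ _ _ _ h; exact: h. Qed.
Lemma rel0 : G 0 0. Proof. by have := relB rel1 rel1; rewrite subrr. Qed.
Lemma relN x x' : G x x' -> G (- x) (- x'). Proof. by move=> h; rewrite -sub0r -[- x']sub0r; apply: relB h;
  exact: rel0. Qed.
Lemma relD x y x' y' : G x x' -> G y y' -> G (x + y) (x' + y').
Proof. by move=> h1 h2; rewrite -[y]opprK -[y']opprK; apply: relB => //; exact: relN. Qed.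
Lemma relX x x' n : G x x' -> G (x ^+ n) (x' ^+ n).
Proof. by move=> h; elim: n => [|n IH]; rewrite ?expr0 ?exprS; [exact: rel1 | exact: relM]. Qed.
Lemma relXz x x' (n : int) : G x x' -> G (x ^ n) (x' ^ n).
Proof. by move=> h; case: n => n; rewrite ?NegzE -?exprnN -?exprnP; [exact: relX | apply: relV; exact: relX].
  Qed.
Lemma rel_sum (I : Type) (l : seq I) (P : pred I) (f f' : I -> F) : (forall i, P i -> G (f i) (f' i)) ->
  G (\sum_(i <- l | P i) f i) (\sum_(i <- l | P i) f' i).
Proof. by move=> H; elim/big_rec2: _ => [|i u v Pi IH]; [exact: rel0 | apply: relD IH; exact: H]. Qed.
Lemma rel_prod (I : Type) (l : seq I) (P : pred I) (f f' : I -> F) : (forall i, P i -> G (f i) (f' i)) ->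
  G (\prod_(i <- l | P i) f i) (\prod_(i <- l | P i) f' i).
Proof. by move=> H; elim/big_rec2: _ => [|i u v Pi IH]; [exact: rel1 | apply: relM IH; exact: H]. Qed.

Definition prelp p p' := forall i, G p`_i p'`_i.

Lemma relp_size p p' : prelp p p' -> size p = size p'.
Proof.
move=> H; apply/eqP; rewrite eqn_leq; apply/andP; split; apply/leq_sizeP => j hj; apply/eqP.
  by rewrite (rel_eq0 (H j)) nth_default.
by rewrite -(rel_eq0 (H j)) nth_default.
Qed.
Lemma relpB p r p' r' : prelp p p' -> prelp r r' -> prelp (p - r) (p' - r').
Proof. by move=> h1 h2 i; rewrite !coefB; exact: relB. Qed.
Lemma relpD p r p' r' : prelp p p' -> prelp r r' -> prelp (p + r) (p' + r').
Proof. by move=> h1 h2 i; rewrite !coefD; exact: relD. Qed.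
Lemma relpM p r p' r' : prelp p p' -> prelp r r' -> prelp (p * r) (p' * r').
Proof. by move=> h1 h2 i; rewrite !coefM; apply: rel_sum => j _; exact: relM. Qed.
Lemma relpC x x' : G x x' -> prelp x%:P x'%:P.
Proof. by move=> h i; rewrite !coefC; case: eqP => _ //; exact: rel0. Qed.
Lemma relpX : prelp 'X 'X.
Proof. by move=> i; rewrite coefX; case: eqP => _; [exact: rel1 | exact: rel0]. Qed.
Lemma relpXn n : prelp 'X^n 'X^n.
Proof. by move=> i; rewrite coefXn; case: eqP => _; [exact: rel1 | exact: rel0]. Qed.
Lemma relp_eq0 p p' : prelp p p' -> (p == 0) = (p' == 0).
Proof. by move=> /relp_size h; rewrite -!size_poly_eq0 h. Qed.

(** One Euclidean division is carried out on both sides at once: related leading coefficients are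
    cancelled by related quotients. *)
Lemma relp_div s s' p p' : prelp s s' -> prelp p p' -> p != 0 ->
  exists d d' r r', [/\ prelp d d', prelp r r', (size r < size p)%N, s = d * p + r & s' = d' * p' + r'].
Proof.
move=> hs hp p0; have [n] := ubnP (size s); elim: n s s' hs => // n IH s s' hs; rewrite ltnS => sn.
case: (ltnP (size s) (size p)) => sp.
  exists 0, 0, s, s'; rewrite !mul0r !add0r; split=> // i; rewrite coef0; exact: rel0.
have sz := relp_size hs; have pz := relp_size hp.
have sp0 : (0 < size p)%N by rewrite size_poly_gt0.
pose c := s`_(size s).-1 / p`_(size p).-1; pose c' := s'`_(size s).-1 / p'`_(size p).-1.
have hc : G c c' by apply: relM; [exact: hs | apply: relV; exact: hp].
pose k := (size s - size p)%N.
have ht : prelp (c%:P * 'X^k) (c'%:P * 'X^k) by apply: relpM; [exact: relpC | exact: relpXn].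
have lp : p`_(size p).-1 != 0 by rewrite -lead_coefE lead_coef_eq0.
have small : (size (s - c%:P * 'X^k * p)%R < size s)%N.
  have s0 : (0 < size s)%N by exact: leq_trans sp.
  rewrite -(prednK s0) ltnS; apply/leq_sizeP => j hj.
  have aux1 (a b i : nat) : (a.-1 <= i)%N -> (0 < b)%N -> (a - b <= i)%N by clear; lia.
  have aux2 (a b : nat) : (b <= a)%N -> (0 < b)%N -> (a.-1 - (a - b))%N = b.-1 by clear; lia.
  have aux3 (a b i : nat) : (a.-1 < i)%N -> (b <= a)%N -> (0 < a)%N ->
    (a <= i)%N && (b <= i - (a - b))%N by clear; lia.
  rewrite coefB -mulrA coefCM coefXnM ltnNge (_ : (k <= j)%N) /=; last exact: aux1 hj sp0.
  move: hj; rewrite leq_eqVlt => /orP[/eqP <-|hj].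
    rewrite (_ : ((size s).-1 - k)%N = (size p).-1); last exact: aux2 sp sp0.
    by rewrite /c divfK // subrr.
  by have /andP[h1 h2] := aux3 _ _ _ hj sp s0; rewrite !nth_default ?mulr0 ?subrr.
have [d [d' [r [r' [h1 h2 h3 h4 h5]]]]] := IH _ _ (relpB hs (relpM ht hp)) (leq_trans small sn).
exists (c%:P * 'X^k + d), (c'%:P * 'X^k + d'), r, r'; split=> //.
- exact: relpD.
- by rewrite mulrDl -addrA -h4 addrC subrK.
- by rewrite mulrDl -addrA -h5 addrC subrK.
Qed.

(** The sequence covers the graph and may list other pairs as well. *)
Definition enumerable (G' : F -> F -> Prop) := exists e : nat -> F * F, forall x y, G' x y ->
  exists n, e n = (x, y).

Section Ext.
Variables x y : F.
Hypothesis ker : forall p p', prelp p p' -> (p.[x] == 0) = (p'.[y] == 0).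
(* The extension of the isomorphism that sends [x] to [y]. *)
Definition extr u v := exists p p' r r', [/\ prelp p p', prelp r r', r.[x] != 0,
  u = p.[x] / r.[x] & v = p'.[y] / r'.[y]].

(** [ker] makes the correspondence of quotients of values well defined and injective. Enumerability
    is inherited because pairs of polynomials are coded by finite lists of indices. *)
Lemma ext_rel : [/\ prel extr, forall u v, G u v -> extr u v, extr x y & enumerable G -> enumerable extr].
Proof.
have base u v : G u v -> extr u v.
  move=> h; exists u%:P, v%:P, 1, 1; rewrite !hornerC !divr1 oner_neq0; split=> //;
    exact: relpC rel1 || exact: relpC.
have rz r r' : prelp r r' -> r.[x] != 0 -> r'.[y] != 0 by move=> h; rewrite (ker h).
split=> //.
- split; first by apply: base; exact: rel1.
  + move=> u v u' v' [p [p' [r [r' [h1 h2 h3 -> ->]]]]] [s [s' [t [t' [g1 g2 g3 -> ->]]]]].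
    exists (p * t - s * r), (p' * t' - s' * r'), (r * t), (r' * t'); split.
    * by apply: relpB; exact: relpM.
    * exact: relpM.
    * by rewrite hornerM mulf_neq0.
    * by rewrite !hornerE; field; rewrite h3 g3.
    * by have a := rz _ _ h2 h3; have b := rz _ _ g2 g3; rewrite !hornerE; field; rewrite a b.
  + move=> u v u' v' [p [p' [r [r' [h1 h2 h3 -> ->]]]]] [s [s' [t [t' [g1 g2 g3 -> ->]]]]].
    exists (p * s), (p' * s'), (r * t), (r' * t'); split; rewrite ?hornerM ?mulf_neq0 //; try exact: relpM.
    * by field; rewrite h3 g3.
    * by have a := rz _ _ h2 h3; have b := rz _ _ g2 g3; field; rewrite a b.
  + move=> u u' [p [p' [r [r' [h1 h2 h3 -> ->]]]]].
    have [p0|p0] := eqVneq p.[x] 0.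
      have p0' : p'.[y] = 0 by apply/eqP; rewrite -(ker h1) p0.
      by rewrite p0 p0' !mul0r invr0; apply: base; exact: rel0.
    by exists r, r', p, p'; split=> //; rewrite invf_div.
  + move=> u u' [p [p' [r [r' [h1 h2 h3 -> ->]]]]].
    by rewrite !mulf_eq0 !invr_eq0 (negbTE h3) (negbTE (rz _ _ h2 h3)) !orbF; exact: ker.
- exists 'X, 'X, 1, 1; rewrite !hornerX !hornerC !divr1 oner_neq0; split=> //;
  [exact: relpX | exact: relpC rel1].
- move=> [e He]; pose P (l : seq nat) : {poly F} := Poly [seq (e n).1 | n <- l].
  pose P' (l : seq nat) : {poly F} := Poly [seq (e n).2 | n <- l].
  have surj p p' : prelp p p' -> exists l, P l = p /\ P' l = p'.
    move=> h; have rec i : exists n, e n = (p`_i, p'`_i) by exact: He.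
    have [N HN] := boolp.choice rec; exists (mkseq N (size p)); split; apply/polyP => i; rewrite coef_Poly.
      case: (ltnP i (size p)) => hi; last by rewrite !nth_default // size_map size_mkseq.
      by rewrite (nth_map 0%N) ?size_mkseq // nth_mkseq // HN.
    case: (ltnP i (size p)) => hi; last by rewrite !nth_default -?(relp_size h) // size_map size_mkseq.
    by rewrite (nth_map 0%N) ?size_mkseq // nth_mkseq // HN.
  exists (fun n => if unpickle n is Some (l1, l2) then ((P l1).[x] / (P l2).[x],
    (P' l1).[y] / (P' l2).[y]) else (0, 0)).
  move=> u v [p [p' [r [r' [h1 h2 h3 -> ->]]]]].
  have [l1 [<- <-]] := surj _ _ h1; have [l2 [<- <-]] := surj _ _ h2.
  by exists (pickle (l1, l2)); rewrite pickleK.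
Qed.
End Ext.
End One.
End Rel.

(** * Extension of partial isomorphisms *)

Section Extend.
Variable R : realType.
Local Notation C := R[i].
Implicit Types (x y z q : C) (p r s : {poly C}) (G : C -> C -> Prop).

(** [p] is the minimal polynomial of [x] over the domain of [G], and [p'] inherits irreducibility:
    Euclidean descent from a smaller polynomial vanishing at [y] would produce a proper factor of
    [p]. *)
Lemma alg_ker G x y p p' : prel G -> prelp G p p' -> p != 0 -> p.[x] = 0 ->
  (forall s s', prelp G s s' -> s != 0 -> s.[x] = 0 -> (size p <= size s)%N) -> p'.[y] = 0 ->
  forall s s', prelp G s s' -> (s.[x] == 0) = (s'.[y] == 0).
Proof.
move=> HG hp p0 px mn py.
have small s s' : prelp G s s' -> s'.[y] = 0 -> (size s < size p)%N -> s = 0.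
  have [n] := ubnP (size s); elim: n s s' => // n IH s s' sn hs sy ssp.
  apply/eqP/negPn/negP => s0.
  have [d [d' [r [r' [hd hr hsr E E']]]]] := relp_div HG hp hs s0.
  have r'y : r'.[y] = 0 by have := py; rewrite E' !hornerE sy mulr0 add0r.
  have r0 := IH r r' (leq_trans hsr sn) hr r'y (ltn_trans hsr ssp).
  have Ep : p = d * s by rewrite E r0 addr0.
  have d0 : d != 0 by apply: contraNneq p0 => d0; rewrite Ep d0 mul0r.
  move: px; rewrite Ep hornerM => /eqP; rewrite mulf_eq0 => /orP[/eqP dx|/eqP sx]; last first.
    by have := mn _ _ hs s0 sx; rewrite leqNgt ssp.
  have := mn _ _ hd d0 dx; rewrite Ep size_mul // leqNgt; apply/negP; rewrite negbK.
  suff : (1 < size s)%N by move: (size d) (size s) => a b; clear; lia.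
  rewrite ltnNge; apply/negP => s1; have := sy; rewrite (relp_size HG hs) in s1.
  rewrite (size1_polyC s1) hornerC => E0; move: s0; rewrite (relp_eq0 HG hs) (size1_polyC s1) E0 eqxx //.
move=> s s' hs; have [d [d' [r [r' [hd hr hsr E E']]]]] := relp_div HG hs hp p0.
have -> : s.[x] = r.[x] by rewrite E !hornerE px mulr0 add0r.
have -> : s'.[y] = r'.[y] by rewrite E' !hornerE py mulr0 add0r.
apply/eqP/eqP => h.
  have [r0|r0] := eqVneq r 0; last by have := mn _ _ hr r0 h; rewrite leqNgt hsr.
  by have := relp_eq0 HG hr; rewrite r0 eqxx => /esym/eqP ->; rewrite horner0.
by rewrite (small _ _ hr h hsr) horner0.
Qed.

(** An enumerable field has only countably many polynomials, hence countably many algebraic numbers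
    over it to avoid. *)
Lemma transcendental_avoid G : prel G -> enumerable G -> exists y, 1 < nm y /\ forall p p', prelp G p p' ->
  p != 0 -> p'.[y] != 0.
Proof.
move=> HG [e He].
have rec (p : {poly C}) : exists rs : seq C,
  p = lead_coef p *: \prod_(z <- rs) ('X - z%:P) by have [rs E] := closed_field_poly_normal p; exists rs.
have [rts Hr] := boolp.choice rec; pose P' (l : seq nat) : {poly C} := Poly [seq (e n).2 | n <- l].
have [y [y1 Hy]] := avoid_sequence (fun n => if unpickle n is Some (l, i) then (rts (P' l))`_i else 0).
exists y; split=> // p p' h p0; apply/eqP => py.
have rec2 i : exists n, e n = (p`_i, p'`_i) by exact: He.
have [N HN] := boolp.choice rec2; pose l := mkseq N (size p).
have El : P' l = p'.
  apply/polyP => i; rewrite coef_Poly.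
  case: (ltnP i (size p)) => hi; last by rewrite !nth_default -?(relp_size HG h) // size_map size_mkseq.
  by rewrite (nth_map 0%N) ?size_mkseq // nth_mkseq // HN.
have p'0 : p' != 0 by rewrite -(relp_eq0 HG h).
have : y \in rts p'.
  have := py; rewrite {1}(Hr p') hornerZ => /eqP; rewrite mulf_eq0 lead_coef_eq0 (negbTE p'0) /=.
  by rewrite -/(root _ _) root_prod_XsubC.
by move=> yr; have := Hy (pickle (l, index y (rts p'))); rewrite /= pickleK El nth_index // eqxx.
Qed.

(** An algebraic [x] goes to a root of its transported minimal polynomial, a transcendental one to a
    transcendental number. Preserving enumerability allows the step to be repeated. *)
Lemma extend_one G x : prel G -> enumerable G ->
  exists y G', [/\ prel G', enumerable G', forall u v, G u v -> G' u v & G' x y].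
Proof.
move=> HG eG; case: (pselect (exists p p', [/\ prelp G p p', p != 0 & p.[x] = 0])) =>
  [[p0 [p0' [h1 h2 h3]]]|ntr].
  pose Q m := `[< exists p p', [/\ prelp G p p', p != 0, p.[x] = 0 & (size p <= m)%N] >].
  have ex : exists m, Q m by exists (size p0); apply/asboolP; exists p0, p0'.
  case: (ex_minnP ex) => m /asboolP [p [p' [hp pn px sp]]] mn.
  have mn' s s' : prelp G s s' -> s != 0 -> s.[x] = 0 -> (size p <= size s)%N.
    by move=> hs sn sx; apply: leq_trans sp _; apply: mn; apply/asboolP; exists s, s'.
  have [y yr] : exists y, root p' y.
    apply/closed_rootP; rewrite -(relp_size HG hp); apply/eqP => /eqP /size_poly1P [c c0 E].
    by move: px; rewrite E hornerC => /eqP; rewrite (negbTE c0).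
  have [a b c d] := ext_rel HG (alg_ker HG hp pn px mn' (rootP yr)).
  by exists y, (extr G x y); split=> //; exact: d.
have [y [_ Hy]] := transcendental_avoid HG eG.
have ker p p' : prelp G p p' -> (p.[x] == 0) = (p'.[y] == 0).
  move=> h; have [p0|p0] := eqVneq p 0.
    by have := relp_eq0 HG h; rewrite p0 eqxx => /esym/eqP ->; rewrite !horner0.
  by rewrite (negbTE (Hy _ _ h p0)); apply/negP => /eqP px; apply: ntr; exists p, p'.
have [a b c d] := ext_rel HG ker; by exists y, (extr G x y); split=> //; exact: d.
Qed.

Lemma extend_seq G (l : seq C) : prel G -> enumerable G -> exists G', [/\ prel G', forall u v, G u v ->
  G' u v & forall x, x \in l -> exists y, G' x y].
Proof.
elim: l G => [|x l IH] G HG eG; first by exists G.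
have [y [G1 [h1 h2 h3 h4]]] := extend_one x HG eG; have [G2 [g1 g2 g3]] := IH _ h1 h2.
exists G2; split=> // [u v /h3 /g2 //|z]; rewrite inE => /orP[/eqP ->|/g3 //]; exists y; exact: g2.
Qed.

Definition ratrel (u v : C) := exists r : rat, u = ratr r /\ v = ratr r.
Lemma prel_rat : prel ratrel /\ enumerable ratrel.
Proof.
split; last first.
  exists (fun n => if unpickle n is Some r then (ratr r, ratr r) else (0, 0)) => x y [r [-> ->]].
  by exists (pickle r); rewrite pickleK.
split.
- by exists 1; rewrite rmorph1.
- by move=> x y x' y' [r [-> ->]] [s [-> ->]]; exists (r - s); rewrite rmorphB.
- by move=> x y x' y' [r [-> ->]] [s [-> ->]]; exists (r * s); rewrite rmorphM.
- by move=> x x' [r [-> ->]]; exists r^-1; rewrite fmorphV.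
- by move=> x x' [r [-> ->]].
Qed.

Lemma prel_ratP s s' : prelp ratrel s s' -> exists p : {poly rat}, s = map_poly ratr p /\ s' = map_poly ratr p.
Proof.
move=> h; have [f Hf] := boolp.choice h; exists (\poly_(i < size s) f i).
have sz := relp_size prel_rat.1 h.
by split; apply/polyP => i; have [a b] := Hf i; rewrite coef_map coef_poly /=; (case: ltnP => hi;
  [by rewrite ?a ?b | by rewrite rmorph0 nth_default // -?sz]).
Qed.

Lemma nonunimodular q : ~ alg_all_conj_unimodular q -> exists z G, [/\ prel G, enumerable G, G q z & nm z != 1].
Proof.
have [HQ eQ] := prel_rat => nA.
case: (pselect (exists p : {poly rat}, p != 0 /\ root (map_poly ratr p) q)) => [[p0 [h1 h2]]|ntr].
  pose Q m := `[< exists p : {poly rat}, [/\ p != 0, root (map_poly ratr p) q & (size p <= m)%N] >].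
  have ex : exists m, Q m by exists (size p0); apply/asboolP; exists p0.
  case: (ex_minnP ex) => m /asboolP [p [pn pq sp]] mn.
  have mn' (s : {poly rat}) : s != 0 -> root (map_poly ratr s) q -> (size p <= size s)%N.
    by move=> sn sx; apply: leq_trans sp _; apply: mn; apply/asboolP; exists s.
  have irr : irreducible_poly p.
    split.
      rewrite ltnNge; apply/negP => /size1_polyC E; move: pq pn;
        rewrite E map_polyC rootC fmorph_eq0 => /eqP ->.
      by rewrite eqxx.
    move=> d d1 /dvdpP [c E]; have c0 : c != 0 by apply: contraNneq pn => c0; rewrite E c0 mul0r.
    have d0 : d != 0 by apply: contraNneq pn => d0; rewrite E d0 mulr0.
    have dp : d %| p by rewrite E dvdp_mull.
    move: pq; rewrite E rmorphM /= rootM => /orP[cq|dq].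
      have := mn' _ c0 cq; rewrite E size_mul //; have := d1; have : (0 < size d)%N by rewrite size_poly_gt0.
      have : (0 < size c)%N by rewrite size_poly_gt0.
      move: (size d) (size c) => a b; clear; lia.
    by rewrite -E -(dvdp_size_eqp dp) eqn_leq (dvdp_leq pn dp) (mn' _ d0 dq).
  have [z [zr z1]] : exists z : C, root (map_poly ratr p) z /\ `|z| <> 1.
    apply: contrapT => H; apply: nA; exists p; split=> //; split=> // z zr.
    by apply: contrapT => h; apply: H; exists z.
  have hp : prelp ratrel (map_poly ratr p) (map_poly ratr p).
    by move=> i; exists p`_i; rewrite coef_map.
  have p0' : map_poly ratr p != 0 :> {poly C} by rewrite map_poly_eq0.
  have mn2 s s' : prelp ratrel s s' -> s != 0 -> s.[q] = 0 -> (size (map_poly ratr p : {poly C}) <= size s)%N.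
    move=> /prel_ratP [t [-> _]] t0 tq; rewrite !size_map_poly; apply: mn'; last exact/rootP.
    by rewrite -(map_poly_eq0 (ratr : rat -> C)).
  have [a b c d] := ext_rel HQ (alg_ker HQ hp p0' (rootP pq) mn2 (rootP zr)).
  exists z, (extr ratrel q z); split=> //; first exact: d.
  by apply/eqP => h; apply: z1; rewrite nm_norm h.
have [y [y1 Hy]] := transcendental_avoid HQ eQ.
have ker p p' : prelp ratrel p p' -> (p.[q] == 0) = (p'.[y] == 0).
  move=> h; have [p0|p0] := eqVneq p 0.
    by have := relp_eq0 HQ h; rewrite p0 eqxx => /esym/eqP ->; rewrite !horner0.
  rewrite (negbTE (Hy _ _ h p0)); apply/negP => /eqP px; apply: ntr.
  have [t [E _]] := prel_ratP h; exists t; split; last by apply/rootP; rewrite -E.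
  by rewrite -(map_poly_eq0 (ratr : rat -> C)) -E.
have [a b c d] := ext_rel HQ ker; exists y, (extr ratrel q y); split=> //; first exact: d.
by rewrite gt_eqF.
Qed.
End Extend.

(** The elimination of [lindep_in] for infinitely many equations: solvability is now supplied by a
    solution in the field, and the pivots stay in [X]. *)
Lemma solve_in (F : fieldType) (X : F -> Prop) (X1 : X 1) (XB : forall a b, X a -> X b -> X (a - b))
  (XM : forall a b, X a -> X b -> X (a * b)) m (M : nat -> nat -> F) (c : nat -> F) : (forall i j, X (M i j)) ->
  (exists2 i, (i < m)%N & c i != 0) -> (forall j, \sum_(i < m) c i * M i j = 0) ->
  exists c' : nat -> F, [/\ forall i, X (c' i), exists2 i, (i < m)%N & c' i != 0 & forall j,
    \sum_(i < m) c' i * M i j = 0].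
Proof.
elim: m M c => [|m IH] M c XMij [i1 i1m ci1] Ec; first by [].
case: (pselect (exists (i0 : 'I_m.+1) (n : nat), M i0 n != 0)) => [[i0 [n p0]]|Hn]; last first.
  exists (fun=> 1); split=> //; first by exists 0%N => //; exact: oner_neq0.
  by move=> j; apply: big1 => i _; have [->|h] := eqVneq (M i j) 0; [rewrite mulr0 | case: Hn; exists i, j].
pose b := bump i0; pose M' i j := M i0 n * M (b i) j - M (b i) n * M i0 j.
have split_sum (a : nat -> F) j : \sum_(i < m.+1) a i * M i j = a i0 * M i0 j + \sum_(i < m) a (b i) * M (b i)
  j.
  by rewrite (bigD1_ord i0).
have [|||c' [Xc' [i2 i2m ci2] Hc]] := IH M' (fun i => c (b i)).
- by move=> i j; apply: XB; apply: XM.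
- apply: contrapT => Hno; have cb i : (i < m)%N -> c (b i) = 0.
    by move=> im; apply/eqP/negPn/negP => h; apply: Hno; exists i.
  have c0 : c i0 = 0.
    have := Ec n; rewrite split_sum big1 ?addr0 => [/eqP|i _]; last by rewrite cb ?mul0r.
    by rewrite mulf_eq0 (negbTE p0) orbF => /eqP.
  move: ci1; have [->|h] := eqVneq i1 (i0 : nat); first by rewrite c0 eqxx.
  have [k Ek] : exists k, i1 = b k by exists (unbump i0 i1); rewrite /b unbumpK // inE.
  rewrite Ek cb ?eqxx //; move: i1m Ek; rewrite /b /bump; have := ltn_ord i0; case: leqP => /=; clear; lia.
- move=> j; have := Ec j; have := Ec n; rewrite !split_sum => E1 E2.
  transitivity (M i0 n * (c i0 * M i0 j + \sum_(i < m) c (b i) * M (b i) j) - (c i0 * M i0 n + \sum_(i < m) c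
    (b i) * M (b i) n) * M i0 j); last by rewrite E1 E2 mulr0 mul0r subrr.
  rewrite mulrDr mulrDl opprD addrACA (_ : M i0 n * (c i0 * M i0 j) - c i0 * M i0 n * M i0 j = 0) ?add0r;
    last by ring.
  by rewrite mulr_sumr mulr_suml -sumrB; apply: eq_bigr => i _; rewrite /M'; ring.
pose S := \sum_(i < m) c' i * M (b i) n.
exists (fun k => if k == i0 :> nat then - S else M i0 n * c' (unbump i0 k)); split.
- move=> i; case: eqP => _; last exact: XM.
  by apply: (closedN X1 XB); apply: (closed_sum X1 XB) => j; exact: XM.
- exists (b i2); first by rewrite /b /bump; case: (i0 <= i2)%N => /=; move: i2m; clear; lia.
  have -> : (b i2 == i0) = false by rewrite eq_sym; apply/negbTE/neq_bump.
  by rewrite /b bumpK mulf_neq0.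
move=> j; rewrite (split_sum (fun k => if k == i0 :> nat then - S else M i0 n * c' (unbump i0 k))) eqxx.
have := Hc j; rewrite /M' => E; rewrite -[RHS]E /S mulNr mulr_suml addrC -sumrB; apply: eq_bigr => i _.
have -> : (b i == i0) = false by rewrite eq_sym; apply/negbTE/neq_bump.
by rewrite /b bumpK; ring.
Qed.

(** * Transport of the data and descent of rationality *)

Section Transport.
Variable R : realType.
Local Notation C := R[i].
Implicit Types (x y z q : C) (f g F H : ps C).
Variable G : C -> C -> Prop.
Hypothesis HG : prel G.

Definition relps F F' := forall n, G (F n) (F' n).
Lemma relpsM F H F' H' : relps F F' -> relps H H' -> relps (F * H) (F' * H').
Proof. by move=> h1 h2 n; rewrite !psM; apply: (rel_sum HG) => i _; exact: (relM HG). Qed.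
Lemma relpsX F F' k : relps F F' -> relps (F ^+ k) (F' ^+ k).
Proof.
move=> h; elim: k => [|k IH]; last by rewrite !exprS; exact: relpsM.
by move=> n; rewrite !expr0 ps1; case: (n == 0)%N; [exact: (rel1 HG) | exact: (rel0 HG)].
Qed.
Lemma relps_sum (I : Type) (l : seq I) (P : pred I) (a a' : I -> ps C) : (forall i, P i ->
  relps (a i) (a' i)) ->
  relps (\sum_(i <- l | P i) a i) (\sum_(i <- l | P i) a' i).
Proof. by move=> h n; rewrite !ps_sum; apply: (rel_sum HG) => i Pi; exact: h. Qed.

Lemma rel_qhyp (s : C -> C) q (al be : seq C) : G q (s q) -> (forall a, a \in al -> G a (s a)) ->
  (forall b, b \in be -> G b (s b)) ->
  relps (qhyp_series q al be) (qhyp_series (s q) [seq s a | a <- al] [seq s b | b <- be]).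
Proof.
move=> hq ha hb n; have G1 := rel1 HG.
have poch (l : seq C) : (forall a, a \in l -> G a (s a)) ->
  G (\prod_(a <- l) qpoch q a n) (\prod_(a <- [seq s a | a <- l]) qpoch (s q) a n).
  move=> h; rewrite big_map !big_seq; apply: (rel_prod HG) => a al'.
  by apply: (rel_prod HG) => i _; apply: (relB HG) => //; apply: (relM HG); [exact: h | exact: (relX HG)].
rewrite /qhyp_series !size_map; apply: (relM HG); last apply: (relV HG).
  apply: (relM HG); first by apply: (relM HG); [exact: poch | apply: (relV HG); exact: poch].
  by apply: (relXz HG); apply: (relM HG); apply: (relX HG) => //; exact: (relN HG).
apply: (rel_prod HG) => i _; apply: (relM HG); [|apply: (relV HG)]; apply: (relB HG) => //; exact: (relX HG).
Qed.

Lemma rel_is_qhyp (s : C -> C) q (al be : seq C) : G q (s q) -> (forall b, b \in be -> G b (s b)) ->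
  (forall b, b \in be -> forall k : nat, b != q ^- k) ->
  is_qhyp (s q) (qhyp_series (s q) [seq s a | a <- al] [seq s b | b <- be]).
Proof.
move=> hq hb H; exists [seq s a | a <- al], [seq s b | b <- be]; split=> // b' /mapP [b bb ->] k.
rewrite -subr_eq0 -(rel_eq0 HG (x := b - q ^- k)) ?subr_eq0 ?H //.
by apply: (relB HG); [exact: hb | apply: (relV HG); exact: (relX HG)].
Qed.

Lemma rel_indep q1 q2 q1' q2' : G q1 q1' -> G q2 q2' -> indep q1 q2 -> indep q1' q2'.
Proof.
move=> h1 h2 ind j k /eqP; rewrite -subr_eq0.
rewrite -(rel_eq0 HG (x := q1 ^ j * q2 ^ k - 1)) ?subr_eq0; first by move/eqP; exact: ind.
by apply: (relB HG); [apply: (relM HG); exact: (relXz HG) | exact: (rel1 HG)].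
Qed.

Lemma ev2_coefs f g a b (c : nat -> nat -> {poly C}) :
  ev2 f g (\poly_(j < a) \poly_(i < b) c j i) = \sum_(j < a) \sum_(i < b) pp (c j i) * f ^+ i * g ^+ j.
Proof.
rewrite poly_def rmorph_sum; apply: eq_bigr => j _ /=.
rewrite -mul_polyC rmorphM rmorphXn /= ev2C ev2X poly_def rmorph_sum mulr_suml; apply: eq_bigr => i _ /=.
by rewrite -mul_polyC rmorphM rmorphXn /= phiC phiX.
Qed.

Lemma rel_dep (s : C -> C) f g f' g' (P : {poly {poly {poly C}}}) : relps f f' -> relps g g' ->
  (forall i j k, G (P`_j`_i)`_k (s (P`_j`_i)`_k)) -> P != 0 -> ev2 f g P = 0 ->
    exists P', P' != 0 /\ ev2 f' g' P' = 0.
Proof.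
move=> hf hg hP P0 E; pose a := size P; pose b := (\max_(j < a) size (P`_j)%R)%N.
pose c' j i : {poly C} := \poly_(k < size (P`_j)`_i) s ((P`_j)`_i)`_k.
have PE : P = \poly_(j < a) \poly_(i < b) (P`_j)`_i.
  apply/polyP => j; rewrite coef_poly; case: ltnP => ja; last by rewrite nth_default.
  apply/polyP => i; rewrite coef_poly; case: ltnP => ib //.
  rewrite nth_default //; apply: leq_trans ib; exact: (leq_bigmax (Ordinal ja)).
have hc j i : prelp G (P`_j)`_i (c' j i).
  move=> k; rewrite coef_poly; case: ltnP => hk; first exact: hP.
  by rewrite nth_default //; exact: (rel0 HG).
exists (\poly_(j < a) \poly_(i < b) c' j i); split.
  apply: contraNneq P0 => P0; rewrite PE; apply/eqP/polyP => j; rewrite coef0 coef_poly; case: ltnP => // ja.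
  apply/polyP => i; rewrite coef0 coef_poly; case: ltnP => // ib.
  have := congr1 (fun p : {poly {poly {poly C}}} => (p`_j)`_i) P0;
    rewrite !coef0 coef_poly ja coef_poly ib => c0.
  by apply/eqP; rewrite (relp_eq0 HG (hc j i)) c0.
apply: psP => n; rewrite ps0 ev2_coefs; apply/eqP.
have h : relps (ev2 f g P) (\sum_(j < a) \sum_(i < b) pp (c' j i) * f' ^+ i * g' ^+ j).
  rewrite PE ev2_coefs; apply: relps_sum => j _; apply: relps_sum => i _.
  by apply: relpsM; [apply: relpsM; [move=> k; exact: hc | exact: relpsX] | exact: relpsX].
by rewrite -(rel_eq0 HG (h n)) E.
Qed.

(** The denominator solves a homogeneous linear system whose entries are coefficients of [f'], all
    in the image of [G]. So there is a nonzero solution in that image, and it can be carried back to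
    [f]. *)
Lemma rel_rational f f' : relps f f' -> fps_rational f' -> fps_rational f.
Proof.
move=> hf /fps_rationalP [a [b [b0 E]]].
pose X y := exists x, G x y.
have X1 : X 1 by exists 1; exact: (rel1 HG).
have XB u v : X u -> X v -> X (u - v) by move=> [x hx] [y hy]; exists (x - y); exact: (relB HG).
have XM u v : X u -> X v -> X (u * v) by move=> [x hx] [y hy]; exists (x * y); exact: (relM HG).
have aux1 (x y o : nat) : (y <= (x + y + o).+1)%N by clear; lia.
have aux2 (x y o k : nat) : (x + y <= k)%N -> (o <= y)%N -> (o <= k.+1)%N by clear; lia.
(* From degree [N] on the numerator vanishes and no index N + j - i is truncated. *)
pose N := (size a + size b)%N; pose M i j := f' (N + j - i)%N.
have XMij i j : X (M i j) by exists (f (N + j - i)%N); exact: hf.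
have cz : exists2 i, (i < size b)%N & b`_i != 0.
  by exists (size b).-1; [rewrite prednK // size_poly_gt0 | rewrite -lead_coefE lead_coef_eq0].
have Ec j : \sum_(i < size b) b`_i * M i j = 0.
  have := congr1 (fun F : ps C => F (N + j)%N) E; rewrite /= psM_poly; last exact: aux1.
  by move=> ->; rewrite /pp nth_default // /N -addnA leq_addr.
have [c [Xc [i0 i0b ci0] Hc]] := solve_in X1 XB XM XMij cz Ec.
have [d Hd] := boolp.choice Xc.
pose T : {poly C} := \poly_(i < size b) d i; apply/fps_rationalP; exists (trunc N (pp T * f)), T.
have sT : (size T <= size b)%N by exact: size_poly.
split.
  apply: contraNneq ci0 => T0; rewrite -(rel_eq0 HG (Hd i0)).
  by have := congr1 (fun p : {poly C} => p`_i0) T0; rewrite coef_poly i0b coef0 => ->.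
apply: psP => n; rewrite /pp coef_poly -/(pp T); case: ltnP => // hn; apply/eqP.
rewrite psM_poly; last exact: aux2 hn sT.
have -> : \sum_(i < size T) T`_i * f (n - i)%N = \sum_(i < size b) T`_i * f (n - i)%N.
  rewrite -!(big_mkord xpredT (fun i => T`_i * f (n - i)%N)) [RHS](big_cat_nat (leq0n _) sT) /= [X in _ = _ +
    X]big_nat [X in _ = _ + X]big1 ?addr0 // => i /andP[h _].
  by rewrite nth_default // mul0r.
have -> : \sum_(i < size b) T`_i * f (n - i)%N = \sum_(i < size b) d i * f (n - i)%N.
  by apply: eq_bigr => i _; rewrite coef_poly ltn_ord.
have h : G (\sum_(i < size b) d i * f (n - i)%N) (\sum_(i < size b) c i * f' (n - i)%N).
  by apply: (rel_sum HG) => i _; apply: (relM HG); [exact: Hd | exact: hf].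
by rewrite (rel_eq0 HG h); have := Hc (n - N)%N; rewrite /M subnKC // => ->.
Qed.
End Transport.

(** Once the image of [q1] is fixed off the unit circle, the isomorphism is extended to the finite
    list formed by [q2], the parameters of both series and the coefficients of [P]. *)
Lemma dependent_rational (R : realType) (q1 q2 : R[i]) (f g : fps R[i]) P : q1 != 0 -> q2 != 0 -> indep q1 q2 ->
  nm q1 != 1 \/ ~ alg_all_conj_unimodular q1 -> is_qhyp q1 f -> is_qhyp q2 g -> P != 0 -> ev2 f g P = 0 ->
  fps_rational f \/ fps_rational g.
Proof.
have step (p1 p2 : R[i]) (F H : ps R[i]) S : p1 != 0 -> p2 != 0 -> indep p1 p2 -> nm p1 != 1 ->
  is_qhyp p1 F -> is_qhyp p2 H ->
    S != 0 -> ev2 F H S = 0 -> fps_rational F \/ fps_rational H.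
  move=> p10 p20 ind n1 qF qH S0 E; have ind' := indep_sym ind.
  case: (qhyp_hyp p10 (indep_root ind) qF) => [|[A1 [B1 [h1 nz1]]]]; first by left.
  case: (qhyp_hyp p20 (indep_root ind') qH) => [|[A2 [B2 [h2 nz2]]]]; first by right.
  exact: dependent_rational_modulus h1 nz1 h2 nz2 ind n1 S0 E.
move=> q10 q20 ind [n1|nA] qf qg P0 E; first exact: step q10 q20 ind n1 qf qg P0 E.
have [z [G [HG eG Gz z1]]] := nonunimodular nA.
have [al1 [be1 [hb1 fE]]] := qf; have [al2 [be2 [hb2 gE]]] := qg.
pose cs := flatten [seq flatten [seq polyseq c | c <- polyseq p] | p <- polyseq P].
have [G' [HG' GG Hl]] := extend_seq (q2 :: al1 ++ be1 ++ al2 ++ be2 ++ cs) HG eG.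
(* The choice function [s] takes the value 0 where [G'] is undefined. *)
have rec x : exists y, (exists y, G' x y) -> G' x y.
  by case: (pselect (exists y, G' x y)) => [[y h]|h]; [exists y | exists 0].
have [s Hs] := boolp.choice rec.
have Gq1 : G' q1 (s q1) by apply: Hs; exists z; exact: GG.
have sz : s q1 = z.
  have h := relB HG' Gq1 (GG _ _ Gz); have := rel_eq0 HG' h; rewrite subrr eqxx => /esym/eqP h2.
  by apply/eqP; rewrite -subr_eq0 h2.
have Gl x : x \in q2 :: al1 ++ be1 ++ al2 ++ be2 ++ cs -> G' x (s x) by move=> /Hl; exact: Hs.
have Gq2 : G' q2 (s q2) by apply: Gl; rewrite inE eqxx.
have Ga1 x : x \in al1 -> G' x (s x) by move=> h; apply: Gl; rewrite inE !mem_cat h !orbT.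
have Gb1 x : x \in be1 -> G' x (s x) by move=> h; apply: Gl; rewrite inE !mem_cat h !orbT.
have Ga2 x : x \in al2 -> G' x (s x) by move=> h; apply: Gl; rewrite inE !mem_cat h !orbT.
have Gb2 x : x \in be2 -> G' x (s x) by move=> h; apply: Gl; rewrite inE !mem_cat h !orbT.
have s0 : s 0 = 0.
  have h : G' 0 (s 0) by apply: Hs; exists 0; exact: (rel0 HG').
  by apply/eqP; rewrite -(rel_eq0 HG' h).
have Gc i j k : G' (P`_j`_i)`_k (s (P`_j`_i)`_k).
  case: (ltnP k (size (P`_j`_i))) => hk; last by rewrite nth_default // s0; exact: (rel0 HG').
  have hi : (i < size (P`_j)%R)%N by rewrite ltnNge; apply/negP => h; move: hk;
    rewrite (nth_default _ h) size_poly0.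
  have hj : (j < size P)%N by rewrite ltnNge; apply/negP => h; move: hi; rewrite (nth_default _ h) size_poly0.
  apply: Gl; rewrite inE !mem_cat; apply/orP; right; do 4!(apply/orP; right).
  apply/flattenP; exists (flatten [seq polyseq c | c <- polyseq P`_j]); first by apply: map_f; exact: mem_nth.
  by apply/flattenP; exists (P`_j`_i : seq R[i]); [apply: map_f; exact: mem_nth | exact: mem_nth].
pose f' := qhyp_series (s q1) [seq s a | a <- al1] [seq s b | b <- be1].
pose g' := qhyp_series (s q2) [seq s a | a <- al2] [seq s b | b <- be2].
have rf : relps G' f f' by rewrite fE; exact: rel_qhyp.
have rg : relps G' g g' by rewrite gE; exact: rel_qhyp.
have [P' [P'0 E']] := rel_dep HG' rf rg Gc P0 E.
have qf' : is_qhyp (s q1) f' by exact: (rel_is_qhyp HG').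
have qg' : is_qhyp (s q2) g' by exact: (rel_is_qhyp HG').
have n1 : nm (s q1) != 1 by rewrite sz.
have q1' : s q1 != 0 by rewrite -(rel_eq0 HG' Gq1).
have q2' : s q2 != 0 by rewrite -(rel_eq0 HG' Gq2).
by case: (step _ _ _ _ _ q1' q2' (rel_indep HG' Gq1 Gq2 ind) n1 qf' qg' P'0 E') => h; [left;
  exact: (rel_rational HG' rf) | right; exact: (rel_rational HG' rg)].
Qed.

Theorem theorem1p7 (R : realType) (q1 q2 : R[i]) (f g : fps R[i]) :
  q1 != 0 -> q2 != 0 ->
  (forall n1 n2 : int, q1 ^ n1 * q2 ^ n2 = 1 -> n1 = 0 /\ n2 = 0) ->
  ~ (alg_all_conj_unimodular q1 /\ alg_all_conj_unimodular q2) ->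
  is_qhyp q1 f -> is_qhyp q2 g ->
  fps_rational f \/ fps_rational g \/ alg_indep2 f g.
Proof.
move=> q10 q20 ind nA qf qg.
case: (pselect (fps_rational f)) => [|nf]; first by left.
case: (pselect (fps_rational g)) => [|ng]; first by right; left.
right; right=> P E; apply/eqP/negPn/negP => P0.
have E' : ev2 f g P = 0.
  move: E; rewrite fps_eval2E => E; rewrite -[RHS]E ev2E; apply: eq_bigr => j _.
  by rewrite phiE mulr_suml; apply: eq_bigr => i _; rewrite mulrA.
(* The base that can be moved off the unit circle has to come first; if it is [q2], the variables of
   the relation are exchanged. *)
case: (pselect (alg_all_conj_unimodular q1)) => [A1|nA1]; last first.
  by case: (dependent_rational q10 q20 ind (or_intror nA1) qf qg P0 E').
have nA2 : ~ alg_all_conj_unimodular q2 by move=> A2; apply: nA.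
have PS0 : swapXY P != 0 by rewrite swapXY_eq0.
have ES : ev2 g f (swapXY P) = 0 by rewrite ev2_swap.
by case: (dependent_rational q20 q10 (indep_sym ind) (or_intror nA2) qg qf PS0 ES).
Qed.
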